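(* Let $k\ge2$ be an integer, let $d>0$ with $m=dn/k$ an integer, and assume either (1) $d>(2^{k-1}-1)/(k-1)$ and $\beta_{\rm Ising}\big(d+\frac1{k-1},k\big)<\beta\le0$, or (2) $d\le(2^{k-1}-1)/(k-1)$ and $\beta=0$. Let $\mathbf{H}=\mathbf{H}(n,m,k)$ and let $\mu=\mu_{\mathbf{H}}$ be the antiferromagnetic Ising model on $\mathbf{H}$ with inverse temperature $\beta$ and external field $h=0$. Then there is a randomized algorithm which on input a $k$-uniform hypergraph $H$ on $n$ vertices outputs a configuration in $\{\pm1\}^V$ and whose running time is $O((n\log n)^2)$ with probability 1, and there exists $c_0>0$ depending on $k,d,\beta$ such that, with probability $1-o(1)$ over $\mathbf{H}$, the distribution $\bar\mu$ of the output on input $\mathbf{H}$ satisfies $\|\bar\mu-\mu\|_{tv}\le n^{-\frac{c_0}{55\log(dk)}}$.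
   Context: $\mathbf{H}(n,m,k)$ is the random $k$-uniform hypergraph on vertex set $V=\{x_1,\dots,x_n\}$ with $m$ hyperedges, each hyperedge being an ordered $k$-tuple of vertices chosen uniformly at random, independently. The Ising model on a $k$-uniform hypergraph $H=(V,E)$ is the distribution on $\{\pm1\}^V$ with $\mu(\sigma)\propto\exp\big(\beta\sum_{e\in E}\prod_{x,y\in e}\mathbf{1}\{\sigma(x)=\sigma(y)\}+h\sum_{x\in V}\sigma(x)\big)$; it is antiferromagnetic when $\beta<0$ (here $\beta\le 0$). For $\Delta>2^{k-1}/(k-1)$, $\beta_{\rm Ising}(\Delta,k)=\log\big(\frac{\Delta(k-1)-2^{k-1}}{\Delta(k-1)}\big)$. $\|\cdot\|_{tv}$ is total variation distance. *)

(* Defs.v *)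
From HB Require Import structures.
From mathcomp Require Import all_boot all_order all_algebra.
From mathcomp Require Import all_classical all_reals all_analysis.

Set Implicit Arguments.
Unset Strict Implicit.
Unset Printing Implicit Defensive.

Import Order.TTheory GRing.Theory Num.Theory.
Import numFieldNormedType.Exports.

Local Open Scope classical_set_scope.
Local Open Scope ring_scope.

(* A k-uniform hypergraph on the vertices 'I_n with m labelled hyperedges, each
   an ordered k-tuple of vertices.  Tuples range over all of V^k and hyperedges
   may coincide, as in the random hypergraph H(n,m,k). *)
Definition hypergraph (n m k : nat) := {ffun 'I_m -> k.-tuple 'I_n}.

(* Probability under H(n,m,k): m independent uniform k-tuples amount to one
   uniform element of [hypergraph n m k]. *)
Definition random_hypergraph_prob (R : realType) (n m k : nat)
    (A : pred (hypergraph n m k)) : R :=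
  #|A|%:R / #|{: hypergraph n m k}|%:R.

(* {-1,+1}^V, with [true] standing for +1 and [false] for -1. *)
Definition spins (n : nat) := {ffun 'I_n -> bool}.

Definition spin_value (R : realType) (b : bool) : R := if b then 1 else -1.

Definition ising_weight (R : realType) (n m k : nat) (beta h : R)
    (H : hypergraph n m k) (sigma : spins n) : R :=
  expR (beta * (\sum_(e < m) \prod_(i < k) \prod_(j < k)
                  (sigma (tnth (H e) i) == sigma (tnth (H e) j))%:R)
        + h * \sum_(x < n) spin_value R (sigma x)).

Definition ising (R : realType) (n m k : nat) (beta h : R)
    (H : hypergraph n m k) (sigma : spins n) : R :=
  ising_weight beta h H sigma / \sum_(tau : spins n) ising_weight beta h H tau.

Definition beta_ising (R : realType) (Delta : R) (k : nat) : R :=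
  ln ((Delta * (k.-1)%:R - 2 ^+ k.-1) / (Delta * (k.-1)%:R)).

Definition tv_dist (R : realType) (T : finType) (mu nu : T -> R) : R :=
  2^-1 * \sum_(x : T) `|mu x - nu x|.

(* Randomized algorithms are programs of a unit-cost random access machine with
   two memories: natural numbers (indices, counters, flags), with the usual RAM
   instructions, and real numbers, with exact field operations and comparisons.
   There is no instruction rounding a real to a natural number, and no real
   constant in programs. *)
Inductive instr :=
  | NatConst of nat & nat         (* N[i] := c *)
  | NatAdd of nat & nat & nat     (* N[i] := N[a] + N[b] *)
  | NatSub of nat & nat & nat     (* N[i] := N[a] - N[b], truncated at 0 *)
  | NatLoad of nat & nat          (* N[i] := N[N[a]] *)
  | NatStore of nat & nat         (* N[N[i]] := N[a] *)
  | RealOfNat of nat & nat        (* X[i] := N[a] *)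
  | RealAdd of nat & nat & nat    (* X[i] := X[a] + X[b] *)
  | RealSub of nat & nat & nat    (* X[i] := X[a] - X[b] *)
  | RealMul of nat & nat & nat    (* X[i] := X[a] * X[b] *)
  | RealDiv of nat & nat & nat    (* X[i] := X[a] / X[b], with x / 0 = 0 *)
  | RealLoad of nat & nat         (* X[i] := X[N[a]] *)
  | RealStore of nat & nat        (* X[N[i]] := X[a] *)
  | JumpNatLe of nat & nat & nat  (* if N[a] <= N[b] goto l *)
  | JumpRealLe of nat & nat & nat (* if X[a] <= X[b] goto l *)
  | Flip of nat & nat             (* N[i] := fresh Bernoulli(X[a]) bit *).

Definition program := seq instr.

Record state (R : realType) := State {
  pc : nat;
  nmem : nat -> nat;
  xmem : nat -> R }.

Definition upd (A : Type) (f : nat -> A) (i : nat) (v : A) : nat -> A :=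
  fun j => if j == i then v else f j.

(* One step; [b] is the outcome of the coin, used by [Flip] only. *)
Definition step (R : realType) (op : instr) (b : bool) (s : state R) : state R :=
  let: State p N X := s in
  match op with
  | NatConst i c => State p.+1 (upd N i c) X
  | NatAdd i a c => State p.+1 (upd N i (N a + N c)%N) X
  | NatSub i a c => State p.+1 (upd N i (N a - N c)%N) X
  | NatLoad i a => State p.+1 (upd N i (N (N a))) X
  | NatStore i a => State p.+1 (upd N (N i) (N a)) X
  | RealOfNat i a => State p.+1 N (upd X i (N a)%:R)
  | RealAdd i a c => State p.+1 N (upd X i (X a + X c))
  | RealSub i a c => State p.+1 N (upd X i (X a - X c))
  | RealMul i a c => State p.+1 N (upd X i (X a * X c))
  | RealDiv i a c => State p.+1 N (upd X i (X a / X c))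
  | RealLoad i a => State p.+1 N (upd X i (X (N a)))
  | RealStore i a => State p.+1 N (upd X (N i) (X a))
  | JumpNatLe a c l => State (if (N a <= N c)%N then l else p.+1) N X
  | JumpRealLe a c l => State (if X a <= X c then l else p.+1) N X
  | Flip i _ => State p.+1 (upd N i (nat_of_bool b)) X
  end.

(* Probability that the coin of the instruction is heads; the bias requested
   from [Flip] is clamped to [0, 1]. *)
Definition heads_prob (R : realType) (op : instr) (s : state R) : R :=
  if op is Flip _ a then Num.max 0 (Num.min 1 (xmem s a)) else 1.

(* Probability that P, started in state s, halts after at most t steps in a
   state satisfying A.  The machine halts when the program counter leaves P. *)
Fixpoint halt_prob (R : realType) (P : program) (A : pred (state R)) (t : nat)
    (s : state R) : R :=
  if onth P (pc s) is Some op then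
    if t is t'.+1 then
      heads_prob op s * halt_prob P A t' (step op true s)
      + (1 - heads_prob op s) * halt_prob P A t' (step op false s)
    else 0
  else (A s)%:R.

(* Input: N[0] = n, N[1] = m, N[2 + e k + i] is the i-th vertex of hyperedge e,
   and X[0] = exp(beta); all other cells are 0. *)
Definition input_nat (n m k : nat) (H : hypergraph n m k) (j : nat) : nat :=
  if j is j'.+2 then
    nth 0%N (flatten [seq [seq nat_of_ord v | v <- tval (H e)] | e <- enum 'I_m]) j'
  else if j is 1%N then m else n.

Definition input_state (R : realType) (n m k : nat) (beta : R)
    (H : hypergraph n m k) : state R :=
  State 0 (input_nat H) (fun j => if j == 0%N then expR beta else 0).

(* Output: the spin of vertex x is +1 iff N[x] is nonzero on halting. *)
Definition output (R : realType) (n : nat) (s : state R) : spins n :=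
  [ffun x : 'I_n => nmem s x != 0%N].

(* With probability 1, P halts within T(n) steps on every k-uniform hypergraph
   on n vertices, whatever its number of hyperedges. *)
Definition runs_in_time (R : realType) (P : program) (k : nat) (beta : R)
    (T : nat -> nat) : Prop :=
  forall (n m : nat) (H : hypergraph n m k),
    halt_prob P xpredT (T n) (input_state beta H) = 1.

Definition output_law (R : realType) (P : program) (n m k : nat) (beta : R)
    (H : hypergraph n m k) (sigma : spins n) : R :=
  limn (fun t => halt_prob P (fun s => output n s == sigma) t
                   (input_state beta H)).

(* Main.v *)
Require Import Defs.
From HB Require Import structures.
From mathcomp Require Import all_boot all_order all_algebra.
From mathcomp Require Import ring lra zify.

(* The measure is a product of hyperedge constraints, each of which is a
   mixture: with probability [1 - p] the hyperedge imposes nothing, with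
   probability [p = 1 - exp beta] it must not be monochromatic. The algorithm
   adds the hyperedges one at a time and repairs the configuration by exploring
   and flipping the cluster of constrained hyperedges hit by the new one. In the
   given regime the branching number [d (k - 1) theta] of these clusters is
   below one, so except with polynomially small probability they have
   logarithmic size; the few hyperedges that close short cycles are treated by
   resampling. Contiguity of the random hypergraph with the planted one
   transfers the first-moment estimates to the Gibbs measure. *)

(** One flip does not turn a sample without the new hyperedge into a sample with it. Insertion works
    because the density of the old Gibbs measure with respect to the new one depends only on the
    spins of the new hyperedge. Lazy cluster flips are reversible for the new measure, so they move
    densities by the same operator that moves functions; as long as no cluster comes back to a small
    vertex set [V], this operator acts on functions of the spins in [V] as a finite chain, which a
    Doeblin minorization contracts to a constant. [V] is the new hyperedge, or that hyperedge with a
    short path closing a cycle through it; in the second case the gap is only polynomially small in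
    [n], and polynomially many sweeps are made. A budget caps the number of such insertions, so that
    the running time is bounded on every input, while on typical inputs the budget suffices. For the
    same reason the program halts at once when there are too many hyperedges. Contiguity has to hold
    for all intermediate hypergraphs at once, whence a maximal inequality for the logarithm of the
    partition function. *)

Set Implicit Arguments.
Unset Strict Implicit.
Unset Printing Implicit Defensive.

Import Order.TTheory GRing.Theory Num.Theory.

(** * Clusters and their behaviour under flipping *)

Section Cluster.
Variables (n m : nat) (E : 'I_m -> {set 'I_n}).
Implicit Types (s : spins n) (A D : {set 'I_n}) (J : {set 'I_m}) (c : {ffun 'I_m -> bool}).

Definition mono s A := [forall x in A, forall y in A, s x == s y].

Definition flip_of s D : spins n := [ffun x => s x (+) (x \in D)].

(** Two hits absorb the hyperedge whatever its coin. This makes firing monotone in [D] and leaves on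
    the boundary of a cluster only hyperedges meeting it in one vertex, for which detailed balance
    can be read off. *)
Definition fires s c D (j : 'I_m) :=
  (1 < #|E j :&: D|) || [&& E j :&: D != set0, c j & mono (flip_of s D) (E j)].

Definition grow J s c A D := A :|: \bigcup_(j in J | fires s c D j) E j.

Definition cluster_of J s c A := fixset (grow J s c A).

Lemma monoP s A : reflect {in A &, forall x y, s x = s y} (mono s A).
Proof.
apply: (iffP forall_inP) => [H x y xA yA|H x xA]; first exact/eqP/(forall_inP (H x xA)).
by apply/forall_inP => y yA; apply/eqP/H.
Qed.

Lemma flipK D : involutive (flip_of^~ D).
Proof. by move=> s; apply/ffunP => x; rewrite !ffunE addbK. Qed.

Lemma eq_mono s s' A : {in A, s =1 s'} -> mono s A = mono s' A.
Proof.
by move=> e; apply/monoP/monoP => H x y xA yA; have := H x y xA yA; rewrite !e.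
Qed.

Lemma mono_negb s s' A : {in A, forall x, s x = ~~ s' x} -> mono s A = mono s' A.
Proof.
move=> e; apply/monoP/monoP => H x y xA yA; have := H x y xA yA; rewrite !e //.
by move/negb_inj.
by move=> ->.
Qed.

(** If [D'] still meets the hyperedge in at most one vertex, it meets it exactly where [D] does, so
    the flipped spins on the hyperedge are the same. *)
Lemma fires_sub s c D D' j : D \subset D' -> fires s c D j -> fires s c D' j.
Proof.
move=> sD; rewrite /fires => /orP[lt1|/and3P[n0 cj mD]].
  by apply/orP; left; apply: leq_trans lt1 _; apply/subset_leq_card/setIS.
have [le1|gt1] := leqP #|E j :&: D'| 1; rewrite //= cj.
have eD : E j :&: D = E j :&: D'.
  by apply/eqP; rewrite eqEcard setIS //= (leq_trans le1) // card_gt0.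
rewrite -eD n0 /=; rewrite -(eq_mono (s := flip_of s D)) // => x xE.
by move/setP: eD => /(_ x); rewrite !inE xE /= => ex; rewrite !ffunE ex.
Qed.

Lemma grow_mono J s c A : {homo grow J s c A : D D' / D \subset D'}.
Proof.
move=> D D' sD; apply: setUS; apply/bigcupsP => j /andP[jJ fj].
by apply: (bigcup_sup j); rewrite // jJ (fires_sub sD).
Qed.

Lemma clusterE_of J s c A : cluster_of J s c A = grow J s c A (cluster_of J s c A).
Proof. by rewrite {2}/cluster_of -[LHS]fixsetK //; apply: grow_mono. Qed.

Lemma sub_cluster J s c A : A \subset cluster_of J s c A.
Proof. by rewrite clusterE_of subsetUl. Qed.

Lemma cluster_closed J s c A j : j \in J -> fires s c (cluster_of J s c A) j ->
  E j \subset cluster_of J s c A.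
Proof.
by move=> jJ fj; rewrite clusterE_of; apply: subsetU; rewrite (bigcup_sup j) ?jJ ?orbT.
Qed.

Lemma cluster_min J s c A D : A \subset D ->
  (forall j, j \in J -> fires s c D j -> E j \subset D) -> cluster_of J s c A \subset D.
Proof.
move=> sA H; rewrite /cluster_of /fixset; elim: #|_| => [|l IH] /=; first exact: sub0set.
apply: subset_trans (grow_mono J s c A IH) _; rewrite subUset sA /=.
by apply/bigcupsP => j /andP[]; apply: H.
Qed.

Lemma eq_cluster J s c s' c' A D :
  (forall D', D' \subset D -> grow J s c A D' = grow J s' c' A D') ->
  cluster_of J s c A = D -> cluster_of J s' c' A = D.
Proof.
move=> e eD; rewrite -eD /cluster_of /fixset.
have : forall l, iter l (grow J s c A) set0 \subset D.
  by move=> l; rewrite -eD; apply: iter_sub_fix; apply: grow_mono.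
move=> sD; suff H l : iter l (grow J s' c' A) set0 = iter l (grow J s c A) set0 by [].
by elim: l => [//|l IH]; rewrite !iterS IH e.
Qed.

Definition inner c D : {ffun 'I_m -> bool} := [ffun j => c j && (E j \subset D)].

(** When the cluster is [D], a hyperedge sticking out of [D] does not fire at [D], hence by
    monotonicity at no earlier stage. The coins thus split into inner ones, which build [D], and
    outer ones, which stop the growth. *)
Lemma cluster_inner J s c A D :
  (cluster_of J s c A == D) = (cluster_of J s (inner c D) A == D) &&
    [forall j in J, ~~ (E j \subset D) ==> ~~ fires s c D j].
Proof.
have key : (forall j, j \in J -> ~~ (E j \subset D) -> ~~ fires s c D j) ->
    forall D', D' \subset D -> grow J s c A D' = grow J s (inner c D) A D'.
  move=> H D' sD; rewrite /grow; congr (_ :|: _); apply: eq_bigl => j.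
  case: (boolP (j \in J)) => //= jJ; rewrite /fires ffunE.
  have [sE|sE] := boolP (E j \subset D); first by rewrite andbT.
  rewrite andbF /= andbF orbF; have := contra (@fires_sub s c D' D j sD) (H j jJ sE).
  by rewrite /fires negb_or => /andP[/negbTE -> /negbTE ->].
apply/eqP/andP => [eD|[/eqP eD /forall_inP H]].
  have H : forall j, j \in J -> ~~ (E j \subset D) -> ~~ fires s c D j.
    by move=> j jJ; rewrite -eD; apply: contra => /(cluster_closed jJ).
  split; first by apply/eqP; apply: eq_cluster eD => D' sD; rewrite key.
  by apply/forall_inP => j jJ; apply/implyP/H.
by apply: eq_cluster eD => D' sD; rewrite key // => j jJ sE; apply: (implyP (H j jJ)).
Qed.

(** On a hyperedge inside [D], flipping [D] first complements all the spins, which does not affect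
    monochromaticity. *)
Lemma cluster_inner_flip J s c A D :
  (cluster_of J (flip_of s D) (inner c D) A == D) = (cluster_of J s (inner c D) A == D).
Proof.
have key D' : D' \subset D ->
    grow J s (inner c D) A D' = grow J (flip_of s D) (inner c D) A D'.
  move=> sD; rewrite /grow; congr (_ :|: _); apply: eq_bigl => j; congr (_ && _).
  rewrite /fires ffunE; congr (_ || _); congr (_ && _).
  have [sE|] := boolP (E j \subset D); last by rewrite andbF.
  congr (_ && _); apply: mono_negb => x xE; rewrite !ffunE (subsetP sE _ xE).
  by case: (s x); case: (x \in D').
by apply/eqP/eqP; apply: eq_cluster => D' sD; rewrite key.
Qed.

End Cluster.

Local Open Scope ring_scope.

(** * Detailed balance of the cluster flip *)

Section CoinSums.
Variables (R : comNzRingType) (I : finType).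

(* Summing a product weight against a function of the coordinates in [P] only
   sees the total mass of the remaining coordinates. *)
Lemma sum_prod_local (P : pred I) (f g : I -> bool -> R)
    (G : {ffun I -> bool} -> R) :
  (forall i, P i -> f i =1 g i) ->
  (forall i, ~~ P i -> f i true + f i false = g i true + g i false) ->
  (forall c, G c = G [ffun i => c i && P i]) ->
  \sum_c G c * \prod_i f i (c i) = \sum_c G c * \prod_i g i (c i).
Proof.
move=> fg1 fg2 GP; pose r (c : {ffun I -> bool}) := [ffun i => c i && P i].
rewrite (partition_big r xpredT) //= [RHS](partition_big r xpredT) //=.
apply: eq_bigr => c0 _.
pose Q i b := (b && P i) == c0 i.
have E (h : I -> bool -> R) : \sum_(c | r c == c0) G c * \prod_i h i (c i) =
    G c0 * \prod_i \sum_(b | Q i b) h i b.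
  rewrite bigA_distr_big_dep mulr_sumr; apply: eq_big => c.
    apply/eqP/familyP => [ec i|H]; first by rewrite unfold_in /Q -ec ffunE.
    by apply/ffunP => i; rewrite ffunE; apply/eqP; exact: H.
  by move=> /eqP ec; rewrite GP -/(r c) ec.
rewrite !E; congr (_ * _); apply: eq_bigr => i _.
have [Pi|Pi] := boolP (P i); first by apply: eq_bigr => b _; rewrite fg1.
rewrite /Q (negbTE Pi); case: (c0 i) => /=.
  by rewrite !big_pred0 // => b; rewrite andbF.
have e (h : bool -> R) : \sum_(b | (b && false) == false) h b = h true + h false.
  by rewrite (eq_bigl xpredT) ?big_bool // => b; rewrite andbF.
by rewrite !e fg2.
Qed.

End CoinSums.

Section Reversibility.
Variables (R : realFieldType) (n m : nat) (E : 'I_m -> {set 'I_n}) (p : R).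
Hypotheses (p_ge0 : 0 <= p) (p_lt1 : p < 1).
Implicit Types (s : spins n) (D : {set 'I_n}) (J : {set 'I_m}) (c : {ffun 'I_m -> bool}).

Definition edge_wt s j : R := 1 - p * (mono s (E j))%:R.

Definition gibbs_wt J s : R := \prod_(j in J) edge_wt s j.

Definition coin_wt c : R := \prod_j (if c j then p else 1 - p).

Lemma sum_coin_wt : \sum_c coin_wt c = 1.
Proof.
rewrite /coin_wt -(bigA_distr_bigA (fun _ (b : bool) => if b then p else 1 - p)).
by rewrite big1 // => j _; rewrite big_bool /= addrC subrK.
Qed.

Lemma coin_wt_ge0 c : 0 <= coin_wt c.
Proof. by apply: prodr_ge0 => j _; case: ifP => _ //; rewrite subr_ge0 ltW. Qed.

Lemma edge_wt_ge s j : 1 - p <= edge_wt s j.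
Proof. by rewrite lerD2l lerN2; case: mono; rewrite ?mulr1 ?mulr0. Qed.

Lemma edge_wt_le1 s j : edge_wt s j <= 1.
Proof. by rewrite gerBl mulr_ge0 ?ler0n. Qed.

Lemma edge_wt_gt0 s j : 0 < edge_wt s j.
Proof. by apply: lt_le_trans (edge_wt_ge s j); rewrite subr_gt0. Qed.

Lemma gibbs_wt_gt0 J s : 0 < gibbs_wt J s.
Proof. by apply: prodr_gt0 => j _; apply: edge_wt_gt0. Qed.

(** Detailed balance holds hyperedge by hyperedge. Inside [D], weight and growth are invariant under
    the flip. Outside, a hyperedge missing [D] keeps its spins; one meeting [D] once contributes its
    weight times its probability of not firing, [(1 - p * a) * (1 - p * b)] with [a] and [b] the
    monochromaticity before and after, which is symmetric; one meeting [D] twice makes both sides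
    vanish. *)
Lemma cluster_reversible J s D A :
  gibbs_wt J s * (\sum_c coin_wt c * (cluster_of E J s c A == D)%:R) =
  gibbs_wt J (flip_of s D) *
    (\sum_c coin_wt c * (cluster_of E J (flip_of s D) c A == D)%:R).
Proof.
pose blk t (j : 'I_m) b := [&& j \in J, ~~ (E j \subset D) &
  (1 < #|E j :&: D|)%N || [&& E j :&: D != set0, b & mono (flip_of t D) (E j)]].
pose f t (j : 'I_m) (b : bool) : R := (if j \in J then edge_wt t j else 1) *
  (if b then p else 1 - p) * (~~ blk t j b)%:R.
have EX t : gibbs_wt J t * (\sum_c coin_wt c * (cluster_of E J t c A == D)%:R) =
    \sum_c (cluster_of E J t (inner E c D) A == D)%:R * \prod_j f t j (c j).
  rewrite mulr_sumr; apply: eq_bigr => c _; rewrite cluster_inner /f.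
  rewrite !big_split /= -natr_prod -big_mkcond /= -/(gibbs_wt J t) -/(coin_wt c).
  rewrite -mulnb natrM; set N := (\prod_i _)%N.
  suff -> : [forall j in J, ~~ (E j \subset D) ==> ~~ fires E t c D j] = N :> nat by ring.
  have -> : N = [forall j, ~~ blk t j (c j)] :> nat.
    have [/forallP H|] := boolP [forall j, ~~ blk t j (c j)].
      by rewrite /N big1 // => j _; rewrite H.
    by rewrite negb_forall => /existsP[j bj]; rewrite /N (bigD1 j) //= (negbTE bj).
  congr nat_of_bool.
  apply: eq_forallb => j; rewrite /blk /fires.
  by case: (j \in J); case: (E j \subset D).
rewrite !EX; under [RHS]eq_bigr => c _ do rewrite cluster_inner_flip.
apply: (sum_prod_local (P := fun j => E j \subset D)) => [j sE b|j sE|c]; last first.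
- by congr (_ == _)%:R; congr cluster_of; apply/ffunP => j; rewrite !ffunE -andbA andbb.
- rewrite /f /blk flipK sE /=; case: (j \in J); rewrite /= ?mulr1 //.
  have [gt1|le1] := ltnP 1 #|E j :&: D|; rewrite /= ?mulr0 //.
  have [e0|n0] := eqVneq (E j :&: D) set0; rewrite /= ?mulr1.
    rewrite /edge_wt (eq_mono (s' := flip_of s D)) // => x xE; rewrite ffunE.
    by move/setP: e0 => /(_ x); rewrite !inE xE /= => ->; rewrite addbF.
  by rewrite /edge_wt; case: (mono s _); case: (mono (flip_of s D) _) => /=; ring.
- rewrite /f /blk sE andbF /= !mulr1; case: (j \in J) => //.
  by rewrite /edge_wt (mono_negb (s' := flip_of s D)) // => x xE; rewrite ffunE (subsetP sE _ xE) addbT negbK.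
Qed.

(* The operator of the move that flips the cluster_of of [x]. *)
Definition cluster_op J (x : 'I_n) (g : spins n -> R) s : R :=
  \sum_c coin_wt c * g (flip_of s (cluster_of E J s c [set x])).

Lemma cluster_op_kernel J x g s : cluster_op J x g s =
  \sum_D (\sum_c coin_wt c * (cluster_of E J s c [set x] == D)%:R) * g (flip_of s D).
Proof.
under eq_bigr => D _ do rewrite mulr_suml.
rewrite exchange_big; apply: eq_bigr => c _ /=.
rewrite (bigD1 (cluster_of E J s c [set x])) //= eqxx mulr1 big1 ?addr0 // => D nD.
by rewrite eq_sym (negbTE nD) mulr0 mul0r.
Qed.

(** Detailed balance summed over all clusters. Self-adjointness is what allows densities to be
    evolved in place of measures. *)
Lemma cluster_op_adjoint J x g h :
  \sum_s gibbs_wt J s * g s * cluster_op J x h s =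
  \sum_s gibbs_wt J s * cluster_op J x g s * h s.
Proof.
pose K s D := \sum_c coin_wt c * (cluster_of E J s c [set x] == D)%:R.
have E1 s : gibbs_wt J s * g s * cluster_op J x h s =
    \sum_D gibbs_wt J s * K s D * (g s * h (flip_of s D)).
  by rewrite cluster_op_kernel mulr_sumr; apply: eq_bigr => D _; rewrite -/(K s D); ring.
have E2 s : gibbs_wt J s * cluster_op J x g s * h s =
    \sum_D gibbs_wt J s * K s D * (g (flip_of s D) * h s).
  by rewrite cluster_op_kernel mulr_sumr mulr_suml; apply: eq_bigr => D _; rewrite -/(K s D); ring.
rewrite (eq_bigr _ (fun s _ => E1 s)) (eq_bigr _ (fun s _ => E2 s)).
rewrite exchange_big [RHS]exchange_big; apply: eq_bigr => D _ /=.
rewrite (reindex_inj (inv_inj (@flipK n D))) /=; apply: eq_bigr => s _.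
by rewrite flipK /K -cluster_reversible.
Qed.

End Reversibility.

(** * Insertion of one hyperedge: evolution and contraction of densities *)

Section Insertion.
Variables (R : realFieldType) (n m : nat) (E : 'I_m -> {set 'I_n}) (p : R).
Hypotheses (p_ge0 : 0 <= p) (p_lt1 : p < 1).
Implicit Types (s : spins n) (D V : {set 'I_n}) (J C : {set 'I_m}) (c : {ffun 'I_m -> bool}).
Implicit Types (nu g f : spins n -> R) (U : spins n -> {ffun 'I_m -> bool} -> {set 'I_n}).

Local Notation coin := (@coin_wt R m p).
Local Notation B := ((1 - p)^-1).

Let p1_gt0 : 0 < 1 - p. Proof. by rewrite subr_gt0. Qed.

Definition l1 f := \sum_s `|f s|.

Lemma l1_triangle f g h : l1 (fun s => f s - h s) <=
  l1 (fun s => f s - g s) + l1 (fun s => g s - h s).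
Proof.
rewrite /l1 -big_split; apply: ler_sum => s _ /=.
by apply: le_trans (ler_normD _ _); rewrite addrA subrK.
Qed.

Definition push U nu s' := \sum_s \sum_c nu s * coin c * (flip_of s (U s c) == s')%:R.

Definition lazy_push U nu s' := 2^-1 * nu s' + 2^-1 * push U nu s'.

Lemma pushB U f g s : push U f s - push U g s = push U (fun s => f s - g s) s.
Proof.
rewrite /push -sumrB; apply: eq_bigr => t _; rewrite -sumrB; apply: eq_bigr => c _.
by ring.
Qed.

Lemma sum_push U f : \sum_s push U f s = \sum_s f s.
Proof.
rewrite /push exchange_big; apply: eq_bigr => s _ /=; rewrite exchange_big /=.
transitivity (\sum_c f s * coin c); last by rewrite -mulr_sumr sum_coin_wt mulr1.
apply: eq_bigr => c _; rewrite -mulr_sumr (bigD1 (flip_of s (U s c))) //= eqxx.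
by rewrite big1 ?addr0 ?mulr1 // => t; rewrite eq_sym => /negbTE ->.
Qed.

Lemma l1_push U f : l1 (push U f) <= l1 f.
Proof.
rewrite /l1 -(sum_push U (fun s => `|f s|)); apply: ler_sum => s _.
apply: le_trans (ler_norm_sum _ _ _) _; apply: ler_sum => t _.
apply: le_trans (ler_norm_sum _ _ _) _; apply: ler_sum => c _.
by rewrite !normrM normr_nat [`|coin c|]ger0_norm // coin_wt_ge0.
Qed.

Lemma lazy_push_le U f g : l1 (fun s => lazy_push U f s - lazy_push U g s) <= l1 (fun s => f s - g s).
Proof.
have H := ler_wpM2l (_ : 0 <= 2^-1) (l1_push U (fun s => f s - g s)).
have {}H := H ltac:(by rewrite invr_ge0 ler0n).
apply: (@le_trans _ _ (2^-1 * l1 (fun s => f s - g s) +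
  2^-1 * l1 (push U (fun s => f s - g s)))); last first.
  by apply: le_trans (lerD (lexx _) H) _; rewrite -mulrDl; lra.
rewrite /l1 !mulr_sumr -big_split; apply: ler_sum => s _ /=.
have -> : lazy_push U f s - lazy_push U g s =
   2^-1 * (f s - g s) + 2^-1 * (push U f s - push U g s) by rewrite /lazy_push; ring.
rewrite pushB; apply: le_trans (ler_normD _ _) _; rewrite !normrM.
by rewrite ger0_norm // invr_ge0 ler0n.
Qed.

Lemma sum_lazy_push U f : \sum_s lazy_push U f s = \sum_s f s.
Proof. by rewrite big_split /= -!mulr_sumr sum_push -mulrDl; lra. Qed.

Definition part_fun J := \sum_s gibbs_wt E p J s.

Definition gibbs J s := gibbs_wt E p J s / part_fun J.

Lemma part_fun_gt0 J : 0 < part_fun J.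
Proof.
rewrite /part_fun (bigD1 [ffun=> true]) //= ltr_pwDl ?gibbs_wt_gt0 //.
by apply: sumr_ge0 => s _; rewrite ltW // gibbs_wt_gt0.
Qed.

Lemma gibbs_ge0 J s : 0 <= gibbs J s.
Proof. by rewrite divr_ge0 // ltW // ?gibbs_wt_gt0 ?part_fun_gt0. Qed.

Lemma sum_gibbs J : \sum_s gibbs J s = 1.
Proof. by rewrite -mulr_suml divff // gt_eqF // part_fun_gt0. Qed.

(** Self-adjointness tested against a point mass. *)
Lemma push_cluster J x g s :
  push (fun s c => cluster_of E J s c [set x]) (fun s => gibbs J s * g s) s =
  gibbs J s * cluster_op E p J x g s.
Proof.
have := cluster_op_adjoint E p J x g (fun t => (t == s)%:R : R).
rewrite [X in _ = X](bigD1 s) //= eqxx mulr1 [X in _ + X]big1 ?addr0; last first.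
  by move=> t /negbTE ->; rewrite mulr0.
move/(congr1 ( *%R^~ (part_fun J)^-1)); rewrite mulrAC -/(gibbs J s) => <-.
rewrite /push mulr_suml; apply: eq_bigr => t _; rewrite /cluster_op mulr_sumr mulr_suml.
by apply: eq_bigr => c _; rewrite /gibbs; ring.
Qed.

Definition depends V f := forall s s', {in V, s =1 s'} -> f s = f s'.

Definition lazy_op C x f s := 2^-1 * f s + 2^-1 * cluster_op E p C x f s.

Definition bad_prob J (bad : spins n -> {ffun 'I_m -> bool} -> bool) : R :=
  \sum_s \sum_c gibbs J s * coin c * (bad s c)%:R.

Lemma bad_prob_ge0 J bad : 0 <= bad_prob J bad.
Proof.
apply: sumr_ge0 => s _; apply: sumr_ge0 => c _.
by rewrite mulr_ge0 ?ler0n // mulr_ge0 ?gibbs_ge0 ?coin_wt_ge0.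
Qed.

(** [U] is the flip actually performed, by a truncated search. Off the bad event it is the true
    cluster, and a function of the spins in [V] cannot tell that cluster from the one grown inside
    the block [C] alone. The first replacement costs [2 * b] times the bad mass, the second [b]
    times, and laziness halves the sum. *)
Lemma lazy_push_step J C V x U bad f b : 0 <= b -> depends V f ->
  (forall s, 0 <= f s <= b) ->
  (forall s c, ~~ bad s c -> U s c = cluster_of E J s c [set x] /\
     cluster_of E J s c [set x] :&: V = cluster_of E C s c [set x] :&: V) ->
  l1 (fun s => lazy_push U (fun s => gibbs J s * f s) s - gibbs J s * lazy_op C x f s)
    <= 2 * b * bad_prob J bad.
Proof.
move=> b0 dV fb good.
pose cl s c := cluster_of E J s c [set x].
pose mf s := gibbs J s * f s.
have f0 s : 0 <= f s by case/andP: (fb s).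
have fl s : f s <= b by case/andP: (fb s).
have -> : l1 (fun s => lazy_push U mf s - gibbs J s * lazy_op C x f s) =
    2^-1 * l1 (fun s => push U mf s - gibbs J s * cluster_op E p C x f s).
  rewrite /l1 mulr_sumr; apply: eq_bigr => s _.
  transitivity `|2^-1 * (push U mf s - gibbs J s * cluster_op E p C x f s)|; last first.
    by rewrite normrM ger0_norm // invr_ge0 ler0n.
  congr `|_|; rewrite /lazy_push /lazy_op /mf; ring.
have H1 : l1 (fun s => push U mf s - push cl mf s) <= 2 * b * bad_prob J bad.
  apply: (@le_trans _ _ (\sum_s' \sum_s \sum_c mf s * coin c * (bad s c)%:R *
     ((flip_of s (U s c) == s')%:R + (flip_of s (cl s c) == s')%:R))).
    apply: ler_sum => s' _; rewrite /push -sumrB; apply: le_trans (ler_norm_sum _ _ _) _.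
    apply: ler_sum => s _; rewrite -sumrB; apply: le_trans (ler_norm_sum _ _ _) _.
    apply: ler_sum => c _; rewrite -mulrBr.
    have w0 : 0 <= mf s * coin c.
      by apply: mulr_ge0; [apply: mulr_ge0; rewrite ?gibbs_ge0 | apply: coin_wt_ge0].
    rewrite normrM ger0_norm // -mulrA ler_wpM2l //.
    case: (boolP (bad s c)) => [_|/good [-> _]]; rewrite ?mul1r ?mul0r ?subrr ?normr0 //.
    by apply: le_trans (ler_normB _ _) _; rewrite !normr_nat.
  rewrite exchange_big /= /bad_prob mulr_sumr; apply: ler_sum => s _.
  rewrite exchange_big /= mulr_sumr; apply: ler_sum => c _; rewrite -mulr_sumr big_split /=.
  have S1 t : \sum_s' (t == s')%:R = 1 :> R.
    by rewrite (bigD1 t) //= eqxx big1 ?addr0 // => u; rewrite eq_sym => /negbTE ->.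
  rewrite !S1 mulrC /mf.
  have w0 : 0 <= gibbs J s * coin c * (bad s c)%:R.
    by rewrite mulr_ge0 ?ler0n // mulr_ge0 ?gibbs_ge0 ?coin_wt_ge0.
  have := ler_wpM2r w0 (fl s); lra.
have H2 : l1 (fun s => push cl mf s - gibbs J s * cluster_op E p C x f s) <= b * bad_prob J bad.
  rewrite /bad_prob mulr_sumr; apply: ler_sum => s _; rewrite push_cluster -mulrBr.
  rewrite normrM ger0_norm ?gibbs_ge0 // /cluster_op -sumrB.
  under [X in _ <= _ * X]eq_bigr => c _ do rewrite -mulrA.
  rewrite -mulr_sumr mulrCA ler_wpM2l ?gibbs_ge0 //.
  apply: le_trans (ler_norm_sum _ _ _) _; rewrite mulr_sumr; apply: ler_sum => c _.
  rewrite -mulrBr normrM ger0_norm ?coin_wt_ge0 // mulrCA ler_wpM2l ?coin_wt_ge0 //.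
  case: (boolP (bad s c)) => [_|/good [_ e]].
    rewrite mulr1 ler_norml lerBrDr lerBlDr.
    have := f0 (flip_of s (cluster_of E J s c [set x])).
    have := fl (flip_of s (cluster_of E J s c [set x])).
    have := f0 (flip_of s (cluster_of E C s c [set x])).
    have := fl (flip_of s (cluster_of E C s c [set x])).
    by move=> *; apply/andP; split; lra.
  rewrite mulr0 normr_le0 subr_eq0; apply/eqP/dV => y yV; rewrite !ffunE.
  by move/setP: e => /(_ y); rewrite !inE yV !andbT => ->.
have := l1_triangle (push U mf) (push cl mf) (fun s => gibbs J s * cluster_op E p C x f s).
have := mulr_ge0 b0 (bad_prob_ge0 J bad).
by move: H1 H2; lra.
Qed.

Lemma cluster_subV C V x s c : (forall j, j \in C -> E j \subset V) -> x \in V ->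
  cluster_of E C s c [set x] \subset V.
Proof.
move=> sC xV; apply: cluster_min; first by rewrite sub1set.
by move=> j jC _; apply: sC.
Qed.

Lemma cluster_dep C V x s s' c : (forall j, j \in C -> E j \subset V) ->
  {in V, s =1 s'} -> cluster_of E C s c [set x] = cluster_of E C s' c [set x].
Proof.
move=> sC e; symmetry; apply: eq_cluster (erefl _) => D' _; rewrite /grow; congr (_ :|: _).
apply: eq_bigl => j; case: (boolP (j \in C)) => //= jC; rewrite /fires.
rewrite (@eq_mono _ (flip_of s D') (flip_of s' D')) // => y yE.
by rewrite !ffunE e // (subsetP (sC j jC)).
Qed.

Section Block.
Variables (C : {set 'I_m}) (V : {set 'I_n}).
Hypothesis sC : forall j, j \in C -> E j \subset V.

Lemma lazy_op_dep x f : x \in V -> depends V f -> depends V (lazy_op C x f).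
Proof.
move=> xV dV s s' e; rewrite /lazy_op (dV _ _ e); congr (_ + _ * _).
apply: eq_bigr => c _; congr (_ * _); apply: dV => y yV.
by rewrite !ffunE e // (cluster_dep _ _ sC e).
Qed.

Lemma lazy_op_bounds x f lo hi : (forall s, lo <= f s <= hi) ->
  forall s, lo <= lazy_op C x f s <= hi.
Proof.
move=> H s; have /andP[h1 h2] := H s.
have : lo <= cluster_op E p C x f s <= hi.
  rewrite -[X in X <= _ <= _](mul1r lo) -[X in _ <= _ <= X](mul1r hi) -(@sum_coin_wt R m p).
  rewrite /cluster_op !mulr_suml; apply/andP; split; apply: ler_sum => c _;
  by apply: ler_wpM2l; rewrite ?coin_wt_ge0 //; case/andP: (H (flip_of s (cluster_of E C s c [set x]))).
by move=> /andP[h3 h4]; rewrite /lazy_op; apply/andP; split; lra.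
Qed.

Definition all_true s (l : seq 'I_n) : spins n := [ffun x => (x \in l) || s x].

(** If no hyperedge of [C] at [x] has its coin up, nothing fires. *)
Lemma prob_still x s : (1 - p) ^+ #|[set j in C | x \in E j]| <=
  \sum_c coin c * (cluster_of E C s c [set x] == [set x])%:R.
Proof.
pose F (j : 'I_m) (b : bool) : R := if b then (if (j \in C) && (x \in E j) then 0 else p) else 1 - p.
have F0 j b : 0 <= F j b by rewrite /F; case: b => /=; [case: ifP|]; rewrite // ltW.
apply: (@le_trans _ _ (\sum_(c : {ffun 'I_m -> bool}) \prod_j F j (c j))).
  rewrite -(bigA_distr_bigA F) -prodr_const [X in X <= _](eq_bigl
    (fun j => (j \in C) && (x \in E j))); last by move=> j; rewrite inE.
  rewrite big_mkcond /=; apply: ler_prod => j _; rewrite big_bool /F /=.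
  case: ((j \in C) && _); first by rewrite add0r lexx ltW.
  by rewrite ler01 /= addrC subrK.
apply: ler_sum => c _.
have [e|ne] := eqVneq (cluster_of E C s c [set x]) [set x].
  rewrite mulr1 /coin_wt; apply: ler_prod => j _; rewrite F0 /F /=.
  by case: (c j) => //; case: ifP.
rewrite mulr0; suff [j cj jx] : exists2 j, c j & (j \in C) && (x \in E j).
  by rewrite (bigD1 j) //= /F cj jx mul0r.
apply/exists_inP; apply: contraR ne; rewrite negb_exists_in => /forall_inP H.
apply/eqP/eqP; rewrite eqEsubset sub_cluster andbT; apply: cluster_min => // j jC.
rewrite /fires => /orP[|/and3P[n0 cj _]].
  by rewrite ltnNge (leq_trans (subset_leq_card (subsetIr _ _))) ?cards1.
have := H j cj; rewrite jC /= => xE; case/set0Pn: n0 => y; rewrite !inE => /andP[yE /eqP yx].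
by rewrite yx (negbTE xE) in yE.
Qed.

Variables (l : seq 'I_n).
Hypotheses (lV : forall x, x \in l = (x \in V)).
Definition still_wt x : R := 2^-1 * (1 - p) ^+ #|[set j in C | x \in E j]|.
Local Notation h := still_wt.

Lemma still_wt_ge0 x : 0 <= h x.
Proof. by rewrite mulr_ge0 ?invr_ge0 ?ler0n ?exprn_ge0 // ltW. Qed.

Lemma still_wt_le x : h x <= 2^-1.
Proof.
have : (1 - p) ^+ #|[set j in C | x \in E j]| <= 1 by apply: exprn_ile1; [exact: ltW|rewrite gerBl].
rewrite /h; lra.
Qed.

(** A move can make the spin at [x] true: by staying put when it is true already, by flipping [x]
    alone otherwise. The factor [2^-1] in [still_wt] serves both cases. *)
Lemma lazy_op_minor x f lo s : x \in V -> (forall s, lo <= f s) ->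
  h x * f (all_true s [:: x]) + (1 - h x) * lo <= lazy_op C x f s.
Proof.
move=> xV H; have hl := still_wt_le x.
have [sx|sx] := boolP (s x).
  have -> : all_true s [:: x] = s.
    by apply/ffunP => y; rewrite ffunE inE; case: eqVneq => // ->; rewrite sx.
  have : lo <= cluster_op E p C x f s.
    rewrite -[X in X <= _](mul1r lo) -(@sum_coin_wt R m p) mulr_suml.
    by apply: ler_sum => c _; apply: ler_wpM2l; rewrite ?coin_wt_ge0.
  move=> h3; rewrite /lazy_op.
  have : 0 <= (2^-1 - h x) * (f s - lo) by rewrite mulr_ge0 ?subr_ge0 ?H //; lra.
  lra.
have -> : all_true s [:: x] = flip_of s [set x].
  by apply/ffunP => y; rewrite !ffunE !inE; case: eqVneq => [->|_] /=; rewrite ?(negbTE sx) ?addbF.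
set P := \sum_c coin c * (cluster_of E C s c [set x] == [set x])%:R.
have PE : P * f (flip_of s [set x]) + (1 - P) * lo <= cluster_op E p C x f s.
  have -> : P * f (flip_of s [set x]) + (1 - P) * lo = P * (f (flip_of s [set x]) - lo) + lo by ring.
  rewrite -[X in _ + X](mul1r lo) -(@sum_coin_wt R m p) !mulr_suml -big_split /=.
  apply: ler_sum => c _; rewrite -mulrA -mulrDr ler_wpM2l ?coin_wt_ge0 //.
  by case: eqP => [->|_]; rewrite ?mul1r ?mul0r ?subrK ?add0r.
have hP : h x <= 2^-1 * P.
  rewrite ler_pM2l ?invr_gt0 ?ltr0n //; exact: prob_still.
have := H s; have H' := H (flip_of s [set x]); rewrite /lazy_op => H''.
have : 0 <= (2^-1 * P - h x) * (f (flip_of s [set x]) - lo) by rewrite mulr_ge0 ?subr_ge0 // .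
lra.
Qed.

Lemma lazy_op_opp x f s : lazy_op C x (fun s => - f s) s = - lazy_op C x f s.
Proof.
rewrite /lazy_op /cluster_op; have -> : \sum_c coin c * - f (flip_of s (cluster_of E C s c [set x])) =
  - \sum_c coin c * f (flip_of s (cluster_of E C s c [set x])).
  by rewrite -sumrN; apply: eq_bigr => c _; rewrite mulrN.
by ring.
Qed.

Definition lazy_ops f (l : seq 'I_n) := foldl (fun f x => lazy_op C x f) f l.

Lemma lazy_ops_dep l' f : {subset l' <= V} -> depends V f -> depends V (lazy_ops f l').
Proof.
elim: l' f => //= x l' IH f sl dV; apply: IH => [y yl|]; first by rewrite sl // inE yl orbT.
by apply: lazy_op_dep; rewrite ?sl ?inE ?eqxx.
Qed.

Lemma lazy_ops_minor l' f lo hi s : {subset l' <= V} -> (forall s, lo <= f s <= hi) ->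
  (\prod_(y <- l') h y) * f (all_true s l') + (1 - \prod_(y <- l') h y) * lo <= lazy_ops f l' s.
Proof.
elim: l' f s => [|x l' IH] f s sl H /=.
  have -> : all_true s [::] = s by apply/ffunP => y; rewrite ffunE.
  by rewrite big_nil mul1r subrr mul0r addr0.
have xV : x \in V by rewrite sl ?inE ?eqxx.
have sl' : {subset l' <= V} by move=> y yl; rewrite sl // inE yl orbT.
apply: (le_trans _ (IH (lazy_op C x f) s sl' (lazy_op_bounds x H))).
have := lazy_op_minor (f := f) (lo := lo) (all_true s l') xV (fun s => proj1 (andP (H s))).
have -> : all_true (all_true s l') [:: x] = all_true s (x :: l').
  by apply/ffunP => y; rewrite !ffunE !inE orbA.
set a := f _; set b := lazy_op _ _ _ _; rewrite big_cons => Hb.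
have hn : 0 <= \prod_(y <- l') h y by apply: prodr_ge0 => y _; apply: still_wt_ge0.
have := ler_wpM2l hn Hb; lra.
Qed.

Lemma lazy_ops_majo l' f lo hi s : {subset l' <= V} -> (forall s, lo <= f s <= hi) ->
  lazy_ops f l' s <= (\prod_(y <- l') h y) * f (all_true s l') + (1 - \prod_(y <- l') h y) * hi.
Proof.
move=> sl H; have E1 : forall f s, lazy_ops (fun s => - f s) l' s = - lazy_ops f l' s.
  elim: l' {sl H} => // x l' IH g t /=; rewrite -IH.
  have ext l2 : forall g1 g2, g1 =1 g2 -> lazy_ops g1 l2 =1 lazy_ops g2 l2.
    elim: l2 => //= y l2 IH2 g1 g2 e12; apply: IH2 => u; rewrite /lazy_op e12.
    by congr (_ + _ * _); apply: eq_bigr => c _; rewrite e12.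
  by apply: ext => u; rewrite lazy_op_opp.
have H' s' : - hi <= - f s' <= - lo by have /andP[] := H s'; rewrite !lerN2 => -> ->.
have := lazy_ops_minor s sl H'; rewrite E1; lra.
Qed.

(** Doeblin's argument: with probability at least the product of the [still_wt], a whole sweep
    leaves all spins of [V] true, where [f] has a value independent of the start. Each sweep
    therefore shrinks the oscillation by one minus that product. *)
Lemma lazy_ops_osc r f lo hi : depends V f -> (forall s, lo <= f s <= hi) ->
  exists a, forall s, a <= lazy_ops f (flatten (nseq r l)) s
    <= a + (1 - \prod_(y <- l) h y) ^+ r * (hi - lo).
Proof.
elim: r f lo hi => [|r IH] f lo hi dV H.
  by exists lo => s; rewrite mul1r /= addrC subrK; apply: H.
rewrite [flatten _]/=.
have cat l2 : lazy_ops f (l ++ l2) = lazy_ops (lazy_ops f l) l2 by rewrite /lazy_ops foldl_cat.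
rewrite cat.
have sl : {subset l <= V} by move=> x; rewrite lV.
pose top := f [ffun=> true]; pose e := \prod_(y <- l) h y.
have ftop s : f (all_true s l) = top.
  by apply: dV => x xV; rewrite !ffunE lV xV.
have H2 s : e * top + (1 - e) * lo <= lazy_ops f l s <= e * top + (1 - e) * hi.
  by have := lazy_ops_minor s sl H; have := lazy_ops_majo s sl H; rewrite ftop => -> ->.
have [a Ha] := IH _ _ _ (lazy_ops_dep sl dV) H2.
exists a => s; rewrite exprSr -mulrA.
by have -> : (1 - e) * (hi - lo) = e * top + (1 - e) * hi - (e * top + (1 - e) * lo) by ring.
Qed.

End Block.

(** The starting measure has density [f0] with respect to the target, bounded by [B] and depending
    only on the spins of hyperedge [i]. The sweeps make the density nearly constant, and
    conservation of mass forces the constant to be near 1. *)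
Lemma insertion_error J C V (i : 'I_m) (l : seq 'I_n) (h : R) (r : nat)
    (U : 'I_n -> spins n -> {ffun 'I_m -> bool} -> {set 'I_n}) bad :
  i \in J -> i \in C -> (forall j, j \in C -> E j \subset V) ->
  (forall x, x \in l = (x \in V)) -> 0 <= h -> h <= \prod_(y <- l) still_wt C y ->
  (forall x s c, x \in V -> ~~ bad x s c -> U x s c = cluster_of E J s c [set x] /\
     cluster_of E J s c [set x] :&: V = cluster_of E C s c [set x] :&: V) ->
  let xs := flatten (nseq r l) in
  l1 (fun s => foldl (fun nu x => lazy_push (U x) nu) (gibbs (J :\ i)) xs s - gibbs J s)
    <= 4 * B * (\sum_(x <- xs) bad_prob J (bad x)) + B * (1 - h) ^+ r.
Proof.
move=> iJ iC sC lV h0 hle good /=; set xs := flatten _.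
pose f0 s := part_fun J / part_fun (J :\ i) / edge_wt E p s i.
have Z0 := part_fun_gt0 J; have Z1 := part_fun_gt0 (J :\ i).
have wE s : gibbs_wt E p J s = edge_wt E p s i * gibbs_wt E p (J :\ i) s.
  by rewrite /gibbs_wt (big_setD1 i).
have f0E : gibbs (J :\ i) =1 (fun s => gibbs J s * f0 s).
  move=> s; rewrite /gibbs /f0 wE; field.
  by rewrite !gt_eqF //= edge_wt_gt0.
have f0b s : 0 <= f0 s <= B.
  have e0 := edge_wt_gt0 E p_ge0 p_lt1 s i.
  apply/andP; split; first by rewrite /f0 !divr_ge0 ?ltW.
  rewrite /f0 -[X in _ <= X]mul1r; apply: ler_pM; rewrite ?invr_ge0 ?divr_ge0 ?(ltW e0) ?(ltW Z0) ?(ltW Z1) //.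
    rewrite ler_pdivrMr // mul1r; apply: ler_sum => t _; rewrite wE ler_piMl ?edge_wt_le1 //.
    by rewrite ltW // gibbs_wt_gt0.
  by rewrite lef_pV2 ?posrE // edge_wt_ge.
have f0d : depends V f0.
  move=> s s' e; rewrite /f0 /edge_wt (eq_mono (s' := s')) // => x xE.
  by apply: e; rewrite (subsetP (sC i iC)).
have slx : {subset xs <= V}.
  by move=> x /flattenP[t /nseqP[-> _]]; rewrite lV.
have main : forall l' f g, {subset l' <= V} -> depends V f -> (forall s, 0 <= f s <= B) ->
   l1 (fun s => foldl (fun nu x => lazy_push (U x) nu) g l' s - gibbs J s * lazy_ops C f l' s)
     <= l1 (fun s => g s - gibbs J s * f s) + 2 * B * \sum_(x <- l') bad_prob J (bad x).
  elim=> [|x l' IH] f g sl fd fb /=; first by rewrite big_nil mulr0 addr0.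
  have xV : x \in V by rewrite sl ?inE ?eqxx.
  have sl' : {subset l' <= V} by move=> y yl; rewrite sl // inE yl orbT.
  apply: le_trans (IH _ _ sl' (lazy_op_dep sC xV fd) (lazy_op_bounds C x fb)) _.
  rewrite big_cons mulrDr addrA lerD2r.
  apply: le_trans (l1_triangle _ (lazy_push (U x) (fun s => gibbs J s * f s)) _) _.
  apply: lerD; first exact: lazy_push_le.
  apply: (lazy_push_step (V := V)) => //; first by rewrite invr_ge0 ltW.
  by move=> s c; apply: good.
have {}main := main xs f0 (gibbs (J :\ i)) slx f0d f0b.
have l10 : l1 (fun s => gibbs (J :\ i) s - gibbs J s * f0 s) = 0.
  by rewrite /l1 big1 // => s _; rewrite -f0E subrr normr0.
rewrite l10 add0r in main.
set b := \sum_(x <- xs) _ in main *; set nu := foldl _ _ _ in main *.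
have hp1 : \prod_(y <- l) still_wt C y <= 1.
  elim: (l) => [|y l' IH]; rewrite ?big_nil // big_cons mulr_ile1 //; first exact: still_wt_ge0.
    by apply: prodr_ge0 => z _; apply: still_wt_ge0.
  by have := still_wt_le C y; lra.
have [a Ha] := lazy_ops_osc sC lV r f0d f0b.
pose o := (1 - h) ^+ r * B.
have {}Ha s : a <= lazy_ops C f0 xs s <= a + o.
  have /andP[-> /= h2] := Ha s; apply: le_trans h2 _.
  rewrite lerD2l subr0 ler_wpM2r ?invr_ge0 ?(ltW p1_gt0) // lerXn2r ?nnegrE ?subr_ge0 ?lerD2l ?lerN2 //.
    by apply: le_trans hle _; apply: hp1.
have mass : \sum_s nu s = 1.
  rewrite /nu -(sum_gibbs (J :\ i)); elim: (xs) (gibbs _) => //= x l' IH g.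
  by rewrite IH sum_lazy_push.
pose g := lazy_ops C f0 xs.
pose avg := \sum_s gibbs J s * g s.
have avg1 : `|avg - 1| <= 2 * B * b.
  rewrite -[X in avg - X]mass distrC; apply: le_trans main; rewrite /avg -sumrB; exact: ler_norm_sum.
have avgb : a <= avg <= a + o.
  rewrite -[X in X <= _ <= _](mul1r a) -[X in _ <= _ <= X]mul1r -(sum_gibbs J) !mulr_suml.
  by apply/andP; split; apply: ler_sum => s _; rewrite ler_wpM2l ?gibbs_ge0 //; case/andP: (Ha s).
apply: le_trans (l1_triangle _ (fun s => gibbs J s * g s) _) _.
have : l1 (fun s => gibbs J s * g s - gibbs J s) <= o + 2 * B * b.
  have -> : o + 2 * B * b = \sum_s gibbs J s * (o + 2 * B * b).
    by rewrite -mulr_suml sum_gibbs mul1r.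
  apply: ler_sum => s _; rewrite -{2}(mulr1 (gibbs J s)) -mulrBr normrM ger0_norm ?gibbs_ge0 // ler_wpM2l ?gibbs_ge0 //.
  have -> : g s - 1 = (g s - avg) + (avg - 1) by rewrite addrA subrK.
  apply: le_trans (ler_normD _ _) _; apply: lerD avg1.
  have := Ha s; rewrite -/g ler_norml; case/andP: avgb => h1 h2 /andP[h3 h4].
  by apply/andP; split; lra.
rewrite -/g /o in main *; lra.
Qed.

End Insertion.

(** * First-moment bounds by exposing hyperedges one at a time *)

Section Exposure.
Variables (R : realFieldType) (n m k : nat).
Local Notation X := (k.-tuple 'I_n * bool)%type.
Local Notation W := {ffun 'I_m -> X}.
Variable w : 'I_m -> X -> R.
Hypotheses (w_ge0 : forall j x, 0 <= w j x) (w_mass : forall j, \sum_x w j x <= 1).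
Implicit Types (L : seq ('I_m * X)) (o : W) (Q : W -> bool).

Definition labels L := unzip1 L.
Definition realized L o := all (fun a => o a.1 == a.2) L.
Definition vert L : seq 'I_n := flatten [seq tval a.2.1 | a <- L].

Lemma labels_fun L j x y : uniq (labels L) -> (j, x) \in L -> (j, y) \in L -> x = y.
Proof.
elim: L => // -[j' z] L IH /= /andP[nL uL]; rewrite !inE !xpair_eqE.
move=> /orP[/andP[/eqP ej /eqP ex]|a] /orP[/andP[/eqP ej' /eqP ey]|b].
- by rewrite ex ey.
- by move/negP: nL; case; rewrite -ej; apply/mapP; exists (j, y).
- by move/negP: nL; case; rewrite -ej'; apply/mapP; exists (j, x).
- exact: IH.
Qed.

(* Mass of the event [Q] once the hyperedges listed in [L] have been exposed. *)
Definition expo L Q : R :=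
  \sum_(o : W) (\prod_(j | j \notin labels L) w j (o j)) * (realized L o)%:R * (Q o)%:R.

Lemma sum_const_seq (T : Type) (r : seq T) (c : R) : \sum_(v <- r) c = (size r)%:R * c.
Proof.
elim: r => [|v r IH]; first by rewrite big_nil mul0r.
by rewrite big_cons IH /= -addn1 natrD mulrDl mul1r addrC.
Qed.

Lemma size_vert L : size (vert L) = (k * size L)%N.
Proof.
rewrite /vert; elim: L => [|a L IH] /=; first by rewrite muln0.
by rewrite size_cat size_tuple IH mulnS.
Qed.

Lemma expo_mono L Q Q' : (forall o, realized L o -> Q o -> Q' o) -> expo L Q <= expo L Q'.
Proof.
move=> H; apply: ler_sum => o _; have := H o.
case: (realized L o) => [H'|_]; last by rewrite !mulr0 !mul0r.
rewrite ler_wpM2l ?mulr1 ?prodr_ge0 //; by case: (Q o) H' => [/(_ isT isT) ->|_].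
Qed.

Lemma expo_or L Q Q' : expo L (fun o => Q o || Q' o) <= expo L Q + expo L Q'.
Proof.
rewrite /expo -big_split; apply: ler_sum => o _ /=; rewrite -mulrDr -natrD.
rewrite ler_wpM2l ?mulr_ge0 ?ler0n ?prodr_ge0 // ler_nat.
by case: (Q o); case: (Q' o).
Qed.

Lemma expo_exists (A : finType) L (Q : A -> W -> bool) :
  expo L (fun o => [exists a, Q a o]) <= \sum_a expo L (Q a).
Proof.
rewrite /expo exchange_big; apply: ler_sum => o _ /=; rewrite -mulr_sumr.
rewrite ler_wpM2l ?mulr_ge0 ?ler0n ?prodr_ge0 // -natr_sum ler_nat.
have [/existsP[a Qa]|] := boolP [exists a, Q a o]; last by [].
by rewrite (bigD1 a) //= Qa.
Qed.

(** Replacing the weight of each exposed label by a point mass at its exposed value turns the sum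
    into a product of factors at most 1. *)
Lemma expo_le1 L Q : uniq (labels L) -> expo L Q <= 1.
Proof.
move=> uL; apply: (@le_trans _ _ (expo L xpredT)); first exact: expo_mono.
pose v (j : 'I_m) x : R := if j \in labels L then ((j, x) \in L)%:R else w j x.
apply: (@le_trans _ _ (\sum_(o : W) \prod_j v j (o j))).
  apply: ler_sum => o _; rewrite mulr1 [X in _ <= X](bigID (mem (labels L))) /= mulrC.
  apply: ler_pM; rewrite ?ler0n ?prodr_ge0 //.
    have [/allP r|] := boolP (realized L o); last by rewrite prodr_ge0 // => j; rewrite /v => ->; rewrite ler0n.
    rewrite big1 // => j; rewrite /v => jL; rewrite jL; case/mapP: (jL) => -[j' x] a /= ej.
    by have /eqP /= e := r _ a; rewrite ej e a.
  by rewrite le_eqVlt; apply/orP; left; apply/eqP/eq_bigr => j jL; rewrite /v (negbTE jL).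
rewrite -(bigA_distr_bigA v); apply: prodr_ile1 => j _; apply/andP; split.
  by apply: sumr_ge0 => x _; rewrite /v; case: ifP.
rewrite /v; have [/mapP[[j' x0] a /= ej]|_] := boolP (j \in labels L); last exact: w_mass.
rewrite (bigD1 x0) //= ej a big1 ?addr0 // => x nx.
case: (boolP ((j', x) \in L)) => // b; case/eqP: nx.
exact: (labels_fun uL b a).
Qed.

(** When [j] joins the exposed list, the factor [w j] splits off the sum and what remains is the
    mass with [(j, x)] exposed. *)
Lemma expo_step L (c : 'I_m -> X -> bool) (Q : 'I_m -> X -> W -> bool) (b : R) : 0 <= b ->
  (forall j x, j \notin labels L -> c j x -> expo ((j, x) :: L) (Q j x) <= b) ->
  expo L (fun o => [exists j, [&& j \notin labels L, c j (o j) & Q j (o j) o]])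
    <= (\sum_j \sum_(x | c j x) w j x) * b.
Proof.
move=> b0 H; apply: le_trans (expo_exists _ _) _; rewrite mulr_suml; apply: ler_sum => j _.
have [jL|jL] := boolP (j \in labels L).
  rewrite /expo big1 => [|o _]; last by rewrite mulr0.
  by rewrite mulr_ge0 // sumr_ge0.
rewrite mulr_suml.
apply: (@le_trans _ _ (\sum_(x | c j x) w j x * expo ((j, x) :: L) (Q j x))); last first.
  by apply: ler_sum => x cx; rewrite ler_wpM2l ?H.
rewrite /expo; under [X in _ <= X]eq_bigr => x _ do rewrite mulr_sumr.
rewrite exchange_big /=; apply: ler_sum => o _ /=.
have [cx|ncx] := boolP (c j (o j)); last first.
  rewrite /= mulr0; apply: sumr_ge0 => x _; rewrite mulr_ge0 // mulr_ge0 ?ler0n //.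
  by rewrite mulr_ge0 ?ler0n ?prodr_ge0.
rewrite (bigD1 (o j)) //= eqxx /= -[X in X <= _]addr0 lerD //; last first.
  apply: sumr_ge0 => x _; rewrite mulr_ge0 // mulr_ge0 ?ler0n //.
  by rewrite mulr_ge0 ?ler0n ?prodr_ge0.
rewrite (bigD1 j) //= -!mulrA le_eqVlt; apply/orP; left; apply/eqP; congr (_ * (_ * _)).
by apply: eq_bigl => j'; rewrite inE negb_or andbC.
Qed.

Lemma expo_root (i : 'I_m) (Q : W -> bool) (b : R) : 0 <= b ->
  (forall x, expo [:: (i, x)] Q <= b) -> expo [::] Q <= b.
Proof.
move=> b0 H.
apply: (@le_trans _ _ (\sum_x w i x * expo [:: (i, x)] Q)); last first.
  apply: (@le_trans _ _ ((\sum_x w i x) * b)); last by rewrite ler_piMl.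
  by rewrite mulr_suml; apply: ler_sum => x _; rewrite ler_wpM2l.
rewrite /expo; under [X in _ <= X]eq_bigr => x _ do rewrite mulr_sumr.
rewrite exchange_big /=; apply: ler_sum => o _.
rewrite (bigD1 (o i)) //= eqxx /= !mulr1 -[X in X <= _]addr0 lerD //; last first.
  apply: sumr_ge0 => x _; rewrite mulr_ge0 // mulr_ge0 ?ler0n //.
  by rewrite mulr_ge0 ?ler0n ?prodr_ge0.
rewrite (bigD1 i) //= mulrA le_eqVlt; apply/orP; left; apply/eqP; congr (_ * _ * _).
by apply: eq_bigl => j'; rewrite inE.
Qed.

Section Segments.
Variables (cnd : X -> 'I_n -> bool) (al : R).
Hypotheses (al_ge0 : 0 <= al) (cndP : forall (a : 'I_k) (v : 'I_n),
  \sum_j \sum_(x | (tnth x.1 a == v) && cnd x v) w j x <= al).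

(* Chain of [l] fresh hyperedges, each entered at a vertex of the previous one
   (of [src] for the first); [C] is required of the resulting exposure. *)
Fixpoint seg (l : nat) L (src : seq 'I_n) (C : seq ('I_m * X) -> W -> bool) (o : W) : bool :=
  if l is l'.+1 then
    [exists a : 'I_k, [exists j, [&& j \notin labels L,
      (tnth (o j).1 a \in src) && cnd (o j) (tnth (o j).1 a) &
      seg l' ((j, o j) :: L) [seq tnth (o j).1 b | b <- enum 'I_k & b != a] C o]]]
  else C L o.

Local Notation rho := (k.-1%:R * k%:R * al).

(** Each step chooses a position of entry among [k] and one of the [k.-1] other vertices of the
    previous hyperedge, whence the branching factor [rho]; only the first step starts from [src]. *)
Lemma expo_seg l L src C b : 0 <= b -> uniq (labels L) ->
  (forall L', uniq (labels L') -> size L' = (size L + l)%N -> expo L' (C L') <= b) ->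
  expo L (seg l L src C) <= (if l is l'.+1 then (size src * k)%:R * al * rho ^+ l' else 1) * b.
Proof.
elim: l L src b => [|l IH] L src b b0 uL H.
  by rewrite mul1r; apply: H => //; rewrite addn0.
have rho0 : 0 <= rho by rewrite !mulr_ge0 ?ler0n.
set B := rho ^+ l * b.
have B0 : 0 <= B by rewrite mulr_ge0 ?exprn_ge0.
apply: le_trans (expo_exists _ _) _.
apply: (@le_trans _ _ (\sum_(a < k) (size src)%:R * al * B)); last first.
  by rewrite sumr_const card_ord -mulr_natr natrM /B le_eqVlt; apply/orP; left; apply/eqP; ring.
apply: ler_sum => a _.
apply: le_trans (expo_step (c := fun j x => (tnth x.1 a \in src) && cnd x (tnth x.1 a))
  (Q := fun j x => seg l ((j, x) :: L) [seq tnth x.1 b | b <- enum 'I_k & b != a] C) B0 _) _.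
  move=> j x jL _; rewrite /=.
  have uL' : uniq (labels ((j, x) :: L)) by rewrite /= jL.
  have H' L' : uniq (labels L') -> size L' = (size ((j, x) :: L) + l)%N -> expo L' (C L') <= b.
    by move=> u e; apply: H => //; rewrite e /= addSnnS.
  apply: le_trans (IH _ _ _ b0 uL' H') _; rewrite /B; case: l {IH H H' B B0} => [|l].
    by rewrite expr0.
  have -> : size [seq tnth x.1 b0 | b0 <- enum 'I_k & b0 != a] = k.-1.
    have := count_predC (pred1 a) (enum 'I_k); rewrite size_enum_ord size_map size_filter.
    by rewrite (count_uniq_mem _ (enum_uniq _)) mem_enum add1n => /(congr1 predn).
  by rewrite exprS natrM le_eqVlt; apply/orP; left; apply/eqP; ring.
rewrite ler_wpM2r //.
apply: (@le_trans _ _ (\sum_(v <- src) al)); last first.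
  by rewrite sum_const_seq.
apply: (@le_trans _ _ (\sum_(v <- src) \sum_j \sum_(x | (tnth x.1 a == v) && cnd x v) w j x)); last first.
  by apply: ler_sum.
rewrite [X in _ <= X]exchange_big /=; apply: ler_sum => j _.
rewrite [X in _ <= X](exchange_big_dep xpredT) //= [X in X <= _]big_mkcond /=.
apply: ler_sum => x _; case: ifP => [/andP[xs cx]|_]; last by rewrite sumr_ge0.
by rewrite (perm_big _ (perm_to_rem xs)) /= big_cons eqxx cx /= lerDl sumr_ge0.
Qed.

Hypothesis rho_lt1 : rho < 1.

(* Either a long chain_of starts at an exposed vertex, or [C] holds after a short one. *)
Definition rch r L C o := seg r.+1 L (vert L) (fun _ _ => true) o ||
  [exists l : 'I_r.+1, seg l L (vert L) C o].

(** A geometric series: the long chains cost [rho ^+ r], the short ones together a factor bounded in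
    [r]. [N] bounds the size of every exposure that occurs. *)
Lemma expo_rch r N L C b : 0 <= b -> uniq (labels L) -> (size L + r <= N)%N ->
  (forall L', uniq (labels L') -> (size L' <= N)%N -> expo L' (C L') <= b) ->
  expo L (rch r L C) <= (k * N * k)%:R * al * rho ^+ r + (1 + (k * N * k)%:R * al / (1 - rho)) * b.
Proof.
move=> b0 uL sN H; have rho0 : 0 <= rho by rewrite !mulr_ge0 ?ler0n.
have sz : ((size (vert L) * k)%:R <= (k * N * k)%:R :> R).
  by rewrite ler_nat size_vert !leq_mul //; lia.
apply: le_trans (expo_or _ _ _) _; apply: lerD.
  apply: le_trans (expo_seg (b := 1) _ _ uL _) _ => //; first by move=> L' uL' _; apply: expo_le1.
  by rewrite mulr1 ler_wpM2r ?exprn_ge0 // ler_wpM2r.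
apply: le_trans (expo_exists _ _) _; rewrite big_ord_recl mulrDl mul1r; apply: lerD.
  apply: le_trans (expo_seg _ b0 uL _) _; last by rewrite mul1r.
  by move=> L' uL' e; apply: H => //; rewrite e /= addn0; lia.
apply: (@le_trans _ _ (\sum_(l < r) (k * N * k)%:R * al * rho ^+ l * b)).
  apply: ler_sum => l _; apply: le_trans (expo_seg _ b0 uL _) _.
    by move=> L' uL' e; apply: H => //; rewrite e /=; have := ltn_ord l; rewrite /bump; lia.
  by rewrite /= ler_wpM2r // ler_wpM2r ?exprn_ge0 // ler_wpM2r.
rewrite -mulr_suml ler_wpM2r // -mulr_sumr ler_wpM2l ?mulr_ge0 ?ler0n //.
have r1 : 0 < 1 - rho by rewrite subr_gt0.
have := subrX1 rho r; rewrite -[X in _ -> _ <= X]mul1r ler_pdivlMr // => e.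
have : (1 - rho) * \sum_(i < r) rho ^+ i = 1 - rho ^+ r by rewrite -[1 - rho]opprB mulNr -e opprB.
by rewrite mulrC => ->; rewrite gerBl exprn_ge0.
Qed.

(* A chain_of of length between [l0] and [r]. *)
Definition long_seg l0 r L C o := [exists l : 'I_r.+1, (l0 < l)%N && seg l L (vert L) C o].

Lemma expo_long_seg l0 r N L C b : 0 <= b -> uniq (labels L) -> (size L + r <= N)%N ->
  (forall L', uniq (labels L') -> (size L' <= N)%N -> expo L' (C L') <= b) ->
  expo L (long_seg l0 r L C) <= (k * N * k)%:R * al * r.+1%:R * rho ^+ l0 * b.
Proof.
move=> b0 uL sN H; have rho0 : 0 <= rho by rewrite !mulr_ge0 ?ler0n.
have sz : ((size (vert L) * k)%:R <= (k * N * k)%:R :> R).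
  by rewrite ler_nat size_vert !leq_mul //; lia.
apply: le_trans (expo_exists _ _) _.
apply: (@le_trans _ _ (\sum_(l < r.+1) (k * N * k)%:R * al * rho ^+ l0 * b)); last first.
  by rewrite sumr_const card_ord -mulr_natr le_eqVlt; apply/orP; left; apply/eqP; ring.
apply: ler_sum => -[[|l] lr] _ /=.
  by rewrite /expo big1 ?mulr_ge0 ?exprn_ge0 // => o _; rewrite mulr0.
have [ll|ll] := boolP (l0 < l.+1)%N; last first.
  by rewrite /expo big1 ?mulr_ge0 ?exprn_ge0 // => o _; rewrite mulr0.
apply: (@le_trans _ _ (expo L (seg l.+1 L (vert L) C))); first exact: expo_mono.
  apply: le_trans (expo_seg _ b0 uL _) _.
    by move=> L' uL' e; apply: H => //; rewrite e; lia.
  rewrite ler_wpM2r // ler_pM ?mulr_ge0 ?exprn_ge0 // ?ler_wpM2r //.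
  by apply: ler_wiXn2l => //; apply: ltW.
Qed.

End Segments.

(** One more cycle: a fresh hyperedge with two entries at exposed vertices. In the application each
    such event costs a factor of order [1 / n], up to logarithms. *)
Definition clo L (C : seq ('I_m * X) -> W -> bool) (o : W) : bool :=
  [exists ab : 'I_k * 'I_k, [exists j, [&& j \notin labels L,
    [&& ab.1 != ab.2, tnth (o j).1 ab.1 \in vert L & tnth (o j).1 ab.2 \in vert L] &
    C ((j, o j) :: L) o]]].

Lemma expo_clo (ga : R) N L C b : 0 <= b -> 0 <= ga -> uniq (labels L) -> (size L < N)%N ->
  (forall (a a' : 'I_k) (v v' : 'I_n), a != a' ->
     \sum_j \sum_(x | (tnth x.1 a == v) && (tnth x.1 a' == v')) w j x <= ga) ->
  (forall L', uniq (labels L') -> (size L' <= N)%N -> expo L' (C L') <= b) ->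
  expo L (clo L C) <= (k * k * (k * N) ^ 2)%:R * ga * b.
Proof.
move=> b0 ga0 uL sN gaP H; apply: le_trans (expo_exists _ _) _.
apply: (@le_trans _ _ (\sum_(ab : 'I_k * 'I_k) ((k * N) ^ 2)%:R * ga * b)); last first.
  by rewrite sumr_const card_prod card_ord -mulr_natr natrM le_eqVlt; apply/orP; left; apply/eqP; ring.
apply: ler_sum => -[a a'] _ /=.
apply: le_trans (expo_step (c := fun j x => [&& a != a', tnth x.1 a \in vert L & tnth x.1 a' \in vert L])
  (Q := fun j x => C ((j, x) :: L)) b0 _) _.
  by move=> j x jL _; apply: H; rewrite //= jL.
rewrite ler_wpM2r //.
have [->|naa] := eqVneq a a'.
  by rewrite big1 ?mulr_ge0 ?ler0n // => j _; rewrite big1 // => x; rewrite eqxx.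
apply: (@le_trans _ _ (\sum_(v <- vert L) \sum_(v' <- vert L) ga)); last first.
  rewrite !sum_const_seq mulrA -natrM ler_wpM2r //.
  by rewrite ler_nat size_vert -mulnn leq_mul // leq_mul2l ltnW ?orbT.
apply: (@le_trans _ _ (\sum_(v <- vert L) \sum_(v' <- vert L)
   \sum_j \sum_(x | (tnth x.1 a == v) && (tnth x.1 a' == v')) w j x)); last first.
  by apply: ler_sum => v _; apply: ler_sum => v' _; apply: gaP.
under [X in _ <= X]eq_bigr => v _ do rewrite exchange_big.
rewrite [X in _ <= X]exchange_big /=; apply: ler_sum => j _.
under [X in _ <= X]eq_bigr => v _ do rewrite (exchange_big_dep xpredT) //=.
rewrite [X in _ <= X]exchange_big /= [X in X <= _]big_mkcond /=; apply: ler_sum => x _.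
case: ifP => [/andP[xs xs']|_]; last by rewrite sumr_ge0 // => v _; rewrite sumr_ge0.
rewrite (perm_big _ (perm_to_rem xs)) /= big_cons eqxx /= (perm_big _ (perm_to_rem xs')) /= big_cons eqxx.
rewrite -addrA lerDl addr_ge0 // ?sumr_ge0 // => v _; by rewrite sumr_ge0.
Qed.

End Exposure.

Local Close Scope ring_scope.
Local Open Scope nat_scope.

(** * Rounds of exploration, in parallel and in place *)

Section Rounds.
Variables (n m : nat) (E : 'I_m -> {set 'I_n}) (s : spins n) (c : {ffun 'I_m -> bool}).
Implicit Types (A D V : {set 'I_n}) (J C O : {set 'I_m}).

Definition rnd J A t := iter t (grow E J s c A) set0.

Lemma rnd_sub J A t : rnd J A t \subset cluster_of E J s c A.
Proof. by apply: iter_sub_fix; apply: grow_mono. Qed.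

Lemma rnd_mono J A t : rnd J A t \subset rnd J A t.+1.
Proof.
elim: t => [|t IH]; first exact: sub0set.
exact: grow_mono.
Qed.

Lemma rnd_leq J A t u : t <= u -> rnd J A t \subset rnd J A u.
Proof.
move/subnKC <-; elim: (u - t) => [|v IH]; first by rewrite addn0.
by rewrite addnS; apply: subset_trans IH (rnd_mono _ _ _).
Qed.

Lemma mem_rnd J A t u x : t <= u -> x \in rnd J A t -> x \in rnd J A u.
Proof. by move=> tu; apply/subsetP/rnd_leq. Qed.

Lemma rnd_sup J A t : A \subset rnd J A t.+1.
Proof. by rewrite /rnd iterS subsetUl. Qed.

Lemma rnd_fires J A t j : j \in J -> fires E s c (rnd J A t) j -> E j \subset rnd J A t.+1.
Proof. by move=> jJ fj; rewrite /rnd iterS; apply: subsetU; rewrite (bigcup_sup j) ?jJ ?orbT. Qed.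

Lemma cluster_rnd J A t : rnd J A t.+1 = rnd J A t -> cluster_of E J s c A = rnd J A t.
Proof.
move=> e; apply/eqP; rewrite eqEsubset rnd_sub andbT; apply: cluster_min.
  by rewrite -e rnd_sup.
by move=> j jJ fj; rewrite -e; apply: rnd_fires.
Qed.

(** The set of firing labels is increasing and determines the next round, so it has to stabilize
    before it could exceed [#|J|] elements. *)
Lemma rnd_card J A : cluster_of E J s c A = rnd J A #|J|.+1.
Proof.
pose F t := [set j in J | fires E s c (rnd J A t) j].
have FS t : F t \subset F t.+1.
  apply/subsetP => j; rewrite !inE => /andP[-> /=]; apply: fires_sub; exact: rnd_mono.
have RE t : rnd J A t.+1 = A :|: \bigcup_(j in F t) E j.
  by rewrite /rnd iterS /grow; congr (_ :|: _); apply: eq_bigl => j; rewrite inE.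
have stab t : F t = F t.+1 -> rnd J A t.+2 = rnd J A t.+1 by move=> e; rewrite !RE -e.
have cl t u : F t = F t.+1 -> t < u -> cluster_of E J s c A = rnd J A u.
  move=> /stab e tu; rewrite (cluster_rnd e); apply/eqP; rewrite eqEsubset; apply/andP; split; first exact: rnd_leq.
  by rewrite -(cluster_rnd e) rnd_sub.
have [[t tJ e]|H] : (exists2 t, t < #|J|.+1 & F t = F t.+1) \/ forall t, t <= #|J|.+1 -> t <= #|F t|.
- elim: #|J|.+1 => [|u [[t tu e]|IH]]; first by right=> t; rewrite leqn0 => /eqP ->.
    by left; exists t => //; apply: ltnW.
  have [e|ne] := eqVneq (F u) (F u.+1); first by left; exists u.
  right=> t; rewrite leq_eqVlt => /orP[/eqP ->|]; last by rewrite ltnS; apply: IH.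
  apply: leq_ltn_trans (IH u (leqnn _)) _; apply: proper_card.
  by rewrite properEneq ne FS.
- by apply: cl e tJ.
have := H _ (leqnn _); rewrite ltnNge subset_leq_card //.
by apply/subsetP => j; rewrite inE => /andP[].
Qed.

(* One pass over a list of labels, updating the cluster_of in place. *)
Definition pass1 D j := if fires E s c D j then D :|: E j else D.
Definition pass (l : seq 'I_m) D := foldl pass1 D l.

Lemma sub_pass l D : D \subset pass l D.
Proof.
elim: l D => //= j l IH D; apply: subset_trans (IH _); rewrite /pass1.
by case: ifP; rewrite ?subsetUl.
Qed.

Lemma pass_sub l D (K : {set 'I_n}) : D \subset K ->
  (forall j, j \in l -> fires E s c K j -> E j \subset K) -> pass l D \subset K.
Proof.
elim: l D => //= j l IH D sD H; apply: IH; last by move=> j' jl; apply: H; rewrite inE jl orbT.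
rewrite /pass1; case: ifP => // fj; rewrite subUset sD H ?inE ?eqxx //.
exact: fires_sub fj.
Qed.

Lemma pass_fires l D j : j \in l -> fires E s c D j -> E j \subset pass l D.
Proof.
elim: l D => //= j' l IH D; rewrite inE => /orP[/eqP <-|jl] fj.
  by apply: subset_trans (sub_pass _ _); rewrite /pass1 fj subsetUr.
apply: IH => //; apply: fires_sub fj; rewrite /pass1.
by case: ifP; rewrite ?subsetUl.
Qed.

(** A pass updates in place and so does at least as much as a round. [rnd] starts from the empty set
    and its first round only produces [A], which accounts for the shift by one. *)
Lemma iter_pass J A (l : seq 'I_m) t u : (forall j, j \in l = (j \in J)) ->
  cluster_of E J s c A = rnd J A t -> t <= u.+1 -> iter u (pass l) A = cluster_of E J s c A.
Proof.
move=> lJ e tu; apply/eqP; rewrite eqEsubset; apply/andP; split.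
  elim: u {tu} => [|u IH]; first exact: sub_cluster.
  by rewrite iterS; apply: pass_sub => // j; rewrite lJ; apply: cluster_closed.
rewrite {1}e; apply: subset_trans (rnd_leq J A tu) _; elim: u {tu} => [|u IH].
  by rewrite /rnd /= /grow subUset subxx /=; apply/bigcupsP => j /andP[_]; rewrite /fires setI0 cards0 eqxx.
rewrite iterS; change (grow E J s c A (rnd J A u.+1) \subset pass l (iter u (pass l) A)).
rewrite /grow subUset; apply/andP; split.
  elim: u {IH} => [|u IH]; first exact: sub_pass.
  by rewrite iterS; apply: subset_trans IH (sub_pass _ _).
apply/bigcupsP => j /andP[jJ fj]; apply: pass_fires; first by rewrite lJ.
exact: fires_sub fj.
Qed.

(* Clusters can be grown first inside a block and then outside of it. *)
Lemma cluster_block O C V x : (forall j, j \in C -> E j \subset V) ->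
  let A := cluster_of E C s c [set x] in
  cluster_of E O s c A :&: V = A :&: V ->
  cluster_of E (O :|: C) s c [set x] = cluster_of E O s c A.
Proof.
move=> sV A e; apply/eqP; rewrite eqEsubset; apply/andP; split.
  apply: cluster_min.
    exact: subset_trans (sub_cluster _ _ _ _ _) (sub_cluster _ _ _ _ _).
  move=> j; rewrite inE => /orP[jO fj|jC fj]; first exact: cluster_closed.
  apply: subset_trans (sub_cluster _ _ _ _ _); rewrite /A cluster_closed // -/A.
  move: fj; rewrite /fires.
  have e' : E j :&: cluster_of E O s c A = E j :&: A.
    by rewrite -(setIidPl (sV j jC)) -!setIA ![V :&: _]setIC e.
  rewrite e'; case/orP=> [->//|/and3P[n0 cj mo]]; rewrite n0 cj /=.
  apply/orP; right; rewrite -(eq_mono (s := flip_of s (cluster_of E O s c A))) // => y yE.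
  by rewrite !ffunE; move/setP: e' => /(_ y); rewrite !inE yE /= => ->.
apply: cluster_min; last first.
  by move=> j jO fj; apply: cluster_closed => //; rewrite inE jO.
apply: cluster_min; first exact: sub_cluster.
by move=> j jC fj; apply: cluster_closed => //; rewrite inE jC orbT.
Qed.

Lemma rnd_block O C x t u :
  let A := cluster_of E C s c [set x] in
  A = rnd C [set x] t -> cluster_of E O s c A = rnd O A u ->
  cluster_of E O s c A = cluster_of E (O :|: C) s c [set x] ->
  cluster_of E (O :|: C) s c [set x] = rnd (O :|: C) [set x] (t + u).
Proof.
move=> A eA eU e; apply/eqP; rewrite eqEsubset rnd_sub andbT -e eU.
have sA : A \subset rnd (O :|: C) [set x] t.
  rewrite {1}eA; elim: t {eA} => [|t IH]; first exact: sub0set.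
  rewrite /rnd iterS {1}/grow subUset rnd_sup /=; apply/bigcupsP => j /andP[jC fj].
  by apply: rnd_fires; rewrite ?inE ?jC ?orbT //; apply: fires_sub fj.
elim: u {eU} => [|u IH]; first exact: sub0set.
rewrite addnS /rnd iterS {1}/grow subUset; apply/andP; split.
  by apply: subset_trans sA (rnd_leq _ _ (leq_trans (leq_addr u t) (leqnSn _))).
apply/bigcupsP => j /andP[jO fj]; apply: rnd_fires; rewrite ?inE ?jO //.
exact: fires_sub fj.
Qed.

End Rounds.

(** * Chains of hyperedges and the cycles met by a cluster *)

Section Chains.
Variables (n m k : nat) (s : spins n).
Local Notation X := (k.-tuple 'I_n * bool)%type.
Local Notation W := {ffun 'I_m -> X}.
Variable o : W.

Definition verts (x : X) : {set 'I_n} := [set v in x.1].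

(* The edge can pass the flip_of of [v] on to its other vertices. *)
Definition act_of (x : X) (v : 'I_n) :=
  [&& x.2, v \in verts x & [forall u in verts x, (u != v) ==> (s u != s v)]].

Local Notation E := (fun j => verts (o j)).
Local Notation c := [ffun j => (o j).2].

Lemma fires_act D j : fires E s c D j ->
  (1 < #|E j :&: D|) \/ exists2 v, v \in D & act_of (o j) v.
Proof.
rewrite /fires ffunE => /orP[|/and3P[/set0Pn[v] + cj /monoP mo]]; first by left.
rewrite inE => /andP[vE vD].
have [le1|] := leqP #|E j :&: D| 1; [right; exists v => //|by left].
rewrite /act_of cj vE /=; apply/forall_inP => u uE; apply/implyP => uv.
have uD : u \notin D.
  apply/negP => uD; move: le1; apply/negP.
  rewrite -ltnNge; apply/card_gt1P; exists u, v; rewrite !in_setI; split=> //; exact/andP.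
by have := mo u v uE vE; rewrite !ffunE vD (negbTE uD) addbT addbF => ->; case: (s v).
Qed.

Lemma act_fires (D : {set 'I_n}) j v : v \in D -> act_of (o j) v -> fires E s c D j.
Proof.
move=> vD /and3P[cj vE /forall_inP H]; rewrite /fires ffunE cj.
have [//|le1] := ltnP 1 #|E j :&: D|; rewrite /=.
have vI : v \in E j :&: D by rewrite inE vE.
apply/andP; split; first by apply/set0Pn; exists v.
have uq u : u \in E j -> u \in D -> u = v.
  move=> uE uD; apply/eqP; move: le1; apply: contraTT => uv.
  rewrite -ltnNge; apply/card_gt1P; exists u, v; rewrite !in_setI; split=> //; exact/andP.
have val u : u \in E j -> flip_of s D u = ~~ s v.
  move=> uE; rewrite ffunE; have [->|uv] := eqVneq u v; first by rewrite vD addbT.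
  have /negbTE -> : u \notin D by apply: contra uv => uD; apply/eqP/uq.
  by have := implyP (H u uE) uv; rewrite addbF; case: (s u); case: (s v).
by apply/monoP => u u' uE uE'; rewrite !val.
Qed.

Definition inc (x : X) (v : 'I_n) := v \in verts x.

Variables (cnd : X -> 'I_n -> bool) (O : {set 'I_m}).
Hypothesis cnd_verts : forall x v, cnd x v -> v \in verts x.

Fixpoint chain_of (v : 'I_n) (ps : seq ('I_m * 'I_n)) : bool :=
  if ps is (j, u) :: ps' then
    [&& j \in O, cnd (o j) v, u \in E j & u != v] && chain_of u ps'
  else true.

Definition tip v (ps : seq ('I_m * 'I_n)) := last v (unzip2 ps).

Definition expose (L : seq ('I_m * X)) (ps : seq ('I_m * 'I_n)) :=
  foldl (fun L a => (a.1, o a.1) :: L) L ps.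

Lemma expose_labels L ps : labels (expose L ps) = rev (unzip1 ps) ++ labels L.
Proof.
elim: ps L => //= -[j u] ps IH L; rewrite IH /= rev_cons cat_rcons.
by [].
Qed.

Lemma vert_expose L ps v : v \in vert (expose L ps) =
  (v \in vert L) || has (fun a => v \in E a.1) ps.
Proof.
elim: ps L => [|[j u] ps IH] L /=; first by rewrite orbF.
by rewrite IH /vert /= mem_cat inE orbA [(v \in _) || (v \in flatten _)]orbC.
Qed.

Lemma chain_cat v p q : chain_of v (p ++ q) = chain_of v p && chain_of (tip v p) q.
Proof. by elim: p v => //= -[j u] p IH v; rewrite IH -!andbA. Qed.

Lemma chain_rcons v p j z : chain_of v (rcons p (j, z)) =
  chain_of v p && [&& j \in O, cnd (o j) (tip v p), z \in E j & z != tip v p].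
Proof. by rewrite -cats1 chain_cat /= andbT. Qed.

(** Distinct labels outside [L] mean that every hyperedge of the chain is fresh when it is met, so a
    combinatorial path becomes the event [seg] that the exposure bounds control. *)
Lemma chain_seg v ps L src (C : seq ('I_m * X) -> W -> bool) : chain_of v ps -> v \in src -> uniq (unzip1 ps) ->
  {in unzip1 ps, forall j, j \notin labels L} -> C (expose L ps) o ->
  seg cnd (size ps) L src C o.
Proof.
elim: ps v L src => //= -[j u] ps IH v L src /andP[/and4P[jO cv uE uv] ch] vs /andP[jn un] fr Co.
have vE := cnd_verts cv; rewrite inE in vE; case/tnthP: (vE) => a ea.
apply/existsP; exists a; apply/existsP; exists j; rewrite -ea vs cv fr ?inE ?eqxx //=.
apply: (IH u) => //.
  move: uE; rewrite inE => /tnthP[b eb]; apply/mapP; exists b => //.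
  by rewrite mem_filter mem_enum andbT; apply: contra uv => /eqP eab; rewrite eb ea eab.
move=> j' jp; rewrite inE negb_or fr ?inE ?jp ?orbT // andbT.
by apply: contra jn => /eqP /= <-.
Qed.

Lemma chain_seg_long r v ps L src (C : seq ('I_m * X) -> W -> bool) : chain_of v ps -> v \in src -> uniq (unzip1 ps) ->
  {in unzip1 ps, forall j, j \notin labels L} -> r < size ps ->
  (forall L', C L' o) -> seg cnd r.+1 L src C o.
Proof.
move=> ch vs un fr lt Co; rewrite -(size_takel lt).
have e : unzip1 (take r.+1 ps) = take r.+1 (unzip1 ps) by rewrite /unzip1 map_take.
apply: (chain_seg (v := v)) => //.
- by move: ch; rewrite -{1}(cat_take_drop r.+1 ps) chain_cat => /andP[].
- by rewrite e take_uniq.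
- by move=> j; rewrite e => /mem_take; apply: fr.
Qed.

(** When the first label recurs, leave it directly through the exit vertex of its later occurrence;
    if that vertex is the starting one, drop the loop altogether. *)
Lemma chain_uniq v ps : chain_of v ps -> exists ps', [/\ chain_of v ps', tip v ps' = tip v ps,
  uniq (unzip1 ps') & size ps' <= size ps].
Proof.
elim: ps v => [|[j u] ps IH] v /=; first by exists [::].
move=> /andP[/and4P[jO cv uE uv] /IH[ps' [ch tp un sz]]].
have [jin|jn] := boolP (j \in unzip1 ps'); last first.
  by exists ((j, u) :: ps'); rewrite /= jO cv uE uv ch jn un; split.
case/mapP: jin => -[j' w] jw /= ej; subst j'.
have [p1 [p2 e]] : exists p1 p2, ps' = p1 ++ (j, w) :: p2 by case/splitPr: jw => p1 p2; exists p1, p2.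
subst ps'; move: ch; rewrite chain_cat /= => /andP[_ /andP[/and4P[_ _ wE _] ch2]].
move: un; rewrite /unzip1 map_cat /= cat_uniq /= => /and3P[_ _ /andP[jn un2]].
have tp2 : tip w p2 = tip u ps by rewrite -tp /tip /unzip2 map_cat last_cat /=.
have [e|nv] := eqVneq w v.
  exists p2; rewrite -e; split=> //; move: sz; rewrite size_cat /=; lia.
exists ((j, w) :: p2); rewrite /= jO cv wE nv ch2 jn un2 /tip /= -/(tip w p2) tp2; split=> //.
by move: sz; rewrite size_cat /=; lia.
Qed.

(* The part of a chain_of after its last visit to [A]. *)
Lemma chain_cut (A : pred 'I_n) v ps : A v -> chain_of v ps -> uniq (unzip1 ps) ->
  exists v' ps', [/\ A v', chain_of v' ps', tip v' ps' = tip v ps, uniq (unzip1 ps') &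
    all (fun a => ~~ A a.2) ps'].
Proof.
have H ps' : forall v', chain_of v' ps' -> uniq (unzip1 ps') -> all (fun a => ~~ A a.2) ps' \/
   exists v2 p2, [/\ A v2, chain_of v2 p2, tip v2 p2 = tip v' ps', uniq (unzip1 p2) &
    all (fun a => ~~ A a.2) p2].
  elim: ps' => [|[j u] ps' IH] v' /=; first by left.
  move=> /andP[_ ch] /andP[_ un]; case: (IH u ch un) => [al|]; last by right.
  have [Au|nA] := boolP (A u); last by left; rewrite al.
  by right; exists u, ps'.
move=> Av ch un; case: (H _ _ ch un) => [al|//]; by exists v, ps.
Qed.

End Chains.

Section Structure.
Variables (n m k : nat) (s : spins n).
Local Notation X := (k.-tuple 'I_n * bool)%type.
Local Notation W := {ffun 'I_m -> X}.
Variables (o : W) (O : {set 'I_m}) (r : nat).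
Local Notation E := (fun j => verts (o j)).
Local Notation c := [ffun j => (o j).2].
Local Notation act_of := (act_of s).
Local Notation achain := (chain_of o act_of O).
Implicit Types (A D : {set 'I_n}) (L : seq ('I_m * X)) (C : seq ('I_m * X) -> W -> bool).

Lemma act_verts (x : X) v : act_of x v -> v \in verts x.
Proof. by case/and3P. Qed.

Definition arel : rel 'I_n := fun v u => [exists j in O, act_of (o j) v && (u \in E j)].
(** The cluster that would arise if hyperedges were only ever entered through a single vertex, as in
    a tree. *)
Definition acl A := [set u | [exists v in A, connect arel v u]].

Lemma sub_acl A : A \subset acl A.
Proof. by apply/subsetP => v vA; rewrite inE; apply/exists_inP; exists v => //; apply: connect0. Qed.

Lemma acl_closed A j v : j \in O -> v \in acl A -> act_of (o j) v -> E j \subset acl A.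
Proof.
move=> jO; rewrite inE => /exists_inP[a aA av] aj; apply/subsetP => u uE; rewrite inE.
apply/exists_inP; exists a => //; apply: connect_trans av (connect1 _).
by apply/exists_inP; exists j; rewrite ?aj.
Qed.

Lemma acl_chain A u : u \in acl A -> exists2 v, v \in A & exists ps,
  [/\ achain v ps, tip v ps = u & uniq (unzip1 ps)].
Proof.
rewrite inE => /exists_inP[a aA /connectP[q pq ->]]; exists a => //.
suff [ps [ch tp]] : exists ps, achain a ps /\ tip a ps = last a q.
  by have [ps' [ch' tp' un _]] := chain_uniq ch; exists ps'; rewrite tp'.
elim: q a {aA} pq => [|x q IH] a /=; first by exists [::].
move=> /andP[/exists_inP[j jO /andP[aj xE]] /IH[ps [ch tp]]].
have [e|nx] := eqVneq x a; first by exists ps; rewrite -e.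
by exists ((j, x) :: ps); rewrite /= jO aj xE nx.
Qed.

Lemma chain_in A v ps : v \in acl A -> achain v ps ->
  all (fun a => [&& a.1 \in O, E a.1 \subset acl A & a.2 \in acl A]) ps.
Proof.
elim: ps v => //= -[j u] ps IH v vA /andP[/and4P[jO aj uE _] ch].
have sE := acl_closed jO vA aj; have uA := subsetP sE _ uE.
by rewrite jO sE uA (IH u).
Qed.

Lemma tip_in A v ps : v \in acl A -> achain v ps -> tip v ps \in acl A.
Proof.
move=> vA /(chain_in vA) /allP al; rewrite /tip; case/lastP: ps al => [//|ps a] al.
by rewrite /unzip2 map_rcons last_rcons; have := al a; rewrite mem_rcons inE eqxx => /(_ isT) /and3P[].
Qed.

Lemma acl_min A D : A \subset D ->
  (forall j v, j \in O -> v \in D -> act_of (o j) v -> E j \subset D) -> acl A \subset D.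
Proof.
move=> sA H; apply/subsetP => u /acl_chain[v vA [ps [ch <- _]]].
have {vA} : v \in D by apply: subsetP vA.
elim: ps v ch => //= -[j w] ps IH v /andP[/and4P[jO aj wE _] ch] vD.
by apply: (IH w ch); apply: subsetP wE; apply: H vD aj.
Qed.

Lemma acl_cluster A : acl A \subset cluster_of E O s c A.
Proof.
apply: acl_min; first exact: sub_cluster.
by move=> j v jO vD aj; apply: cluster_closed => //; apply: act_fires vD aj.
Qed.

(** A hyperedge that fires through a single vertex is active there, so only double hits could lead
    out of the closure. *)
Lemma cluster_acl A : (forall j, j \in O -> 1 < #|E j :&: acl A| -> E j \subset acl A) ->
  cluster_of E O s c A = acl A.
Proof.
move=> H; apply/eqP; rewrite eqEsubset acl_cluster andbT; apply: cluster_min.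
  exact: sub_acl.
by move=> j jO /fires_act[|[v vD aj]]; [apply: H | apply: acl_closed vD aj].
Qed.

Lemma chain_rnd A v ps t : v \in rnd E s c O A t -> achain v ps ->
  tip v ps \in rnd E s c O A (t + size ps).
Proof.
elim: ps v t => [|[j u] ps IH] v t vT /=; first by rewrite addn0.
move=> /andP[/and4P[jO aj uE _] ch]; rewrite addnS -addSn; apply: IH => //.
by apply: (subsetP (rnd_fires jO _)) uE; apply: act_fires vT aj.
Qed.

Lemma realized_vert L j : realized L o -> j \in labels L -> {subset E j <= vert L}.
Proof.
move=> /allP H /mapP[[j' x] a /= ->] v; have /eqP /= -> := H _ a; rewrite inE => vx.
by apply/flattenP; exists (tval x.1) => //; apply/mapP; exists (j', x).
Qed.

Lemma realized_expose L ps : realized L o -> realized (expose o L ps) o.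
Proof. by elim: ps L => //= a ps IH L H; apply: IH; rewrite /= eqxx. Qed.

(** What later steps of an exposure may assume. The new hyperedges lie inside [D], so one that
    sticks out of [D] and was fresh before is fresh still. *)
Record extends (D : {set 'I_n}) L L' : Prop := Extends {
  ext_uniq : uniq (labels L');
  ext_real : realized L' o;
  ext_vert : {subset vert L <= vert L'};
  ext_lab : forall j, j \in labels L' -> j \in labels L \/ j \in O /\ E j \subset D }.

Lemma extends_trans D D' L L' L'' : D \subset D' -> extends D L L' -> extends D' L' L'' ->
  extends D' L L''.
Proof.
move=> sD [u1 r1 v1 l1] [u2 r2 v2 l2]; split=> // [v /v1 /v2 //|j /l2[/l1[|[jO jD]]|]]; [by left|right|by right].
by split=> //; apply: subset_trans sD.
Qed.

(** Only the part of the chain after its last visit to an exposed vertex is used. Its labels are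
    fresh, since otherwise one of its later vertices would lie on an exposed hyperedge and be
    exposed itself. *)
Lemma reach A L y C : realized L o -> uniq (labels L) -> {subset A <= vert L} ->
  y \in acl A ->
  (forall L', extends (acl A) L L' -> y \in vert L' -> C L' o) -> rch act_of r L C o.
Proof.
move=> rL uL sA yA HC.
have [v vA [ps [ch tp un]]] := acl_chain yA.
pose P v := (v \in vert L) && (v \in acl A).
have Pv : P v by rewrite /P sA // (subsetP (sub_acl A)).
have [v' [q [/andP[v'L v'A] chq tpq unq alq]]] := chain_cut Pv ch un.
have inq := allP (chain_in v'A chq).
have fr : {in unzip1 q, forall j, j \notin labels L}.
  move=> j /mapP[[j' u] ju /= ->]; apply/negP => jL.
  have /and3P[_ _ uA] := inq _ ju; have := allP alq _ ju; rewrite /P /= uA andbT => /negP; apply.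
  apply: (realized_vert rL jL); have := chq.
  case/splitPr: ju => q1 q2; rewrite chain_cat /= => /andP[_ /andP[/and4P[]]//].
rewrite /rch; have [sz|sz] := leqP (size q) r; last first.
  by rewrite (chain_seg_long act_verts chq).
apply/orP; right; apply/existsP; exists (Ordinal (sz : size q < r.+1)) => /=.
apply: (chain_seg act_verts chq) => //; apply: HC.
  split=> //.
  - by rewrite expose_labels cat_uniq rev_uniq unq uL andbT /=; apply/hasPn => j jL; rewrite mem_rev; apply/negP => /fr; rewrite jL.
  - exact: realized_expose.
  - by move=> u uL'; rewrite vert_expose uL'.
  - move=> j; rewrite expose_labels mem_cat mem_rev => /orP[/mapP[a aq ->]|]; last by left.
    by right; have /and3P[] := inq _ aq.
rewrite vert_expose -tp -tpq /tip; case/lastP: q chq {tpq unq alq inq fr sz} => [_|q a ch'].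
  by rewrite v'L.
case: a ch' => j u; rewrite chain_rcons => /andP[_ /and4P[_ _ uE _]].
by rewrite /unzip2 map_rcons last_rcons has_rcons /= uE orbT.
Qed.

(** A chain to each of the two hits is exposed in turn. The hyperedge itself sticks out of the
    closure, so neither chain has used it and it closes a cycle. *)
Lemma reach_clo A L j C : realized L o -> uniq (labels L) -> {subset A <= vert L} ->
  j \in O -> j \notin labels L -> 1 < #|E j :&: acl A| -> ~~ (E j \subset acl A) ->
  (forall L2, extends (acl A) L L2 -> j \notin labels L2 -> C ((j, o j) :: L2) o) ->
  rch act_of r L (fun L1 => rch act_of r L1 (fun L2 => clo L2 C)) o.
Proof.
move=> rL uL sA jO jL /card_gt1P[y [y' [+ + yy]]] nE HC.
rewrite !in_setI => /andP[yE yA] /andP[yE' yA'].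
apply: (reach rL uL sA yA) => L1 X1 y1; have [u1 r1 v1 l1] := X1.
have sA1 : {subset A <= vert L1} by move=> v /sA /v1.
apply: (reach r1 u1 sA1 yA') => L2 X2 y2; have [u2 r2 v2 l2] := X2.
have X02 := extends_trans (subxx _) X1 X2.
have j2 : j \notin labels L2.
  apply/negP => /(ext_lab X02)[jl|[_ sE]]; last by rewrite sE in nE.
  by rewrite jl in jL.
move: (yE) (yE'); rewrite !inE => /tnthP[a ea] /tnthP[b eb].
apply/existsP; exists (a, b); apply/existsP; exists j.
rewrite j2 /= -ea -eb v2 // y2 HC // !andbT.
by apply: contra yy => /eqP eab; rewrite ea eb eab.
Qed.

(** In the application this has probability of order [1 / n] and [two_clo] of order [1 / n^2], up to
    powers of the logarithm. Through [rch] both events also contain the rare case of a chain longer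
    than [r]. *)
Definition one_clo L := rch act_of r L (fun L1 => rch act_of r L1 (fun L2 => clo L2 (fun _ _ => true))).
Definition two_clo L := rch act_of r L (fun L1 => rch act_of r L1 (fun L2 => clo L2 one_clo)).

(* The last step of a achain that returns to an exposed vertex closes a cycle. *)
Lemma chain_clo L v p j z : realized L o -> uniq (labels L) -> v \in vert L -> achain v (rcons p (j, z)) ->
  uniq (unzip1 (rcons p (j, z))) -> {in unzip1 (rcons p (j, z)), forall j, j \notin labels L} ->
  z \in vert L -> one_clo L o /\
  (size p <= r -> seg act_of (size p) L (vert L) (fun L' => clo L' (fun _ _ => true)) o).
Proof.
move=> rL uL vL; rewrite chain_rcons /unzip1 map_rcons rcons_uniq => /andP[ch /and4P[jO aj zE zt]] /andP[jn un] fr zL.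
have fr' : {in unzip1 p, forall j, j \notin labels L}.
  by move=> j' jp; apply: fr; rewrite mem_rcons inE jp orbT.
have CL : clo (expose o L p) (fun _ _ => true) o.
  have tE := act_verts aj; move: (tE) (zE); rewrite !inE => /tnthP[a ea] /tnthP[b eb].
  apply/existsP; exists (a, b); apply/existsP; exists j; rewrite /= -ea -eb !andbT.
  rewrite expose_labels mem_cat mem_rev negb_or jn fr ?mem_rcons ?inE ?eqxx //=.
  rewrite !vert_expose zL /= andbT; apply/andP; split.
    by apply: contra zt => /eqP eab; rewrite ea eb eab.
  rewrite /tip; case/lastP: p ch {un jn fr fr' aj zt tE ea} => [|p [j' u]]; first by rewrite vL.
  by rewrite chain_rcons /unzip2 map_rcons last_rcons has_rcons => /andP[_ /and4P[_ _ /= -> _]]; rewrite orbT.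
split; last by move=> _; apply: (chain_seg act_verts ch).
rewrite /one_clo /rch; have [sz|sz] := leqP (size p) r; last first.
  by rewrite (chain_seg_long act_verts ch).
apply/orP; right; apply/existsP; exists (Ordinal (sz : size p < r.+1)) => /=.
apply: (chain_seg act_verts ch) => //.
by apply/orP; right; apply/existsP; exists ord0.
Qed.

Lemma acl_rnd A L u : realized L o -> uniq (labels L) -> {subset A <= vert L} ->
  {in O, forall j, j \notin labels L} ->
  ~~ seg act_of r.+1 L (vert L) (fun _ _ => true) o -> u \in acl A -> u \in rnd E s c O A r.+1.
Proof.
move=> rL uL sA fr ns /acl_chain[v vA [ps [ch <- un]]].
have [sz|sz] := leqP (size ps) r; last first.
  case/negP: ns; apply: (chain_seg_long act_verts ch) => //; first exact: sA.
  move=> j /mapP[a aps ->]; apply: fr.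
  by have /and3P[] := allP (chain_in (subsetP (sub_acl A) _ vA) ch) _ aps.
have v1 : v \in rnd E s c O A 1 by apply: subsetP vA; apply: rnd_sup.
by apply: (mem_rnd _ (chain_rnd v1 ch)); rewrite add1n.
Qed.

(** The cycle through the new hyperedge is already in [L]; a double hit, or a return to [vert L],
    would close a further one, which [~~ one_clo] excludes. *)
Lemma closer_structure L A : realized L o -> uniq (labels L) -> {subset A <= vert L} ->
  {in O, forall j, j \notin labels L} -> ~~ one_clo L o ->
  cluster_of E O s c A = rnd E s c O A r.+1 /\
  forall z, z \in vert L -> z \in cluster_of E O s c A -> z \in A.
Proof.
move=> rL uL sA fr no.
have cl : cluster_of E O s c A = acl A.
  apply: cluster_acl => j jO gt1; apply: contraR no => nE.
  by apply: (reach_clo rL uL sA jO (fr j jO) gt1 nE) => L2 _ _.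
have ns : ~~ seg act_of r.+1 L (vert L) (fun _ _ => true) o by apply: contra no => h; rewrite /one_clo /rch h.
split.
  apply/eqP; rewrite eqEsubset rnd_sub andbT cl; apply/subsetP => u; exact: (acl_rnd rL uL sA fr ns).
move=> z zL; rewrite cl => /acl_chain[v vA [ps [ch tp un]]].
case/lastP: ps ch tp un => [_ <- _ //|p [j u]] ch; rewrite /tip /unzip2 map_rcons last_rcons /= => e un.
case/negP: no; subst u; apply: (proj1 (chain_clo rL uL (sA _ vA) ch un _ zL)).
move=> j' /mapP[a aps ->]; apply: fr.
by have /and3P[] := allP (chain_in (subsetP (sub_acl A) _ vA) ch) _ aps.
Qed.

(** Only the new hyperedge is exposed at this point. One cycle in the cluster must be tolerated: its
    probability is of order [1 / n] for each of order [n] insertions, which does not vanish in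
    total. It shows as a hyperedge [j] hitting the closure twice, and once [j] is added [~~ two_clo]
    forbids another cycle. *)
Lemma noncloser_structure (i : 'I_m) A : i \notin O -> A \subset E i ->
  ~~ two_clo [:: (i, o i)] o ->
  cluster_of E O s c A = rnd E s c O A (r + r).+3 /\
  (cluster_of E O s c A = acl A \/ exists j, [/\ j \in O, 1 < #|E j :&: acl A|,
    ~~ (E j \subset acl A) & forall z, z \in E i -> z \in cluster_of E O s c A ->
      z \in acl A \/ z \in E j]).
Proof.
have le1 : r.+1 <= (r + r).+3 by lia.
have le2 : r.+2 <= (r + r).+3 by lia.
have le3 t : t <= r -> r.+2 + t <= (r + r).+3 by lia.
move=> iO sAi; set L0 := [:: _] => no.
have rL : realized L0 o by rewrite /= eqxx.
have uL : uniq (labels L0) by [].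
have iv v : v \in E i -> v \in vert L0 by rewrite /vert /= cats0 inE.
have sA : {subset A <= vert L0} by move=> v /(subsetP sAi) /iv.
have fr : {in O, forall j, j \notin labels L0}.
  by move=> j jO; rewrite inE /=; apply: contraNneq iO => <-.
have ns : ~~ seg act_of r.+1 L0 (vert L0) (fun _ _ => true) o by apply: contra no => h; rewrite /two_clo /rch h.
have D1 u : u \in acl A -> u \in rnd E s c O A r.+1 by apply: (acl_rnd rL uL sA fr ns).
have [cl|] := boolP [forall j in O, (1 < #|E j :&: acl A|) ==> (E j \subset acl A)].
  have e : cluster_of E O s c A = acl A.
    by apply: cluster_acl => j jO; apply: (implyP (forall_inP cl j jO)).
  split; last by left.
  apply/eqP; rewrite eqEsubset rnd_sub andbT e; apply/subsetP => u /D1 h.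
  exact: (mem_rnd le1 h).
rewrite negb_forall_in => /exists_inP[j jO]; rewrite negb_imply => /andP[gt1 nE].
pose A2 := A :|: E j.
have s12 : acl A \subset acl A2.
  apply: acl_min; first by apply: subset_trans (sub_acl _); rewrite subsetUl.
  by move=> j' v jO' vD aj; apply: acl_closed vD aj.
have Ej2 : E j \subset acl A2 by apply: subset_trans (sub_acl _); rewrite subsetUr.
(* The facts available once the first cycle has been exposed. *)
have two (P : Prop) : (forall L3, realized L3 o -> uniq (labels L3) -> {subset A2 <= vert L3} ->
     {subset E i <= vert L3} -> (forall j', j' \in labels L3 -> [\/ j' \notin O, j' = j |
       E j' \subset acl A]) -> ~ P -> one_clo L3 o) -> ~ ~ P.
  move=> H nP; case/negP: no.
  apply: (reach_clo rL uL sA jO (fr j jO) gt1 nE) => L2 [u2 r2 v2 l2] j2; apply: H => //=.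
  - by rewrite eqxx.
  - by rewrite j2.
  - move=> v; rewrite inE => /orP[/sA /v2 vv|]; rewrite /vert /= mem_cat; first by rewrite vv orbT.
    by rewrite inE => ->.
  - by move=> v /iv /v2; rewrite /vert /= mem_cat => ->; rewrite orbT.
  - move=> j'; rewrite inE => /orP[/eqP ->|/l2[|[_ h]]]; [by constructor 2| |by constructor 3].
    by rewrite inE => /eqP ->; constructor 1.
(* A vertex gained through [j] is reached by a chain that leaves [E j] and re-enters neither [acl A]
   nor [E j]; hence its labels are fresh for [L3]. *)
have from2 L3 : realized L3 o -> {subset A2 <= vert L3} ->
   (forall j', j' \in labels L3 -> [\/ j' \notin O, j' = j | E j' \subset acl A]) ->
   forall u, u \in acl A2 -> u \notin acl A -> u \notin E j -> exists v ps,
   [/\ v \in E j, achain v ps, tip v ps = u, uniq (unzip1 ps) &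
     {in unzip1 ps, forall j', j' \notin labels L3}].
  move=> r3 s3 l3 u uA2 nu1 nu2; have [v0 v0A [ps0 [ch0 tp0 un0]]] := acl_chain uA2.
  pose P v := (v \in acl A) || (v \in E j).
  have Pv : P v0 by move: v0A; rewrite inE /P => /orP[/(subsetP (sub_acl A)) ->|->]; rewrite ?orbT.
  have [v [ps [Pv' ch tp un al]]] := chain_cut Pv ch0 un0.
  have chO := chain_in (A := setT).
  have vE : v \in E j.
    move: Pv' => /orP[vA|//]; move: tp ch al; rewrite tp0.
    case: ps {un} => [e|[j1 u1] ps] /=; first by rewrite -e vA in nu1.
    move=> _ /andP[/and4P[j1O aj1 u1E _] _] /andP[]; rewrite /P negb_or => /andP[/negP []].
    by apply: (subsetP (acl_closed j1O vA aj1)).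
  exists v, ps; split=> //; first by rewrite tp.
  move=> j' /mapP[[j1 u1] ju /= ->]; apply/negP => /l3.
  have := allP al _ ju; rewrite /P /= negb_or => /andP[n1 n2].
  have [j1O u1E] : j1 \in O /\ u1 \in E j1.
    move: ch; case/splitPr: ju => q1 q2; rewrite chain_cat /= => /andP[_ /andP[/and4P[]]//].
  case=> [|e|sE]; [by rewrite j1O|by rewrite -e u1E in n2|by rewrite (subsetP sE _ u1E) in n1].
have dn (b : bool) : ~ ~ b -> b by case: b => // H; case: H.
have cl2 : cluster_of E O s c A2 = acl A2.
  apply: cluster_acl => j' jO' gt1'; apply: dn; apply: two => L3 r3 u3 s3 _ l3 nE'.
  apply: (reach_clo r3 u3 s3 jO' _ gt1' (introN idP nE')) => //.
  apply/negP => /l3[|e|sE]; first by rewrite jO'.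
    by apply: nE'; rewrite e.
  by apply: nE'; apply: subset_trans s12.
have cl : cluster_of E O s c A = acl A2.
  apply/eqP; rewrite eqEsubset; apply/andP; split.
    rewrite -cl2; apply: cluster_min; last by move=> j' jO'; apply: cluster_closed.
    by apply: subset_trans (sub_cluster _ _ _ _ _); rewrite subsetUl.
  apply: acl_min; last by move=> j' v jO' vD aj; apply: cluster_closed => //; apply: act_fires vD aj.
  rewrite subUset sub_cluster /=; apply: cluster_closed => //.
  by rewrite /fires (leq_trans gt1) // subset_leq_card // setIS // acl_cluster.
split.
  apply/eqP; rewrite eqEsubset rnd_sub andbT cl; apply/subsetP => u uA2.
  have [/D1 h|n1] := boolP (u \in acl A); first exact: (mem_rnd le1 h).
  have Ej : E j \subset rnd E s c O A r.+2.
    apply: rnd_fires => //; rewrite /fires (leq_trans gt1) // subset_leq_card // setIS //.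
    exact/subsetP.
  have [uE|n2] := boolP (u \in E j).
    exact: (mem_rnd le2 (subsetP Ej _ uE)).
  apply: dn; apply: two => L3 r3 u3 s3 _ l3 nu.
  have [v [ps [vE ch tp un fr3]]] := from2 L3 r3 s3 l3 u uA2 n1 n2.
  have [sz|sz] := leqP (size ps) r.
    case: nu; rewrite -tp; exact: (mem_rnd (le3 _ sz) (chain_rnd (subsetP Ej _ vE) ch)).
  apply/orP; left; apply: (chain_seg_long act_verts ch) => //.
  by apply: s3; rewrite inE vE orbT.
right; exists j; split=> // z zi; rewrite cl => z2.
have [z1|n1] := boolP (z \in acl A); first by left.
right; apply: dn; apply: two => L3 r3 u3 s3 i3 l3 /negP n2.
have [v [ps [vE ch tp un fr3]]] := from2 L3 r3 s3 l3 z z2 n1 n2.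
case/lastP: ps ch tp un fr3 => [|p [j' u]] ch; rewrite /tip /=.
  by move=> e; rewrite -e vE in n2.
rewrite /unzip2 map_rcons last_rcons /= => e un fr3; subst u.
apply: (proj1 (chain_clo r3 u3 _ ch un fr3 (i3 z zi))).
by apply: s3; rewrite inE vE orbT.
Qed.

(* Returning to another vertex of the new hyperedge needs a long cycle, unless
   a short free path already joins the two vertices. *)
Lemma noncloser_return (i : 'I_m) x z (ell : nat) : i \notin O -> x \in E i -> z \in E i -> z != x ->
  (forall ps, chain_of o (@inc n k) O x ps -> tip x ps = z -> ell < size ps) ->
  ~~ two_clo [:: (i, o i)] o ->
  ~~ long_seg act_of ell.-1 r [:: (i, o i)] (fun L => clo L (fun _ _ => true)) o ->
  0 < ell -> z \notin cluster_of E O s c [set x].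
Proof.
move=> iO xi zi zx short no nl ell0.
set L0 := [:: (i, o i)] in no nl *.
have rL : realized L0 o by rewrite /= eqxx.
have iv v : v \in E i -> v \in vert L0 by rewrite /vert /= cats0 inE.
have fr : {in O, forall j, j \notin labels L0}.
  by move=> j jO; rewrite inE /=; apply: contraNneq iO => <-.
have ns : ~~ seg act_of r.+1 L0 (vert L0) (fun _ _ => true) o by apply: contra no => h; rewrite /two_clo /rch h.
have free v ps : achain v ps -> chain_of o (@inc n k) O v ps.
  elim: ps v => //= -[j u] ps IH v /andP[/and4P[-> /act_verts vE -> ->] /IH ->].
  by rewrite /inc vE.
(* Without its closing hyperedge the chain still has at least [ell] steps; [long_seg] asks for
   strictly more than its parameter, hence [ell.-1]. *)
have key p j v ps' : v = x -> ps' = rcons p (j, z) -> achain x p -> uniq (unzip1 ps') ->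
    chain_of o (@inc n k) O x ps' -> j \in O -> tip x p \in E j -> False.
  move=> _ -> ch un fch jO tE.
  have sz : ell <= size p.
    by rewrite -ltnS -(size_rcons p (j, z)); apply: short => //; rewrite /tip /unzip2 map_rcons last_rcons.
  have chO := allP (chain_in (subsetP (sub_acl [set x]) x (set11 x)) ch).
  have frp : {in unzip1 p, forall j, j \notin labels L0}.
    by move=> j' /mapP[a ap ->]; apply: fr; have /and3P[] := chO _ ap.
  move: un; rewrite /unzip1 map_rcons rcons_uniq => /andP[jn un].
  have [pr|pr] := leqP (size p) r; last first.
    by case/negP: ns; apply: (chain_seg_long act_verts ch) => //; apply: iv.
  case/negP: nl; apply/existsP; exists (Ordinal (pr : size p < r.+1)); rewrite /= prednK // sz /=.
  apply: (chain_seg act_verts ch) => //; first exact: iv.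
  move: fch; rewrite chain_rcons => /andP[_ /and4P[_ _ zE zt]].
  move: (tE) (zE); rewrite !inE => /tnthP[a ea] /tnthP[b eb].
  apply/existsP; exists (a, b); apply/existsP; exists j; rewrite /= -ea -eb !andbT.
  rewrite expose_labels mem_cat mem_rev negb_or jn fr //= !vert_expose (iv z zi) /= andbT.
  apply/andP; split; first by apply: contra zt => /eqP eab; rewrite ea eb eab.
  rewrite /tip; case/lastP: p ch {un jn frp tE zt ea sz pr chO} => [|p [j' u]]; first by rewrite (iv x xi).
  by rewrite chain_rcons /unzip2 map_rcons last_rcons has_rcons => /andP[_ /and4P[_ _ /= -> _]]; rewrite orbT.
have nacl : z \notin acl [set x].
  apply/negP => /acl_chain[v]; rewrite inE => /eqP -> [ps [ch tp un]].
  case/lastP: ps ch tp un => [|p [j u]] ch; rewrite /tip /=; first by move=> e; rewrite e eqxx in zx.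
  rewrite /unzip2 map_rcons last_rcons /= => e un; subst u.
  have fch := free _ _ ch; move: (ch); rewrite chain_rcons => /andP[chp /and4P[jO aj _ _]].
  by apply: (key p j x _ erefl erefl chp un fch jO); apply: act_verts aj.
have sxi : [set x] \subset E i by rewrite sub1set.
apply/negP => zc; have [_ [e|[j [jO gt1 nE H]]]] := noncloser_structure iO sxi no.
  by rewrite e (negbTE nacl) in zc.
have [zA|zE] := H z zi zc; first by rewrite zA in nacl.
case/card_gt1P: gt1 => y [_ [+ _ _]]; rewrite in_setI => /andP[yE /acl_chain[v]].
rewrite inE => /eqP -> [ps [ch tp un]].
have yz : z != y by apply: contraNneq nacl => ->; rewrite -tp (tip_in (subsetP (sub_acl [set x]) x (set11 x))).
have inx := allP (chain_in (subsetP (sub_acl [set x]) x (set11 x)) ch).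
apply: (key ps j x _ erefl erefl ch) => //; last by rewrite tp.
  rewrite /unzip1 map_rcons rcons_uniq un andbT; apply/negP => /mapP[a aps /= e].
  by have /and3P[_] := inx _ aps; rewrite -e (negbTE nE).
by rewrite chain_rcons free // jO tp /inc yE zE yz.
Qed.

End Structure.

From mathcomp Require Import all_classical all_reals all_analysis.
From mathcomp Require Import fintype finset.
Import Order.TTheory GRing.Theory Num.Theory.

Local Open Scope ring_scope.

(** * Contiguity: fractional moments of the partition function *)

Section Averages.
Variables (R : realType) (T : finType) (m : nat).
Local Notation W := {ffun 'I_m -> T}.

Definition avg (A : finType) (F : A -> R) : R := (\sum_a F a) / #|A|%:R.

Definition setl (H : W) (i : 'I_m) (t : T) : W := [ffun j => if j == i then t else H j].

Lemma avg_ge0 (A : finType) (F : A -> R) : (forall a, 0 <= F a) -> 0 <= avg F.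
Proof. by move=> H; rewrite divr_ge0 ?ler0n ?sumr_ge0. Qed.

Lemma ler_avg (A : finType) (F G : A -> R) : (forall a, F a <= G a) -> avg F <= avg G.
Proof. by move=> H; rewrite ler_wpM2r ?invr_ge0 ?ler0n ?ler_sum. Qed.

Lemma eq_avg (A : finType) (F G : A -> R) : F =1 G -> avg F = avg G.
Proof. by move=> H; rewrite /avg (eq_bigr _ (fun a _ => H a)). Qed.

Lemma avgD (A : finType) (F G : A -> R) : avg (fun a => F a + G a) = avg F + avg G.
Proof. by rewrite /avg big_split mulrDl. Qed.

Lemma avgZ (A : finType) (F : A -> R) c : avg (fun a => c * F a) = c * avg F.
Proof. by rewrite /avg -mulr_sumr mulrA. Qed.

Lemma avg_const (A : finType) (c : R) : (0 < #|A|)%N -> avg (fun _ : A => c) = c.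
Proof. by move=> A0; rewrite /avg sumr_const -[c *+ _]mulr_natr mulfK // pnatr_eq0 -lt0n. Qed.

Lemma avg_sum (A I : finType) (P : pred I) (F : I -> A -> R) :
  avg (fun a => \sum_(i | P i) F i a) = \sum_(i | P i) avg (F i).
Proof. by rewrite /avg exchange_big mulr_suml. Qed.

Hypothesis T0 : (0 < #|T|)%N.

(** Exchanging coordinate [i] with an independent copy is an involution, so it preserves the uniform
    measure. *)
Lemma avg_resample (F : W -> R) (i : 'I_m) :
  avg F = avg (fun H => avg (fun t => F (setl H i t))).
Proof.
rewrite {1 2}/avg -mulr_suml; congr (_ / _).
rewrite pair_big /=.
have inv : involutive (fun x : W * T => (setl x.1 i x.2, x.1 i)).
  move=> [H t]; rewrite /= ffunE eqxx; congr (_, _); apply/ffunP => j; rewrite !ffunE.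
  by case: eqP => [->|].
rewrite (reindex_inj (inv_inj inv)) /=.
rewrite (eq_bigr (fun x : W * T => F x.1)) => [|[H t] _ /=]; last first.
  congr F; apply/ffunP => j; rewrite !ffunE; case: eqP => // -> //.
rewrite -(pair_big xpredT xpredT (fun H (t : T) => F H)) /=.
rewrite [X in _ = X / _](eq_bigr (fun H => F H * #|T|%:R)) => [|H _]; last first.
  by rewrite sumr_const -[_ *+ _]mulr_natr.
by rewrite -mulr_suml mulfK // pnatr_eq0 -lt0n.
Qed.

Lemma avg_prod (J : {set 'I_m}) (F : T -> R) :
  avg (fun H : W => \prod_(j in J) F (H j)) = avg F ^+ #|J|.
Proof.
rewrite /avg card_ffun card_ord.
have -> : \sum_(H : W) \prod_(j in J) F (H j) =
   \sum_(H : W) \prod_j (if j \in J then F (H j) else 1).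
  by apply: eq_bigr => H _; rewrite big_mkcond.
rewrite -(bigA_distr_bigA (fun j t => if j \in J then F t else 1)) (bigID (mem J)) /=.
rewrite (eq_bigr (fun=> \sum_t F t)) => [|j ->] //.
rewrite [X in _ * X / _](eq_bigr (fun=> #|T|%:R)) => [|j /negbTE ->]; last by rewrite sumr_const.
rewrite !prodr_const expr_div_n -[X in _ / X = _](_ : #|T|%:R ^+ (#|J| + #|~: J|) = _).
  rewrite exprD; have -> : #|[predC J]| = #|~: J| by apply: eq_card => j; rewrite !inE.
  have h e : #|T|%:R ^+ e != 0 :> R by rewrite expf_neq0 // pnatr_eq0 -lt0n.
  by field; rewrite !h.
by rewrite cardsC card_ord natrX.
Qed.

End Averages.

(** The labels present after [t] insertions: loops of the program count down, so hyperedges enter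
    from the last label on. *)
Definition suffix_set m t : {set 'I_m} := [set j : 'I_m | (m - t <= j)%N].

Lemma suffix_setS m t (i : 'I_m) : i = (m - t.+1)%N :> nat -> (t < m)%N ->
  suffix_set m t.+1 = i |: suffix_set m t.
Proof. by move=> e tm; apply/setP => j; rewrite !inE -val_eqE /=; lia. Qed.

Lemma notin_suffix_set m t (i : 'I_m) u : i = (m - t.+1)%N :> nat -> (t < m)%N -> (u <= t)%N ->
  i \notin suffix_set m u.
Proof. by move=> e tm ut; rewrite inE; lia. Qed.

Section Contiguity.
Variables (R : realType) (T S : finType) (m : nat).
Variables (f : S -> T -> R) (Bal : {set S}) (rr : S -> S -> R).
Variables (N0 nu lo C0 a2 c C2 : R).
Local Notation W := {ffun 'I_m -> T}.
Implicit Types (J : {set 'I_m}) (H : W).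
Hypotheses (T0 : (0 < #|T|)%N) (N0_gt0 : 0 < N0) (nu_gt0 : 0 < nu) (lo_gt0 : 0 < lo)
  (C0_ge0 : 0 <= C0) (a2_ge0 : 0 <= a2) (c_gt0 : 0 < c) (C2_ge0 : 0 <= C2).
Hypothesis Bal_size : N0 <= 2 * #|Bal|%:R.
Hypothesis f_lo : forall s t, lo <= f s t.
Hypothesis rr_ge0 : forall s s', 0 <= rr s s'.
Hypothesis avg_le1 : forall s, avg (f s) <= 1.
Hypothesis avg_ge : forall s, s \in Bal -> 1 - avg (f s) <= C0 / nu.
Hypothesis avg_pair : forall s s', s \in Bal -> s' \in Bal ->
  avg (fun t => f s t * f s' t) <= 1 + (a2 * rr s s' + C0) / nu.
Hypothesis exp_overlap : \sum_(s in Bal) \sum_(s' in Bal)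
  expR ((a2 * m%:R / nu + c) * rr s s') <= C2 * N0 ^+ 2.

Let f_gt0 s t : 0 < f s t. Proof. exact: lt_le_trans (f_lo s t). Qed.

Definition wgt (J : {set 'I_m}) (H : W) s := \prod_(j in J) f s (H j).
(** In the application [N0] is [2 ^+ n], [nu] is [n], [rr] is the squared overlap over [n], and [f]
    is the hyperedge weight divided by [kap]. Then [Mf] is the partition function over balanced
    configurations, normalized to order one, and [Lf] is large exactly when it is too small. *)
Definition Mf J H : R := (\sum_(s in Bal) wgt J H s) / N0.
Definition Lf J H : R := - ln (Mf J H).

Lemma wgt_gt0 J H s : 0 < wgt J H s.
Proof. by apply: prodr_gt0. Qed.

Lemma Bal_neq0 : exists s, s \in Bal.
Proof.
apply/set0Pn; apply: contraTneq N0_gt0 => e; rewrite -leNgt.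
by apply: le_trans Bal_size _; rewrite e cards0 mulr0.
Qed.

Lemma sumBal_gt0 (F : S -> R) : (forall s, 0 < F s) -> 0 < \sum_(s in Bal) F s.
Proof.
move=> F0; have [s sB] := Bal_neq0; rewrite (bigD1 s) //= ltr_pwDl //.
by apply: sumr_ge0 => ? _; apply: ltW.
Qed.

Lemma Mf_gt0 J H : 0 < Mf J H.
Proof. by rewrite divr_gt0 // sumBal_gt0 // => s; apply: wgt_gt0. Qed.

Definition gav J H (F : S -> R) := (\sum_(s in Bal) wgt J H s * F s) / (\sum_(s in Bal) wgt J H s).

Let Z J H := \sum_(s in Bal) wgt J H s.
Let Z_gt0 J H : 0 < Z J H. Proof. by apply: sumBal_gt0 => s; apply: wgt_gt0. Qed.

Lemma ler_gav J H (F G : S -> R) : (forall s, s \in Bal -> F s <= G s) -> gav J H F <= gav J H G.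
Proof.
move=> h; rewrite ler_wpM2r ?invr_ge0 ?(ltW (Z_gt0 J H)) //; apply: ler_sum => s sB.
by rewrite ler_wpM2l ?h // ltW // wgt_gt0.
Qed.

Lemma gav_const J H a : gav J H (fun=> a) = a.
Proof. by rewrite /gav -mulr_suml mulrAC divff ?mul1r // gt_eqF // Z_gt0. Qed.

Lemma eq_gav J H F G : F =1 G -> gav J H F = gav J H G.
Proof. by move=> h; rewrite /gav; congr (_ / _); apply: eq_bigr => s _; rewrite h. Qed.

Lemma gavD J H F G : gav J H (fun s => F s + G s) = gav J H F + gav J H G.
Proof. by rewrite /gav -mulrDl -big_split; congr (_ / _); apply: eq_bigr => s _; rewrite mulrDr. Qed.

Lemma gavZ J H a F : gav J H (fun s => a * F s) = a * gav J H F.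
Proof. by rewrite /gav mulrA mulr_sumr; congr (_ / _); apply: eq_bigr => s _; rewrite mulrCA. Qed.

Lemma gav_avg J H (F : S -> T -> R) : gav J H (fun s => avg (F s)) = avg (fun t => gav J H (F^~ t)).
Proof.
rewrite /gav /avg -[in RHS]mulr_suml mulrAC; congr (_ / _).
rewrite exchange_big /= mulr_suml; apply: eq_bigr => s _; rewrite -mulr_sumr mulrA.
by [].
Qed.

Lemma wgt_setl J H (i : 'I_m) t s : i \notin J -> wgt J (setl H i t) s = wgt J H s.
Proof.
move=> iJ; apply: eq_bigr => j jJ; rewrite ffunE; case: eqP => // e.
by rewrite -e jJ in iJ.
Qed.

Lemma Mf_setl J H i t : i \notin J -> Mf J (setl H i t) = Mf J H.
Proof. by move=> iJ; rewrite /Mf; congr (_ / _); apply: eq_bigr => s _; apply: wgt_setl. Qed.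

Lemma Mf_step J H i t : i \notin J -> Mf (i |: J) (setl H i t) = Mf J H * gav J H (f^~ t).
Proof.
move=> iJ; rewrite /Mf /gav [RHS]mulrC [RHS]mulrA divfK ?gt_eqF ?Z_gt0 //; congr (_ / _).
apply: eq_bigr => s _; rewrite /wgt big_setU1 //= ffunE eqxx mulrC; congr (_ * _).
exact: wgt_setl.
Qed.

Let y J H t := gav J H (f^~ t).

Let y_lo J H t : lo <= y J H t.
Proof. by rewrite -(gav_const J H lo); apply: ler_gav => s _; apply: f_lo. Qed.

Let y_gt0 J H t : 0 < y J H t. Proof. exact: lt_le_trans (y_lo J H t). Qed.

Let avg_y J H : avg (y J H) <= 1.
Proof. by rewrite -gav_avg -[X in _ <= X](gav_const J H); apply: ler_gav. Qed.

Lemma Lf_step J H i t : i \notin J -> Lf (i |: J) (setl H i t) = Lf J H - ln (y J H t).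
Proof. by move=> iJ; rewrite /Lf Mf_step // lnM ?posrE ?Mf_gt0 ?y_gt0 // opprD. Qed.

(** A new hyperedge multiplies [Mf] by [y], whose mean is at most 1, and [ln y <= y - 1]. *)
Lemma Lf_submart J H i a : i \notin J -> 0 <= a ->
  expR (a * Lf J H) <= avg (fun t => expR (a * Lf (i |: J) (setl H i t))).
Proof.
move=> iJ a0; rewrite (eq_avg (G := fun t => expR (a * Lf J H) * expR (- (a * ln (y J H t))))); last first.
  by move=> t; rewrite Lf_step // mulrBr expRD.
rewrite avgZ -{1}[expR _]mulr1 ler_wpM2l ?expR_ge0 //.
apply: (@le_trans _ _ (avg (fun t => (1 + a) + (- a) * y J H t))).
  rewrite avgD avgZ avg_const //; have := avg_y J H; have := mulr_ge0 a0 (_ : 0 <= 1 - avg (y J H)).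
  by rewrite subr_ge0 => h /h; lra.
apply: ler_avg => t; apply: le_trans (expR_ge1Dx _).
have : ln (y J H t) <= y J H t - 1.
  have := @le_ln1Dx _ (y J H t - 1); rewrite addrCA subrr addr0; apply.
  by rewrite -subr_gt0 opprK subrK y_gt0.
by move/(ler_wpM2l a0); lra.
Qed.

(** Mean overlap of two replicas of the Gibbs measure restricted to [Bal]. *)
Definition ov J H := gav J H (fun s => gav J H (rr s)).

Let ov_ge0 J H : 0 <= ov J H.
Proof.
rewrite -(gav_const J H 0); apply: ler_gav => s _; rewrite -(gav_const J H 0).
by apply: ler_gav.
Qed.

Let C1 := C0 + (a2 + C0 * 3) / lo.
Let C1_ge0 : 0 <= C1.
Proof. by rewrite addr_ge0 // divr_ge0 ?(ltW lo_gt0) // addr_ge0 // mulr_ge0. Qed.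

(** The mean square of [1 - y] is a correlation of two replicas, hence of the order of their mean
    overlap over [nu]; its mean is of order [1 / nu] by balance. The lower bound [lo] turns [1 / y]
    into a quadratic polynomial in [1 - y]. *)
Lemma Lf_drift J H i a : i \notin J -> 0 <= a <= 1 ->
  avg (fun t => expR (a * Lf (i |: J) (setl H i t))) <=
  expR (a * Lf J H) * (1 + a * C1 / nu * (1 + ov J H)).
Proof.
move=> iJ /andP[a0 a1]; rewrite (eq_avg (G := fun t => expR (a * Lf J H) * expR (a * (- ln (y J H t))))); last first.
  by move=> t; rewrite Lf_step // mulrDr expRD.
rewrite avgZ ler_wpM2l ?expR_ge0 //.
(* Convexity of the exponential between 0 and [z], obtained from two uses of [1 + x <= expR x]. *)
have conv z : expR (a * z) <= 1 - a + a * expR z.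
  have h1 : expR (a * z) * (1 + (1 - a) * z) <= expR z.
    have -> : expR z = expR (a * z) * expR ((1 - a) * z) by rewrite -expRD; congr expR; ring.
    by rewrite ler_wpM2l ?expR_ge0 ?expR_ge1Dx.
  have h2 : expR (a * z) * (1 - a * z) <= 1.
    rewrite [X in _ <= X](_ : 1 = expR (a * z) * expR (- (a * z))); last by rewrite -expRD subrr expR0.
    by rewrite ler_wpM2l ?expR_ge0 ?expR_ge1Dx.
  have := ler_wpM2l a0 h1; have := @ler_wpM2l _ (1 - a) _ _ _ h2.
  by rewrite subr_ge0 => /(_ a1); lra.
pose xi t := 1 - y J H t.
apply: (@le_trans _ _ (avg (fun t => 1 + (a * xi t + (a / lo) * (xi t * xi t))))).
  apply: ler_avg => t; apply: le_trans (conv _) _.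
  rewrite expRN lnK ?posrE ?y_gt0 //.
  have y0 := y_gt0 J H t; have yl := y_lo J H t.
  have e : (y J H t)^-1 = 1 + xi t + xi t * xi t / y J H t.
    by rewrite /xi; field; rewrite gt_eqF.
  have : xi t * xi t / y J H t <= xi t * xi t / lo.
    by rewrite ler_wpM2l ?lef_pV2 ?posrE // -expr2 sqr_ge0.
  move=> h; have h' := ler_wpM2l a0 h; rewrite e; move: h'.
  by rewrite (_ : a * (xi t * xi t / lo) = a / lo * (xi t * xi t)); [rewrite /xi; lra | ring].
rewrite avgD avg_const // lerD2l avgD !avgZ.
have x1 : avg xi <= C0 / nu.
  rewrite /xi avgD avg_const // (eq_avg (G := fun t => (-1) * y J H t)); last by move=> t; rewrite mulN1r.
  rewrite avgZ mulN1r -gav_avg.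
  have : 1 - C0 / nu <= gav J H (fun s => avg (f s)).
    rewrite -(gav_const J H (1 - C0 / nu)); apply: ler_gav => s sB.
    by have := avg_ge sB; lra.
  by lra.
have x2 : avg (fun t => xi t * xi t) <= (a2 * ov J H + C0 * 3) / nu.
  have -> : avg (fun t => xi t * xi t) =
      gav J H (fun s => gav J H (fun s' => avg (fun t => (1 - f s t) * (1 - f s' t)))).
    have e t : xi t * xi t = gav J H (fun s => gav J H (fun s' => (1 - f s t) * (1 - f s' t))).
      have xiE : xi t = gav J H (fun s => 1 - f s t).
        rewrite /xi gavD gav_const (_ : gav J H (fun s => - f s t) = - y J H t) //.
        by rewrite /y -mulN1r -gavZ; congr (_ / _); apply: eq_bigr => s _; rewrite mulN1r.
      rewrite [RHS](@eq_gav _ _ _ (fun s => xi t * (1 - f s t))) => [|s]; last by rewrite gavZ -xiE mulrC.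
      by rewrite gavZ -xiE.
    rewrite (eq_avg e) -gav_avg; congr (_ / _); apply: eq_bigr => s _; congr (_ * _).
    by rewrite -gav_avg.
  have -> : (a2 * ov J H + C0 * 3) / nu = gav J H (fun s => gav J H (fun s' => (a2 * rr s s' + C0 * 3) / nu)).
    have e s : gav J H (fun s' => (a2 * rr s s' + C0 * 3) / nu) = (a2 / nu) * gav J H (rr s) + C0 * 3 / nu.
      rewrite -gavZ -[X in _ + X](gav_const J H) -gavD; congr (_ / _); apply: eq_bigr => s' _.
      by congr (_ * _); ring.
    rewrite /gav (eq_bigr _ (fun s _ => congr1 _ (e s))) -/(gav J H _) gavD gavZ gav_const -/(ov J H).
    by ring.
  apply: ler_gav => s sB; apply: ler_gav => s' sB'.
  rewrite (eq_avg (G := fun t => 1 + ((-1) * f s t + ((-1) * f s' t + f s t * f s' t)))); last by move=> t; ring.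
  rewrite !avgD !avgZ avg_const //.
  have := avg_pair sB sB'; have := avg_ge sB; have := avg_ge sB'; rewrite !mulrDl; lra.
have h1 := ler_wpM2l a0 x1.
have al0 : 0 <= a / lo by rewrite divr_ge0 // ltW.
have h2 := ler_wpM2l al0 x2.
have -> : a * C1 / nu * (1 + ov J H) = a * (C0 / nu) + a / lo * ((a2 * ov J H + C0 * 3) / nu) +
   (a * C0 / nu * ov J H + a / lo * (a2 / nu) + a / lo * (C0 * 3 / nu) * ov J H).
  by rewrite /C1; field; rewrite !gt_eqF.
suff : 0 <= a * C0 / nu * ov J H + a / lo * (a2 / nu) + a / lo * (C0 * 3 / nu) * ov J H by lra.
have nv : 0 <= nu^-1 by rewrite invr_ge0 ltW.
have lv : 0 <= lo^-1 by rewrite invr_ge0 ltW.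
move: (ov J H) (ov_ge0 J H) => o o0.
by apply: addr_ge0; [apply: addr_ge0|]; repeat (apply: mulr_ge0 => //).
Qed.

(** A second moment tilted by the overlap. Its mean stays bounded because [exp_overlap] leaves the
    room [c] in the exponent. *)
Definition Nf J H : R := (\sum_(s in Bal) \sum_(s' in Bal) wgt J H s * wgt J H s' * expR (c * rr s s')) / N0 ^+ 2.

Let C3 := expR (C0 * m%:R / nu) * C2.

Lemma avg_Nf J : avg (Nf J) <= C3.
Proof.
rewrite /Nf (eq_avg (G := fun H => N0 ^- 2 * \sum_(s in Bal) \sum_(s' in Bal)
   expR (c * rr s s') * \prod_(j in J) (f s (H j) * f s' (H j)))); last first.
  move=> H; rewrite mulrC; congr (_ * _); apply: eq_bigr => s _; apply: eq_bigr => s' _.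
  by rewrite big_split mulrC.
rewrite avgZ mulrC ler_pdivrMr ?exprn_gt0 // avg_sum.
apply: (@le_trans _ _ (expR (C0 * m%:R / nu) * \sum_(s in Bal) \sum_(s' in Bal)
  expR ((a2 * m%:R / nu + c) * rr s s'))); last by rewrite /C3 -[X in _ <= X]mulrA ler_wpM2l ?expR_ge0.
rewrite mulr_sumr; apply: ler_sum => s sB; rewrite avg_sum mulr_sumr; apply: ler_sum => s' sB'.
rewrite avgZ (avg_prod T0 J (fun t => f s t * f s' t)).
have av0 : 0 <= avg (fun t => f s t * f s' t) by apply: avg_ge0 => t; rewrite mulr_ge0 // ltW.
set e := (a2 * rr s s' + C0) / nu.
have e0 : 0 <= e by rewrite divr_ge0 ?(ltW nu_gt0) // addr_ge0 // mulr_ge0.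
have : avg (fun t => f s t * f s' t) ^+ #|J| <= expR (e * m%:R).
  apply: (@le_trans _ _ (expR e ^+ #|J|)).
    rewrite lerXn2r ?nnegrE ?expR_ge0 //; apply: le_trans (avg_pair sB sB') _; exact: expR_ge1Dx.
  rewrite -expRM_natr ler_expR ler_wpM2l // ler_nat -[X in (_ <= X)%N]card_ord; exact: max_card.
move/(ler_wpM2l (expR_ge0 (c * rr s s')))/le_trans; apply.
rewrite -!expRD ler_expR /e le_eqVlt; apply/orP; left; apply/eqP; field.
by rewrite gt_eqF.
Qed.

(* Jensen's inequality for the two-replica overlap. *)
Lemma ov_Nf J H : expR (c * ov J H - 2 * Lf J H) <= Nf J H.
Proof.
have M0 := Mf_gt0 J H.
have -> : Nf J H = Mf J H ^+ 2 * gav J H (fun s => gav J H (fun s' => expR (c * rr s s'))).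
  have Z0 : Z J H != 0 by rewrite gt_eqF // Z_gt0.
  rewrite /Nf /Mf /gav -/(Z J H) expr_div_n mulrAC; congr (_ / _).
  rewrite (eq_bigr (fun s => (wgt J H s * \sum_(s' in Bal) wgt J H s' * expR (c * rr s s')))).
    rewrite [in RHS](eq_bigr (fun s => (wgt J H s * \sum_(s' in Bal) wgt J H s' * expR (c * rr s s')) / Z J H)).
      by rewrite -mulr_suml; field.
    by move=> s _; rewrite mulrA.
  by move=> s _; rewrite mulr_sumr; apply: eq_bigr => s' _; rewrite mulrA.
have -> : expR (c * ov J H - 2 * Lf J H) = Mf J H ^+ 2 * expR (c * ov J H).
  rewrite expRD mulrC; congr (_ * _).
  by rewrite /Lf mulrN opprK expRM_natl lnK ?posrE.
rewrite ler_wpM2l ?exprn_ge0 ?(ltW M0) //.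
set z := c * ov J H.
apply: (@le_trans _ _ (gav J H (fun s => gav J H (fun s' => expR z * (1 - z) + (expR z * c) * rr s s')))).
  have e s : gav J H (fun s' => expR z * (1 - z) + (expR z * c) * rr s s') =
     expR z * (1 - z) + (expR z * c) * gav J H (rr s) by rewrite gavD gav_const gavZ.
  rewrite /gav (eq_bigr _ (fun s _ => congr1 _ (e s))) -/(gav J H _) gavD gav_const gavZ -/(ov J H).
  by rewrite -mulrA -/z -mulrDr subrK mulr1.
apply: ler_gav => s _; apply: ler_gav => s' _.
have -> : c * rr s s' = z + (c * rr s s' - z) by ring.
rewrite expRD -mulrA -mulrDr ler_wpM2l ?expR_ge0 //; apply: le_trans (expR_ge1Dx _); lra.
Qed.

Let kp := C1 / c.

(* The exponent shrinks at each step so as to absorb the logarithm produced by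
   Young's inequality. *)
Lemma Lf_moment_step J i a : i \notin J -> 0 <= a <= 1 ->
  let a' := a * (1 + kp * (a + 2) / nu) in
  avg (fun H => expR (a * Lf (i |: J) H)) <=
  (1 + C1 / nu) * avg (fun H => expR (a' * Lf J H)) + (C1 + kp * C3) / nu.
Proof.
move=> iJ a01 /=; set a' := a * (1 + _); have /andP[a0 a1] := a01.
have kp0 : 0 <= kp by rewrite divr_ge0 // ltW.
have nv : 0 <= nu^-1 by rewrite invr_ge0 ltW.
have aa' : a <= a'.
  rewrite /a' mulrDr mulr1 lerDl; apply: mulr_ge0 => //; apply: mulr_ge0 => //.
  by apply: mulr_ge0 => //; apply: addr_ge0.
rewrite (avg_resample T0 _ i).
apply: (@le_trans _ _ (avg (fun H => (1 + C1 / nu) * expR (a' * Lf J H) + (C1 / nu + kp / nu * Nf J H)))).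
  apply: ler_avg => H; apply: le_trans (Lf_drift H iJ a01) _.
  set A := expR (a * Lf J H); set l := Lf J H; set Y := ov J H.
  have A0 : 0 <= A by apply: expR_ge0.
  (* Young's inequality: [1 + z <= expR z] at [z = c * Y - (a + 2) * l], multiplied by
     [A = expR (a * l)], yields exactly the exponent bounded by [ov_Nf]. *)
  have Y1 : A * (c * Y) <= Nf J H + A * ((a + 2) * l).
    have := ov_Nf J H; rewrite -/Y -/l => N1.
    have : A * (c * Y - (a + 2) * l) <= expR (c * Y - 2 * l).
      have -> : c * Y - 2 * l = a * l + (c * Y - (a + 2) * l) by ring.
      rewrite expRD ler_wpM2l // ; apply: le_trans (expR_ge1Dx _); lra.
    by lra.
  (* The leftover factor [l] is absorbed by raising the exponent from [a] to [a']. *)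
  have h1 : A * (1 + a * (kp * (a + 2) / nu) * l) <= expR (a' * l).
    have -> : a' * l = a * l + a * (kp * (a + 2) / nu) * l by rewrite /a'; ring.
    by rewrite expRD ler_wpM2l // expR_ge1Dx.
  have h2 : A <= 1 + expR (a' * l).
    have [l0|l0] := leP 0 l.
      by apply: le_trans (_ : expR (a' * l) <= _); rewrite ?ler_expR ?ler_wpM2r // lerDr.
    apply: le_trans (_ : 1 <= _); last by rewrite lerDl expR_ge0.
    by rewrite /A -/l expR_le1 mulr_ge0_le0 // ltW.
  have -> : A * (1 + a * C1 / nu * (1 + Y)) = A + a * C1 / nu * A + a * kp / nu * (A * (c * Y)).
    by rewrite /kp; field; rewrite !gt_eqF.
  have c1 : 0 <= a * kp / nu by apply: mulr_ge0 => //; apply: mulr_ge0.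
  have h3 := ler_wpM2l c1 Y1.
  have N0' : 0 <= Nf J H by apply: le_trans (ov_Nf J H); apply: expR_ge0.
  have h4 : a * kp / nu * Nf J H <= kp / nu * Nf J H.
    rewrite ler_wpM2r // ler_wpM2r // ler_piMl //.
  have c2 : 0 <= C1 / nu by rewrite mulr_ge0.
  have h5 : a * C1 / nu * A <= C1 / nu * (1 + expR (a' * l)).
    by apply: ler_pM => //; rewrite ?mulr_ge0 // ler_wpM2r // ler_piMl.
  lra.
have -> : (C1 + kp * C3) / nu = C1 / nu + kp / nu * C3 by ring.
rewrite avgD avgZ; apply: lerD => //.
rewrite avgD avg_const ?card_ffun ?card_ord ?expn_gt0 ?T0 // avgZ; apply: lerD => //.
by apply: ler_wpM2l; [apply: mulr_ge0 | apply: avg_Nf].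
Qed.

Lemma Mf0 H : 1 / 2 <= Mf set0 H.
Proof.
rewrite /Mf (eq_bigr (fun=> 1)) => [|s _]; last by rewrite /wgt big_set0.
rewrite sumr_const ler_pdivrMr // mulrAC ler_pdivlMr // mul1r; move: Bal_size; rewrite mulrC; lra.
Qed.

Definition moment_bound := (2 + (C1 + kp * C3) / nu * m%:R) * expR (C1 / nu * m%:R).

(** Induction on the number of hyperedges. Removing one multiplies the exponent by at most
    [expR (3 * kp / nu)], because [a + 2 <= 3]; the hypothesis on [a] keeps it at most 1 all the way
    to the empty hypergraph. *)
Lemma Lf_moment J a : 0 <= a -> a * expR (3 * kp / nu * m%:R) <= 1 ->
  avg (fun H => expR (a * Lf J H)) <= moment_bound.
Proof.
have kp0 : 0 <= kp by rewrite divr_ge0 // ltW.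
have nv : 0 <= nu^-1 by rewrite invr_ge0 ltW.
set D := (C1 + kp * C3) / nu.
have C3_ge0 : 0 <= C3 by rewrite mulr_ge0 ?expR_ge0.
have D0 : 0 <= D by rewrite mulr_ge0 // addr_ge0 // mulr_ge0.
have g0 : 0 <= C1 / nu by rewrite mulr_ge0.
have ex1 (x : R) : 0 <= x -> 1 <= expR x.
  by move=> x0; apply: le_trans (expR_ge1Dx x); rewrite lerDl.
have k3 : 0 <= 3 * kp / nu by apply: mulr_ge0 => //; apply: mulr_ge0.
suff main (t : nat) : (t <= m)%N -> forall a J, #|J| = t -> 0 <= a ->
   a * expR (3 * kp / nu * t%:R) <= 1 ->
   avg (fun H => expR (a * Lf J H)) <= (2 + D * t%:R) * expR (C1 / nu * t%:R).
  move=> a0 ha; have Jm : (#|J| <= m)%N by rewrite -[X in (_ <= X)%N]card_ord max_card.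
  have Jr : (#|J|%:R <= m%:R :> R) by rewrite ler_nat.
  apply: le_trans (main _ Jm a J erefl a0 _) _.
    by apply: le_trans ha; rewrite ler_wpM2l // ler_expR ler_wpM2l.
  rewrite /moment_bound -/D; apply: ler_pM; rewrite ?expR_ge0 //.
  - by apply: addr_ge0 => //; apply: mulr_ge0.
  - by rewrite lerD2l ler_wpM2l.
  - by rewrite ler_expR ler_wpM2l.
elim: t => [|t IH] tm b J' Jt b0 hb.
  move/eqP: Jt; rewrite cards_eq0 => /eqP ->; rewrite !mulr0 addr0 expR0 mulr1.
  move: hb; rewrite mulr0 expR0 mulr1 => b1.
  rewrite -[X in _ <= X](@avg_const _ {ffun 'I_m -> T}); last by rewrite card_ffun card_ord expn_gt0 T0.
  apply: ler_avg => H; have M0 := Mf_gt0 set0 H.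
  have l2 : Lf set0 H <= ln 2.
    rewrite /Lf -lnV ?posrE // ler_ln ?posrE ?invr_gt0 // -[X in _ <= X]invrK lef_pV2 ?posrE ?invr_gt0 //.
    by have := Mf0 H; rewrite div1r.
  apply: (@le_trans _ _ (expR (ln 2))); last by rewrite lnK ?posrE.
  rewrite ler_expR; apply: le_trans (ler_wpM2l b0 l2) _; rewrite ler_piMl // ln_ge0 //; lra.
have /card_gt0P[i iJ] : (0 < #|J'|)%N by rewrite Jt.
have iD : i \notin J' :\ i by rewrite !inE eqxx.
have Jc : #|J' :\ i| = t by move: Jt; rewrite (cardsD1 i) iJ => -[].
have b1 : b <= 1.
  by apply: le_trans hb; rewrite ler_peMr // ex1 // mulr_ge0.
have b01 : 0 <= b <= 1 by rewrite b0.
have := Lf_moment_step iD b01; rewrite setD1K //= => /le_trans; apply.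
set a' := b * _.
have a'0 : 0 <= a'.
  apply: mulr_ge0 => //; apply: addr_ge0 => //; apply: mulr_ge0 => //; apply: mulr_ge0 => //.
  exact: addr_ge0.
have {}IH := IH (ltnW tm) a' (J' :\ i) Jc a'0.
have ha' : a' * expR (3 * kp / nu * t%:R) <= 1.
  have hE : b * expR (3 * kp / nu * t.+1%:R) = b * expR (3 * kp / nu) * expR (3 * kp / nu * t%:R).
    by rewrite -[RHS]mulrA -expRD; congr (_ * expR _); rewrite -[t.+1%:R]natr1; ring.
  apply: le_trans hb; rewrite hE ler_wpM2r ?expR_ge0 //.
  rewrite /a'; apply: ler_wpM2l => //; apply: le_trans (expR_ge1Dx _); rewrite lerD2l.
  by apply: ler_wpM2r => //; rewrite [3 * kp]mulrC; apply: ler_wpM2l => //; move: b1; lra.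
have g1 : 0 <= 1 + C1 / nu by rewrite addr_ge0.
have := ler_wpM2l g1 (IH ha'); rewrite -/D => h; apply: le_trans (lerD h (lexx D)) _.
rewrite -[t.+1%:R]natr1 !mulrDr !mulr1 [X in _ <= _ * expR X]addrC expRD.
set e := expR (C1 / nu * t%:R).
have e1 : 1 <= e by rewrite ex1 // mulr_ge0.
have x1 : 1 + C1 / nu <= expR (C1 / nu) by apply: expR_ge1Dx.
have d0 : 0 <= 2 + D * t%:R by rewrite addr_ge0 // mulr_ge0.
have h1 : (1 + C1 / nu) * ((2 + D * t%:R) * e) <= (2 + D * t%:R) * (expR (C1 / nu) * e).
  by rewrite mulrCA ler_wpM2l // ler_wpM2r // expR_ge0.
have h2 : D <= D * (expR (C1 / nu) * e).
  rewrite ler_peMr // -[X in X <= _]mulr1 ler_pM //; apply: le_trans x1; lra.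
have -> : (2 + (D * t%:R + D)) * (expR (C1 / nu) * e) =
  (2 + D * t%:R) * (expR (C1 / nu) * e) + D * (expR (C1 / nu) * e) by ring.
exact: lerD.
Qed.

Section Maximal.
Variables (a l0 : R).
Hypotheses (a_ge0 : 0 <= a).
Definition small_seen t (H : W) := [exists u : 'I_m.+1, (u <= t)%N && (l0 <= Lf (suffix_set m u) H)].

(** Doob's maximal inequality for the submartingale [expR (a * Lf)], along the order of
    insertion. *)
Lemma Lf_maximal : a * expR (3 * kp / nu * m%:R) <= 1 ->
  avg (fun H : W => (small_seen m H)%:R) <= expR (- (a * l0)) * moment_bound.
Proof.
move=> ha.
have key t : (t <= m)%N -> expR (a * l0) * avg (fun H => (small_seen t H)%:R) <=
    avg (fun H => expR (a * Lf (suffix_set m t) H) * (small_seen t H)%:R).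
  elim: t => [|t IH] tm.
    rewrite -avgZ; apply: ler_avg => H; case: (boolP (small_seen 0 H)) => [|_]; last by rewrite !mulr0.
    case/existsP => -[[|u] um] //= h; rewrite !mulr1 ler_expR ler_wpM2l //.
  have mt : (m - t.+1 < m)%N by rewrite ltn_subrL /= (leq_ltn_trans _ tm).
  pose i := Ordinal mt.
  have iN u : (u <= t)%N -> i \notin suffix_set m u by apply: notin_suffix_set.
  have Se : suffix_set m t.+1 = i |: suffix_set m t by apply: suffix_setS.
  have Su (u : nat) H v : (u <= t)%N -> Lf (suffix_set m u) (setl H i v) = Lf (suffix_set m u) H.
    by move=> ut; rewrite /Lf Mf_setl // iN.
  have sm H v : small_seen t (setl H i v) = small_seen t H.
    by apply: eq_existsb => u; case: leqP => //= ut; rewrite Su.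
  have sS H : small_seen t.+1 H = small_seen t H || (l0 <= Lf (suffix_set m t.+1) H).
    apply/existsP/orP => [[u /andP[ut h]]|[/existsP[u /andP[ut h]]|h]].
    - move: ut; rewrite leq_eqVlt => /orP[/eqP e|ut]; first by right; rewrite -e.
      by left; apply/existsP; exists u; rewrite -ltnS ut.
    - by exists u; rewrite h (leq_trans ut).
    - by exists (inord t.+1); rewrite inordK ?ltnS // leqnn h.
  have -> : avg (fun H => expR (a * Lf (suffix_set m t.+1) H) * (small_seen t.+1 H)%:R) =
     avg (fun H => expR (a * Lf (suffix_set m t.+1) H) * (small_seen t H)%:R) +
     avg (fun H => expR (a * Lf (suffix_set m t.+1) H) * ((l0 <= Lf (suffix_set m t.+1) H) && ~~ small_seen t H)%:R).
    by rewrite -avgD; apply: eq_avg => H; rewrite sS; case: small_seen; case: (l0 <= _); rewrite /=; ring.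
  have -> : avg (fun H => (small_seen t.+1 H)%:R) = avg (fun H => (small_seen t H)%:R) +
     avg (fun H => ((l0 <= Lf (suffix_set m t.+1) H) && ~~ small_seen t H)%:R) :> R.
    by rewrite -avgD; apply: eq_avg => H; rewrite sS; case: small_seen; case: (l0 <= _); rewrite /=; ring.
  rewrite mulrDr; apply: lerD.
    apply: le_trans (IH (ltnW tm)) _; rewrite [X in _ <= X](avg_resample T0 _ i).
    apply: ler_avg => H; rewrite [X in _ <= X](eq_avg (G := fun v => (small_seen t H)%:R * expR (a * Lf (suffix_set m t.+1) (setl H i v)))).
      by rewrite avgZ mulrC ler_wpM2l ?ler0n // Se Lf_submart ?iN.
    by move=> v; rewrite sm mulrC.
  rewrite -avgZ; apply: ler_avg => H; case: (boolP (l0 <= _)) => [h|_]; last by rewrite !mulr0.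
  by rewrite ler_wpM2r ?ler0n // ler_expR ler_wpM2l.
have := key m (leqnn _); rewrite expRN -ler_pdivlMl ?expR_gt0 // => /le_trans; apply.
rewrite ler_wpM2l ?invr_ge0 ?expR_ge0 //.
apply: le_trans (Lf_moment (suffix_set m m) a_ge0 ha); apply: ler_avg => H.
by rewrite ler_piMr ?expR_ge0 // lern1 leq_b1.
Qed.

End Maximal.
End Contiguity.

(** * Gaussian moments of magnetization and overlap *)

Section FfunSums.
Variable (R : realType).

Definition consf q (c : {ffun 'I_q -> bool}) (b : bool) : {ffun 'I_q.+1 -> bool} :=
  [ffun i => if unlift ord_max i is Some j then c j else b].

Lemma consf_max q (c : {ffun 'I_q -> bool}) b : consf c b ord_max = b.
Proof. by rewrite ffunE unlift_none. Qed.

Lemma consf_widen q (c : {ffun 'I_q -> bool}) b j : consf c b (widen_ord (leqnSn q) j) = c j.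
Proof.
have -> : widen_ord (leqnSn q) j = lift ord_max j.
  by apply: val_inj; rewrite /= /bump leqNgt ltn_ord.
by rewrite ffunE liftK.
Qed.

Lemma sum_consf q (F : {ffun 'I_q.+1 -> bool} -> R) :
  \sum_c F c = \sum_(c : {ffun 'I_q -> bool}) \sum_(b : bool) F (consf c b).
Proof.
rewrite pair_big /= (reindex (fun cb : {ffun 'I_q -> bool} * bool => consf cb.1 cb.2)) //=.
exists (fun c : {ffun 'I_q.+1 -> bool} => ([ffun j => c (widen_ord (leqnSn q) j)], c ord_max)) => [[c b] _|c _] /=.
  by rewrite consf_max; congr (_, _); apply/ffunP => j; rewrite ffunE consf_widen.
apply/ffunP => i; rewrite ffunE; case: unliftP => [j ->|->] //; rewrite ffunE; congr (c _).
by apply: val_inj; rewrite /= /bump leqNgt ltn_ord.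
Qed.

Lemma sum_tuple_prod n k (F : 'I_k -> 'I_n -> R) :
  \sum_(t : k.-tuple 'I_n) \prod_b F b (tnth t b) = \prod_b \sum_v F b v.
Proof.
rewrite bigA_distr_bigA /= (reindex (fun f : {ffun 'I_k -> 'I_n} => [tuple f b | b < k])) /=.
  by apply: eq_bigr => f _; apply: eq_bigr => b _; rewrite tnth_mktuple.
exists (fun t : k.-tuple 'I_n => [ffun b => tnth t b]) => [f _|t _].
  by apply/ffunP => b; rewrite ffunE tnth_mktuple.
by apply: eq_from_tnth => b; rewrite tnth_mktuple ffunE.
Qed.

End FfunSums.

Section Magnetization.
Variable (R : realType).
Local Notation sv := (spin_value R).

Definition mag n (s : spins n) : R := \sum_x sv (s x).

Lemma mag_consf n (c : spins n) b : mag (consf c b) = mag c + sv b.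
Proof.
by rewrite /mag big_ord_recr /= consf_max; congr (_ + _); apply: eq_bigr => x _; rewrite consf_widen.
Qed.

Lemma sum_spins0 (F : spins 0 -> R) : \sum_s F s = F [ffun=> true].
Proof.
rewrite (bigD1 [ffun=> true]) //= big1 ?addr0 // => s /eqP[]; apply/ffunP => -[].
by [].
Qed.

Lemma sum_mag2 n : \sum_(s : spins n) mag s ^+ 2 = n%:R * 2 ^+ n.
Proof.
elim: n => [|n IH]; first by rewrite sum_spins0 /mag big_ord0 mul0r expr0n.
rewrite sum_consf (eq_bigr (fun c : spins n => 2 * mag c ^+ 2 + 2)) => [|c _]; last first.
  by rewrite big_bool /= !mag_consf /spin_value; ring.
rewrite big_split /= -mulr_sumr IH sumr_const card_ffun card_bool card_ord.
by rewrite -[2 *+ _]mulr_natr natrX -[n.+1%:R]natr1 exprS; ring.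
Qed.

(** With [b] half of [a], the quantity [expR a + expR (- a) - 2] is the square of
    [expR b - expR (- b)], which is close to [a]; the slack [de] pays for the difference. *)
Lemma cosh_small (a de : R) : 0 <= a -> a <= de -> de <= 1 ->
  expR a + expR (- a) <= 2 * expR (a ^+ 2 * (1 / 2 + de)).
Proof.
move=> a0 ad d1.
apply: (@le_trans _ _ (2 * (1 + a ^+ 2 * (1 / 2 + de)))); last first.
  by rewrite ler_wpM2l // expR_ge1Dx.
pose b := a / 2.
have eb : expR (- b) = (expR b)^-1 by rewrite expRN.
have B0 : 0 < expR b := expR_gt0 b.
have -> : expR a = expR b ^+ 2 by rewrite -expRM_natl; congr expR; rewrite /b; field.
have -> : expR (- a) = (expR b)^-1 ^+ 2 by rewrite -eb -expRM_natl; congr expR; rewrite /b; field.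
have b1 : 0 < 1 - b by rewrite /b; lra.
have h1 : 1 - b <= (expR b)^-1 by rewrite -eb; apply: le_trans (expR_ge1Dx _); lra.
have h2 : expR b <= (1 - b)^-1 by rewrite -[expR b]invrK lef_pV2 ?posrE ?invr_gt0.
have h3 : 1 + b <= expR b := expR_ge1Dx b.
set x := expR b in B0 h1 h2 h3 *; set y := x^-1 in h1 *.
have xy : x * y = 1 by rewrite divff // gt_eqF.
have y1 : y <= 1 by rewrite invf_le1 //; move: h3; rewrite /b; lra.
have h4 : (1 - b)^-1 - (1 - b) <= 2 * b * (1 + b).
  have -> : (1 - b)^-1 - (1 - b) = (2 * b - b ^+ 2) / (1 - b) by field; rewrite gt_eqF.
  rewrite ler_pdivrMr //.
  have -> : 2 * b * (1 + b) * (1 - b) = 2 * b - b ^+ 2 + b ^+ 2 * (1 - 2 * b) by ring.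
  by rewrite lerDl mulr_ge0 ?sqr_ge0 // /b; lra.
have h5 : 0 <= x - y <= 2 * b * (1 + b).
  by apply/andP; split; [move: y1 h3; rewrite /b; lra | lra].
have h6 : (x - y) ^+ 2 <= (2 * b * (1 + b)) ^+ 2.
  by case/andP: h5 => u v; rewrite lerXn2r ?nnegrE //; apply: le_trans v.
have -> : x ^+ 2 + y ^+ 2 = 2 + (x - y) ^+ 2.
  have -> : (x - y) ^+ 2 = x ^+ 2 + y ^+ 2 - 2 * (x * y) by ring.
  by rewrite xy; ring.
rewrite mulrDr mulr1 lerD2l; apply: le_trans h6 _.
have -> : (2 * b * (1 + b)) ^+ 2 = a ^+ 2 * (1 + b) ^+ 2 by rewrite /b; field.
have -> : 2 * (a ^+ 2 * (1 / 2 + de)) = a ^+ 2 * (1 + 2 * de) by field.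
rewrite ler_wpM2l ?sqr_ge0 //.
have -> : (1 + b) ^+ 2 = 1 + 2 * b + b * b by ring.
have : b * b <= b by rewrite ler_piMl // /b; lra.
by rewrite /b; lra.
Qed.

(** A bound of [cosh a] by [expR (ka * a ^+ 2)] passes from [a] to [2 * a], since [cosh (2 a)] is
    [2 cosh^2 a - 1]. Halving [y] until [cosh_small] applies gives the constant [1 / 2 + de], and
    then [de] tends to 0. *)
Lemma cosh_le (y : R) : expR y + expR (- y) <= 2 * expR (y ^+ 2 / 2).
Proof.
wlog y0 : y / 0 <= y.
  by move=> H; have [/H //|/ltW yn] := leP 0 y; have := H (- y); rewrite oppr_ge0 opprK sqrrN addrC; apply.
have dbl (ka a : R) : expR a + expR (- a) <= 2 * expR (ka * a ^+ 2) ->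
    expR (2 * a) + expR (- (2 * a)) <= 2 * expR (ka * (2 * a) ^+ 2).
  move=> h; set C := expR a + expR (- a) in h.
  have -> : expR (2 * a) + expR (- (2 * a)) = C ^+ 2 - 2.
    have -> : expR (2 * a) = expR a ^+ 2 by rewrite -expRM_natl.
    have -> : expR (- (2 * a)) = expR (- a) ^+ 2 by rewrite -expRM_natl mulrN.
    have e1 : expR a * expR (- a) = 1 by rewrite -expRD subrr expR0.
    have -> : C ^+ 2 = expR a ^+ 2 + 2 * (expR a * expR (- a)) + expR (- a) ^+ 2 by rewrite /C; ring.
    by rewrite e1; ring.
  have C0 : 0 <= C by rewrite addr_ge0 ?expR_ge0.
  have : C ^+ 2 <= (2 * expR (ka * a ^+ 2)) ^+ 2 by rewrite lerXn2r ?nnegrE // mulr_ge0 ?expR_ge0.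
  set x := expR (ka * a ^+ 2).
  have -> : expR (ka * (2 * a) ^+ 2) = (x ^+ 2) ^+ 2.
    by rewrite /x -!expRM_natl; congr expR; ring.
  have := sqr_ge0 (x ^+ 2 - 1).
  have -> : (x ^+ 2 - 1) ^+ 2 = (x ^+ 2) ^+ 2 - 2 * x ^+ 2 + 1 by ring.
  have -> : (2 * x) ^+ 2 = 4 * x ^+ 2 by ring.
  lra.
have iterd (ka : R) N (a : R) : expR a + expR (- a) <= 2 * expR (ka * a ^+ 2) ->
    expR (2 ^+ N * a) + expR (- (2 ^+ N * a)) <= 2 * expR (ka * (2 ^+ N * a) ^+ 2).
  by elim: N => [|N IH] h; rewrite ?expr0 ?mul1r // exprS -mulrA dbl // IH.
have key de : 0 < de -> de <= 1 -> expR y + expR (- y) <= 2 * expR ((1 / 2 + de) * y ^+ 2).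
  (* This makes [y / 2 ^+ N] at most [de], because [N < 2 ^ N]. *)
  move=> d0 d1; pose N := `|Num.ceil (y / de)|%N.
  have yN : y <= de * 2 ^+ N.
    rewrite -ler_pdivrMl // mulrC; apply: le_trans (_ : N%:R <= _).
      by apply: le_trans (ceil_ge _) _; rewrite /N natr_absz ler_int ler_norm.
    by rewrite -natrX ler_nat ltnW // ltn_expl.
  have P0 : 0 < 2 ^+ N :> R by rewrite exprn_gt0.
  have := @iterd (1 / 2 + de) N (y / 2 ^+ N).
  rewrite (_ : 2 ^+ N * (y / 2 ^+ N) = y); last by rewrite mulrC divfK ?gt_eqF.
  apply; rewrite [(1 / 2 + de) * _]mulrC; apply: cosh_small => //.
    by rewrite divr_ge0 // ltW.
  by rewrite ler_pdivrMr.
have S0 : 0 < expR y + expR (- y) by rewrite addr_gt0 ?expR_gt0.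
rewrite -ler_pdivrMl // mulrC -[X in X <= _]lnK ?posrE ?divr_gt0 // ler_expR.
apply/ler_addgt0Pr => e e0.
pose de := Num.min 1 (e / (y ^+ 2 + 1)).
have q0 : 0 < y ^+ 2 + 1 by rewrite ltr_wpDl ?sqr_ge0.
have d0 : 0 < de by rewrite lt_min ltr01 divr_gt0.
have d1 : de <= 1 by rewrite ge_min lexx.
have h := key de d0 d1.
rewrite -ler_pdivrMl // mulrC -[X in X <= _]lnK ?posrE ?divr_gt0 // ler_expR in h; apply: le_trans h _.
have -> : (1 / 2 + de) * y ^+ 2 = y ^+ 2 / 2 + de * y ^+ 2 by field.
rewrite lerD2l; apply: (@le_trans _ _ (e / (y ^+ 2 + 1) * y ^+ 2)).
  by rewrite ler_wpM2r ?sqr_ge0 // ge_min lexx orbT.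
rewrite mulrAC ler_pdivrMr // ler_pM2l //; lra.
Qed.

(** Averaging out one spin replaces [x] by [x - 1]: the cross term is a hyperbolic cosine, and
    [(x + 1) * (x - 1) <= x ^+ 2]. The hypothesis [n%:R < x] allows [n] such steps. *)
Lemma exp_moment n (x : R) : n%:R < x ->
  \sum_(s : spins n) expR (mag s ^+ 2 / (2 * x)) <= 2 ^+ n * expR (n%:R / (2 * (x - n%:R))).
Proof.
elim: n x => [|n IH] x nx.
  by rewrite sum_spins0 /mag big_ord0 expr0n mul0r !mul0r expR0 mulr1 expr0.
have n0 : 0 <= n%:R :> R by [].
have nS : n.+1%:R = n%:R + 1 :> R by rewrite -natr1.
rewrite nS in nx *.
have x0 : 0 < x by lra.
have x1 : 0 < x - 1 by lra.
have x2 : 0 < x - (n%:R + 1) by lra.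
rewrite sum_consf.
apply: (@le_trans _ _ (\sum_(c : spins n) 2 * expR (1 / (2 * x)) * expR (mag c ^+ 2 / (2 * (x - 1))))).
  apply: ler_sum => c _; rewrite big_bool /= !mag_consf /spin_value; set M := mag c.
  have e1 : (M + 1) ^+ 2 / (2 * x) = (1 / (2 * x) + M ^+ 2 / (2 * x)) + M / x by field; rewrite gt_eqF.
  have e2 : (M - 1) ^+ 2 / (2 * x) = (1 / (2 * x) + M ^+ 2 / (2 * x)) + - (M / x) by field; rewrite gt_eqF.
  rewrite e1 e2 !expRD -mulrDr.
  have := ler_wpM2l (expR_ge0 (1 / (2 * x) + M ^+ 2 / (2 * x))) (cosh_le (M / x)).
  rewrite expRD => /le_trans; apply.
  rewrite -mulrA mulrCA -mulrA ler_wpM2l // ler_wpM2l ?expR_ge0 // -expRD ler_expR.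
  have -> : M ^+ 2 / (2 * x) + (M / x) ^+ 2 / 2 = M ^+ 2 * ((x + 1) / (2 * x ^+ 2)) by field; rewrite gt_eqF.
  rewrite ler_wpM2l ?sqr_ge0 // ler_pdivrMr ?mulr_gt0 ?exprn_gt0 // mulrC ler_pdivlMr ?mulr_gt0 //.
  have -> : (x + 1) * (2 * (x - 1)) = 2 * x ^+ 2 - 2 by ring.
  lra.
rewrite -mulr_sumr; have nx1 : n%:R < x - 1 by lra.
have := ler_wpM2l _ (IH _ nx1) => /(_ (2 * expR (1 / (2 * x)))) h.
apply: le_trans (h _) _; first by rewrite mulr_ge0 ?expR_ge0.
rewrite exprS -!mulrA ler_wpM2l // mulrCA ler_wpM2l ?exprn_ge0 // -expRD ler_expR.
have -> : x - 1 - n%:R = x - (n%:R + 1) by ring.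
rewrite [(n%:R + 1) / _]mulrDl [X in _ <= X]addrC lerD2r !div1r lef_pV2 ?posrE ?mulr_gt0 //.
lra.
Qed.

Definition ovl n (s s' : spins n) : R := \sum_x sv (s x) * sv (s' x).

(** Multiplying spin by spin with [s] is a bijection that turns the overlap with [s] into a
    magnetization. *)
Lemma sum_ovl n (s : spins n) (F : R -> R) : \sum_(s' : spins n) F (ovl s s') = \sum_(u : spins n) F (mag u).
Proof.
have inv : involutive (fun u : spins n => [ffun x => s x == u x] : spins n).
  by move=> u; apply/ffunP => x; rewrite !ffunE; case: (s x); case: (u x).
rewrite (reindex_inj (inv_inj inv)) /=; apply: eq_bigr => u _; congr F; apply: eq_bigr => x _.
by rewrite ffunE /spin_value; case: (s x); case: (u x); rewrite /=; ring.
Qed.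

(* Gaussian-type tail; [la < 1 / 2] is what keeps the bound independent of [n]. *)
Lemma exp_mag n (la : R) : (0 < n)%N -> 0 < la -> la < 1 / 2 ->
  \sum_(s : spins n) expR (la * (mag s ^+ 2 / n%:R)) <= 2 ^+ n * expR (la / (1 - 2 * la)).
Proof.
move=> n0 l0 l1; have N0 : 0 < n%:R :> R by rewrite ltr0n.
pose x := n%:R / (2 * la).
have := @exp_moment n x; rewrite (eq_bigr (fun s : spins n => expR (la * (mag s ^+ 2 / n%:R)))) => [h|s _]; last first.
  by congr expR; rewrite /x; field; rewrite !gt_eqF.
have l2 : 0 < 1 - 2 * la by lra.
have -> : la / (1 - 2 * la) = n%:R / (2 * (x - n%:R)).
  rewrite /x; field; rewrite !gt_eqF //=.
  by apply: (lt_le_trans (mulr_gt0 N0 l2)); rewrite le_eqVlt; apply/orP; left; apply/eqP; ring.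
by apply: h; rewrite /x ltr_pdivlMr ?mulr_gt0 // gtr_pMr //; lra.
Qed.

Definition balanced n := [set s : spins n | mag s ^+ 2 <= 2 * n%:R].

(** Chebyshev's inequality with the variance from [sum_mag2]. *)
Lemma card_balanced n : (0 < n)%N -> 2 ^+ n <= 2 * #|balanced n|%:R :> R.
Proof.
move=> n0; have N0 : 0 < n%:R :> R by rewrite ltr0n.
have cT : #|balanced n|%:R + #|~: balanced n|%:R = 2 ^+ n :> R.
  by rewrite -natrD cardsC card_ffun card_bool card_ord natrX.
have : #|~: balanced n|%:R * (2 * n%:R) <= n%:R * 2 ^+ n :> R.
  rewrite -sum_mag2 mulr_natl -sumr_const [X in _ <= X](bigID (mem (~: balanced n))) /=.
  rewrite -[X in X <= _]addr0; apply: lerD; last by apply: sumr_ge0 => s _; rewrite sqr_ge0.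
  by apply: ler_sum => s; rewrite !inE -ltNge => /ltW.
rewrite mulrCA [n%:R * _ ^+ _]mulrC mulrCA; set c := #|~: _|%:R.
rewrite mulrA ler_pM2r //; lra.
Qed.

End Magnetization.

(** * One- and two-replica averages of hyperedge weights *)

Section PowerSums.
Variable (R : realType).

Lemma pow_sum_ge (t : R) k : 2 <= (1 + t) ^+ k + (1 - t) ^+ k.
Proof.
suff : 2 <= (1 + t) ^+ k + (1 - t) ^+ k /\ 0 <= t * ((1 + t) ^+ k - (1 - t) ^+ k) by case.
elim: k => [|k [h1 h2]]; first by rewrite !expr0; lra.
rewrite !exprS; set P := (1 + t) ^+ k in h1 h2 *; set Q := (1 - t) ^+ k in h1 h2 *.
have -> : (1 + t) * P + (1 - t) * Q = P + Q + t * (P - Q) by ring.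
have -> : t * ((1 + t) * P - (1 - t) * Q) = t * (P - Q) + t ^+ 2 * (P + Q) by ring.
have := sqr_ge0 t => t0; have : 0 <= t ^+ 2 * (P + Q) by rewrite mulr_ge0 //; lra.
lra.
Qed.

Lemma pow_sum_le (t : R) k : `|t| <= 1 ->
  (1 + t) ^+ k.+1 + (1 - t) ^+ k.+1 <= 2 + 2 * (2 ^+ k - 1) * t ^+ 2.
Proof.
move=> t1; have t2 : t ^+ 2 <= 1 by rewrite -real_normK ?num_real // expr_le1.
have t0 := sqr_ge0 t.
suff [] : [/\ (1 + t) ^+ k.+1 + (1 - t) ^+ k.+1 <= 2 + 2 * (2 ^+ k - 1) * t ^+ 2,
   t * ((1 + t) ^+ k.+1 - (1 - t) ^+ k.+1) <= 2 * 2 ^+ k * t ^+ 2 &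
   (1 + t) ^+ k.+1 + (1 - t) ^+ k.+1 <= 2 * 2 ^+ k] by [].
elim: k => [|k [h1 h2 h3]]; first by rewrite !expr1 !expr0; split; lra.
rewrite ![_ ^+ k.+2]exprS [2 ^+ k.+1]exprS; set P := (1 + t) ^+ k.+1 in h1 h2 h3 *; set Q := (1 - t) ^+ k.+1 in h1 h2 h3 *.
have -> : (1 + t) * P + (1 - t) * Q = P + Q + t * (P - Q) by ring.
have -> : t * ((1 + t) * P - (1 - t) * Q) = t * (P - Q) + t ^+ 2 * (P + Q) by ring.
have a := ler_wpM2l t0 h3.
have K0 : 0 <= 2 ^+ k :> R by rewrite exprn_ge0.
have b := ler_wpM2l K0 t2.
by split; lra.
Qed.

(** With [t], [t'] the magnetizations and [r] the overlap of two configurations, all divided by the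
    number of vertices, the four bases are four times the proportions of vertices with each pair of
    spins. *)
Definition four (t t' r : R) k : R := ((1 + t + t' + r) ^+ k + (1 + t - t' - r) ^+ k +
  (1 - t + t' - r) ^+ k + (1 - t - t' + r) ^+ k) / 4.

(** The four signed combinations [A], [B], [C], [D] satisfy a linear recursion in the exponent. [B]
    and [C] are of order [w], and they enter [A] and [D] only multiplied by [t] or [t'], so [A] and
    [D] deviate quadratically from their values at zero magnetization. *)
Lemma four_le t t' r k : `|r| <= 1 -> `|t| <= 1 -> `|t'| <= 1 ->
  four t t' r k <= ((1 + r) ^+ k + (1 - r) ^+ k) / 2 + 2 * 4 ^+ k * (t ^+ 2 + t' ^+ 2).
Proof.
move=> r1 t1 t1'; pose w := `|t| + `|t'|.
have w0 : 0 <= w by rewrite addr_ge0.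
suff H : `|four t t' r k - ((1 + r) ^+ k + (1 - r) ^+ k) / 2| <= 4 ^+ k * w ^+ 2.
  have : w ^+ 2 <= 2 * (t ^+ 2 + t' ^+ 2).
    rewrite -[t ^+ 2]real_normK ?num_real // -[t' ^+ 2]real_normK ?num_real //.
    have := sqr_ge0 (`|t| - `|t'|); rewrite /w.
    have -> : (`|t| - `|t'|) ^+ 2 = `|t| ^+ 2 + `|t'| ^+ 2 - 2 * (`|t| * `|t'|) by ring.
    have -> : (`|t| + `|t'|) ^+ 2 = `|t| ^+ 2 + `|t'| ^+ 2 + 2 * (`|t| * `|t'|) by ring.
    lra.
  have K0 : 0 <= 4 ^+ k :> R by rewrite exprn_ge0.
  move/(ler_wpM2l K0); move: H; rewrite ler_norml => /andP[_]; lra.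
have nD (a b c d K : R) : `|a| <= K -> `|b| <= K -> `|c| <= K -> `|d| <= K ->
   `|a + b + c + d| <= 4 * K.
  move=> ha hb hc hd; apply: le_trans (ler_normD _ _) _.
  have := ler_normD a b; have := ler_normD (a + b) c; lra.
have nM (a b A B' : R) : `|a| <= A -> `|b| <= B' -> `|a * b| <= A * B'.
  by move=> ha hb; rewrite normrM; apply: ler_pM.
have one (x y z : R) : `|x| <= 1 -> `|y| <= z -> `|x * y| <= z by move=> hx hy; rewrite -[z]mul1r; apply: nM.
have tw : `|t| <= w by rewrite lerDl.
have tw' : `|t'| <= w by rewrite lerDr.
pose A j := four t t' r j.
pose D j := ((1 + t + t' + r) ^+ j - (1 + t - t' - r) ^+ j - (1 - t + t' - r) ^+ j + (1 - t - t' + r) ^+ j) / 4.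
pose B j := ((1 + t + t' + r) ^+ j + (1 + t - t' - r) ^+ j - (1 - t + t' - r) ^+ j - (1 - t - t' + r) ^+ j) / 4.
pose C j := ((1 + t + t' + r) ^+ j - (1 + t - t' - r) ^+ j + (1 - t + t' - r) ^+ j - (1 - t - t' + r) ^+ j) / 4.
pose a j := ((1 + r) ^+ j + (1 - r) ^+ j) / 2.
pose d j := ((1 + r) ^+ j - (1 - r) ^+ j) / 2.
have AS j : A j.+1 = A j + t * B j + t' * C j + r * D j by rewrite /A /B /C /D /four !exprS; field.
have DS j : D j.+1 = D j + t * C j + t' * B j + r * A j by rewrite /A /B /C /D /four !exprS; field.
have BS j : B j.+1 = B j + t * A j + t' * D j + r * C j by rewrite /A /B /C /D /four !exprS; field.
have CS j : C j.+1 = C j + t * D j + t' * A j + r * B j by rewrite /A /B /C /D /four !exprS; field.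
have aS j : a j.+1 = a j + r * d j by rewrite /a /d !exprS; field.
have dS j : d j.+1 = d j + r * a j by rewrite /a /d !exprS; field.
have A0 : A 0%N = 1 by rewrite /A /four !expr0; field.
have D0 : D 0%N = 0 by rewrite /D !expr0; field.
have B0 : B 0%N = 0 by rewrite /B !expr0; field.
have C0 : C 0%N = 0 by rewrite /C !expr0; field.
have a0 : a 0%N = 1 by rewrite /a !expr0; field.
have d0 : d 0%N = 0 by rewrite /d !expr0; field.
have h4 j : [/\ `|A j| <= 4 ^+ j, `|B j| <= 4 ^+ j, `|C j| <= 4 ^+ j & `|D j| <= 4 ^+ j].
  elim: j => [|j [hA hB hC hD]]; first by rewrite A0 B0 C0 D0 normr0 normr1 expr0 ler01.
  by rewrite AS BS CS DS exprS; split; apply: nD => //; apply: one.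
have hw j : `|B j| <= 4 ^+ j * w /\ `|C j| <= 4 ^+ j * w.
  elim: j => [|j [hB hC]]; first by rewrite B0 C0 normr0 expr0 mul1r.
  have [hA _ _ hD] := h4 j; rewrite BS CS exprS -!mulrA.
  by split; apply: nD => //; first [by apply: one | by rewrite [_ * w]mulrC; apply: nM].
suff hh j : `|A j - a j| <= 4 ^+ j * w ^+ 2 /\ `|D j - d j| <= 4 ^+ j * w ^+ 2 by case: (hh k).
elim: j => [|j [hA hD]]; first by rewrite A0 D0 a0 d0 !subrr normr0 expr0 mul1r sqr_ge0.
have [hB hC] := hw j; rewrite exprS -!mulrA AS DS aS dS.
have -> : A j + t * B j + t' * C j + r * D j - (a j + r * d j) =
  (A j - a j) + t * B j + t' * C j + r * (D j - d j) by ring.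
have -> : D j + t * C j + t' * B j + r * A j - (d j + r * a j) =
  (D j - d j) + t * C j + t' * B j + r * (A j - a j) by ring.
have e : 4 ^+ j * w ^+ 2 = w * (4 ^+ j * w) by ring.
by split; apply: nD => //; first [by apply: one | by rewrite e; apply: nM].
Qed.

End PowerSums.

Section Planted.
Variables (R : realType) (k : nat) (p : R).
Hypotheses (k_ge2 : (2 <= k)%N) (p_ge0 : 0 <= p) (p_lt1 : p < 1).

Definition ed n (t : k.-tuple 'I_n) : {set 'I_n} := [set v in t].
Definition qk : R := (2 ^+ k.-1)^-1.
Definition kap : R := 1 - p * qk.
(** In the planted model at zero magnetization, the probability that a hyperedge through a given
    vertex is constrained and all its other spins oppose that vertex, so that it passes a flip on.
    [kap] is the mean weight of a hyperedge. *)
Definition theta : R := p * qk / kap.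
Definition ft n (s : spins n) (t : k.-tuple 'I_n) : R := (1 - p * (mono s (ed t))%:R) / kap.

Lemma qk_gt0 : 0 < qk. Proof. by rewrite invr_gt0 exprn_gt0. Qed.

Lemma qk_half : qk <= 1 / 2.
Proof.
rewrite /qk div1r lef_pV2 ?posrE ?exprn_gt0 // -{1}[2]expr1 ler_eXn2l //; first by lia.
lra.
Qed.

Lemma kap_bound : 1 / 2 <= kap <= 1.
Proof.
have := qk_half; have := qk_gt0; rewrite /kap => q0 q1.
have h1 : 0 <= p * qk by rewrite mulr_ge0 // ltW.
have h2 : p * qk <= qk by rewrite ler_piMl // ltW.
by apply/andP; split; lra.
Qed.

Lemma kap_gt0 : 0 < kap. Proof. by have /andP[h _] := kap_bound; apply: lt_le_trans h; lra. Qed.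

Lemma theta_ge0 : 0 <= theta.
Proof. by rewrite divr_ge0 ?(ltW kap_gt0) // mulr_ge0 // ltW // qk_gt0. Qed.

Lemma theta_le : theta * (2 ^+ k.-1 - 1) <= 1.
Proof.
rewrite /theta mulrAC ler_pdivrMr ?kap_gt0 // mul1r /kap.
have e : qk * 2 ^+ k.-1 = 1 by rewrite mulVf // gt_eqF // exprn_gt0.
have -> : p * qk * (2 ^+ k.-1 - 1) = p * (qk * 2 ^+ k.-1) - p * qk by ring.
by rewrite e mulr1 lerD2r ltW.
Qed.

Lemma theta_le1 : theta <= 1.
Proof.
apply: le_trans theta_le; rewrite ler_peMr ?theta_ge0 //.
have : 2 <= 2 ^+ k.-1 :> R by rewrite -{1}[2]expr1 ler_eXn2l ?ltr1n //; lia.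
lra.
Qed.

Lemma card_tup n : #|{: k.-tuple 'I_n}|%:R = n%:R ^+ k :> R.
Proof. by rewrite card_tuple card_ord natrX. Qed.

Local Notation sv := (spin_value R).

Lemma mono_prod n (s : spins n) (t : k.-tuple 'I_n) :
  (mono s (ed t))%:R = \prod_b ((1 + sv (s (tnth t b))) / 2) + \prod_b ((1 - sv (s (tnth t b))) / 2) :> R.
Proof.
have k0 : (0 < k)%N by lia.
pose b0 := Ordinal k0.
have e1 b : (1 + sv (s (tnth t b))) / 2 = (s (tnth t b))%:R :> R.
  by rewrite /spin_value; case: (s _) => /=; [field | rewrite subrr mul0r].
have e2 b : (1 - sv (s (tnth t b))) / 2 = (~~ s (tnth t b))%:R :> R.
  by rewrite /spin_value; case: (s _) => /=; [rewrite subrr mul0r | field].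
rewrite (eq_bigr _ (fun b _ => e1 b)) [X in _ + X](eq_bigr _ (fun b _ => e2 b)).
have z (F : 'I_k -> bool) b : ~~ F b -> \prod_b (F b)%:R = 0 :> R.
  by move=> h; rewrite (bigD1 b) //= (negbTE h) mul0r.
have o (F : 'I_k -> bool) : (forall b, F b) -> \prod_b (F b)%:R = 1 :> R.
  by move=> h; rewrite big1 // => b _; rewrite h.
case: (boolP (mono s (ed t))) => [/monoP m1|m0].
  have E b : s (tnth t b) = s (tnth t b0) by apply: m1; rewrite inE mem_tnth.
  case sb : (s (tnth t b0)).
    by rewrite o => [|b]; rewrite ?E // (z _ b0) ?addr0 // sb.
  by rewrite (z _ b0) ?sb // add0r o // => b; rewrite E sb.
case: (pickP (fun b => s (tnth t b))) => [b sb|none].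
  case: (pickP (fun b => ~~ s (tnth t b))) => [b' sb'|none].
    by rewrite (z _ b') // (z _ b) ?addr0 // negbK.
  case/negP: m0; apply/monoP => x y; rewrite !inE => /tnthP[b1 ->] /tnthP[b2 ->].
  by have := none b1; have := none b2 => /negbFE -> /negbFE ->.
case/negP: m0; apply/monoP => x y; rewrite !inE => /tnthP[b1 ->] /tnthP[b2 ->].
by rewrite !none.
Qed.

Section Fixed.
Variable n : nat.
Hypothesis n_gt0 : (0 < n)%N.
Let N0 : 0 < n%:R :> R. Proof. by rewrite ltr0n. Qed.
Implicit Types s : spins n.

Lemma avg_tuple_prod (F : 'I_n -> R) :
  avg (fun t : k.-tuple 'I_n => \prod_b F (tnth t b)) = ((\sum_v F v) / n%:R) ^+ k.
Proof. by rewrite /avg (sum_tuple_prod (fun _ : 'I_k => F)) prodr_const card_ord card_tup expr_div_n. Qed.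

Lemma avg_lin s (e : R) : (\sum_v ((1 + e * sv (s v)) / 2)) / n%:R = (1 + e * (mag R s / n%:R)) / 2.
Proof.
rewrite -mulr_suml big_split /= sumr_const card_ord -mulr_sumr -/(mag R s) -[1 *+ n]/(n%:R).
by field; rewrite gt_eqF.
Qed.

Lemma avg_mono s : avg (fun t : k.-tuple 'I_n => (mono s (ed t))%:R) =
  qk * (((1 + mag R s / n%:R) ^+ k + (1 - mag R s / n%:R) ^+ k) / 2).
Proof.
rewrite (eq_avg (mono_prod s)) avgD (avg_tuple_prod (fun v => (1 + sv (s v)) / 2)).
rewrite (avg_tuple_prod (fun v => (1 - sv (s v)) / 2)).
have := avg_lin s 1; rewrite mul1r (eq_bigr (fun v => (1 + sv (s v)) / 2)) => [->|v _]; last by rewrite mul1r.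
have := avg_lin s (-1); rewrite mulN1r (eq_bigr (fun v => (1 - sv (s v)) / 2)) => [->|v _]; last by rewrite mulN1r.
rewrite !expr_div_n /qk; case: k k_ge2 => // k' _ /=; rewrite [2 ^+ k'.+1]exprS.
by field; rewrite expf_neq0.
Qed.

Lemma mag_norm s : `|mag R s / n%:R| <= 1.
Proof.
rewrite normrM normfV [`|n%:R|]ger0_norm // ler_pdivrMr // mul1r.
apply: le_trans (ler_norm_sum _ _ _) _; rewrite (eq_bigr (fun=> 1)) ?sumr_const ?card_ord // => x _.
by rewrite /spin_value; case: (s x); rewrite ?normrN normr1.
Qed.

Lemma ovl_norm s s' : `|ovl R s s' / n%:R| <= 1.
Proof.
rewrite normrM normfV [`|n%:R|]ger0_norm // ler_pdivrMr // mul1r.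
apply: le_trans (ler_norm_sum _ _ _) _; rewrite (eq_bigr (fun=> 1)) ?sumr_const ?card_ord // => x _.
by rewrite /spin_value normrM; case: (s x); case: (s' x); rewrite ?normrN ?normr1 mulr1.
Qed.

Lemma avg_mono2 s s' : avg (fun t : k.-tuple 'I_n => (mono s (ed t))%:R * (mono s' (ed t))%:R) =
  qk ^+ 2 * four (mag R s / n%:R) (mag R s' / n%:R) (ovl R s s' / n%:R) k.
Proof.
rewrite (eq_avg (G := fun t : k.-tuple 'I_n =>
  \prod_b ((1 + sv (s (tnth t b))) / 2 * ((1 + sv (s' (tnth t b))) / 2)) +
  \prod_b ((1 + sv (s (tnth t b))) / 2 * ((1 - sv (s' (tnth t b))) / 2)) +
  \prod_b ((1 - sv (s (tnth t b))) / 2 * ((1 + sv (s' (tnth t b))) / 2)) +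
  \prod_b ((1 - sv (s (tnth t b))) / 2 * ((1 - sv (s' (tnth t b))) / 2)))); last first.
  by move=> t; rewrite !mono_prod !big_split /=; ring.
rewrite !avgD.
rewrite (avg_tuple_prod (fun v => (1 + sv (s v)) / 2 * ((1 + sv (s' v)) / 2))).
rewrite (avg_tuple_prod (fun v => (1 + sv (s v)) / 2 * ((1 - sv (s' v)) / 2))).
rewrite (avg_tuple_prod (fun v => (1 - sv (s v)) / 2 * ((1 + sv (s' v)) / 2))).
rewrite (avg_tuple_prod (fun v => (1 - sv (s v)) / 2 * ((1 - sv (s' v)) / 2))).
have L (e e' : R) : (\sum_v (1 + e * sv (s v)) / 2 * ((1 + e' * sv (s' v)) / 2)) / n%:R =
  (1 + e * (mag R s / n%:R) + e' * (mag R s' / n%:R) + e * e' * (ovl R s s' / n%:R)) / 4.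
  rewrite (eq_bigr (fun v => 1 / 4 + (e / 4 * sv (s v) + (e' / 4 * sv (s' v) + e * e' / 4 * (sv (s v) * sv (s' v)))))).
    rewrite !big_split /= sumr_const card_ord -!mulr_sumr -/(mag R s) -/(mag R s') -/(ovl R s s') -[_ *+ n]mulr_natr.
    by field; rewrite gt_eqF.
  by move=> v _; field.
have L1 := L 1 1; have L2 := L 1 (-1); have L3 := L (-1) 1; have L4 := L (-1) (-1).
rewrite (eq_bigr (fun v => (1 + sv (s v)) / 2 * ((1 + sv (s' v)) / 2))) in L1; last by move=> v _; rewrite !mul1r.
rewrite (eq_bigr (fun v => (1 + sv (s v)) / 2 * ((1 - sv (s' v)) / 2))) in L2; last by move=> v _; rewrite !mul1r !mulN1r.
rewrite (eq_bigr (fun v => (1 - sv (s v)) / 2 * ((1 + sv (s' v)) / 2))) in L3; last by move=> v _; rewrite !mul1r !mulN1r.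
rewrite (eq_bigr (fun v => (1 - sv (s v)) / 2 * ((1 - sv (s' v)) / 2))) in L4; last by move=> v _; rewrite !mulN1r.
rewrite L1 L2 L3 L4 /four !expr_div_n !mul1r !mulN1r !opprK ?mul1r.
set T := mag R s / _; set T' := mag R s' / _; set O := ovl R s s' / _.
have -> : 4 ^+ k = 4 * (2 ^+ k.-1) ^+ 2 :> R.
  have -> : 4 = 2 ^+ 2 :> R by ring.
  by rewrite -!exprM -exprD; congr (_ ^+ _); lia.
rewrite /qk; field; rewrite expf_neq0 //.
Qed.

Lemma avg_ft s : avg (ft s) = 1 - theta * (((1 + mag R s / n%:R) ^+ k + (1 - mag R s / n%:R) ^+ k) / 2 - 1).
Proof.
have T0 : (0 < #|{: k.-tuple 'I_n}|)%N by rewrite card_tuple card_ord expn_gt0 n_gt0.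
rewrite (eq_avg (G := fun t => kap^-1 + (- p / kap) * (mono s (ed t))%:R)); last first.
  by move=> t; rewrite /ft; field; rewrite gt_eqF // kap_gt0.
rewrite avgD avg_const // avgZ avg_mono /theta.
have e : kap^-1 = 1 + p * qk / kap by rewrite /kap; field; rewrite gt_eqF // kap_gt0.
rewrite [X in X + _]e; by field; rewrite gt_eqF // kap_gt0.
Qed.

(** By [pow_sum_ge], a nonzero magnetization only makes monochromatic hyperedges more frequent. *)
Lemma avg_ft_le1 s : avg (ft s) <= 1.
Proof.
rewrite avg_ft gerBl mulr_ge0 ?theta_ge0 //.
by have := pow_sum_ge (mag R s / n%:R) k; lra.
Qed.

Lemma avg_ft2 s s' : avg (fun t => ft s t * ft s' t) <=
  1 + theta ^+ 2 * (four (mag R s / n%:R) (mag R s' / n%:R) (ovl R s s' / n%:R) k - 1).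
Proof.
have T0 : (0 < #|{: k.-tuple 'I_n}|)%N by rewrite card_tuple card_ord expn_gt0 n_gt0.
rewrite (eq_avg (G := fun t => - kap^-2 + (kap^-1 * ft s t + (kap^-1 * ft s' t +
  (p / kap) ^+ 2 * ((mono s (ed t))%:R * (mono s' (ed t))%:R))))); last first.
  by move=> t; rewrite /ft; field; rewrite gt_eqF // kap_gt0.
rewrite avgD avg_const // avgD avgZ avgD !avgZ avg_mono2.
have K := kap_gt0.
have -> : - kap^-2 = 1 - 2 * kap^-1 + theta ^+ 2 *(- 1) by rewrite /theta /kap; field; rewrite gt_eqF.
have -> : forall F : R, (p / kap) ^+ 2 * (qk ^+ 2 * F) = theta ^+ 2 * F by move=> F; rewrite /theta; field; rewrite gt_eqF.
have K1 : 0 <= kap^-1 by rewrite invr_ge0 ltW.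
have := ler_wpM2l K1 (avg_ft_le1 s); have := ler_wpM2l K1 (avg_ft_le1 s'); lra.
Qed.

Lemma mag_balanced s : s \in balanced R n -> (mag R s / n%:R) ^+ 2 <= 2 / n%:R.
Proof.
rewrite inE => h; rewrite expr_div_n ler_pdivrMr ?exprn_gt0 //.
by have -> : 2 / n%:R * n%:R ^+ 2 = 2 * n%:R :> R by field; rewrite gt_eqF.
Qed.

Definition rrf s s' : R := ovl R s s' ^+ 2 / n%:R.

Lemma avg_ge_bal s : s \in balanced R n -> 1 - avg (ft s) <= 8 * 4 ^+ k / n%:R.
Proof.
move=> /mag_balanced h; rewrite avg_ft opprB addrCA subrr addr0.
have := pow_sum_le k.-1 (mag_norm s); rewrite prednK; last by lia.
set T := mag R s / n%:R in h *; set P := _ + _ => hP.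
apply: (@le_trans _ _ (theta * ((2 ^+ k.-1 - 1) * T ^+ 2))).
  by rewrite ler_wpM2l ?theta_ge0 //; lra.
rewrite mulrA; have T2 := sqr_ge0 T.
apply: (@le_trans _ _ (1 * T ^+ 2)); first by rewrite ler_wpM2r ?theta_le.
rewrite mul1r; apply: le_trans h _; rewrite ler_wpM2r ?invr_ge0 ?ler0n //.
have : 1 <= 4 ^+ k :> R by rewrite exprn_ege1 //; lra.
lra.
Qed.

(** The coefficient of the overlap is [pow_sum_le] applied to it; by [four_le] and balance, the
    magnetizations only contribute order [1 / n]. *)
Lemma avg_pair_bal s s' : s \in balanced R n -> s' \in balanced R n ->
  avg (fun t => ft s t * ft s' t) <=
    1 + (theta ^+ 2 * (2 ^+ k.-1 - 1) * rrf s s' + 8 * 4 ^+ k) / n%:R.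
Proof.
move=> /mag_balanced h /mag_balanced h'; apply: le_trans (avg_ft2 s s') _.
rewrite lerD2l.
have := four_le k (ovl_norm s s') (mag_norm s) (mag_norm s').
have := pow_sum_le k.-1 (ovl_norm s s'); rewrite prednK; last by lia.
set T := mag R s / n%:R in h *; set T' := mag R s' / n%:R in h' *; set O := ovl R s s' / n%:R.
set F := four _ _ _ _ => a b.
have K0 : 0 <= 4 ^+ k :> R by rewrite exprn_ge0.
have c : F - 1 <= (2 ^+ k.-1 - 1) * O ^+ 2 + 8 * 4 ^+ k / n%:R.
  have : 2 * 4 ^+ k * (T ^+ 2 + T' ^+ 2) <= 2 * 4 ^+ k * (2 / n%:R + 2 / n%:R).
    by rewrite ler_wpM2l ?mulr_ge0 //; lra.
  rewrite (_ : 2 * 4 ^+ k * (2 / n%:R + 2 / n%:R) = 8 * 4 ^+ k / n%:R); [lra | by field; rewrite gt_eqF].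
have t2 : 0 <= theta ^+ 2 by rewrite sqr_ge0.
have t21 : theta ^+ 2 <= 1 by rewrite expr_le1 ?theta_ge0 ?theta_le1.
apply: le_trans (ler_wpM2l t2 c) _.
have -> : (theta ^+ 2 * (2 ^+ k.-1 - 1) * rrf s s' + 8 * 4 ^+ k) / n%:R =
  theta ^+ 2 * ((2 ^+ k.-1 - 1) * O ^+ 2) + 8 * 4 ^+ k / n%:R.
  by rewrite /rrf /O; field; rewrite gt_eqF.
rewrite mulrDr lerD2l ler_piMl // mulr_ge0 ?invr_ge0 ?ler0n // mulr_ge0 //.
Qed.

Lemma exp_overlap_bal (la : R) : 0 < la -> la < 1 / 2 ->
  \sum_(s in balanced R n) \sum_(s' in balanced R n) expR (la * rrf s s') <=
    expR (la / (1 - 2 * la)) * (2 ^+ n) ^+ 2.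
Proof.
move=> l0 l1.
apply: (@le_trans _ _ (\sum_(s : spins n) \sum_(s' : spins n) expR (la * rrf s s'))).
  rewrite [X in _ <= X](bigID (mem (balanced R n))) /= -[X in X <= _]addr0; apply: lerD; last first.
    by apply: sumr_ge0 => s _; apply: sumr_ge0 => s' _; apply: expR_ge0.
  apply: ler_sum => s _; rewrite [X in _ <= X](bigID (mem (balanced R n))) /= lerDl.
  by apply: sumr_ge0 => s' _; apply: expR_ge0.
rewrite (eq_bigr (fun=> \sum_(u : spins n) expR (la * (mag R u ^+ 2 / n%:R)))) => [|s _]; last first.
  exact: (sum_ovl s (fun z => expR (la * (z ^+ 2 / n%:R)))).
rewrite sumr_const card_ffun card_bool card_ord -[_ *+ _]mulr_natr natrX expr2 mulrA ler_wpM2r ?exprn_ge0 //.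
by rewrite mulrC; apply: exp_mag.
Qed.

End Fixed.

Lemma contiguity (d eps : R) : 0 < d -> d * k.-1%:R * theta < 1 -> 0 < eps ->
  exists de : R, 0 < de /\ forall n m, (0 < n)%N -> m%:R = d * n%:R / k%:R ->
   avg (fun H : {ffun 'I_m -> k.-tuple 'I_n} => ([exists u : 'I_m.+1,
     part_fun (fun j => ed (H j)) p (suffix_set m u) < de * 2 ^+ n * kap ^+ #|suffix_set m u|])%:R) <= eps.
Proof.
move=> d0 cond eps0.
have k0 : 0 < k%:R :> R by rewrite ltr0n; lia.
pose a2 := theta ^+ 2 * (2 ^+ k.-1 - 1).
have pw : 1 <= 2 ^+ k.-1 :> R by rewrite exprn_ege1 //; lra.
have a20 : 0 <= a2 by rewrite mulr_ge0 ?sqr_ge0 //; lra.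
(* The second-moment condition is implied by the branching condition: [a2 <= theta] by [theta_le],
   and [theta * d <= d * k.-1%:R * theta < 1] while [k >= 2]. *)
have a2d : a2 * (d / k%:R) < 1 / 2.
  have : a2 <= theta.
    by rewrite /a2 expr2 -mulrA ler_piMr ?theta_ge0 // theta_le.
  have dk : 0 <= d / k%:R by rewrite divr_ge0 // ltW.
  move/(ler_wpM2r dk)/le_lt_trans; apply.
  rewrite mulrA ltr_pdivrMr //.
  have k1 : 1 <= k.-1%:R :> R by rewrite ler1n; lia.
  have kS : k%:R = k.-1%:R + 1 :> R by rewrite natr1 prednK //; lia.
  have : theta * d <= d * k.-1%:R * theta.
    have -> : d * k.-1%:R * theta = theta * d * k.-1%:R by ring.
    by rewrite ler_peMr // mulr_ge0 ?theta_ge0 // ltW.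
  rewrite kS; lra.
(* Half of the room left below [1 / 2], spent on the tilt of [Nf]. *)
pose c := (1 / 2 - a2 * (d / k%:R)) / 2.
have c0 : 0 < c by rewrite divr_gt0 //; lra.
pose la := a2 * (d / k%:R) + c.
have la0 : 0 < la by rewrite /la ltr_wpDl // mulr_ge0 // divr_ge0 // ltW.
have la1 : la < 1 / 2 by rewrite /la /c; lra.
pose C0 : R := 8 * 4 ^+ k; pose C2 := expR (la / (1 - 2 * la)).
have C00 : 0 <= C0 by rewrite mulr_ge0 ?exprn_ge0.
pose lo := 1 - p; have lo0 : 0 < lo by rewrite subr_gt0.
pose C1 := C0 + (a2 + C0 * 3) / lo.
pose ra := d / k%:R.
pose C3 := expR (C0 * ra) * C2.
pose MB := (2 + (C1 + C1 / c * C3) * ra) * expR (C1 * ra).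
pose a := expR (- (3 * (C1 / c) * ra)).
have a0 : 0 < a by apply: expR_gt0.
have C10 : 0 <= C1 by rewrite addr_ge0 // divr_ge0 ?(ltW lo0) // addr_ge0 // mulr_ge0.
have ra0 : 0 <= ra by rewrite divr_ge0 // ltW.
have MB0 : 0 < MB.
  rewrite mulr_gt0 ?expR_gt0 //; apply: ltr_pwDl => //; apply: mulr_ge0 => //; apply: addr_ge0 => //.
  apply: mulr_ge0; first by apply: divr_ge0 => //; apply: ltW.
  by apply: mulr_ge0; apply: expR_ge0.
(* Chosen so that the bound of [Lf_maximal] equals [eps]. *)
pose l0 := ln (MB / eps) / a.
exists (expR (- l0)); split; first exact: expR_gt0.
move=> n m n0 mE.
have N0 : 0 < n%:R :> R by rewrite ltr0n.
have T0 : (0 < #|{: k.-tuple 'I_n}|)%N by rewrite card_tuple card_ord expn_gt0 n0.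
have mr : m%:R / n%:R = ra by rewrite mE /ra; field; rewrite !gt_eqF.
have mx (x : R) : x * m%:R / n%:R = x * ra by rewrite -mulrA mr.
have mx' (x : R) : x / n%:R * m%:R = x * ra by rewrite mulrAC mx.
have flo (s : spins n) t : lo <= ft s t.
  have /andP[_ k1] := kap_bound.
  rewrite /ft ler_pdivlMr ?kap_gt0 //; apply: le_trans (_ : lo * 1 <= _); first by rewrite ler_wpM2l // ltW.
  by rewrite mulr1 /lo lerD2l lerN2 ler_piMr // lern1 leq_b1.
have rr0 (s s' : spins n) : 0 <= rrf s s' by rewrite divr_ge0 ?sqr_ge0.
have eo : \sum_(s in balanced R n) \sum_(s' in balanced R n)
    expR ((a2 * m%:R / n%:R + c) * rrf s s') <= C2 * (2 ^+ n) ^+ 2.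
  by rewrite mx; apply: exp_overlap_bal.
have P2 : 0 < 2 ^+ n :> R by rewrite exprn_gt0.
have ha : a * expR (3 * (C1 / c) / n%:R * m%:R) <= 1.
  by rewrite mx' /a -expRD addrC subrr expR0.
have := @Lf_maximal R _ _ m (@ft n) (balanced R n) (@rrf n) (2 ^+ n) n%:R lo C0 a2 c C2 T0 P2 N0 lo0 C00 a20 c0
  (expR_ge0 _) (card_balanced R n0) flo rr0 (avg_ft_le1 n0) (@avg_ge_bal n n0) (@avg_pair_bal n n0) eo a l0 (ltW a0) ha.
have -> : moment_bound m n%:R lo C0 a2 c C2 = MB.
  by rewrite /moment_bound !mx' !mx.
have -> : expR (- (a * l0)) * MB = eps.
  have -> : a * l0 = ln (MB / eps) by rewrite /l0 mulrC divfK ?gt_eqF.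
  rewrite expRN lnK ?posrE ?divr_gt0 //; field.
  by rewrite !gt_eqF.
apply: le_trans; apply: ler_avg => H.
rewrite ler_nat; case: (boolP [exists _, _]) => // /existsP[u hu].
suff -> : small_seen (@ft n) (balanced R n) (2 ^+ n) l0 m H by [].
apply/existsP; exists u; rewrite -ltnS ltn_ord /=.
have M0 := @Mf_gt0 R _ _ m (@ft n) (balanced R n) (2 ^+ n) lo P2 lo0 (card_balanced R n0) flo (suffix_set m u) H.
rewrite /Lf -[l0]expRK -lnV ?posrE // ler_ln ?posrE ?expR_gt0 ?invr_gt0 //.
rewrite -[expR l0]invrK lef_pV2 ?posrE ?invr_gt0 ?expR_gt0 // -expRN.
rewrite /Mf ler_pdivrMr // -(ler_pM2r (exprn_gt0 #|suffix_set m u| kap_gt0)).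
apply: ltW; apply: le_lt_trans hu.
rewrite mulr_suml /part_fun [X in _ <= X](bigID (mem (balanced R n))) /= -[X in X <= _]addr0; apply: lerD; last first.
  by apply: sumr_ge0 => s _; apply: ltW; apply: gibbs_wt_gt0.
by apply: ler_sum => s _; rewrite /wgt /gibbs_wt /ft prodf_div prodr_const divfK // expf_neq0 // gt_eqF // kap_gt0.
Qed.

End Planted.

(* [Cnt j] is the [j]-th enclosing loop counter (or [Let]-bound value), counted
   from the outermost one; counters are read-only. *)
Inductive expr :=
  Cst of nat | Cnt of nat | Ld of 'I_8 & expr | Plus of expr & expr | Minus of expr & expr.

(* [For e c] runs [c] for the counter values [e - 1], ..., [0], in this order;
   [Coin t e x] stores a coin of bias [X[x]]. *)
Inductive cmd :=
  | Skip
  | Put of 'I_8 & expr & expr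
  | Coin of 'I_8 & expr & nat
  | Seq of cmd & cmd
  | If of expr & expr & cmd & cmd
  | For of expr & cmd
  | Let of expr & cmd.

Definition st := 'I_8 -> nat -> nat.

Definition put (s : st) t a v : st := fun t' a' => if (t' == t) && (a' == a) then v else s t' a'.

Fixpoint ev (cs : seq nat) (s : st) e : nat :=
  match e with
  | Cst c => c
  | Cnt j => nth 0 cs j
  | Ld t e => s t (ev cs s e)
  | Plus e f => ev cs s e + ev cs s f
  | Minus e f => ev cs s e - ev cs s f
  end%N.

(** * Compiling a structured language to the random access machine *)

Section Code.
Variables (Dm Tm : nat).

(** Layout of the low cells: four fixed ones, of which cell 3 holds the base of the arrays; [Dm]
    loop counters; [Tm] temporaries used as an evaluation stack. *)
Definition ctr j := (4 + j)%N.
Definition tmp j := (4 + Dm + j)%N.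

(** The eight arrays are interleaved above the base: entry [a] of array [t] is the cell
    [base + 8 * a + t], and multiplication by 8 is three doublings. *)
Definition addr (d : nat) (t : 'I_8) : seq instr :=
  [:: NatAdd (tmp d) (tmp d) (tmp d); NatAdd (tmp d) (tmp d) (tmp d); NatAdd (tmp d) (tmp d) (tmp d);
      NatConst (tmp d.+1) t; NatAdd (tmp d) (tmp d) (tmp d.+1); NatAdd (tmp d) (tmp d) 3].

Lemma size_addr d t : size (addr d t) = 6%N. Proof. by []. Qed.

Fixpoint cex (dl d : nat) e : seq instr :=
  match e with
  | Cst c => [:: NatConst (tmp d) c]
  | Cnt j => NatConst (tmp d) 0 :: (if (j < dl)%N then [:: NatAdd (tmp d) (tmp d) (ctr j)] else [::])
  | Ld t e => (cex dl d e ++ addr d t) ++ [:: NatLoad (tmp d) (tmp d)]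
  | Plus e f => cex dl d e ++ cex dl d.+1 f ++ [:: NatAdd (tmp d) (tmp d) (tmp d.+1)]
  | Minus e f => cex dl d e ++ cex dl d.+1 f ++ [:: NatSub (tmp d) (tmp d) (tmp d.+1)]
  end.

Fixpoint hx e : nat :=
  match e with
  | Cst _ | Cnt _ => 1
  | Ld _ e => (hx e).+1
  | Plus e f | Minus e f => maxn (hx e) (hx f).+1
  end%N.

Lemma hx_gt0 e : (0 < hx e)%N.
Proof. by case: e => //= e f; rewrite leq_max orbT. Qed.

Definition xc dl d e := size (cex dl d e).

Fixpoint csize (dl : nat) c : nat :=
  match c with
  | Skip => 0
  | Put t e f => xc dl 0 e + 6 + xc dl 1 f + 1
  | Coin t e x => xc dl 0 e + 8
  | Seq a b => csize dl a + csize dl b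
  | If e f a b => xc dl 0 e + xc dl 1 f + 2 + csize dl b + csize dl a
  | For e c => xc dl 0 e + 7 + csize dl.+1 c
  | Let e c => xc dl 0 e + 2 + csize dl.+1 c
  end%N.

(** [JumpNatLe 0 0 l] is the unconditional jump, and a register is copied by adding it to a cleared
    one. A counter is decremented before the body, which therefore sees the values from the bound
    minus one down to 0. *)
Fixpoint compile (dl pc : nat) c : seq instr :=
  match c with
  | Skip => [::]
  | Put t e f => (cex dl 0 e ++ addr 0 t) ++ cex dl 1 f ++ [:: NatStore (tmp 0) (tmp 1)]
  | Coin t e x => (cex dl 0 e ++ addr 0 t) ++ [:: Flip (tmp 1) x; NatStore (tmp 0) (tmp 1)]
  | Seq a b => compile dl pc a ++ compile dl (pc + csize dl a) b
  | If e f a b =>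
      let p1 := (pc + (xc dl 0 e + xc dl 1 f + 1))%N in
      let p2 := (p1 + csize dl b + 1)%N in
      (cex dl 0 e ++ cex dl 1 f) ++ JumpNatLe (tmp 0) (tmp 1) p2 ::
        compile dl p1 b ++ JumpNatLe 0 0 (p2 + csize dl a) :: compile dl p2 a
  | For e c =>
      let p1 := (pc + (xc dl 0 e + 2))%N in
      (cex dl 0 e ++ [:: NatConst (ctr dl) 0; NatAdd (ctr dl) (ctr dl) (tmp 0)]) ++
      NatConst (tmp 0) 0 :: JumpNatLe (ctr dl) (tmp 0) (p1 + 5 + csize dl.+1 c) ::
      [:: NatConst (tmp 0) 1; NatSub (ctr dl) (ctr dl) (tmp 0)] ++
      compile dl.+1 (p1 + 4) c ++ [:: JumpNatLe 0 0 p1]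
  | Let e c =>
      (cex dl 0 e ++ [:: NatConst (ctr dl) 0; NatAdd (ctr dl) (ctr dl) (tmp 0)]) ++
      compile dl.+1 (pc + (xc dl 0 e + 2)) c
  end.

Fixpoint depth c : nat :=
  match c with
  | Seq a b | If _ _ a b => maxn (depth a) (depth b)
  | For _ c | Let _ c => (depth c).+1
  | _ => 0
  end%N.

Fixpoint height c : nat :=
  match c with
  | Skip => 0
  | Put _ e f => maxn (maxn (hx e) (hx f).+1) 2
  | Coin _ e _ => maxn (hx e) 2
  | Seq a b => maxn (height a) (height b)
  | If e f a b => maxn (maxn (hx e) (hx f).+1) (maxn (height a) (height b))
  | For e c | Let e c => maxn (hx e) (height c)
  end%N.

Lemma size_comp dl pc c : size (compile dl pc c) = csize dl c.
Proof.
elim: c dl pc => [|t e f|t e x|a IHa b IHb|e f a IHa b IHb|e c IH|e c IH] dl pc //=;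
  rewrite ?size_cat /= ?size_cat /= ?size_addr ?IHa ?IHb ?IH /xc ?size_cat /=; lia.
Qed.

End Code.

Section Run.
Variables (R : realType) (P : program) (A : pred (state R)).
Implicit Types (N : nat -> nat) (X : nat -> R).

Definition placed pc (l : seq instr) := exists pre post, P = pre ++ l ++ post /\ size pre = pc.

Lemma placed_cat pc l1 l2 : placed pc (l1 ++ l2) -> placed pc l1 /\ placed (pc + size l1) l2.
Proof.
case=> pre [post [e <-]]; split; first by exists pre, (l2 ++ post); rewrite e -catA.
by exists (pre ++ l1), post; rewrite size_cat e !catA.
Qed.

Lemma placed_cons pc op l : placed pc (op :: l) -> onth P pc = Some op /\ placed pc.+1 l.
Proof.
move=> h; have [_ h2] := @placed_cat pc [:: op] l h; split; last by rewrite addn1 in h2.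
case: h => pre [post [-> <-]].
by elim: pre {h2} => //= a pre ->.
Qed.

Definition nstep op N : nat -> nat :=
  match op with
  | NatConst i c => upd N i c
  | NatAdd i a c => upd N i (N a + N c)
  | NatSub i a c => upd N i (N a - N c)
  | NatLoad i a => upd N i (N (N a))
  | NatStore i a => upd N (N i) (N a)
  | _ => N
  end%N.

Definition isnat op :=
  match op with
  | NatConst _ _ | NatAdd _ _ _ | NatSub _ _ _ | NatLoad _ _ | NatStore _ _ => true
  | _ => false
  end.

Definition run l N := foldl (fun N op => nstep op N) N l.

Lemma run_cat l1 l2 N : run (l1 ++ l2) N = run l2 (run l1 N).
Proof. by rewrite /run foldl_cat. Qed.

Lemma halt_line l pc N X t : placed pc l -> all isnat l -> (size l <= t)%N ->
  halt_prob P A t (State pc N X) = halt_prob P A (t - size l) (State (pc + size l) (run l N) X).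
Proof.
elim: l pc N t => [|op l IH] pc N t pl; first by rewrite addn0 subn0.
move=> /= /andP[io il]; case: t => // t tl.
have [q1 p1] := placed_cons pl.
rewrite /= q1 subSS addnS -addSn -(IH _ _ _ p1 il tl).
by case: op io {pl q1} => //= *; rewrite mul1r subrr mul0r addr0.
Qed.

Lemma halt_jump pc a b l N X t : onth P pc = Some (JumpNatLe a b l) -> (0 < t)%N ->
  halt_prob P A t (State pc N X) =
  halt_prob P A t.-1 (State (if (N a <= N b)%N then l else pc.+1) N X).
Proof. by move=> q1; case: t => //= t _; rewrite q1 /= mul1r subrr mul0r addr0. Qed.

Lemma halt_flip pc i a N X t : onth P pc = Some (Flip i a) -> (0 < t)%N ->
  let h := Num.max 0 (Num.min 1 (X a)) in
  halt_prob P A t (State pc N X) = h * halt_prob P A t.-1 (State pc.+1 (upd N i 1%N) X) +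
    (1 - h) * halt_prob P A t.-1 (State pc.+1 (upd N i 0%N) X).
Proof. by move=> q1; case: t => //= t _; rewrite q1. Qed.

Variables (X : nat -> R) (B Dm Tm : nat).
Let c0 := (4 + Dm + Tm)%N.
Hypothesis B_ge : (c0 <= B)%N.
Local Notation tmp := (tmp Dm).

Definition pr x : R := Num.max 0 (Num.min 1 (X x)).

(** Expectation of [Psi] in the final state, in continuation-passing style. Structural recursion is
    enough because the number of iterations of a loop is fixed on entry. *)
Fixpoint ex c cs (Psi : st -> R) (s : st) : R :=
  match c with
  | Skip => Psi s
  | Put t e f => Psi (put s t (ev cs s e) (ev cs s f))
  | Coin t e x => pr x * Psi (put s t (ev cs s e) 1%N) + (1 - pr x) * Psi (put s t (ev cs s e) 0%N)
  | Seq a b => ex a cs (ex b cs Psi) s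
  | If e f a b => if (ev cs s e <= ev cs s f)%N then ex a cs Psi s else ex b cs Psi s
  | For e c => iteri (ev cs s e) (fun j K => ex c (rcons cs j) K) Psi s
  | Let e c => ex c (rcons cs (ev cs s e)) Psi s
  end.

Local Notation xs cs d e := (xc Dm (size cs) d e).

(* Worst-case running time of [c] followed by a computation of running time [post]. *)
Fixpoint tmx c cs (post : st -> nat) (s : st) : nat :=
  match c with
  | Skip => post s
  | Put t e f => xs cs 0 e + 6 + xs cs 1 f + 1 + post (put s t (ev cs s e) (ev cs s f))
  | Coin t e x => xs cs 0 e + 8 + maxn (post (put s t (ev cs s e) 1)) (post (put s t (ev cs s e) 0))
  | Seq a b => tmx a cs (tmx b cs post) s
  | If e f a b => xs cs 0 e + xs cs 1 f + 1 +
      if ev cs s e <= ev cs s f then tmx a cs post s else tmx b cs (fun s => (post s).+1) s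
  | For e c => xs cs 0 e + 2 + iteri (ev cs s e)
      (fun j K s => 4 + tmx c (rcons cs j) (fun s => (K s).+1) s) (fun s => 2 + post s) s
  | Let e c => xs cs 0 e + 2 + tmx c (rcons cs (ev cs s e)) post s
  end%N.

Record rep cs N (s : st) : Prop := Rep {
  rep_base : N 3%N = B;
  rep_arr : forall (t : 'I_8) a, N (B + 8 * a + t)%N = s t a;
  rep_ctr : forall j, (j < size cs)%N -> N (ctr j) = nth 0%N cs j }.

Lemma rep_eq cs N N' s : rep cs N s -> (size cs <= Dm)%N ->
  (forall c, (c < 4 + Dm)%N || (c0 <= c)%N -> N' c = N c) -> rep cs N' s.
Proof.
case=> h1 h2 h3 sD e; split.
- by rewrite e // ltn_addr.
- by move=> t a; rewrite e ?h2 //; apply/orP; right; lia.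
- by move=> j jc; rewrite e ?h3 // /ctr; lia.
Qed.

Lemma all_cex dl d e : all isnat (cex Dm dl d e).
Proof. by elim: e d => //= [j|t e IH|e IH f IH'|e IH f IH'] d; rewrite ?all_cat ?IH ?IH' //=; case: ifP. Qed.

Lemma updE N i v j : upd N i v j = if j == i then v else N j. Proof. by []. Qed.

Lemma run_addr d t N : N 3%N = B -> let N' := run (addr Dm d t) N in
  N' (tmp d) = (B + 8 * N (tmp d) + t)%N /\ forall c, (c < tmp d)%N || (tmp d.+2 <= c)%N -> N' c = N c.
Proof.
move=> NB; rewrite /addr /run /=.
have n1 : (tmp d == tmp d.+1) = false by apply/negbTE; rewrite /tmp; lia.
have n2 : (tmp d.+1 == tmp d) = false by rewrite eq_sym.
have n3 : (3%N == tmp d) = false by apply/negbTE; rewrite /tmp; lia.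
have n4 : (3%N == tmp d.+1) = false by apply/negbTE; rewrite /tmp; lia.
split; first by rewrite !(updE, eqxx, n1, n2, n3, n4, NB); lia.
move=> c hc; have m1 : (c == tmp d) = false by apply/negbTE; move: hc; rewrite /tmp; lia.
have m2 : (c == tmp d.+1) = false by apply/negbTE; move: hc; rewrite /tmp; lia.
by rewrite !updE m1 m2.
Qed.

Lemma run_cex cs s e d N : rep cs N s -> (size cs <= Dm)%N -> (d + hx e <= Tm)%N ->
  let N' := run (cex Dm (size cs) d e) N in
  N' (tmp d) = ev cs s e /\ forall c, (c < tmp d)%N || (c0 <= c)%N -> N' c = N c.
Proof.
elim: e d N => [c|j|t e IH|e IHe f IHf|e IHe f IHf] d N rN sD hd /=.
- split; first by rewrite /run /= updE eqxx.
  by move=> a ha; rewrite /run /= updE; case: eqP => // ea; move: ha hd; rewrite ea /= /c0 /tmp; lia.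
- case: ltnP => [jc|jc].
    have n1 : (ctr j == tmp d) = false by apply/negbTE; rewrite /tmp /ctr; lia.
    split; first by rewrite /run /= !updE !eqxx n1 (rep_ctr rN).
    by move=> a ha; rewrite /run /= !updE; case: eqP => // ea; move: ha hd; rewrite ea /= /c0 /tmp; lia.
  split; first by rewrite /run /= updE eqxx nth_default.
  by move=> a ha; rewrite /run /= updE; case: eqP => // ea; move: ha hd; rewrite ea /= /c0 /tmp; lia.
- rewrite !run_cat; have {}hd : (d + (hx e).+1 <= Tm)%N := hd.
  have hd' : (d + hx e <= Tm)%N by lia.
  have [v1 f1] := IH d N rN sD hd'; set N1 := run _ N in v1 f1 *.
  have b1 : N1 3%N = B by rewrite f1 ?(rep_base rN) // /tmp; lia.
  have [v2 f2] := run_addr d t b1; set N2 := run _ N1 in v2 f2 *.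
  have h1 := hx_gt0 e.
  have f3 c : (c < tmp d)%N || (c0 <= c)%N -> N2 c = N c.
    move=> hc; rewrite f2 ?f1 //; move: hc hd h1; rewrite /c0 /tmp; lia.
  have -> : run [:: NatLoad (tmp d) (tmp d)] N2 = upd N2 (tmp d) (N2 (N2 (tmp d))) by [].
  split; last first.
    move=> c hc; rewrite updE; case: eqP => [ec|_]; last exact: f3.
    by move: hc hd; rewrite ec /c0 /tmp; lia.
  rewrite updE eqxx v2 f3 ?v1 ?(rep_arr rN) //; apply/orP; right; lia.
- rewrite !run_cat /=; move: hd => /= hd.
  have hd1 : (d + hx e <= Tm)%N by lia.
  have hd2 : (d.+1 + hx f <= Tm)%N by lia.
  have [v1 f1] := IHe d N rN sD hd1; set N1 := run _ N in v1 f1 *.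
  have r1 : rep cs N1 s by apply: rep_eq rN sD _ => c hc; rewrite f1 //; move: hc; rewrite /tmp; lia.
  have [v2 f2] := IHf d.+1 N1 r1 sD hd2; set N2 := run _ N1 in v2 f2 *.
  split; first by rewrite /run /= updE eqxx v2 f2 ?v1 // /tmp; lia.
  move=> c hc; rewrite /run /= updE; case: eqP => [ec|_]; first by move: hc hd; rewrite ec /c0 /tmp; lia.
  by rewrite f2 ?f1 //; move: hc; rewrite /tmp; lia.
- rewrite !run_cat /=; move: hd => /= hd.
  have hd1 : (d + hx e <= Tm)%N by lia.
  have hd2 : (d.+1 + hx f <= Tm)%N by lia.
  have [v1 f1] := IHe d N rN sD hd1; set N1 := run _ N in v1 f1 *.
  have r1 : rep cs N1 s by apply: rep_eq rN sD _ => c hc; rewrite f1 //; move: hc; rewrite /tmp; lia.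
  have [v2 f2] := IHf d.+1 N1 r1 sD hd2; set N2 := run _ N1 in v2 f2 *.
  split; first by rewrite /run /= updE eqxx v2 f2 ?v1 // /tmp; lia.
  move=> c hc; rewrite /run /= updE; case: eqP => [ec|_]; first by move: hc hd; rewrite ec /c0 /tmp; lia.
  by rewrite f2 ?f1 //; move: hc; rewrite /tmp; lia.
Qed.

Lemma addr_inj (a b : nat) (t u : 'I_8) : (B + 8 * a + t == B + 8 * b + u)%N = (t == u) && (a == b).
Proof.
have := ltn_ord t; have := ltn_ord u => hu ht.
rewrite -val_eqE /=; apply/eqP/andP => [e|[/eqP -> /eqP ->]] //.
by split; apply/eqP; lia.
Qed.

Lemma rep_put cs N s (t : 'I_8) a v : rep cs N s -> (size cs <= Dm)%N ->
  rep cs (upd N (B + 8 * a + t)%N v) (put s t a v).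
Proof.
case=> h1 h2 h3 sD; split.
- by rewrite updE; case: eqP => // e; move: B_ge; rewrite /c0; lia.
- by move=> u b; rewrite updE addr_inj h2 /put.
- by move=> j jc; rewrite updE h3 //; case: eqP => // e; move: B_ge e; rewrite /c0 /ctr; lia.
Qed.

Lemma rep_rcons cs N N' s q : rep cs N s -> N' (ctr (size cs)) = q ->
  (forall c, (c != ctr (size cs)) && ((c < 4 + Dm)%N || (c0 <= c)%N) -> N' c = N c) -> (size cs < Dm)%N ->
  rep (rcons cs q) N' s.
Proof.
case=> h1 h2 h3 e f sD; split.
- by rewrite f //=; rewrite /ctr; lia.
- move=> t a; rewrite f ?h2 //; move: B_ge; rewrite /c0 /ctr => b; lia.
- move=> j; rewrite size_rcons ltnS leq_eqVlt => /orP[/eqP ->|jc].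
    by rewrite e nth_rcons ltnn eqxx.
  by rewrite nth_rcons jc f ?h3 // /ctr; apply/andP; split; [apply/eqP|]; lia.
Qed.

Lemma rep_belast cs N s q : rep (rcons cs q) N s -> rep cs N s.
Proof.
case=> h1 h2 h3; split => // j jc; rewrite h3 ?size_rcons ?nth_rcons ?jc //.
by rewrite ltnS ltnW.
Qed.

(** [post] is the time still needed after [c]. Since it is a function of the state, the time of
    later commands may depend on what earlier ones have computed. *)
Lemma comp_correct c cs pc (Psi : st -> R) (post : st -> nat) :
  placed pc (compile Dm (size cs) pc c) -> (size cs + depth c <= Dm)%N -> (height c <= Tm)%N ->
  (forall N s t, rep cs N s -> (post s <= t)%N ->
     halt_prob P A t (State (pc + csize Dm (size cs) c) N X) = Psi s) ->
  forall N s t, rep cs N s -> (tmx c cs post s <= t)%N ->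
    halt_prob P A t (State pc N X) = ex c cs Psi s.
Proof.
elim: c cs pc Psi post => [|u e f|u e x|a IHa b IHb|e f a IHa b IHb|e c IH|e c IH] cs pc Psi post /= pl dD hT fin N s t rN ht.
- by have := fin N s t rN ht; rewrite addn0.
- have sD : (size cs <= Dm)%N by rewrite addn0 in dD.
  have [h1 h2] : (hx e <= Tm)%N /\ (1 + hx f <= Tm)%N by move: hT; rewrite !geq_max; lia.
  set l := _ ++ _ in pl *.
  have zl : size l = (xc Dm (size cs) 0 e + 6 + xc Dm (size cs) 1 f + 1)%N by rewrite /l !size_cat size_addr /= /xc; lia.
  rewrite (halt_line _ _ pl); last by rewrite zl; lia.
    rewrite zl; apply: fin; last by lia.
    rewrite /l !run_cat.
    have [v1 f1] := run_cex rN sD (h1 : (0 + hx e <= Tm)%N); set N1 := run _ N in v1 f1 *.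
    have b1 : N1 3%N = B by rewrite f1 ?(rep_base rN) // /tmp; lia.
    have [v2 f2] := run_addr 0 u b1; set N2 := run _ N1 in v2 f2 *.
    have hf := hx_gt0 f.
    have r2 : rep cs N2 s.
      by apply: rep_eq rN sD _ => c hc; rewrite f2 ?f1 //; move: hc; rewrite /c0 /tmp; lia.
    have [v3 f3] := run_cex r2 sD h2; set N3 := run _ N2 in v3 f3 *.
    have r3 : rep cs N3 s by apply: rep_eq r2 sD _ => c hc; rewrite f3 //; move: hc; rewrite /tmp; lia.
    rewrite /run /= v3 f3; last by rewrite /tmp; lia.
    by rewrite v2 v1; apply: rep_put.
  by rewrite /l !all_cat !all_cex.
- have sD : (size cs <= Dm)%N by rewrite addn0 in dD.
  have [h1 h2] : (hx e <= Tm)%N /\ (2 <= Tm)%N by move: hT; rewrite !geq_max; lia.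
  set l := cex _ _ _ _ ++ _ in pl *.
  have zl : size l = (xc Dm (size cs) 0 e + 6)%N by rewrite /l !size_cat size_addr.
  have [p1 p2] := placed_cat pl; have [q1 p3] := placed_cons p2.
  rewrite (halt_line _ _ p1); last by rewrite zl; lia.
    rewrite (halt_flip _ _ q1); last by rewrite zl; lia.
    have [v1 f1] := run_cex rN sD (h1 : (0 + hx e <= Tm)%N).
    have rl : run l N = run (addr Dm 0 u) (run (cex Dm (size cs) 0 e) N) by rewrite /l run_cat.
    rewrite rl; set N1 := run _ N in v1 f1 *.
    have b1 : N1 3%N = B by rewrite f1 ?(rep_base rN) // /tmp; lia.
    have [v2 f2] := run_addr 0 u b1; set N2 := run _ N1 in v2 f2 *.
    have r2 : rep cs N2 s.
      by apply: rep_eq rN sD _ => c hc; rewrite f2 ?f1 //; move: hc; rewrite /c0 /tmp; lia.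
    have one b : (post (put s u (ev cs s e) b) <= t - (xc Dm (size cs) 0 e + 8))%N ->
       halt_prob P A (t - size l).-1 (State (pc + size l).+1 (upd N2 (tmp 1) b) X) = Psi (put s u (ev cs s e) b).
      move=> hb; rewrite (halt_line _ _ p3) //; last by rewrite zl /=; lia.
      have -> : ((t - size l).-1 - size [:: NatStore (tmp 0) (tmp 1)] = t - (xc Dm (size cs) 0 e + 8))%N by rewrite zl /=; lia.
      have -> : ((pc + size l).+1 + size [:: NatStore (tmp 0) (tmp 1)] = pc + (xc Dm (size cs) 0 e + 8))%N by rewrite zl /=; lia.
      apply: fin => //.
      have n1 : (tmp 0 == tmp 1) = false by apply/negbTE; rewrite /tmp; lia.
      rewrite /run /= !updE n1 eqxx v2 v1; apply: rep_put => //.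
      apply: rep_eq r2 sD _ => c hc; rewrite updE; case: eqP => // ec; move: hc; rewrite ec /c0 /tmp; lia.
    by rewrite !one //; move: ht; lia.
  by rewrite /l !all_cat !all_cex.
- have [pa pb] := placed_cat pl; rewrite size_comp in pb.
  have hd : (size cs + depth a <= Dm)%N /\ (size cs + depth b <= Dm)%N by lia.
  have hh : (height a <= Tm)%N /\ (height b <= Tm)%N by move: hT; rewrite geq_max => /andP.
  apply: (IHa cs pc (ex b cs Psi) (tmx b cs post)) => //; try by case: hd; case: hh.
  move=> N' s' t' r' h'; apply: (IHb cs _ Psi post) => //; try by case: hd; case: hh.
  by move=> N'' s'' t'' r'' h''; rewrite -addnA; apply: fin.
- have sD : (size cs <= Dm)%N by lia.
  have hd : (size cs + depth a <= Dm)%N /\ (size cs + depth b <= Dm)%N by lia.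
  have [[h1 h2] hh] : ((hx e <= Tm)%N /\ (1 + hx f <= Tm)%N) /\ ((height a <= Tm)%N /\ (height b <= Tm)%N).
    by move: hT; rewrite !geq_max; lia.
  set l := cex _ _ _ _ ++ _ in pl *.
  have zl : size l = (xc Dm (size cs) 0 e + xc Dm (size cs) 1 f)%N by rewrite /l !size_cat.
  have [p1 p2] := placed_cat pl; have [q1 p3] := placed_cons p2.
  have [p4 p5] := placed_cat p3; have [q2 p6] := placed_cons p5.
  rewrite size_comp zl in q1 q2 p4 p6.
  rewrite (halt_line _ _ p1); first last.
  + by rewrite zl; lia.
  + by rewrite /l all_cat !all_cex.
  rewrite zl (halt_jump _ _ q1); last by lia.
  have [v1 f1] := run_cex rN sD (h1 : (0 + hx e <= Tm)%N).
  rewrite /l run_cat; set N1 := run _ N in v1 f1 *.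
  have r1 : rep cs N1 s by apply: rep_eq rN sD _ => c hc; rewrite f1 //; move: hc; rewrite /tmp; lia.
  have [v2 f2] := run_cex r1 sD h2; set N2 := run _ N1 in v2 f2 *.
  have r2 : rep cs N2 s by apply: rep_eq r1 sD _ => c hc; rewrite f2 //; move: hc; rewrite /tmp; lia.
  have -> : N2 (tmp 0) = ev cs s e by rewrite f2 ?v1 // /tmp; lia.
  rewrite v2; move: ht; case: ifP => hle ht.
    set p2' := (_ + _ + 1)%N in q1 p6 *.
    apply: (IHa cs p2' Psi post _ _ _ _ N2 s) => //; try by case: hd; case: hh.
    - by move: p6; congr (placed _ _); rewrite /p2'; lia.
    - have -> : (p2' + csize Dm (size cs) a = pc + (xc Dm (size cs) 0 e + xc Dm (size cs) 1 f + 2 + csize Dm (size cs) b + csize Dm (size cs) a))%N by rewrite /p2'; lia.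
      exact: fin.
    - by lia.
  apply: (IHb cs _ Psi (fun s => (post s).+1) _ _ _ _ N2 s) => //; try by case: hd; case: hh.
  - by move: p4; rewrite (_ : (pc + _).+1 = pc + (xc Dm (size cs) 0 e + xc Dm (size cs) 1 f + 1))%N //; lia.
  - move=> N' s' t' r' h'.
    rewrite (halt_jump _ _ q2); last by lia.
    rewrite leqnn (_ : _ + _ + 1 + _ = pc + (xc Dm (size cs) 0 e + xc Dm (size cs) 1 f + 2 + csize Dm (size cs) b + csize Dm (size cs) a))%N; last by lia.
    by apply: fin => //; lia.
  - by lia.
- have sD : (size cs < Dm)%N by lia.
  have [h1 h2] : (hx e <= Tm)%N /\ (height c <= Tm)%N by move: hT; rewrite geq_max => /andP.
  set l := cex _ _ _ _ ++ _ in pl *.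
  have zl : size l = (xc Dm (size cs) 0 e + 2)%N by rewrite /l !size_cat.
  have [p1 p2] := placed_cat pl; rewrite zl in p2.
  set L := (pc + _)%N in p2.
  have [q1 p3] := placed_cons p2; have [q2 p4] := placed_cons p3.
  have [p5 p6] := placed_cat (p4 : placed _ ([:: _; _] ++ _)).
  have [p7 p8] := placed_cat p6; have [q3 _] := placed_cons p8; rewrite size_comp in q3.
  have {}q3 : onth P (L.+2 + 2 + csize Dm (size cs).+1 c)%N = Some (JumpNatLe 0 0 L) := q3.
  rewrite /= in p7.
  have h0 : (0 < Tm)%N by apply: leq_trans h1; apply: hx_gt0.
  have head q : forall N s t, rep cs N s -> N (ctr (size cs)) = q ->
     (iteri q (fun j K s => 4 + tmx c (rcons cs j) (fun s => (K s).+1) s) (fun s => 2 + post s) s <= t)%N ->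
     halt_prob P A t (State L N X) = iteri q (fun j K => ex c (rcons cs j) K) Psi s.
    elim: q => [|q IHq] N' s' t' r' cq h'.
      move: h' => /= h'.
      rewrite (halt_line (l := [:: NatConst (tmp 0) 0]) _ _ (proj1 (placed_cat (p2 : placed _ ([:: _] ++ _))))) //=; last by lia.
      rewrite addn1 (halt_jump _ _ q2) /run /=; last by lia.
      have n1 : (ctr (size cs) == tmp 0) = false by apply/negbTE; rewrite /tmp /ctr; lia.
      rewrite !updE eqxx n1 cq leqnn.
      rewrite (_ : _ + _ + _ = pc + (xc Dm (size cs) 0 e + 7 + csize Dm (size cs).+1 c))%N; last by rewrite /L; lia.
      apply: fin; last by lia.
      by apply: rep_eq r' (ltnW sD) _ => a ha; rewrite updE; case: eqP => // ea; move: ha; rewrite ea /c0 /tmp; lia.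
    move: h'; rewrite /= => h'.
    rewrite (halt_line (l := [:: NatConst (tmp 0) 0]) _ _ (proj1 (placed_cat (p2 : placed _ ([:: _] ++ _))))) //=; last by lia.
    rewrite addn1 (halt_jump _ _ q2) /run /=; last by lia.
    have n1 : (ctr (size cs) == tmp 0) = false by apply/negbTE; rewrite /tmp /ctr; lia.
    rewrite !updE eqxx n1 cq ltn0.
    rewrite (halt_line _ _ p5) //=; last by lia.
    rewrite /run /=; set N2 := upd _ _ _.
    have r2 : rep (rcons cs q) N2 s'.
      apply: (rep_rcons (N := N') r') => //.
        by rewrite /N2 !(updE, eqxx, n1) cq subn1.
      move=> a /andP[a1 a2]; rewrite /N2 updE (negbTE a1) !updE.
      by case: eqP => // ea; move: a2; rewrite ea /c0 /tmp; lia.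
    rewrite -(size_rcons cs q) in p7 q3.
    apply: (IH (rcons cs q) _ _ (fun s => (iteri q (fun j K s => 4 + tmx c (rcons cs j) (fun s => (K s).+1) s) (fun s => 2 + post s) s).+1)%N _ _ _ _ N2 s') => //.
    - by move: p7; rewrite (_ : L.+2 + 2 = pc + (xc Dm (size cs) 0 e + 2) + 4)%N //; rewrite /L; lia.
    - by rewrite size_rcons; lia.
    - move=> N3 s3 t3 r3 h3; rewrite (halt_jump _ _ q3); last by lia.
      rewrite leqnn; apply: IHq; first exact: rep_belast r3.
        by rewrite (rep_ctr r3) ?size_rcons // nth_rcons ltnn eqxx.
      by lia.
    - by lia.
  rewrite (halt_line _ _ p1); first last.
  + by rewrite zl; lia.
  + by rewrite /l all_cat all_cex.
  rewrite zl -/L.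
  have [v1 f1] := run_cex rN (ltnW sD) (h1 : (0 + hx e <= Tm)%N).
  rewrite /l run_cat; set N1 := run _ N in v1 f1 *.
  have n2 : (tmp 0 == ctr (size cs)) = false by apply/negbTE; rewrite /tmp /ctr; lia.
  have r1 : rep (rcons cs (ev cs s e)) (run [:: NatConst (ctr (size cs)) 0; NatAdd (ctr (size cs)) (ctr (size cs)) (tmp 0)] N1) s.
    apply: (rep_rcons rN) => //; first by rewrite /run /= !updE !eqxx n2 v1.
    move=> a /andP[a1 a2]; rewrite /run /= !updE (negbTE a1) f1 //; move: a2; rewrite /tmp; lia.
  apply: head; first exact: rep_belast r1.
    by rewrite (rep_ctr r1) ?size_rcons // nth_rcons ltnn eqxx.
  by lia.
- have sD : (size cs < Dm)%N by lia.
  have [h1 h2] : (hx e <= Tm)%N /\ (height c <= Tm)%N by move: hT; rewrite geq_max => /andP.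
  set l := cex _ _ _ _ ++ _ in pl *.
  have zl : size l = (xc Dm (size cs) 0 e + 2)%N by rewrite /l !size_cat.
  have [p1 p2] := placed_cat pl; rewrite zl in p2.
  rewrite (halt_line _ _ p1); first last.
  + by rewrite zl; lia.
  + by rewrite /l all_cat all_cex.
  rewrite zl.
  have [v1 f1] := run_cex rN (ltnW sD) (h1 : (0 + hx e <= Tm)%N).
  rewrite /l run_cat; set N1 := run _ N in v1 f1 *.
  have n2 : (tmp 0 == ctr (size cs)) = false by apply/negbTE; rewrite /tmp /ctr; lia.
  have r1 : rep (rcons cs (ev cs s e)) (run [:: NatConst (ctr (size cs)) 0; NatAdd (ctr (size cs)) (ctr (size cs)) (tmp 0)] N1) s.
    apply: (rep_rcons rN) => //; first by rewrite /run /= !updE !eqxx n2 v1.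
    move=> a /andP[a1 a2]; rewrite /run /= !updE (negbTE a1) f1 //; move: a2; rewrite /tmp; lia.
  rewrite -(size_rcons cs (ev cs s e)) in p2.
  apply: (IH _ _ Psi post p2 _ _ _ _ s _ r1) => //.
  + by rewrite size_rcons; lia.
  + move=> N' s' t' r' h'; rewrite size_rcons -addnA; apply: fin => //; exact: rep_belast r'.
  + by lia.
Qed.

End Run.

(** * Program logic and static cost *)

Fixpoint writes c (t : 'I_8) : bool :=
  match c with
  | Skip => false
  | Put u _ _ | Coin u _ _ => t == u
  | Seq a b | If _ _ a b => writes a t || writes b t
  | For _ c | Let _ c => writes c t
  end.

Definition agree c (s s' : st) := forall t, ~~ writes c t -> s' t =1 s t.

Section Logic.
Variables (R : realType) (X : nat -> R).
Local Notation ex := (ex X).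

Lemma put_other s t a v t' : t' != t -> put s t a v t' =1 s t'.
Proof. by move=> h b; rewrite /put (negbTE h). Qed.

Lemma ex_frame c cs Psi Psi' s : (forall s', agree c s s' -> Psi s' = Psi' s') ->
  ex c cs Psi s = ex c cs Psi' s.
Proof.
elim: c cs Psi Psi' s => [|u e f|u e x|a IHa b IHb|e f a IHa b IHb|e c IH|e c IH] cs Psi Psi' s /= h.
- exact: h.
- by apply: h => t /= ht; apply: put_other.
- by congr (_ * _ + _ * _); apply: h => t /= ht; apply: put_other.
- apply: IHa => s' h'; apply: IHb => s'' h''; apply: h => t /=; rewrite negb_or => /andP[h1 h2] x.
  by rewrite h'' // h'.
- case: ifP => _; [apply: IHa|apply: IHb] => s' h'; apply: h => t /=; rewrite negb_or => /andP[h1 h2]; exact: h'.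
- suff gen q : forall s1, agree (For e c) s s1 -> iteri q (fun j K => ex c (rcons cs j) K) Psi s1 =
      iteri q (fun j K => ex c (rcons cs j) K) Psi' s1 by apply: gen.
  elim: q => [|q IHq] s1 h1 /=; first exact: h.
  by apply: IH => s' h'; apply: IHq => t ht x; rewrite h' // h1.
- by apply: IH => s' h'; apply: h.
Qed.

(* [c] is deterministic when started in [s], and leads to a state satisfying [Q]. *)
Definition sat cs c s (Q : st -> Prop) := exists s', Q s' /\ forall Psi, ex c cs Psi s = Psi s'.

Lemma sat_weak cs c s (Q Q' : st -> Prop) : sat cs c s Q -> (forall s', Q s' -> Q' s') -> sat cs c s Q'.
Proof. by case=> s' [q e] h; exists s'; split => //; apply: h. Qed.

Lemma sat_frame cs c s Q : sat cs c s Q -> sat cs c s (fun s' => Q s' /\ agree c s s').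
Proof.
case=> s' [q e]; exists s'; split => //; split => //.
(* [sat] only speaks of expectations; testing with the indicator of the frame property turns that
   property into an equation between numbers. *)
pose Psi s1 : R := `[< agree c s s1 >]%:R.
have h1 : ex c cs Psi s = ex c cs (fun=> 1) s.
  by apply: ex_frame => s1 h; rewrite /Psi asboolT.
have : Psi s' = 1 by rewrite -e h1 e.
by rewrite /Psi; case: asboolP => //= _ /eqP; rewrite eq_sym oner_eq0.
Qed.

Lemma sat_skip cs s (Q : st -> Prop) : Q s -> sat cs Skip s Q.
Proof. by move=> q; exists s. Qed.

Lemma sat_put cs t e f s (Q : st -> Prop) : Q (put s t (ev cs s e) (ev cs s f)) -> sat cs (Put t e f) s Q.
Proof. by move=> q; exists (put s t (ev cs s e) (ev cs s f)). Qed.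

Lemma sat_seq cs a b s Q Q' : sat cs a s Q -> (forall s', Q s' -> sat cs b s' Q') -> sat cs (Seq a b) s Q'.
Proof.
case=> s1 [q1 e1] h; have [s2 [q2 e2]] := h s1 q1; exists s2; split => // Psi.
by rewrite /= e1 e2.
Qed.

Lemma sat_if cs e f a b s Q : ((ev cs s e <= ev cs s f)%N -> sat cs a s Q) ->
  ((ev cs s f < ev cs s e)%N -> sat cs b s Q) -> sat cs (If e f a b) s Q.
Proof.
move=> ha hb; have [h|h] := leqP (ev cs s e) (ev cs s f).
  by have [s' [q e']] := ha h; exists s'; split => // Psi /=; rewrite h.
by have [s' [q e']] := hb h; exists s'; split => // Psi /=; rewrite leqNgt h /=; apply: e'.
Qed.

Lemma sat_for cs e c s (I : nat -> st -> Prop) : I (ev cs s e) s ->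
  (forall j s', (j < ev cs s e)%N -> I j.+1 s' -> sat (rcons cs j) c s' (I j)) -> sat cs (For e c) s (I 0%N).
Proof.
rewrite /sat /=; move: (ev cs s e) => q.
elim: q s => [|q IH] s1 i1 h; first by exists s1.
have [s2 [i2 e2]] := h q s1 (ltnSn q) i1.
have [|s3 [i3 e3]] := IH s2 i2; first by move=> j s' jq; apply: h; rewrite ltnS ltnW.
by exists s3; split => // Psi /=; rewrite e2 e3.
Qed.

Definition unroll k (f : nat -> cmd) := foldr Seq Skip [seq f b | b <- iota 0 k].

Lemma sat_unroll cs k f s (I : nat -> st -> Prop) : I 0%N s ->
  (forall b s', (b < k)%N -> I b s' -> sat cs (f b) s' (I b.+1)) -> sat cs (unroll k f) s (I k).
Proof.
rewrite /unroll; suff H l n : I n s -> (forall b s', (n <= b < n + l)%N -> I b s' -> sat cs (f b) s' (I b.+1)) ->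
    sat cs (foldr Seq Skip [seq f b | b <- iota n l]) s (I (n + l)%N).
  by move=> i0 h; apply: (H k 0%N) => // b s' /andP[_]; rewrite add0n; apply: h.
elim: l n s => [|l IH] n s1 i1 h /=; first by apply: sat_skip; rewrite addn0.
apply: sat_seq (h n s1 _ i1) _; first by rewrite leqnn addnS ltnS leq_addr.
move=> s2 i2; rewrite -addSnnS; apply: IH => // b s' /andP[h1 h2]; apply: h.
by rewrite (ltnW h1) addnS -addSn.
Qed.

Lemma writes_unroll k f t : writes (unroll k f) t = has (fun b => writes (f b) t) (iota 0 k).
Proof. by rewrite /unroll; elim: (iota 0 k) => //= b l ->. Qed.

Fixpoint xb e : nat :=
  match e with
  | Cst _ => 1 | Cnt _ => 2 | Ld _ e => xb e + 7 | Plus e f | Minus e f => xb e + xb f + 1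
  end%N.

Lemma xc_le Dm dl d e : (xc Dm dl d e <= xb e)%N.
Proof.
rewrite /xc; elim: e d => //= [j|t e IH|e IHe f IHf|e IHe f IHf] d; rewrite ?size_cat /=; first by case: ifP.
- by have := IH d; lia.
- by have := IHe d; have := IHf d.+1; lia.
- by have := IHe d; have := IHf d.+1; lia.
Qed.

Fixpoint nold e : bool :=
  match e with Cst _ | Cnt _ => true | Ld _ _ => false | Plus e f | Minus e f => nold e && nold f end.

Lemma ev_nold cs s s' e : nold e -> ev cs s e = ev cs s' e.
Proof. by elim: e => //= e IHe f IHf /andP[/IHe -> /IHf ->]. Qed.

(** Loop bounds must not read the memory; the cost is then a function of the counters alone. *)
Fixpoint static c : bool :=
  match c with
  | Seq a b | If _ _ a b => static a && static b
  | For e c | Let e c => nold e && static c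
  | _ => true
  end.

Definition st0 : st := fun _ _ => 0%N.

Fixpoint cost c cs : nat :=
  match c with
  | Skip => 0
  | Put _ e f => xb e + xb f + 7
  | Coin _ e _ => xb e + 8
  | Seq a b => cost a cs + cost b cs
  | If e f a b => xb e + xb f + 2 + maxn (cost a cs) (cost b cs)
  | For e c => xb e + 4 + \sum_(0 <= j < ev cs st0 e) (5 + cost c (rcons cs j))
  | Let e c => xb e + 2 + cost c (rcons cs (ev cs st0 e))
  end%N.

Lemma tmx_static Dm c cs post s M : static c ->
  (forall s', agree c s s' -> (post s' <= M)%N) -> (tmx Dm c cs post s <= cost c cs + M)%N.
Proof.
elim: c cs post s M => [|u e f|u e x|a IHa b IHb|e f a IHa b IHb|e c IH|e c IH] cs post s M /= hs h.
- exact: h.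
- have := xc_le Dm (size cs) 0 e; have := xc_le Dm (size cs) 1 f.
  have : (post (put s u (ev cs s e) (ev cs s f)) <= M)%N by apply: h => t ht; apply: put_other.
  lia.
- have := xc_le Dm (size cs) 0 e.
  have h1 v : (post (put s u (ev cs s e) v) <= M)%N by apply: h => t ht; apply: put_other.
  by have := h1 1%N; have := h1 0%N; lia.
- case/andP: hs => sa sb; rewrite -addnA; apply: IHa => // s' h'; apply: IHb => // s'' h''.
  by apply: h => t /=; rewrite negb_or => /andP[h1 h2] x; rewrite h'' // h'.
- case/andP: hs => sa sb; have := xc_le Dm (size cs) 0 e; have := xc_le Dm (size cs) 1 f.
  have ha : (tmx Dm a cs post s <= cost a cs + M)%N.
    by apply: IHa => // s' h'; apply: h => t /=; rewrite negb_or => /andP[h1 h2]; apply: h'.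
  have hb : (tmx Dm b cs (fun s => (post s).+1) s <= cost b cs + M.+1)%N.
    by apply: IHb => // s' h'; rewrite ltnS; apply: h => t /=; rewrite negb_or => /andP[h1 h2]; apply: h'.
  by case: ifP => _; lia.
- case/andP: hs => se sc; rewrite (ev_nold _ s st0) //; have := xc_le Dm (size cs) 0 e.
  suff : (iteri (ev cs st0 e) (fun j K s => 4 + tmx Dm c (rcons cs j) (fun s => (K s).+1) s) (fun s => 2 + post s) s
     <= 2 + \sum_(0 <= j < ev cs st0 e) (5 + cost c (rcons cs j)) + M)%N by lia.
  suff gen q : forall s1, agree (For e c) s s1 ->
     (iteri q (fun j K s => 4 + tmx Dm c (rcons cs j) (fun s => (K s).+1) s) (fun s => 2 + post s) s1
     <= 2 + \sum_(0 <= j < q) (5 + cost c (rcons cs j)) + M)%N by apply: gen.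
  elim: q => [|q IHq] s1 h1 /=; first by rewrite big_geq // addn0 leq_add2l h.
  rewrite big_nat_recr //=; set S := \sum_(0 <= j < q) _ in IHq *.
  have := IH (rcons cs q) (fun s => (iteri q (fun j K s => 4 + tmx Dm c (rcons cs j) (fun s => (K s).+1) s) (fun s => 2 + post s) s).+1)%N s1 (2 + S + M).+1 sc.
  suff hh : forall s', agree c s1 s' -> (iteri q (fun j K s => 4 + tmx Dm c (rcons cs j) (fun s => (K s).+1) s) (fun s => 2 + post s) s' < (2 + S + M).+1)%N.
    by move=> /(_ hh); lia.
  by move=> s' h'; rewrite ltnS; apply: IHq => t ht x; rewrite h' // h1.
- case/andP: hs => se sc; rewrite (ev_nold _ s st0) //; have := xc_le Dm (size cs) 0 e.
  by have := IH (rcons cs (ev cs st0 e)) post s M sc h; lia.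
Qed.

Lemma cost_for e c cs M : (forall j, (j < ev cs st0 e)%N -> (cost c (rcons cs j) <= M)%N) ->
  (cost (For e c) cs <= xb e + 4 + ev cs st0 e * (5 + M))%N.
Proof.
move=> h /=; rewrite leq_add2l -[X in (X * _)%N]subn0 -sum_nat_const_nat big_nat [X in (_ <= X)%N]big_nat.
by apply: leq_sum => j /andP[_ jq]; rewrite leq_add2l h.
Qed.

Fixpoint noloop c : bool :=
  match c with
  | Seq a b | If _ _ a b => noloop a && noloop b
  | For _ _ => false
  | Let _ c => noloop c
  | _ => true
  end.

Lemma cost_noloop c cs cs' : noloop c -> cost c cs = cost c cs'.
Proof.
elim: c cs cs' => //= [a IHa b IHb|e f a IHa b IHb|e c IH] cs cs'.
- by case/andP => ha hb; rewrite (IHa _ cs') // (IHb _ cs').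
- by case/andP => ha hb; rewrite (IHa _ cs') // (IHb _ cs').
- by move=> hc; rewrite (IH _ (rcons cs' (ev cs' st0 e))).
Qed.

End Logic.

Notation tE := (@Ordinal 8 0 isT).
Notation tS := (@Ordinal 8 1 isT).

(** * Moving the input away from the registers and the output back *)

Section Frame.
Variables (k Ce Dm Tm : nat).
Let c0 := (4 + Dm + Tm)%N.
Hypothesis c0_ge : (12 <= c0)%N.
Let sf := (c0 + k + 4)%N.

(* The input occupies every low cell.  A Fibonacci-like iteration on the cells 0
   and 1 produces a pointer beyond the input without losing [n] and [m], since
   it can be run backwards. *)
Definition fib := flatten (nseq sf [:: NatAdd 0 0 1; NatAdd 1 1 0]).
Definition unfib := flatten (nseq sf [:: NatSub 1 1 0; NatSub 0 0 1]).
Definition save l := flatten [seq [:: NatAdd 1 1 2; NatStore 1 x] | x <- iota 3 l].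
(** Cell 2 has to be saved first because it then holds the stride 8. Rewinding the pointer recovers
    the second value of the iteration, without which the iteration could not be undone. *)
Definition line1 := fib ++ NatStore 1 2 :: NatConst 2 8 :: save (c0 - 3) ++
  [:: NatConst 3 (8 * (c0 - 3)); NatSub 3 1 3; NatConst 4 0; NatAdd 1 3 4] ++ unfib ++
  [:: NatConst 4 0; NatAdd 4 4 0; NatConst 5 0; NatAdd 5 5 1; NatConst 6 0; NatAdd 6 6 4] ++
  nseq Ce (NatAdd 6 6 6).

Definition fibs s (p : nat * nat) := iter s (fun p => (p.1 + p.2, p.1 + p.2 + p.2)%N) p.

Lemma run_fib s N : let N' := run (flatten (nseq s [:: NatAdd 0 0 1; NatAdd 1 1 0])) N in
  [/\ N' 0%N = (fibs s (N 0, N 1)%N).1, N' 1%N = (fibs s (N 0, N 1)%N).2 & forall c, (1 < c)%N -> N' c = N c].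
Proof.
elim: s N => [|s IH] N; first by [].
pose N1 := nstep (NatAdd 1 1 0) (nstep (NatAdd 0 0 1) N).
rewrite -[run _ N]/(run (flatten (nseq s [:: NatAdd 0 0 1; NatAdd 1 1 0])) N1).
have [] := IH N1; have -> : (N1 0%N, N1 1%N) = (N 0 + N 1, N 0 + N 1 + N 1)%N.
  by rewrite /N1 /= !updE /=; congr (_, _); rewrite addnC.
have -> : fibs s (N 0 + N 1, N 0 + N 1 + N 1)%N = fibs s.+1 (N 0, N 1)%N by rewrite /fibs iterSr.
move=> h1 h2 h3; split => //.
by move=> c c1; rewrite h3 // /N1 /= !updE; case: c c1 => [|[]].
Qed.

Lemma run_unfib s N a b : N 0%N = (fibs s (a, b)).1 -> N 1%N = (fibs s (a, b)).2 ->
  let N' := run (flatten (nseq s [:: NatSub 1 1 0; NatSub 0 0 1])) N in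
  [/\ N' 0%N = a, N' 1%N = b & forall c, (1 < c)%N -> N' c = N c].
Proof.
elim: s N => [|s IH] N //= h0 h1.
have := IH (nstep (NatSub 0 0 1) (nstep (NatSub 1 1 0) N)); set N1 := nstep _ _ => h.
have [] := h _ _.
- by rewrite /N1 /= !updE /= h0 h1; lia.
- by rewrite /N1 /= !updE /= h0 h1; lia.
move=> e0 e1 e2; split => // c c1; rewrite e2 // /N1 /= !updE; case: c c1 => [|[]] //.
Qed.

Lemma fibs_ge s n m : (2 ^ s * (n + 2 * m) <= (fibs s.+1 (n, m)).2)%N.
Proof.
elim: s => [|s IH]; first by rewrite /=; lia.
by move: IH; rewrite expnS /fibs !iterS /=; set p := iter s _ _ => /=; lia.
Qed.

Lemma run_save B l N : N 1%N = B -> N 2%N = 8%N -> (3 + l <= B)%N ->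
  let N' := run (save l) N in
  [/\ N' 1%N = (B + 8 * l)%N, N' 2%N = 8%N,
   forall c, (2 < c)%N -> (c < B + 8)%N -> N' c = N c &
   forall x, (3 <= x < 3 + l)%N -> N' (B + 8 * (x - 2))%N = N x] .
Proof.
move=> h1 h2; rewrite /save; elim: l => [|l IH] hl.
  by split => //; [rewrite muln0 addn0 | move=> x; lia].
rewrite (_ : iota 3 l.+1 = iota 3 l ++ iota (3 + l) 1); last by rewrite -iotaD addn1.
rewrite map_cat flatten_cat run_cat.
have [//|e1 e2 e3 e4] := IH _; first by lia.
set N1 := run _ N in e1 e2 e3 e4 *.
pose M := nstep (NatAdd 1 1 2) N1.
have -> : run (flatten [seq [:: NatAdd 1 1 2; NatStore 1 x] | x <- iota (3 + l) 1]) N1 =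
   upd M (M 1%N) (M (3 + l)%N) by [].
have M1 : M 1%N = (B + 8 * l.+1)%N by rewrite /M /= updE /= e1 e2; lia.
have Mc c : c != 1%N -> M c = N1 c by move=> /negbTE h; rewrite /M /= updE h.
rewrite M1; split.
- by rewrite updE M1; case: eqP => // e; lia.
- by rewrite updE; case: eqP => [e|_]; [lia | rewrite Mc].
- move=> c c2 cB; rewrite updE; case: eqP => [e|_]; first by lia.
  by rewrite Mc ?e3 //; apply/eqP; lia.
- move=> x hx; rewrite updE; case: eqP => [e|ne].
    have -> : x = (3 + l)%N by lia.
    by rewrite Mc ?e3 //; try (apply/eqP); lia.
  by rewrite Mc ?e4 //; try (apply/eqP); lia.
Qed.

Section Input.
Variables (n m : nat) (N : nat -> nat).
Hypotheses (n_gt0 : (0 < n)%N) (N0 : N 0%N = n) (N1 : N 1%N = m).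
Definition base := (fibs sf (n, m)).2.

(** The fixed number [sf] of steps multiplies [n + 2 * m] by more than [c0 + k + 3], so the pointer
    clears the registers and the input whatever [m] is. *)
Lemma base_ge : [/\ (c0 + 2 + k * m <= base)%N & (n <= base)%N].
Proof.
have := fibs_ge (c0 + k + 3) n m; rewrite (_ : (c0 + k + 3).+1 = sf); last by rewrite /sf -addnS.
rewrite -/base => h.
have h2 : (c0 + k + 3 < 2 ^ (c0 + k + 3))%N by apply: ltn_expl.
have h3 : ((c0 + k + 3) * (n + 2 * m) <= base)%N.
  by apply: leq_trans h; rewrite leq_mul2r (ltnW h2) orbT.
have h4 : (k * m <= (c0 + k + 3) * (2 * m))%N by rewrite leq_mul // ?leq_pmull //; lia.
have h5 : (c0 + k + 3 <= (c0 + k + 3) * n)%N by rewrite leq_pmulr.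
have h6 : (n <= (c0 + k + 3) * n)%N by rewrite leq_pmull //; lia.
by rewrite mulnDr in h3; split; lia.
Qed.

Lemma run_line1 : let N' := run line1 N in
  [/\ N' 3%N = base, N' 4%N = n, N' 5%N = m, N' 6%N = (2 ^ Ce * n)%N &
   (forall c, (c0 <= c < base)%N -> N' c = N c) /\
   (forall q, (q + 2 < c0)%N -> N' (base + 8 * q)%N = N (q + 2)%N)].
Proof.
have [bg _] := base_ge.
rewrite /line1 run_cat.
have [f0 f1 f2] := run_fib sf N; rewrite -/fib N0 N1 in f0 f1 f2.
set A1 := run fib N in f0 f1 f2 *.
rewrite -/base in f1.
have -> : forall l, run (NatStore 1 2 :: NatConst 2 8 :: l) A1 = run l (upd (upd A1 base (A1 2%N)) 2 8%N).
  by move=> l; rewrite /run /= f1.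
set A2 := upd _ _ _; rewrite run_cat.
have a21 : A2 1%N = base by rewrite /A2 !updE /= f1; case: eqP => // e; lia.
have a22 : A2 2%N = 8%N by rewrite /A2 updE.
have [|g1 g2 g3 g4] := @run_save base (c0 - 3) A2 a21 a22; first by lia.
set A3 := run _ A2 in g1 g2 g3 g4 *; rewrite run_cat.
set A4 := run _ A3.
have A4E : A4 = upd (upd (upd (upd A3 3 (8 * (c0 - 3))%N) 3 (A3 1 - 8 * (c0 - 3))%N) 4 0%N) 1 (A3 1 - 8 * (c0 - 3) + 0)%N.
  by [].
have h41 : A4 1%N = base by rewrite A4E updE /= g1; lia.
have h43 : A4 3%N = base by rewrite A4E !updE /= g1; lia.
have h40 : A4 0%N = (fibs sf (n, m)).1.
  rewrite A4E !updE /=.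
  have k0 l D : (1 < D 1)%N -> run (save l) D 0%N = D 0%N.
    rewrite /save; elim: l 3%N D => //= l IH x D hD.
    rewrite /run /= -/(run _ _) IH; last by rewrite /= !updE /=; case: eqP; lia.
    by rewrite /= !updE /=; case: eqP => // e; lia.
  rewrite /A3 k0 ?a21; last by lia.
  by rewrite /A2 !updE /=; case: eqP => [e|_]; [lia|rewrite f0].
have h4c c : (4 < c)%N -> A4 c = A3 c by move=> hc; rewrite A4E !updE; case: c hc => [|[|[|[|[]]]]].
rewrite run_cat.
have [u0 u1 u2] := run_unfib h40 (h41 : A4 1%N = (fibs sf (n, m)).2); rewrite -/unfib in u0 u1 u2.
set A5 := run unfib A4 in u0 u1 u2 *.
rewrite run_cat; set A6 := run _ A5.
have A6E : A6 = upd (upd (upd (upd (upd (upd A5 4 0%N) 4 (0 + A5 0)%N) 5 0%N) 5 (0 + A5 1)%N) 6 0%N) 6 (0 + (0 + A5 0))%N.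
  by [].
have dbl j D : let D' := run (nseq j (NatAdd 6 6 6)) D in
    D' 6%N = (2 ^ j * D 6)%N /\ forall c, c != 6%N -> D' c = D c.
  elim: j D => [|j IH] D; first by rewrite mul1n.
  have [e1 e2] := IH (nstep (NatAdd 6 6 6) D); split.
    by rewrite -[run _ D]/(run (nseq j (NatAdd 6 6 6)) (nstep (NatAdd 6 6 6) D)) e1 /= updE /= expnS; lia.
  by move=> c hc; rewrite -[run _ D]/(run (nseq j (NatAdd 6 6 6)) (nstep (NatAdd 6 6 6) D)) e2 // /= updE (negbTE hc).
have [d1 d2] := dbl Ce A6.
have h6c c : (6 < c)%N -> A6 c = A5 c by move=> hc; rewrite A6E !updE; case: c hc => [|[|[|[|[|[|[]]]]]]].
split.
- by rewrite d2 // A6E !updE /= u2 // h43.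
- by rewrite d2 // A6E !updE /= u0.
- by rewrite d2 // A6E !updE /= u1.
- by rewrite d1 A6E !updE /= u0.
split=> [c /andP[cl ch]|q hq].
  have hc : (6 < c)%N by apply: leq_trans cl; apply: leq_trans c0_ge.
  rewrite d2 ?h6c ?u2 ?h4c ?g3 //; try by apply: ltn_trans hc.
  - rewrite /A2 !updE; case: eqP => [e|_]; first by lia.
    by case: eqP => [e|_]; [lia | rewrite f2 //; lia].
  - by lia.
  - by apply/eqP; lia.
have hb : (6 < base + 8 * q)%N by lia.
rewrite d2; last by apply/eqP; lia.
rewrite h6c // u2; last by apply: leq_trans hb.
rewrite h4c; last by apply: leq_trans hb.
case: q hq hb => [|q] hq hb.
  rewrite muln0 addn0 add0n g3; [|lia|lia].
  by rewrite /A2 !updE eqxx; case: eqP => [e|_]; [lia | rewrite f2].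
have := g4 (q.+1 + 2)%N; rewrite addnK => -> ; last by lia.
rewrite /A2 !updE; case: eqP => [e|_]; first by lia.
by case: eqP => [e|_]; [lia | rewrite f2 //; lia].
Qed.

End Input.

Definition line2 := NatConst 6 0 :: nseq k (NatAdd 6 6 5) ++
  [:: NatConst 7 (c0 - 2); NatConst 8 1; NatConst 11 2].
Definition body1 := [:: NatSub 6 6 8; NatConst 9 0; NatAdd 9 9 6; NatAdd 9 9 9; NatAdd 9 9 9; NatAdd 9 9 9;
  NatAdd 9 9 3; NatAdd 10 6 11; NatLoad 10 10; NatStore 9 10].
Definition reals := [:: RealOfNat 1 8; RealSub 2 1 0; RealAdd 3 1 1; RealDiv 1 1 3].
Let P1 := (size line1).+1.
Let P2 := (P1 + 2 + size line2)%N.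
Definition pmain := (P2 + 16)%N.
(** Cell 2 holds a vertex, hence a number below [n], or 0 when the input has no vertex entry;
    comparing it with cell 0 tests [n = 0] without a spare register. The second test stops on more
    than [2 ^ Ce * n] hyperedges, since the running time may depend on [n] only. *)
Definition prologue (pend : nat) : seq instr :=
  JumpNatLe 0 2 pend :: line1 ++ [:: JumpNatLe 5 6 (P1 + 2); JumpNatLe 0 0 pend] ++ line2 ++
  JumpNatLe 6 7 (P2 + 12) :: body1 ++ JumpNatLe 0 0 P2 :: reals.

Definition body2 := [:: NatSub 6 6 8; NatConst 9 0; NatAdd 9 9 6; NatAdd 9 9 9; NatAdd 9 9 9; NatAdd 9 9 9;
  NatAdd 9 9 3; NatAdd 9 9 8; NatLoad 9 9; NatStore 6 9].
Definition line3 := [:: NatConst 6 0; NatAdd 6 6 4; NatConst 7 c0; NatConst 8 1].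
(** The registers are output cells too. Each is loaded with the address of its own value, computed
    from cell 3, after which [NatLoad x x] needs no other register. The constant 25 is [8 * 3 + 1]:
    it makes cell 3 point to its own entry of array 1. *)
Definition low := [:: NatConst 2 25; NatAdd 3 3 2] ++
  flatten [seq [:: NatConst x (8 * (x - 3)); NatAdd x x 3] | x <- iota 4 (c0 - 4)] ++
  flatten [seq [:: NatConst x (8 * (3 - x)); NatSub x 3 x] | x <- iota 0 3] ++
  [seq NatLoad x x | x <- iota 0 c0].
Definition epilogue pc : seq instr :=
  line3 ++ JumpNatLe 6 7 (pc + 16) :: body2 ++ JumpNatLe 0 0 (pc + 4) :: low.

Lemma size_prologue p : size (prologue p) = pmain.
Proof. rewrite /pmain /P2 /P1 /prologue; move: line1 line2 => l1 l2; rewrite /= !size_cat /= size_cat /=; lia. Qed.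

Lemma run_cons op l N : run (op :: l) N = run l (nstep op N). Proof. by []. Qed.

Lemma updK (D : nat -> nat) i x y : upd (upd D i x) i y = upd D i y.
Proof. by apply: funext => c; rewrite !updE; case: eqP. Qed.

Lemma addE (D : nat -> nat) c x : c != 9%N -> nstep (NatAdd 9 9 c) (upd D 9 x) = upd D 9 (x + D c)%N.
Proof. by move=> /negbTE h; rewrite /= updK !updE eqxx h. Qed.

Lemma dblE (D : nat -> nat) x : nstep (NatAdd 9 9 9) (upd D 9 x) = upd D 9 (x + x)%N.
Proof. by rewrite /= updK !updE eqxx. Qed.

Section Exec.
Variables (R : realType) (P : program) (A : pred (state R)) (X : nat -> R).

(** Copying runs downwards and stops at [c0 - 2], since the entries below that were saved by
    [line1]. *)
Lemma halt_body1 B q N : placed P P2 (JumpNatLe 6 7 (P2 + 12) :: body1 ++ JumpNatLe 0 0 P2 :: reals) ->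
  (c0 <= B)%N -> (q + 2 <= B)%N ->
  N 6%N = q -> N 3%N = B -> N 7%N = (c0 - 2)%N -> N 8%N = 1%N -> N 11%N = 2%N ->
  exists N' u, [/\ (u <= 12 * q + 1)%N,
     (forall A t, (u <= t)%N -> halt_prob P A t (State P2 N X) = halt_prob P A (t - u) (State (P2 + 12) N' X)),
     (forall c, (c < 6)%N || (c == 8%N) || ((c0 <= c) && (c < B))%N -> N' c = N c) &
     (forall a, (a < q)%N -> (c0 - 2 <= a)%N -> N' (B + 8 * a)%N = N (a + 2)%N) /\
     (forall a, (q <= a)%N || (a < c0 - 2)%N -> N' (B + 8 * a)%N = N (B + 8 * a)%N)].
Proof.
move=> pl hB; elim: q N => [|q IH] N qB h6 h3 h7 h8 h11; have [q1 p1] := placed_cons pl.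
  exists N, 1%N; split => // A' t ht.
  by rewrite (halt_jump _ _ _ q1) // h6 leq0n subn1.
have [p2 p3] := placed_cat p1; have [q2 _] := placed_cons p3.
have [hq|hq] := leqP q.+1 (c0 - 2).
  exists N, 1%N; split; first by lia.
  - by move=> A' t ht; rewrite (halt_jump _ _ _ q1) // h6 h7 hq subn1.
  - by [].
  - by split=> // a a1 a2; lia.
set N1 := run body1 N.
have E : N1 = upd (upd (upd (upd N 6 q) 9 (B + 8 * q)%N) 10 (N (q + 2)%N)) (B + 8 * q)%N (N (q + 2)%N).
  have s1 : nstep (NatSub 6 6 8) N = upd N 6 q by rewrite /= h6 h8 subn1.
  rewrite /N1 /body1 !run_cons s1; set D := upd N 6 q.
  rewrite [nstep (NatConst 9 0) D]/= addE // !dblE addE //.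
  have -> : D 6%N = q by []; have -> : D 3%N = B by [].
  rewrite !add0n; have -> : (q + q + (q + q) + (q + q + (q + q)) + B = B + 8 * q)%N by lia.
  set D1 := upd D 9 _.
  have -> : nstep (NatAdd 10 6 11) D1 = upd D1 10 (q + 2)%N by rewrite /= /D1 /D !updE /= h11.
  have -> : nstep (NatLoad 10 10) (upd D1 10 (q + 2)%N) = upd D1 10 (N (q + 2)%N).
    rewrite /= [upd D1 10 _ 10%N]updE /= updK; congr upd; rewrite /D1 /D !updE.
    by case: eqP => [e|_]; [lia|]; case: eqP => [e|_]; [lia|]; case: eqP => [e|_]; [lia|].
  by rewrite /= !updE /= /D1 updE /=.
have [||||||N' [u [u1 u2 u3 [u4 u5]]]] := IH N1.
- by lia.
- by rewrite E !updE /=; case: eqP => // e; lia.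
- by rewrite E !updE /=; case: eqP => // e; lia.
- by rewrite E !updE /=; case: eqP => // e; lia.
- by rewrite E !updE /=; case: eqP => // e; lia.
- by rewrite E !updE /=; case: eqP => // e; lia.
have eN c : c != 6%N -> c != 9%N -> c != 10%N -> c != (B + 8 * q)%N -> N1 c = N c.
  by move=> /negbTE c1 /negbTE c2 /negbTE c3 /negbTE c4; rewrite E !updE c1 c2 c3 c4.
exists N', (12 + u)%N; split => //.
- by move: u1; lia.
- move=> A' t ht; rewrite (halt_jump _ _ _ q1); last by lia.
  rewrite h6 h7 leqNgt hq /= (halt_line _ _ _ p2) //; last by rewrite /=; lia.
  rewrite (halt_jump _ _ _ q2); last by rewrite /=; lia.
  rewrite leqnn -/N1 u2; last by rewrite /=; lia.
  by rewrite [size _]/=; congr (halt_prob _ _ _ _); lia.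
- by move=> c hc; rewrite u3 // eN //; apply/eqP; lia.
split=> a.
  rewrite ltnS leq_eqVlt => /orP[/eqP -> _|aq ac].
    by rewrite u5 ?leqnn // E updE eqxx.
  by rewrite u4 // eN //; apply/eqP; lia.
move=> ha; rewrite u5; last by lia.
by rewrite eN //; apply/eqP; lia.
Qed.

Lemma halt_body2 pc B q N t :
  placed P (pc + 4) (JumpNatLe 6 7 (pc + 16) :: body2 ++ JumpNatLe 0 0 (pc + 4) :: low) ->
  (c0 <= B)%N -> (q <= B)%N ->
  N 6%N = q -> N 3%N = B -> N 7%N = c0 -> N 8%N = 1%N -> (12 * q + 1 <= t)%N ->
  exists N' t', [/\ (t <= t' + (12 * q + 1))%N,
     halt_prob P A t (State (pc + 4) N X) = halt_prob P A t' (State (pc + 16) N' X),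
     (forall c, (c == 3%N) || (B <= c)%N -> N' c = N c) &
     (forall a, (a < q)%N -> (c0 <= a)%N -> N' a = N (B + 8 * a + 1)%N)
      /\ (forall a, (q <= a)%N -> (c0 <= a)%N -> N' a = N a)].
Proof.
move=> pl hB; elim: q N t => [|q IH] N t qB h6 h3 h7 h8 ht; have [q1 p1] := placed_cons pl.
  exists N, t.-1; split => //; first by lia.
  by rewrite (halt_jump _ _ _ q1) ?h6 //; lia.
have [p2 p3] := placed_cat p1; have [q2 _] := placed_cons p3.
have [hq|hq] := leqP q.+1 c0.
  exists N, t.-1; split; first by lia.
  - by rewrite (halt_jump _ _ _ q1) ?h6 ?h7 ?hq //; lia.
  - by [].
  - by split=> // a a1 a2; lia.
rewrite (halt_jump _ _ _ q1); last by lia.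
rewrite h6 h7 leqNgt hq /= (halt_line _ _ _ p2) //; last by rewrite /=; lia.
rewrite (halt_jump _ _ _ q2); last by rewrite /=; lia.
rewrite leqnn.
set N1 := run body2 N.
have E : N1 = upd (upd (upd N 6 q) 9 (N (B + 8 * q + 1)%N)) q (N (B + 8 * q + 1)%N).
  have s1 : nstep (NatSub 6 6 8) N = upd N 6 q by rewrite /= h6 h8 subn1.
  rewrite /N1 /body2 !run_cons s1; set D := upd N 6 q.
  rewrite [nstep (NatConst 9 0) D]/= addE // !dblE addE // addE //.
  have -> : D 6%N = q by []; have -> : D 3%N = B by []; have -> : D 8%N = 1%N by [].
  rewrite !add0n; have -> : (q + q + (q + q) + (q + q + (q + q)) + B + 1 = B + 8 * q + 1)%N by lia.
  have -> : nstep (NatLoad 9 9) (upd D 9 (B + 8 * q + 1)%N) = upd D 9 (N (B + 8 * q + 1)%N).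
    rewrite /= [upd D 9 _ 9%N]updE /= updK; congr upd; rewrite /D !updE.
    by case: eqP => [e|_]; [lia|]; case: eqP => [e|_]; [lia|].
  by rewrite /= !updE /= /D updE /=.
have [|||||| N' [t' [u1 u2 u3 [u4 u5]]]] := IH N1 (t.-1 - size body2).-1.
- by lia.
- by rewrite E !updE /=; case: eqP => // e; lia.
- by rewrite E !updE /=; case: eqP => // e; lia.
- by rewrite E !updE /=; case: eqP => // e; lia.
- by rewrite E !updE /=; case: eqP => // e; lia.
- by rewrite /=; lia.
have eN c : c != 6%N -> c != 9%N -> c != q -> N1 c = N c.
  by move=> /negbTE c1 /negbTE c2 /negbTE c4; rewrite E !updE c1 c2 c4.
exists N', t'; split => //.
- by move: u1; rewrite /=; lia.
- by move=> c hc; rewrite u3 // eN //; apply/eqP; lia.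
split=> a.
  rewrite ltnS leq_eqVlt => /orP[/eqP -> qc|aq ac].
    by rewrite u5 ?leqnn // E updE eqxx.
  by rewrite u4 // eN //; apply/eqP; lia.
by move=> ha ac; rewrite u5 ?eN //; try (apply/eqP); lia.
Qed.

Lemma run_low B N : (c0 <= B)%N -> N 3%N = B -> let N' := run low N in
  (forall x, (x < c0)%N -> N' x = N (B + 8 * x + 1)%N) /\ (forall c, (c0 <= c)%N -> N' c = N c).
Proof.
move=> hB h3; rewrite /low run_cat.
have -> : run [:: NatConst 2 25; NatAdd 3 3 2] N = upd (upd N 2 25%N) 3 (B + 25)%N by rewrite /run /= !updE /= h3.
set A1 := upd _ _ _; rewrite run_cat.
have up l D : D 3%N = (B + 25)%N -> (4 + l <= c0)%N ->
   let D' := run (flatten [seq [:: NatConst x (8 * (x - 3)); NatAdd x x 3] | x <- iota 4 l]) D in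
   (forall x, (4 <= x < 4 + l)%N -> D' x = (B + 8 * x + 1)%N) /\ (forall c, (c < 4)%N || (4 + l <= c)%N -> D' c = D c).
  move=> d3; elim: l => [|l IH] hl; first by split => // x; lia.
  rewrite (_ : iota 4 l.+1 = iota 4 l ++ iota (4 + l) 1); last by rewrite -iotaD addn1.
  rewrite map_cat flatten_cat run_cat.
  have [|e1 e2] := IH _; first by lia.
  set D1 := run _ D in e1 e2 *.
  have -> : run (flatten [seq [:: NatConst x (8 * (x - 3)); NatAdd x x 3] | x <- iota (4 + l) 1]) D1 =
    upd (upd D1 (4 + l) (8 * (4 + l - 3))%N) (4 + l) (upd D1 (4 + l) (8 * (4 + l - 3)) (4 + l) + upd D1 (4 + l) (8 * (4 + l - 3)) 3)%N by [].
  split=> [x hx|c hc]; rewrite !updE; case: eqP => [e|ne].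
  - by rewrite e eqxx /= e2 // d3; lia.
  - by rewrite e1 //; lia.
  - by lia.
  - by rewrite e2 //; lia.
have a13 : A1 3%N = (B + 25)%N by rewrite /A1 updE.
have l4 : (4 + (c0 - 4) <= c0)%N by lia.
have [b1 b2] := up (c0 - 4)%N A1 a13 l4.
set A2 := run _ A1 in b1 b2 *; rewrite run_cat.
set A3 := run _ A2.
have A3E : A3 = upd (upd (upd (upd (upd (upd A2 0 24%N) 0 (A2 3%N - 24)%N) 1 16%N) 1 (A2 3%N - 16)%N) 2 8%N) 2 (A2 3%N - 8)%N.
  by [].
have a23 : A2 3%N = (B + 25)%N by rewrite b2 // /A1 updE.
have a3 x : (x < c0)%N -> A3 x = (B + 8 * x + 1)%N.
  move=> hx; rewrite A3E !updE a23; case: x hx => [|[|[|[|x]]]] hx /=; try lia.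
  by rewrite b1 //; lia.
have a3c c : (c0 <= c)%N -> A3 c = N c.
  move=> hc; rewrite A3E !updE; have := c0_ge => h12.
  case: c hc => [|[|[|[|c]]]] hc /=; try lia.
  by rewrite b2 ?/A1 ?updE //; lia.
have ld l D : (forall x, (l <= x < c0)%N -> D x = (B + 8 * x + 1)%N) -> (l <= c0)%N ->
   let D' := run [seq NatLoad x x | x <- iota l (c0 - l)] D in
   (forall x, (l <= x < c0)%N -> D' x = D (B + 8 * x + 1)%N) /\ (forall c, (c < l)%N || (c0 <= c)%N -> D' c = D c).
  have [j] := ubnP (c0 - l); elim: j l D => // j IH l D hj hD lc.
  have [e|ne] := eqVneq l c0; first by rewrite e subnn /=; split => // x; lia.
  rewrite (_ : c0 - l = (c0 - l.+1).+1)%N; last by lia.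
  rewrite -[run _ D]/(run [seq NatLoad x x | x <- iota l.+1 (c0 - l.+1)] (upd D l (D (D l)))).
  set D1 := upd _ _ _.
  have d1 x : x != l -> D1 x = D x by move=> /negbTE h; rewrite /D1 updE h.
  have [||| f1 f2] := IH l.+1 D1; first by lia.
  - by move=> x hx; rewrite d1 ?hD //; try (apply/eqP); lia.
  - by lia.
  split=> [x hx|c hc].
    have [e|nx] := eqVneq x l.
      have lc' : (l <= l < c0)%N by rewrite leqnn; move: hx; rewrite e => /andP[].
      by rewrite e f2 ?ltnSn // /D1 updE eqxx (hD l lc').
    by rewrite f1 ?d1 //; try (apply/eqP); move/eqP: nx; lia.
  by rewrite f2 ?d1 //; try (apply/eqP); lia.
have [|| g1 g2] := ld 0%N A3 => //; rewrite ?subn0 in g1 g2.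
by split=> [x hx|c hc]; [rewrite g1 // a3c //; lia | rewrite g2 ?a3c // hc orbT].
Qed.

Definition xfin (X0 : nat -> R) : nat -> R := upd (upd (upd (upd X0 1 1) 2 (1 - X0 0%N)) 3 (1 + 1)) 1 (1 / (1 + 1)).

Lemma halt_det pc op N X0 t : onth P pc = Some op -> (if op is Flip _ _ then false else true) -> (0 < t)%N ->
  halt_prob P A t (State pc N X0) = halt_prob P A t.-1 (step op true (State pc N X0)).
Proof. by move=> q1; case: t => //= t h _; rewrite q1; case: op h {q1} => //= *; rewrite mul1r subrr mul0r addr0. Qed.

Lemma halt_reals pc N t X0 : placed P pc reals -> N 8%N = 1%N -> (4 <= t)%N ->
  halt_prob P A t (State pc N X0) = halt_prob P A (t - 4) (State (pc + 4) N (xfin X0)).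
Proof.
move=> p0 n8; case: t => [|[|[|[|t]]]] // _.
have [q1 p1] := placed_cons p0; have [q2 p2] := placed_cons p1.
have [q3 p3] := placed_cons p2; have [q4 _] := placed_cons p3.
rewrite (halt_det _ _ q1) // [step _ _ _]/= (halt_det _ _ q2) // [step _ _ _]/=.
rewrite (halt_det _ _ q3) // [step _ _ _]/= (halt_det _ _ q4) // [step _ _ _]/=.
rewrite n8 subSS subSS subSS subSS subn0 !addnS addn0; by congr (halt_prob _ _ _ (State _ _ _)).
Qed.

End Exec.
End Frame.

Lemma halt_none (R : realType) (P : program) (A : pred (state R)) t s :
  onth P (pc s) = None -> halt_prob P A t s = (A s)%:R.
Proof. by case: t => [|t] h /=; rewrite h. Qed.

Section Whole.
Variables (R : realType) (k Ce : nat) (beta : R) (c : cmd).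
Let Dm := (depth c + 12)%N.
Let Tm := (height c + 2)%N.
Let c0 := (4 + Dm + Tm)%N.
Let c0_ge : (12 <= c0)%N. Proof. by rewrite /c0 /Dm; lia. Qed.
Let pm := pmain k Ce Dm Tm.
Let pe := (pm + csize Dm 2 c)%N.
Definition pend := (pe + size (epilogue Dm Tm pe))%N.
Definition prog : program := prologue k Ce Dm Tm pend ++ compile Dm 2 pm c ++ epilogue Dm Tm pe.

Let p_pro : placed prog 0 (prologue k Ce Dm Tm pend).
Proof. by exists [::], (compile Dm 2 pm c ++ epilogue Dm Tm pe). Qed.

Let p_main : placed prog pm (compile Dm 2 pm c).
Proof. by exists (prologue k Ce Dm Tm pend), (epilogue Dm Tm pe); split => //; rewrite size_prologue. Qed.

Let p_epi : placed prog pe (epilogue Dm Tm pe).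
Proof.
exists (prologue k Ce Dm Tm pend ++ compile Dm 2 pm c), [::]; rewrite cats0 -catA; split => //.
have zc := size_comp Dm 2 pm c; have zp := size_prologue k Ce c0_ge pend.
by rewrite size_cat zp zc.
Qed.

Lemma size_prog : size prog = pend.
Proof. have zc := size_comp Dm 2 pm c; have zp := size_prologue k Ce c0_ge pend.
by rewrite /prog !size_cat zp zc addnA. Qed.

Lemma halt_end A t (N : nat -> nat) (X : nat -> R) :
  halt_prob prog A t (State pend N X) = (A (State pend N X))%:R.
Proof.
have h : onth prog pend = None by rewrite -size_prog; elim: prog.
by apply: halt_none.
Qed.

Definition tim_low := size (low Dm Tm).
Definition tim_epi n := (17 + 12 * n + tim_low)%N.
Definition tim_line := (size (line1 k Ce Dm Tm) + size (line2 k Dm Tm))%N.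
Definition tim_pro m := (tim_line + 12 * (k * m) + 8)%N.

Section Run.
Variables (n m : nat) (H : hypergraph n m k).
Local Notation N0 := (input_nat H).
Local Notation X0 := (fun j => if j == 0%N then expR beta else 0 : R).

Lemma input_lt j : (0 < n)%N -> (N0 j.+2 < n)%N.
Proof.
move=> n0; rewrite /input_nat; set l := flatten _.
have [hj|hj] := ltnP j (size l); last by rewrite nth_default.
have := mem_nth 0%N hj; rewrite -/l => /flattenP[s /mapP[e _ ->]] /mapP[v _ ->].
exact: ltn_ord.
Qed.

Lemma prog_zero A t : n = 0%N -> (0 < t)%N ->
  halt_prob prog A t (input_state beta H) = (A (State pend N0 X0))%:R.
Proof.
move=> n0 t0; have [q1 _] := placed_cons p_pro.
rewrite /input_state (halt_jump _ _ _ q1) //.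
have -> : (N0 0%N <= N0 2%N)%N by apply: (leq_trans (_ : n <= 0)%N (leq0n _)); rewrite n0.
exact: halt_end.
Qed.

Let n_start A t : (0 < n)%N -> (size (line1 k Ce Dm Tm) < t)%N ->
  halt_prob prog A t (input_state beta H) = halt_prob prog A (t.-1 - size (line1 k Ce Dm Tm))
    (State (size (line1 k Ce Dm Tm)).+1 (run (line1 k Ce Dm Tm) N0) X0).
Proof.
move=> n0 ht; have [q1 p1] := placed_cons p_pro; have [p2 _] := placed_cat p1.
rewrite /input_state (halt_jump _ _ _ q1); last by lia.
have -> : (N0 0%N <= N0 2%N)%N = false.
  by apply/negbTE; rewrite -ltnNge; apply: input_lt.
rewrite (halt_line _ _ _ p2) ?add1n //; last by lia.
have cc op l : all isnat (op :: l) = isnat op && all isnat l by [].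
have f l b : all isnat b -> all isnat (flatten (nseq l b)) by move=> hb; elim: l => //= l IH; rewrite all_cat hb.
have g l x : all isnat (flatten [seq [:: NatAdd 1 1 2; NatStore 1 x] | x <- iota x l]) by elim: l x => //= l IH x; apply: IH.
by rewrite /line1 !(all_cat, cc) /fib /unfib !f // /save g all_nseq orbT.
Qed.

Lemma prog_dense A t : (0 < n)%N -> (2 ^ Ce * n < m)%N -> (tim_pro 0 <= t)%N ->
  exists N X, halt_prob prog A t (input_state beta H) = (A (State pend N X))%:R.
Proof.
move=> n0 hm ht; have [_ p1] := placed_cons p_pro; have [_ p3] := placed_cat p1.
have [q2 p4] := placed_cons (p3 : placed _ _ (_ :: _)); have [q3 _] := placed_cons p4.
have [r3 r4 r5 r6 _] := @run_line1 k Ce Dm Tm c0_ge n m N0 n0 erefl erefl.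
rewrite n_start //; last by move: ht; rewrite /tim_pro /tim_line; lia.
rewrite (halt_jump _ _ _ q2); last by move: ht; rewrite /tim_pro /tim_line; lia.
have hf : (m <= 2 ^ Ce * n)%N = false by apply/negbTE; rewrite -ltnNge.
rewrite r5 r6 hf (halt_jump _ _ _ q3); last by move: ht; rewrite /tim_pro /tim_line; lia.
by rewrite leqnn halt_end; do 2 eexists.
Qed.

Lemma halt_epi A (N : nat -> nat) (X : nat -> R) B s t : (c0 <= B)%N -> (n <= B)%N ->
  rep B [:: n; m] N s -> (tim_epi n <= t)%N ->
  exists N', (forall x, (x < n)%N -> N' x = s tS x) /\
    halt_prob prog A t (State pe N X) = (A (State pend N' X))%:R.
Proof.
move=> cB nB [h3 ha hc] ht.
have n4 : N 4%N = n by have := hc 0%N isT.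
have [p1 p2] := placed_cat p_epi; rewrite [size _]/= in p2.
rewrite (halt_line _ _ _ p1) //; last by move: ht; rewrite /tim_epi /=; lia.
set N1 := run _ N.
have E c' : (8 < c')%N -> N1 c' = N c' by move=> h; rewrite /N1 /run /= !updE; do 9 (case: c' h => [|c' h] //).
have e3 : N1 3%N = B by rewrite /N1 /run /= !updE.
have e6 : N1 6%N = n by rewrite /N1 /run /= !updE /= n4.
have [||||||||N2 [t2 [u1 u2 u3 [u4 u5]]]] := @halt_body2 k Ce Dm Tm c0_ge R prog A X pe B n N1 (t - 4)%N => //.
  by move: ht; rewrite /tim_epi; lia.
rewrite [size _]/= u2.
have [_ p3] := placed_cons p2; have [_ p4] := placed_cat p3; have [_ p5] := placed_cons p4.
have {}p5 : placed prog (pe + 16)%N (low Dm Tm).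
  by move: p5; rewrite [size _]/=; congr (placed _ _ _); lia.
have [l1 l2] := @run_low k Ce Dm Tm c0_ge B N2 cB (eq_trans (u3 3%N isT) e3).
rewrite (halt_line _ _ _ p5); first last.
- by move: ht u1; rewrite /tim_epi /tim_low; lia.
- rewrite /low !all_cat; apply/and4P; split => //; first by elim: (iota _ _).
  by rewrite all_map; apply/allP.
have -> : (pe + 16 + size (low Dm Tm) = pend)%N.
  by rewrite /pend /epilogue size_cat /= size_cat /=; lia.
rewrite halt_end; exists (run (low Dm Tm) N2); split => // x xn.
have [xc|xc] := ltnP x c0.
  rewrite l1 // u3; last by rewrite (leq_trans _ (leq_addr _ _)) ?orbT // leq_addr.
  by rewrite E ?(ha tS) //; lia.
by rewrite l2 // u4 // E ?(ha tS) //; lia.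
Qed.

Lemma prog_correct : (0 < n)%N -> (m <= 2 ^ Ce * n)%N ->
  exists s0 : st, (forall q, (q < k * m)%N -> s0 tE q = N0 (q + 2)%N) /\
  forall (A : pred (state R)) (phi : st -> R),
    (forall s N X, (forall x, (x < n)%N -> N x = s tS x) -> (A (State pend N X))%:R = phi s) ->
  forall t, (tim_pro m + tmx Dm c [:: n; m] (fun=> tim_epi n) s0 <= t)%N ->
    halt_prob prog A t (input_state beta H) = ex (xfin X0) c [:: n; m] phi s0.
Proof.
move=> n0 hm.
have [r3 r4 r5 r6 [r7 r8]] := @run_line1 k Ce Dm Tm c0_ge n m N0 n0 erefl erefl.
have [bg nB] := @base_ge k Dm Tm c0_ge n m N0 n0 erefl erefl; set B := base _ _ _ _ _ in r3 r4 r5 r6 r7 r8 bg nB.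
set N1 := run _ N0 in r3 r4 r5 r6 r7 r8.
set N2 := run (line2 k Dm Tm) N1.
have rep5 j D : D 5%N = m -> let D' := run (nseq j (NatAdd 6 6 5)) D in
    D' 6%N = (D 6 + j * m)%N /\ forall c', c' != 6%N -> D' c' = D c'.
  elim: j D => [|j IH] D d5; first by rewrite /= mul0n addn0.
  rewrite -[run _ D]/(run (nseq j (NatAdd 6 6 5)) (nstep (NatAdd 6 6 5) D)).
  have [|e1 e2] := IH (nstep (NatAdd 6 6 5) D); first by rewrite /= updE.
  split; first by rewrite e1 /= updE /= d5 mulSn; lia.
  by move=> c' hc; rewrite e2 // /= updE (negbTE hc).
have [|v1 v2] := rep5 k (upd N1 6 0%N); first by rewrite updE.
set D2 := run _ (upd N1 6 0%N) in v1 v2.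
have N2E : N2 = upd (upd (upd D2 7 (c0 - 2)%N) 8 1%N) 11 2%N.
  by rewrite /N2 /line2 run_cons run_cat.
have n26 : N2 6%N = (k * m)%N by rewrite N2E !updE /= v1 updE.
have n23 : N2 3%N = B by rewrite N2E !updE /= v2 // updE.
have n2c c' : (c' < 6)%N || (11 < c')%N -> N2 c' = N1 c'.
  move=> hc; rewrite N2E !updE v2; last by apply/eqP; lia.
  rewrite updE; do 4 (case: eqP => [e|_]; first by lia).
  by [].
have cB : (c0 <= B)%N by lia.
have kB : (k * m + 2 <= B)%N by lia.
have [_ p1] := placed_cons p_pro; have [_ p3] := placed_cat p1.
have [q2 p4] := placed_cons (p3 : placed _ _ (_ :: _)); have [_ p5] := placed_cons p4.
have [p6 p7] := placed_cat p5.
pose P1 := (size (line1 k Ce Dm Tm)).+1.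
pose P2 := (P1 + 2 + size (line2 k Dm Tm))%N.
have {}p6 : placed prog (P1 + 2)%N (line2 k Dm Tm) by move: p6; rewrite /P1 addn2 add1n.
have {}p7 : placed prog P2 (JumpNatLe 6 7 (P2 + 12) :: body1 ++ JumpNatLe 0 0 P2 :: reals).
  by move: p7; rewrite /P2 /P1 addn2 add1n.
have n28 : N2 8%N = 1%N by rewrite N2E !updE.
have n211 : N2 11%N = 2%N by rewrite N2E !updE.
have n27 : N2 7%N = (c0 - 2)%N by rewrite N2E !updE.
have [N3 [u [w1 w2 w3 [w4 w5]]]] := @halt_body1 k Ce Dm Tm c0_ge R prog X0 B (k * m)%N N2 p7 cB kB n26 n23 n27 n28 n211.
have s0E : rep B [:: n; m] N3 (fun t a => N3 (B + 8 * a + t)%N).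
  split => //; first by rewrite w3.
  case=> [|[|j]] // _; rewrite w3 // n2c //.
exists (fun t a => N3 (B + 8 * a + t)%N); split.
  move=> q hq; rewrite addn0; have [qc|qc] := ltnP q (c0 - 2).
    rewrite w5; last by rewrite qc orbT.
    rewrite n2c; last by apply/orP; right; lia.
    by rewrite r8 //; lia.
  by rewrite w4 // n2c ?r7 //; lia.
move=> A phi hA t ht.
rewrite n_start //; last by move: ht; rewrite /tim_pro /tim_line; lia.
rewrite -/N1 (halt_jump _ _ _ q2); last by move: ht; rewrite /tim_pro /tim_line; lia.
rewrite r5 r6 hm (halt_line _ _ _ p6); first last.
- by move: ht; rewrite /tim_pro /tim_line; lia.
- by rewrite /line2 /= all_cat all_nseq /= orbT.
rewrite -/N2 -/P2.
rewrite (w2 A); last by move: ht; rewrite /tim_pro /tim_line; lia.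
have [_ p8] := placed_cons p7; have [_ p9] := placed_cat p8; have [_ p10] := placed_cons p9.
have {}p10 : placed prog (P2 + 12)%N reals by move: p10; rewrite [size _]/=; congr (placed _ _ _); lia.
rewrite (halt_reals _ _ p10); first last.
- by move: ht; rewrite /tim_pro /tim_line; lia.
- by rewrite w3.
have -> : (P2 + 12 + 4 = pm)%N by rewrite /pm /pmain /P2 /P1; lia.
apply: (@comp_correct R prog A (xfin X0) B Dm Tm cB c [:: n; m] pm phi (fun=> tim_epi n)) => //.
- by rewrite /Dm /=; lia.
- by rewrite /Tm; lia.
- move=> N' s' t' r' h'; have [N'' [e1 e2]] := halt_epi A (xfin X0) cB nB r' h'.
  by rewrite -/pe e2; apply: hA.
- by move: ht; rewrite /tim_pro /tim_line; lia.
Qed.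

End Run.
End Whole.

Local Close Scope ring_scope.
Local Open Scope nat_scope.

Notation tD := (@Ordinal 8 2 isT).
Notation tC := (@Ordinal 8 3 isT).
Notation tM := (@Ordinal 8 4 isT).
Notation tV := (@Ordinal 8 5 isT).
Notation tT := (@Ordinal 8 6 isT).
Notation tB := (@Ordinal 8 7 isT).

Definition emul c e := iter c (Plus e) (Cst 0).
Definition cnds (l : seq (expr * expr)) c := foldr (fun ef c => If ef.1 ef.2 c Skip) c l.
Definition allc cs s (l : seq (expr * expr)) := all (fun ef => ev cs s ef.1 <= ev cs s ef.2) l.

Lemma ev_emul cs s c e : ev cs s (emul c e) = c * ev cs s e.
Proof. by rewrite /emul; elim: c => //= c ->. Qed.

(** * The sampling algorithm as a program *)

Section Prog.
Variable k : nat.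

Definition eg j b := Ld tE (Plus (emul k j) (Cst b)).
Definition sumS j := foldr Plus (Cst 0) [seq Ld tS (eg j b) | b <- iota 0 k].
Definition flag K l x := unroll K (fun b => cnds (l b) (Put tT (Cst x) (Cst 1))).

(** Performs [pass1] with the cluster in [tD] and the spins in [tS] already flipped on it. The three
    flags detect two distinct vertices in the cluster, and then, through a spin sum of 0 or [k],
    monochromaticity after the flip. *)
Definition edge j : cmd :=
  Seq (Put tT (Cst 0) (Cst 0))
  (Seq (flag (k * k) (fun b => [:: (Cst 1, Ld tD (eg j (b %/ k))); (Cst 1, Ld tD (eg j (b %% k)));
                                   (Plus (Cst 1) (eg j (b %/ k)), eg j (b %% k))]) 0)
  (Seq (flag k (fun b => [:: (Cst 1, Ld tD (eg j b)); (Cst 1, Ld tC j); (sumS j, Cst 0)]) 0)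
  (Seq (flag k (fun b => [:: (Cst 1, Ld tD (eg j b)); (Cst 1, Ld tC j); (Cst k, sumS j)]) 0)
  (cnds [:: (Cst 1, Ld tT (Cst 0))]
    (unroll k (fun b => cnds [:: (Ld tD (eg j b), Cst 0)]
       (Seq (Put tD (eg j b) (Cst 1)) (Put tS (eg j b) (Minus (Cst 1) (Ld tS (eg j b))))))))))).

(* Counter levels: 0 = n, 1 = m, 2 = ell, 3 = Rbig, 4 = i; inner loops from 5 on. *)
Definition fill (t : 'I_8) dl := For (Cnt 0) (Put t (Cnt dl) (Cst 0)).

(** All coins are drawn afresh at every flip, since [push] takes them independent of the
    configuration. Labels below [i] are not inserted yet and are skipped. *)
Definition cluster_cmd (csw : nat) (dl : nat) (x : expr) : cmd :=
  Seq (For (Cnt 1) (Coin tC (Cnt dl) 2))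
  (Seq (fill tD dl)
  (Seq (Put tD x (Cst 1))
  (Seq (Put tS x (Minus (Cst 1) (Ld tS x)))
  (For (Plus (emul csw (Cnt 2)) (Cst csw)) (For (Cnt 1) (cnds [:: (Cnt 4, Cnt dl.+1)] (edge (Cnt dl.+1)))))))).

Definition flip_cmd csw dl x : cmd :=
  Seq (Coin tT (Cst 0) 1) (cnds [:: (Cst 1, Ld tT (Cst 0))] (cluster_cmd csw dl x)).

Definition sweep_cmd csw dl : cmd := For (Cnt 0) (cnds [:: (Cst 1, Ld tV (Cnt dl))] (flip_cmd csw dl.+1 (Cnt dl))).

(** [tM] holds one plus the distance to [x], and 0 for a vertex not reached. *)
Definition bfs_cmd dl x : cmd :=
  Seq (fill tM dl)
  (Seq (Put tM x (Cst 1))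
  (For (Cnt 2) (For (Cnt 1) (cnds [:: (Plus (Cnt 4) (Cst 1), Cnt dl.+1)]
    (Seq (Put tT (Cst 0) (Cst 0))
    (Seq (flag k (fun b => [:: (Cst 1, Ld tM (eg (Cnt dl.+1) b)); (Ld tM (eg (Cnt dl.+1) b), Minus (Cnt 2) (Cnt dl))]) 0)
    (cnds [:: (Cst 1, Ld tT (Cst 0))]
      (unroll k (fun b => cnds [:: (Ld tM (eg (Cnt dl.+1) b), Cst 0)]
         (Put tM (eg (Cnt dl.+1) b) (Plus (Minus (Cnt 2) (Cnt dl)) (Cst 1)))))))))))).

(** During the preparation of an insertion [tD] is scratch space: cell 0 records that a cycle was
    found, cell 1 the current vertex of the path walked back, cell 2 the next one. *)
Definition trace_cmd dl : cmd :=
  For (Cnt 2) (For (Cnt 1) (cnds [:: (Plus (Cnt 4) (Cst 1), Cnt dl.+1)]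
    (Seq (Put tT (Cst 0) (Cst 0))
    (Seq (flag k (fun b => [:: (eg (Cnt dl.+1) b, Ld tD (Cst 1)); (Ld tD (Cst 1), eg (Cnt dl.+1) b)]) 0)
    (cnds [:: (Cst 1, Ld tT (Cst 0))]
      (Seq (Put tT (Cst 0) (Cst 0))
      (Seq (unroll k (fun b => cnds [:: (Cst 1, Ld tM (eg (Cnt dl.+1) b));
               (Plus (Ld tM (eg (Cnt dl.+1) b)) (Cst 1), Ld tM (Ld tD (Cst 1)));
               (Ld tM (Ld tD (Cst 1)), Plus (Ld tM (eg (Cnt dl.+1) b)) (Cst 1))]
             (Seq (Put tT (Cst 0) (Cst 1)) (Put tD (Cst 2) (eg (Cnt dl.+1) b)))))
      (cnds [:: (Cst 1, Ld tT (Cst 0))]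
        (Seq (unroll k (fun b => Put tV (eg (Cnt dl.+1) b) (Cst 1)))
             (Put tD (Cst 1) (Ld tD (Cst 2)))))))))))).

Definition pre_cmd : cmd :=
  Seq (fill tV 5)
  (Seq (unroll k (fun b => Put tV (eg (Cnt 4) b) (Cst 1)))
  (Seq (Put tD (Cst 0) (Cst 0))
  (unroll k (fun a => Seq (bfs_cmd 5 (eg (Cnt 4) a))
    (unroll k (fun b => cnds [:: (Ld tD (Cst 0), Cst 0); (Cst 2, Ld tM (eg (Cnt 4) b))]
      (Seq (Put tD (Cst 0) (Cst 1)) (Seq (Put tD (Cst 1) (eg (Cnt 4) b)) (trace_cmd 5))))))))).

(** Cell 0 of [tB] is the remaining budget of insertions closing a short cycle. Once it is exhausted
    such a hyperedge is skipped, which bounds the running time on every input at the price of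
    correctness on atypical ones. *)
Definition ins_cmd csw cR : cmd :=
  Seq pre_cmd
  (If (Cst 1) (Ld tD (Cst 0))
    (cnds [:: (Cst 1, Ld tB (Cst 0))]
      (Seq (Put tB (Cst 0) (Minus (Ld tB (Cst 0)) (Cst 1))) (For (Cnt 3) (sweep_cmd csw 6))))
    (For (emul cR (Cnt 2)) (sweep_cmd csw 6))).

(** Finds the logarithm of [n] in base [2 ^ q0] by repeated multiplication; [n] iterations are
    enough because a power outgrows its exponent. *)
Definition setup_cmd q0 g : cmd :=
  Seq (Put tT (Cst 4) (Cst 1)) (Seq (Put tT (Cst 5) (Cst 0)) (Seq (Put tT (Cst 6) (Cst 1))
  (For (Cnt 0) (cnds [:: (emul (2 ^ q0) (Ld tT (Cst 4)), Cnt 0)]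
    (Seq (Put tT (Cst 4) (emul (2 ^ q0) (Ld tT (Cst 4))))
    (Seq (Put tT (Cst 5) (Plus (Ld tT (Cst 5)) (Cst 1)))
         (Put tT (Cst 6) (emul (2 ^ g) (Ld tT (Cst 6)))))))))).

Definition main_cmd q0 g csw cR : cmd :=
  Seq (setup_cmd q0 g) (Let (Ld tT (Cst 5)) (Let (Ld tT (Cst 6))
    (Seq (For (Cnt 0) (Coin tS (Cnt 4) 1))
    (Seq (Put tB (Cst 0) (Cnt 3)) (For (Cnt 1) (ins_cmd csw cR)))))).

End Prog.

Section Mirror.
Variables (n m k : nat) (H : hypergraph n m k).
Local Notation E := (fun j => [set v in H j]).
Implicit Types (M : {ffun 'I_n -> nat}) (V : {set 'I_n}).

(** The order in which [For] meets its counter values. *)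
Definition down q : seq 'I_q := rev (enum 'I_q).

Variables (ell : nat) (i : 'I_m).

Definition bstep t M (j : 'I_m) : {ffun 'I_n -> nat} :=
  if (i < j) && [exists v in E j, 1 <= M v <= t] then
    [ffun v => if (v \in E j) && (M v == 0) then t.+1 else M v] else M.
Definition bfs (x : 'I_n) : {ffun 'I_n -> nat} :=
  foldl (fun M (r : 'I_ell) => foldl (bstep (ell - r)) M (down m)) [ffun v => (v == x) : nat] (down ell).

Definition nexts M (z : 'I_n) (j : 'I_m) :=
  [seq tnth (H j) b | b <- enum 'I_k & (1 <= M (tnth (H j) b)) && (M (tnth (H j) b) + 1 == M z)].
Definition tstep M (p : 'I_n * {set 'I_n}) (j : 'I_m) :=
  if [&& i < j, p.1 \in E j & nexts M p.1 j != [::]] then (last p.1 (nexts M p.1 j), p.2 :|: E j) else p.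
Definition trace M z V := iter ell (fun p => foldl (tstep M) p (down m)) (z, V).

Definition visit M (p : bool * {set 'I_n}) (b : 'I_k) :=
  if ~~ p.1 && (2 <= M (tnth (H i) b)) then (true, (trace M (tnth (H i) b) p.2).2) else p.
Definition pre : bool * {set 'I_n} :=
  foldl (fun p a => foldl (visit (bfs (tnth (H i) a))) p (enum 'I_k)) (false, E i) (enum 'I_k).

End Mirror.

(** * Correctness of the program with respect to its functional model *)

Section Loops.
Variables (R : realType) (X : nat -> R).
Local Notation sat := (sat X).
Local Notation ex := (ex X).

Lemma sat_for_fold (A : Type) (rel : A -> st -> Prop) q (f : A -> 'I_q -> A) cs e c s a :
  ev cs s e = q -> rel a s ->
  (forall (j : 'I_q) a s', rel a s' -> sat (rcons cs j) c s' (rel (f a j))) ->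
  sat cs (For e c) s (rel (foldl f a (down q))).
Proof.
move=> eq ra h; pose I j s' := rel (foldl f a (rev (drop j (enum 'I_q)))) s'.
suff : sat cs (For e c) s (I 0) by rewrite /I drop0.
apply: sat_for; rewrite eq; first by rewrite /I drop_oversize ?size_enum_ord.
move=> j s' jq; pose j' := Ordinal jq; rewrite /I.
have nj : nth j' (enum 'I_q) j = j' := nth_ord_enum j' j'.
rewrite [drop j _](drop_nth j') ?size_enum_ord // nj rev_cons foldl_rcons.
exact: (h j').
Qed.

Lemma sat_unroll_fold (A : Type) (rel : A -> st -> Prop) k (f : A -> 'I_k -> A) cs (c : nat -> cmd) s a :
  rel a s -> (forall (b : 'I_k) a s', rel a s' -> sat cs (c b) s' (rel (f a b))) ->
  sat cs (unroll k c) s (rel (foldl f a (enum 'I_k))).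
Proof.
move=> ra h; pose I b s' := rel (foldl f a (take b (enum 'I_k))) s'.
suff : sat cs (unroll k c) s (I k) by rewrite /I take_oversize ?size_enum_ord.
apply: sat_unroll; first by rewrite /I take0.
move=> b s' bk; pose b' := Ordinal bk; rewrite /I.
have nb : nth b' (enum 'I_k) b = b' := nth_ord_enum b' b'.
rewrite (take_nth b') ?size_enum_ord // nb foldl_rcons.
exact: (h b').
Qed.

(** A loop that tosses coins has no single final state; it is a composition of operators [T j] on
    test functions of the abstract state. *)
Lemma ex_for_fold (A : Type) (rel : A -> st -> Prop) q (T : 'I_q -> (A -> R) -> A -> R) cs e c g Psi a s :
  ev cs s e = q -> (forall a s', rel a s' -> Psi s' = g a) -> rel a s ->
  (forall (j : 'I_q) g' Psi', (forall a s', rel a s' -> Psi' s' = g' a) ->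
     forall a s', rel a s' -> ex c (rcons cs j) Psi' s' = T j g' a) ->
  ex (For e c) cs Psi s = foldr T g (down q) a.
Proof.
move=> eq hP ra h /=; rewrite eq.
suff gen r : r <= q -> forall a s, rel a s ->
    iteri r (fun j K => ex c (rcons cs j) K) Psi s = foldr T g (rev (take r (enum 'I_q))) a.
  by rewrite (gen q (leqnn q) a s ra) take_oversize ?size_enum_ord.
elim: r => [|r IH] rq a1 s1 r1; first by rewrite take0 /= (hP a1).
pose r' := Ordinal rq; have nr : nth r' (enum 'I_q) r = r' := nth_ord_enum r' r'.
rewrite (take_nth r') ?size_enum_ord // nr rev_rcons /=.
by apply: (h r') => // a2 s2 r2; apply: IH => //; apply: ltnW.
Qed.

Lemma foldl_const (A : Type) (B : Type) (g : A -> A) a (l : seq B) : foldl (fun a _ => g a) a l = iter (size l) g a.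
Proof. by elim: l a => //= x l IH a; rewrite IH -iterSr. Qed.

Lemma size_down q : size (down q) = q. Proof. by rewrite size_rev size_enum_ord. Qed.

Lemma has_iota (P : pred nat) k : has P (iota 0 k) = [exists b : 'I_k, P b].
Proof.
apply/hasP/existsP => [[b]|[b pb]]; last by exists (b : nat); rewrite ?mem_iota ?ltn_ord.
by rewrite mem_iota => /= bk pb; exists (Ordinal bk).
Qed.

Lemma has_iota2 (P : nat -> nat -> bool) k : has (fun b => P (b %/ k) (b %% k)) (iota 0 (k * k)) =
  [exists a : 'I_k, [exists b : 'I_k, P a b]].
Proof.
case: (posnP k) => [->|k0]; first by rewrite /=; apply/esym/existsP => -[[]].
apply/hasP/existsP => [[b]|[a /existsP[b pab]]].
  rewrite mem_iota => /= bk pb.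
  have h1 : b %/ k < k by rewrite ltn_divLR.
  by exists (Ordinal h1); apply/existsP; exists (Ordinal (ltn_pmod b k0)).
exists (a * k + b); last by rewrite divnMDl // divn_small // addn0 modnMDl modn_small.
rewrite mem_iota add0n /=; have := ltn_ord a; have := ltn_ord b => hb ha.
by apply: leq_trans (_ : a.+1 * k <= _); [rewrite mulSn; lia | rewrite leq_mul2r ha orbT].
Qed.

Lemma sat_cnds cs l c s Q : (allc cs s l -> sat cs c s Q) -> (~~ allc cs s l -> Q s) -> sat cs (cnds l c) s Q.
Proof.
elim: l => [|[e f] l IH] /= h1 h2; first exact: h1.
apply: sat_if => hef; last by apply: sat_skip; apply: h2; rewrite leqNgt hef.
by apply: IH => h; [apply: h1; rewrite hef | apply: h2; rewrite hef].
Qed.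

Lemma ex_cnds cs l c Psi s : ex (cnds l c) cs Psi s = if allc cs s l then ex c cs Psi s else Psi s.
Proof. by elim: l => //= -[e f] l IH /=; case: ifP. Qed.

Definition off (t : 'I_8) (s s' : st) := forall u, u != t -> s' u =1 s u.

Fixpoint loads e (t : 'I_8) : bool :=
  match e with
  | Cst _ | Cnt _ => false
  | Ld u e => (t == u) || loads e t
  | Plus e f | Minus e f => loads e t || loads f t
  end.

Lemma ev_off cs s s' e t : off t s s' -> ~~ loads e t -> ev cs s' e = ev cs s e.
Proof.
move=> h; elim: e => //= [u e IH|e IHe f IHf|e IHe f IHf].
- by rewrite negb_or eq_sym => /andP[hu /IH ->]; rewrite h.
- by rewrite negb_or => /andP[/IHe -> /IHf ->].
- by rewrite negb_or => /andP[/IHe -> /IHf ->].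
Qed.

Definition freec (t : 'I_8) (l : seq (expr * expr)) := all (fun ef => ~~ loads ef.1 t && ~~ loads ef.2 t) l.

Lemma allc_off cs s s' l t : off t s s' -> freec t l -> allc cs s' l = allc cs s l.
Proof.
move=> h; elim: l => //= -[e f] l IH /andP[/andP[h1 h2] /IH ->] /=.
by rewrite (ev_off _ h h1) (ev_off _ h h2).
Qed.

Lemma off_trans t s1 s2 s3 : off t s1 s2 -> off t s2 s3 -> off t s1 s3.
Proof. by move=> o1 o2 u hu a; rewrite o2 // o1. Qed.

Lemma off_put t s a v : off t s (put s t a v).
Proof. by move=> u hu; apply: put_other. Qed.

Lemma sat_flag cs K l x s : (forall b, freec tT (l b)) ->
  sat cs (flag K l x) s (fun s' => off tT s s' /\
    s' tT x = (if has (fun b => allc cs s (l b)) (iota 0 K) then 1 else s tT x)).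
Proof.
move=> hl; pose I b s' := off tT s s' /\
    s' tT x = (if has (fun b => allc cs s (l b)) (iota 0 b) then 1 else s tT x).
apply: (sat_unroll (I := I)); first by split.
move=> b s' _ [h1 h2]; rewrite /I.
have io : iota 0 b.+1 = rcons (iota 0 b) b by rewrite -cats1 -[b.+1]addn1 iotaD.
rewrite io has_rcons.
apply: sat_cnds; rewrite (allc_off _ h1) // => hb.
  apply: sat_put; split; first by apply: (off_trans h1); apply: off_put.
  by rewrite /put /= hb eqxx.
by rewrite (negbTE hb).
Qed.

Lemma loads_emul c d t : loads (emul c (Cnt d)) t = false.
Proof. by elim: c. Qed.

Lemma loads_eg k d b t : loads (eg k (Cnt d) b) t = (t == tE).
Proof. by rewrite /= loads_emul !orbF. Qed.

Lemma loads_sumS k d t : t != tS -> t != tE -> loads (sumS k (Cnt d)) t = false.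
Proof.
move=> h1 h2; rewrite /sumS; elim: (iota 0 k) => //= b l ->.
by rewrite (negbTE h1) (negbTE h2) loads_emul.
Qed.

End Loops.

Arguments cnds : simpl never.

Section Spec.
Variables (R : realType) (X : nat -> R) (n m k : nat) (H : hypergraph n m k).
Variables (ell Rb csw cR : nat) (p : R).
Hypotheses (X1 : pr X 1 = 2^-1%R) (X2 : pr X 2 = p).
Local Notation sat := (sat X).
Local Notation ex := (ex X).
Local Notation E := (fun j => [set v in H j]).
Implicit Types (s : st) (sg : spins n) (D V : {set 'I_n}) (c : {ffun 'I_m -> bool}).

Definition hasE s := forall (j : 'I_m) (b : 'I_k), s tE (k * j + b) = tnth (H j) b.

Lemma hasE_put s t a v : t != tE -> hasE s -> hasE (put s t a v).
Proof. by move=> h hs j b; rewrite put_other // eq_sym. Qed.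

Lemma hasE_eq s s' : s' tE =1 s tE -> hasE s -> hasE s'.
Proof. by move=> h hs j b; rewrite h hs. Qed.

Lemma ev_eg cs s d (j : 'I_m) (b : 'I_k) : hasE s -> nth 0 cs d = j -> ev cs s (eg k (Cnt d) b) = tnth (H j) b.
Proof. by move=> hs ej; rewrite /= ev_emul /= ej hs. Qed.

Definition spn s sg D :=
  (forall v : 'I_n, s tS v = flip_of sg D v) /\ (forall v : 'I_n, s tD v = (v \in D)).

Lemma foldl_edge (j : 'I_m) D :
  foldl (fun A b => tnth (H j) b |: A) D (enum 'I_k) = D :|: E j.
Proof.
have gen (l : seq 'I_k) A : foldl (fun A b => tnth (H j) b |: A) A l = A :|: [set v | v \in [seq tnth (H j) b | b <- l]].
  elim: l A => [|b l IH] A /=; first by apply/setP => v; rewrite !inE orbF.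
  by rewrite IH; apply/setP => v; rewrite !inE orbA [(v == _) || _]orbC.
rewrite gen; congr (_ :|: _); apply/setP => v; rewrite !inE.
apply/mapP/tnthP => [[b _ ->]|[b ->]]; first by exists b.
by exists b; rewrite ?mem_enum.
Qed.

Lemma val_neq (u v : 'I_n) : u != v -> ((u : nat) == v) = false.
Proof. by move=> h; apply/negbTE. Qed.

Lemma fire_spec cs d (j : 'I_m) s sg D : nth 0 cs d = j -> hasE s -> spn s sg D ->
  sat cs (unroll k (fun b => cnds [:: (Ld tD (eg k (Cnt d) b), Cst 0)]
       (Seq (Put tD (eg k (Cnt d) b) (Cst 1)) (Put tS (eg k (Cnt d) b) (Minus (Cst 1) (Ld tS (eg k (Cnt d) b)))))))
    s (fun s' => hasE s' /\ spn s' sg (D :|: E j)).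
Proof.
move=> ej hs hd; rewrite -foldl_edge.
apply: (sat_unroll_fold (rel := fun A s' => hasE s' /\ spn s' sg A)) => // b A s' [h1 [h2 h3]].
have ve s1 : hasE s1 -> ev cs s1 (eg k (Cnt d) b) = tnth (H j) b by move=> hs1; apply: ev_eg.
move: ve; move: (eg k (Cnt d) b) (tnth (H j) b) => e v ve.
apply: sat_cnds; rewrite /allc /= ve // h3 andbT leqn0 eqb0 => vA.
  apply: sat_seq (sat_put (Q := fun s1 => s1 = put s' tD v 1) _ _) _; first by rewrite /= ve.
  move=> s1 ->; have i1 : hasE (put s' tD v 1) by apply: hasE_put.
  apply: sat_put; rewrite /= ve //; split; first exact: hasE_put.
  have -> : put s' tD v 1 tS v = s' tS v by [].
  rewrite h2; split=> u; rewrite /put /=; case: (eqVneq u v) => [->|uv].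
  - by rewrite eqxx !ffunE !inE eqxx (negbTE vA) /=; case: (sg v).
  - by rewrite val_neq // h2 !ffunE !inE (negbTE uv).
  - by rewrite eqxx !inE eqxx.
  - by rewrite val_neq // h3 !inE (negbTE uv).
split => //; have -> : v |: A = A by apply/setUidPr; rewrite sub1set; move: vA; rewrite negbK.
by [].
Qed.

Lemma ev_sumS cs s d (j : 'I_m) : hasE s -> nth 0 cs d = j ->
  ev cs s (sumS k (Cnt d)) = \sum_(b < k) s tS (tnth (H j) b).
Proof.
move=> hs ej; rewrite /sumS.
have -> : ev cs s (foldr Plus (Cst 0) [seq Ld tS (eg k (Cnt d) b) | b <- iota 0 k]) = \sum_(b <- iota 0 k) s tS (ev cs s (eg k (Cnt d) b)).
  by elim: (iota 0 k) => [|b l IH]; rewrite ?big_nil // big_cons -IH.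
rewrite -[X in iota _ X]subn0 -/(index_iota 0 k) big_mkord; apply: eq_bigr => b _.
by rewrite (ev_eg b hs ej).
Qed.

Lemma mono_sum (s1 : spins n) (j : 'I_m) :
  (\sum_(b < k) s1 (tnth (H j) b) <= 0) || (k <= \sum_(b < k) s1 (tnth (H j) b)) = mono s1 (E j).
Proof.
apply/orP/monoP => [[h|h] x y|mo].
- rewrite !inE => /tnthP[a ->] /tnthP[b ->].
  have z (d : 'I_k) : s1 (tnth (H j) d) = false.
    by move: h; rewrite leqn0 sum_nat_eq0 => /forallP/(_ d) /=; rewrite eqb0 => /negbTE.
  by rewrite !z.
- rewrite !inE => /tnthP[a ->] /tnthP[b ->].
  have z (d : 'I_k) : s1 (tnth (H j) d).
    apply: contraLR h => nd; rewrite -ltnNge (bigD1 d) //= (negbTE nd) add0n.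
    apply: (@leq_ltn_trans (\sum_(i0 < k | i0 != d) 1)); first by apply: leq_sum => d' _; apply: leq_b1.
    rewrite sum1_card -[X in _ < X]card_ord; apply: proper_card; apply/properP; split; first exact/subsetP.
    by exists d => //; rewrite unfold_in eqxx.
  by rewrite !z.
case: (pickP (fun b => s1 (tnth (H j) b))) => [b sb|none]; [right|left].
  rewrite (eq_bigr (fun=> 1)) ?sum1_card ?card_ord // => d _.
  by rewrite (mo _ (tnth (H j) b)) ?inE ?mem_tnth // sb.
by rewrite big1 // => d _; rewrite none.
Qed.

Lemma edge_spec cs d (j : 'I_m) s sg c D : nth 0 cs d = j -> hasE s ->
  spn s sg D -> s tC j = c j ->
  sat cs (edge k (Cnt d)) s (fun s' => hasE s' /\ spn s' sg (pass1 E sg c D j)).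
Proof.
move=> ej hs [h1 h2] hc.
have inv s1 : off tT s s1 -> hasE s1 /\ spn s1 sg D.
  move=> o1; split; first by apply: hasE_eq hs => a; rewrite o1.
  by split=> v; rewrite o1 ?h1 ?h2.
have fe b t : t != tE -> ~~ loads (eg k (Cnt d) b) t by rewrite loads_eg.
have fs t : t != tS -> t != tE -> ~~ loads (sumS k (Cnt d)) t by move=> *; rewrite loads_sumS.
set l1 := fun b => [:: (Cst 1, Ld tD (eg k (Cnt d) (b %/ k))); (Cst 1, Ld tD (eg k (Cnt d) (b %% k)));
                                   (Plus (Cst 1) (eg k (Cnt d) (b %/ k)), eg k (Cnt d) (b %% k))].
set l2 := fun b => [:: (Cst 1, Ld tD (eg k (Cnt d) b)); (Cst 1, Ld tC (Cnt d)); (sumS k (Cnt d), Cst 0)].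
set l3 := fun b => [:: (Cst 1, Ld tD (eg k (Cnt d) b)); (Cst 1, Ld tC (Cnt d)); (Cst k, sumS k (Cnt d))].
have f1 b : freec tT (l1 b) by rewrite /freec /= !loads_emul.
have f2 b : freec tT (l2 b) by rewrite /freec /l2 /= loads_emul /= fs.
have f3 b : freec tT (l3 b) by rewrite /freec /l3 /= loads_emul /= fs.
pose g1 := has (fun b => allc cs s (l1 b)) (iota 0 (k * k)).
pose g2 := has (fun b => allc cs s (l2 b)) (iota 0 k).
pose g3 := has (fun b => allc cs s (l3 b)) (iota 0 k).
have G1 : g1 = (1 < #|E j :&: D|).
  rewrite /g1 (has_iota2 (fun a b => allc cs s [:: (Cst 1, Ld tD (eg k (Cnt d) a)); (Cst 1, Ld tD (eg k (Cnt d) b));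
                                   (Plus (Cst 1) (eg k (Cnt d) a), eg k (Cnt d) b)])).
  have ex2 (a b : 'I_k) : allc cs s [:: (Cst 1, Ld tD (eg k (Cnt d) a)); (Cst 1, Ld tD (eg k (Cnt d) b));
                                   (Plus (Cst 1) (eg k (Cnt d) a), eg k (Cnt d) b)] =
     [&& tnth (H j) a \in D, tnth (H j) b \in D & tnth (H j) a < tnth (H j) b].
    rewrite /allc; have := ev_eg a hs ej; have := ev_eg b hs ej.
    move: (eg k (Cnt d) a) (eg k (Cnt d) b) => ea eb /= -> ->; rewrite !h2 andbT add1n.
    by case: (_ \in D); case: (_ \in D).
  apply/existsP/card_gt1P => [[a /existsP[b]]|[u [v [uA vA uv]]]].
    rewrite ex2 => /and3P[aD bD ab]; exists (tnth (H j) a), (tnth (H j) b).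
    by rewrite !inE !mem_tnth aD bD; split => //; apply: contraTneq ab => ->; rewrite ltnn.
  wlog lt : u v uA vA uv / u < v.
    by move=> hw; have [/hw h|/hw h|/val_inj e] := ltngtP u v; [apply: h | apply: h; rewrite // eq_sym | rewrite e eqxx in uv].
  move: uA vA lt {uv}; rewrite !inE => /andP[/tnthP[a ->] aD] /andP[/tnthP[b ->] bD] lt.
  by exists a; apply/existsP; exists b; rewrite ex2 aD bD.
have G23 : g2 || g3 = [&& E j :&: D != set0, c j & mono (flip_of sg D) (E j)].
  have ev2 (b : 'I_k) : allc cs s (l2 b) = [&& tnth (H j) b \in D, c j & \sum_(b < k) flip_of sg D (tnth (H j) b) <= 0].
    rewrite /allc /l2; have := ev_eg b hs ej; have := ev_sumS hs ej.
    move: (eg k (Cnt d) b) (sumS k (Cnt d)) => eb es /= -> ->; rewrite h2 ej hc andbT (eq_bigr _ (fun b _ => h1 _)).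
    by case: (_ \in D); case: (c j).
  have ev3 (b : 'I_k) : allc cs s (l3 b) = [&& tnth (H j) b \in D, c j & k <= \sum_(b < k) flip_of sg D (tnth (H j) b)].
    rewrite /allc /l3; have := ev_eg b hs ej; have := ev_sumS hs ej.
    move: (eg k (Cnt d) b) (sumS k (Cnt d)) => eb es /= -> ->; rewrite h2 ej hc andbT (eq_bigr _ (fun b _ => h1 _)).
    by case: (_ \in D); case: (c j).
  rewrite -mono_sum /g2 /g3 !has_iota; apply/orP/and3P.
    case=> /existsP[b]; rewrite ?ev2 ?ev3 => /and3P[bD cj hm]; split => //; rewrite ?hm ?orbT //;
      by apply/set0Pn; exists (tnth (H j) b); rewrite !inE mem_tnth.
  case=> /set0Pn[v]; rewrite !inE => /andP[/tnthP[b ->] bD] cj /orP[hm|hm]; [left|right].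
    by apply/existsP; exists b; rewrite ev2 bD cj.
  by apply/existsP; exists b; rewrite ev3 bD cj.
apply: sat_seq (sat_put (Q := fun s1 => off tT s s1 /\ s1 tT 0 = 0) _ _) _.
  by split => //; apply: off_put.
move=> s0 [oo t0]; apply: sat_seq (sat_flag X cs (k * k) 0 s0 f1) _ => s1 [q1 t1].
have {}q1 := off_trans oo q1; rewrite (eq_has (a2 := fun b => allc cs s (l1 b))) in t1; last by move=> b; apply: (allc_off _ oo (f1 b)).
apply: sat_seq (sat_flag X cs k 0 s1 f2) _ => s2 [q2 t2].
rewrite (eq_has (a2 := fun b => allc cs s (l2 b))) in t2; last by move=> b; apply: (allc_off _ q1 (f2 b)).
have {}q2 := off_trans q1 q2.
apply: sat_seq (sat_flag X cs k 0 s2 f3) _ => s3 [q3 t3].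
rewrite (eq_has (a2 := fun b => allc cs s (l3 b))) in t3; last by move=> b; apply: (allc_off _ q2 (f3 b)).
have {}q3 := off_trans q2 q3.
have [i3 p3] := inv _ q3.
have T3 : s3 tT 0 = fires E sg c D j.
  rewrite /fires -G23 -G1 t3 -/g3 t2 -/g2 t1 -/g1 t0.
  by case: (g1); case: (g2); case: (g3).
apply: sat_cnds; rewrite /allc /= T3 andbT lt0b /pass1 => hf; rewrite ?hf ?(negbTE hf) //; exact: fire_spec.
Qed.

Lemma wr_unroll K f t : (forall b, ~~ writes (f b) t) -> ~~ writes (unroll K f) t.
Proof. by move=> h; rewrite writes_unroll; apply/hasPn => b _. Qed.

Lemma wr_cnds l (a : cmd) t : writes (cnds l a) t = writes a t.
Proof. by elim: l => // ef l /= IH; rewrite -[LHS]/(writes (cnds l a) t || false) IH orbF. Qed.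

Lemma wr_flag K l x t : t != tT -> ~~ writes (flag K l x) t.
Proof. by move=> h; apply: wr_unroll => b; rewrite wr_cnds. Qed.

Lemma wr_edge e t : t != tT -> t != tD -> t != tS -> ~~ writes (edge k e) t.
Proof.
move=> h1 h2 h3; rewrite /edge /= (negbTE h1) !(negbTE (wr_flag _ _ _ h1)) /= orbF.
by apply: wr_unroll => b /=; rewrite orbF negb_or h2.
Qed.

Definition lab (i : 'I_m) := [seq j : 'I_m <- down m | i <= j].
Definition nsw := csw * ell + csw.
Definition upd_set (i : 'I_m) x sg c := iter nsw (pass E sg c (lab i)) [set x].

Lemma sweeps_spec (i : 'I_m) r (v : 'I_n) s sg c D : hasE s -> spn s sg D -> (forall j : 'I_m, s tC j = c j) ->
  sat [:: n; m; ell; Rb; i : nat; r; v : nat]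
    (For (Plus (emul csw (Cnt 2)) (Cst csw)) (For (Cnt 1) (cnds [:: (Cnt 4, Cnt 8)] (edge k (Cnt 8))))) s
    (fun s' => hasE s' /\ spn s' sg (iter nsw (pass E sg c (lab i)) D)).
Proof.
move=> hs hd hc; pose rel A s' := [/\ hasE s', spn s' sg A & forall j : 'I_m, s' tC j = c j].
have -> : iter nsw (pass E sg c (lab i)) D = foldl (fun A (_ : 'I_nsw) => pass E sg c (lab i) A) D (down nsw).
  by rewrite foldl_const size_down.
apply: sat_weak (sat_for_fold (rel := rel) (q := nsw) (a := D) (f := fun A _ => pass E sg c (lab i) A) _ _ _) _.
- by rewrite /= ev_emul.
- by split.
- move=> q A s' ra.
  have -> : pass E sg c (lab i) A = foldl (fun A (j : 'I_m) => if i <= j then pass1 E sg c A j else A) A (down m).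
    by rewrite /pass /lab; elim: (down m) A {ra} => //= j l IH A; case: ifP => //= _; rewrite IH.
  apply: (sat_for_fold (rel := rel)) => // j A' s1 [e1 e2 e3].
  apply: sat_cnds; rewrite /allc /= andbT => ij; rewrite ?ij ?(negbTE ij) //.
  have := @edge_spec [:: n; m; ell; Rb; i : nat; r; v : nat; q : nat; j : nat] 8 j s1 sg c A' erefl e1 e2 (e3 j).
  move=> /sat_frame /sat_weak; apply => s2 [[a1 a2] a3]; split => // j'.
  by rewrite a3 ?e3 //; apply: wr_edge.
- by move=> s' [].
Qed.

Lemma ex_coin_for cs e (t : 'I_8) x q Psi s (G : {ffun 'I_q -> bool} -> R) : ev cs s e = q ->
  (forall (c : {ffun 'I_q -> bool}) s', off t s s' -> (forall j : 'I_q, s' t j = c j) -> Psi s' = G c) ->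
  ex (For e (Coin t (Cnt (size cs)) x)) cs Psi s = (\sum_c coin_wt (pr X x) c * G c)%R.
Proof.
move=> eq hG /=; rewrite eq {eq}.
suff gen : forall q s (G : {ffun 'I_q -> bool} -> R), (forall (c : {ffun 'I_q -> bool}) s', off t s s' -> (forall j : 'I_q, s' t j = c j) ->
     (forall a, q <= a -> s' t a = s t a) -> Psi s' = G c) ->
   iteri q (fun j K => ex (Coin t (Cnt (size cs)) x) (rcons cs j) K) Psi s = (\sum_c coin_wt (pr X x) c * G c)%R.
  by apply: gen => c s' h1 h2 _; apply: hG.
elim=> [|r IH] s1 G1 h.
  rewrite (sum_spins0 (fun c : spins 0 => coin_wt (pr X x) c * G1 c)%R) /coin_wt big_ord0 mul1r /=; apply: h => //.
  by case.
rewrite sum_consf -[LHS]/(ex (Coin t (Cnt (size cs)) x) (rcons cs r) (iteri r (fun j K => ex (Coin t (Cnt (size cs)) x) (rcons cs j) K) Psi) s1).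
rewrite [LHS]/= nth_rcons ltnn eqxx.
have st b : iteri r (fun j K => ex (Coin t (Cnt (size cs)) x) (rcons cs j) K) Psi (put s1 t r (b : bool)) =
   (\sum_c coin_wt (pr X x) c * G1 (consf c b))%R.
  apply: IH => c s' h1 h2 h3; apply: h.
  - by move=> u hu a; rewrite h1 // put_other.
  - move=> j; case: (unliftP ord_max j) => [j' ->|->].
      have -> : lift ord_max j' = widen_ord (leqnSn r) j' by apply: val_inj; rewrite /= /bump leqNgt ltn_ord.
      by rewrite consf_widen h2.
    by rewrite consf_max h3 // /put !eqxx.
  - by move=> a ra; rewrite h3 ?(ltnW ra) // /put eqxx /= gtn_eqF.
have := st true; have := st false; rewrite /= => -> ->.
rewrite !mulr_sumr -big_split /=; apply: eq_bigr => c _; rewrite big_bool /= /coin_wt.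
rewrite !big_ord_recr /= !consf_max.
have E1 b : (\prod_(i0 < r) (if consf c b (widen_ord (leqnSn r) i0) then pr X x else 1 - pr X x) =
   \prod_j (if c j then pr X x else 1 - pr X x))%R by apply: eq_bigr => j _; rewrite consf_widen.
by rewrite !E1; ring.
Qed.

Lemma fill_spec cs (t : 'I_8) s : nth 0 cs 0 = n -> sat cs (fill t (size cs)) s
  (fun s' => off t s s' /\ forall v, v < n -> s' t v = 0).
Proof.
move=> e0; pose I j s' := off t s s' /\ forall v, j <= v < n -> s' t v = 0.
apply: sat_weak (sat_for (I := I) _ _) _ => /=; rewrite ?e0.
- by split => // v; rewrite andbC => /andP[h]; rewrite leqNgt h.
- move=> j s' jn [h1 h2]; apply: sat_put; rewrite /= nth_rcons ltnn eqxx; split.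
    by apply: (off_trans h1); apply: off_put.
  move=> v; rewrite /put eqxx /= leq_eqVlt eq_sym => /andP[/orP[->|jv] vn] //.
  by case: eqP => // _; apply: h2; rewrite jv.
- by move=> s' [h1 h2]; split => // v vn; apply: h2.
Qed.

Definition arrV s V := forall v : 'I_n, s tV v = (v \in V).
Definition arrM s (M : {ffun 'I_n -> nat}) := forall v : 'I_n, s tM v = M v.
Definition rel1 V b sg s := [/\ hasE s, (forall u : 'I_n, s tS u = sg u), arrV s V & s tB 0 = b].

Definition flip_op (i : 'I_m) (v : 'I_n) (g : spins n -> R) sg : R :=
  (2^-1 * g sg + 2^-1 * \sum_(c : {ffun 'I_m -> bool}) coin_wt p c * g (flip_of sg (upd_set i v sg c)))%R.

Lemma flip_law (i : 'I_m) r (v : 'I_n) V b g Psi sg s :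
  (forall sg s', rel1 V b sg s' -> Psi s' = g sg) -> rel1 V b sg s ->
  ex (flip_cmd k csw 7 (Cnt 6)) [:: n; m; ell; Rb; i : nat; r; v : nat] Psi s = flip_op i v g sg.
Proof.
move=> hP r1; set cs := [:: n; m; _; _; _; _; _].
have rp x : rel1 V b sg (put s tT 0 x).
  by case: r1 => a1 a2 a3 a4; split => //; apply: hasE_put.
pose cl := cnds [:: (Cst 1, Ld tT (Cst 0))] (cluster_cmd k csw 7 (Cnt 6)).
rewrite -[LHS]/(pr X 1 * ex cl cs Psi (put s tT 0 1) + (1 - pr X 1) * ex cl cs Psi (put s tT 0 0))%R X1 /cl !ex_cnds.
have -> : allc cs (put s tT 0 1) [:: (Cst 1, Ld tT (Cst 0))] = true by [].
have -> : allc cs (put s tT 0 0) [:: (Cst 1, Ld tT (Cst 0))] = false by [].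
rewrite (hP _ _ (rp 0)) addrC /flip_op.
have -> : (1 - 2^-1 = 2^-1 :> R)%R by lra.
congr (_ + _ * _)%R; move: (put s tT 0 1) (rp 1) => {r1 rp}s [a1 a2 a3 a4].
rewrite /cluster_cmd; set rest := Seq (fill tD 7) _.
rewrite -[LHS]/(ex (For (Cnt 1) (Coin tC (Cnt (size cs)) 2)) cs (ex rest cs Psi) s) -X2.
apply: ex_coin_for => // c s1 w1 hc.
suff [s2 [q2 ->]] : sat cs rest s1 (rel1 V b (flip_of sg (upd_set i v sg c))) by rewrite (hP _ _ q2).
have i1 : hasE s1 by apply: hasE_eq a1 => a; rewrite w1.
apply: sat_seq (fill_spec (cs := cs) tD s1 erefl) _ => s2 [w2 d2].
apply: sat_seq (sat_put (Q := fun s3 => s3 = put s2 tD v 1) _ _) _ => // s3 ->.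
apply: sat_seq (sat_put (Q := fun s4 => s4 = put (put s2 tD v 1) tS v (1 - s2 tS v)) _ _) _ => // s4 ->.
set s5 := put _ _ _ _.
have i5 : hasE s5 by do 2 (apply: hasE_put => //); apply: hasE_eq i1 => a; rewrite w2.
have sp5 : spn s5 sg [set v].
  split=> u; rewrite /s5 /put /= ?ffunE inE; case: (eqVneq u v) => [->|uv].
  - by rewrite eqxx w2 // w1 // a2; case: (sg v).
  - by rewrite val_neq // w2 // w1 // a2 addbF.
  - by rewrite eqxx.
  - by rewrite val_neq // d2.
have c5 (j : 'I_m) : s5 tC j = c j by rewrite /s5 /put /= w2 // hc.
have := sweeps_spec i r v i5 sp5 c5; rewrite -/cs => /sat_frame /sat_weak; apply => s6 [[e1 [e2 e3]] e4].
have fr t : t != tT -> t != tD -> t != tS -> s6 t =1 s5 t.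
  by move=> t1 t2 t3 a; rewrite e4 //= orbF wr_edge.
split => //.
- by move=> u; rewrite fr // /s5 /put /= w2 // w1 // a3.
- by rewrite fr // /s5 /put /= w2 // w1.
Qed.

Definition sweep_op (i : 'I_m) V g : spins n -> R :=
  foldr (fun v g => if v \in V then flip_op i v g else g) g (down n).

Lemma sweep_law (i : 'I_m) r V b g Psi sg s :
  (forall sg s', rel1 V b sg s' -> Psi s' = g sg) -> rel1 V b sg s ->
  ex (sweep_cmd k csw 6) [:: n; m; ell; Rb; i : nat; r] Psi s = sweep_op i V g sg.
Proof.
move=> hP r1; apply: (ex_for_fold (rel := rel1 V b)) => // v g' Psi' hP' sg' s' r'.
rewrite ex_cnds /allc /= andbT; have [_ _ -> _] := r'; rewrite lt0b.
by case: ifP => _; [apply: flip_law r' | apply: hP'].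
Qed.

Lemma rounds_law (i : 'I_m) q e V b g Psi sg s : (forall s, ev [:: n; m; ell; Rb; i : nat] s e = q) ->
  (forall sg s', rel1 V b sg s' -> Psi s' = g sg) -> rel1 V b sg s ->
  ex (For e (sweep_cmd k csw 6)) [:: n; m; ell; Rb; i : nat] Psi s = iter q (sweep_op i V) g sg.
Proof.
move=> eq hP r1; rewrite (ex_for_fold (rel := rel1 V b) (q := q) (T := fun _ => sweep_op i V) (g := g) (a := sg)) //.
  have -> : forall l : seq 'I_q, foldr (fun _ => sweep_op i V) g l = iter (size l) (sweep_op i V) g by elim=> //= a l ->.
  by rewrite size_down.
by move=> r g' Psi' hP' sg' s' r'; apply: sweep_law r'.
Qed.

Lemma foldl_mark (M : {ffun 'I_n -> nat}) t (j : 'I_m) :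
  foldl (fun (M' : {ffun 'I_n -> nat}) b => [ffun v => if (v == tnth (H j) b) && (M' v == 0) then t.+1 else M' v] : {ffun 'I_n -> nat})
    M (enum 'I_k) = [ffun v => if (v \in E j) && (M v == 0) then t.+1 else M v].
Proof.
have gen (l : seq 'I_k) (M1 : {ffun 'I_n -> nat}) :
    foldl (fun (M' : {ffun 'I_n -> nat}) b => [ffun v => if (v == tnth (H j) b) && (M' v == 0) then t.+1 else M' v] : {ffun 'I_n -> nat}) M1 l =
    [ffun v => if (v \in [seq tnth (H j) b | b <- l]) && (M1 v == 0) then t.+1 else M1 v].
  elim: l M1 => [|b l IH] M1 /=; first by apply/ffunP => v; rewrite ffunE.
  rewrite IH; apply/ffunP => v; rewrite !ffunE inE; case: (v == _) => //=.
  by case e0: (M1 v == 0); rewrite ?e0 /= ?andbF.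
rewrite gen; apply/ffunP => v; rewrite !ffunE inE; congr (if _ && _ then _ else _).
apply/mapP/tnthP => [[b _ ->]|[b ->]]; first by exists b.
by exists b; rewrite ?mem_enum.
Qed.

Definition relM (M : {ffun 'I_n -> nat}) s := hasE s /\ arrM s M.

Lemma bstep_spec (i : 'I_m) r (j : 'I_m) M s : relM M s ->
  sat [:: n; m; ell; Rb; i : nat; r; j : nat] (cnds [:: (Plus (Cnt 4) (Cst 1), Cnt 6)]
    (Seq (Put tT (Cst 0) (Cst 0))
    (Seq (flag k (fun b => [:: (Cst 1, Ld tM (eg k (Cnt 6) b)); (Ld tM (eg k (Cnt 6) b), Minus (Cnt 2) (Cnt 5))]) 0)
    (cnds [:: (Cst 1, Ld tT (Cst 0))]
      (unroll k (fun b => cnds [:: (Ld tM (eg k (Cnt 6) b), Cst 0)]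
         (Put tM (eg k (Cnt 6) b) (Plus (Minus (Cnt 2) (Cnt 5)) (Cst 1)))))))))
    s (relM (bstep H i (ell - r) M j)).
Proof.
move=> [hs hM]; set cs := [:: n; m; _; _; _; _; _]; set t := ell - r.
apply: sat_cnds; rewrite /allc /= andbT addn1 /bstep => ij; rewrite ?ij ?(negbTE ij) //=.
apply: sat_seq (sat_put (Q := fun s1 => off tT s s1 /\ s1 tT 0 = 0) _ _) _; first by split => //; apply: off_put.
move=> s0 [oo t0].
apply: sat_seq (sat_flag X cs k 0 s0 _) _ => [b|s1 [q1 t1]]; first by rewrite /freec /= !loads_emul.
have oo1 := off_trans oo q1.
have i0 : hasE s0 by apply: hasE_eq hs => a; rewrite oo.
have m0 : arrM s0 M by move=> v; rewrite oo.
have r1 : relM M s1 by split; [apply: hasE_eq hs => a; rewrite oo1 | move=> v; rewrite oo1].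
have T1 : s1 tT 0 = [exists v in E j, 1 <= M v <= t].
  rewrite t1 t0 has_iota.
  have -> : [exists b : 'I_k, allc cs s0 [:: (Cst 1, Ld tM (eg k (Cnt 6) b)); (Ld tM (eg k (Cnt 6) b), Minus (Cnt 2) (Cnt 5))]]
     = [exists v in E j, 1 <= M v <= t].
    have ev1 (b : 'I_k) : allc cs s0 [:: (Cst 1, Ld tM (eg k (Cnt 6) b)); (Ld tM (eg k (Cnt 6) b), Minus (Cnt 2) (Cnt 5))] =
       (1 <= M (tnth (H j) b) <= t).
      rewrite /allc; have := @ev_eg cs s0 6 j b i0 erefl; move: (eg _ _ _) => eb /= ->.
      by rewrite m0 andbT.
    apply/existsP/exists_inP => [[b]|[v]]; first by rewrite ev1 => h; exists (tnth (H j) b); rewrite ?inE ?mem_tnth.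
    by rewrite inE => /tnthP[b ->] h; exists b; rewrite ev1.
  by case: [exists v in _, _].
apply: sat_cnds; rewrite /allc /= T1 andbT lt0b => hx; rewrite ?hx ?(negbTE hx) //.
rewrite -foldl_mark; apply: (sat_unroll_fold (rel := relM)) => // b M' s2 [i2 m2].
have ve := @ev_eg cs s2 6 j b i2 erefl.
move: ve; move: (eg k (Cnt 6) b) (tnth (H j) b) => e v ve.
apply: sat_cnds; rewrite /allc /= ve m2 andbT leqn0 => mv.
  apply: sat_put; rewrite /= ve; split; first exact: hasE_put.
  move=> u; rewrite /put /= ffunE; case: (eqVneq u v) => [->|uv]; first by rewrite eqxx mv addn1.
  by rewrite val_neq.
split => // u; rewrite ffunE m2; case: (eqVneq u v) => [->|uv] //=.
by rewrite (negbTE mv).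
Qed.

Lemma bfs_spec (i : 'I_m) (a : 'I_k) s : hasE s ->
  sat [:: n; m; ell; Rb; i : nat] (bfs_cmd k 5 (eg k (Cnt 4) a)) s (relM (bfs H ell i (tnth (H i) a))).
Proof.
move=> hs; set cs := [:: n; m; _; _; _].
apply: sat_seq (fill_spec (cs := cs) tM s erefl) _ => s1 [w1 z1].
have i1 : hasE s1 by apply: hasE_eq hs => b; rewrite w1.
have ve := @ev_eg cs s1 4 i a i1 erefl.
apply: sat_seq (sat_put (Q := relM [ffun v => (v == tnth (H i) a) : nat]) _ _) _.
  rewrite ve; split; first exact: hasE_put.
  move=> v; rewrite /put /= ffunE; case: (eqVneq v (tnth (H i) a)) => [->|uv]; first by rewrite eqxx.
  by rewrite val_neq // z1.
move=> s2 r2; apply: (sat_for_fold (rel := relM)) => // r M s3 r3.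
by apply: (sat_for_fold (rel := relM)) => // j M' s4 r4; apply: bstep_spec.
Qed.

Lemma wr_bfs dl x t : t != tM -> t != tT -> ~~ writes (bfs_cmd k dl x) t.
Proof.
move=> h1 h2; rewrite /bfs_cmd /= !negb_or h1 h2 wr_flag //= !andbT.
by apply: wr_unroll => b /=; rewrite orbF.
Qed.

Definition relT M (a : 'I_n * {set 'I_n}) s :=
  [/\ relM M s, arrV s a.2, s tD 1 = a.1 & s tD 0 = 1].

Lemma foldl_filter (A B : Type) (P : pred A) (f : A -> B) l w :
  foldl (fun w b => if P b then rcons w (f b) else w) w l = w ++ [seq f b | b <- l & P b].
Proof.
elim: l w => [|b l IH] w /=; first by rewrite cats0.
by rewrite IH; case: (P b) => //=; rewrite cat_rcons.
Qed.

Lemma relT_off M a s s' : off tT s s' -> relT M a s -> relT M a s'.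
Proof.
move=> oo [[h1 h2] h3 h4 h5]; split; rewrite ?oo //.
  by split; [apply: hasE_eq h1 => b; rewrite oo | move=> v; rewrite oo].
by move=> v; rewrite oo.
Qed.

Lemma tstep_spec (i : 'I_m) r (j : 'I_m) M a s : relT M a s ->
  sat [:: n; m; ell; Rb; i : nat; r; j : nat] (cnds [:: (Plus (Cnt 4) (Cst 1), Cnt 6)]
    (Seq (Put tT (Cst 0) (Cst 0))
    (Seq (flag k (fun b => [:: (eg k (Cnt 6) b, Ld tD (Cst 1)); (Ld tD (Cst 1), eg k (Cnt 6) b)]) 0)
    (cnds [:: (Cst 1, Ld tT (Cst 0))]
      (Seq (Put tT (Cst 0) (Cst 0))
      (Seq (unroll k (fun b => cnds [:: (Cst 1, Ld tM (eg k (Cnt 6) b));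
               (Plus (Ld tM (eg k (Cnt 6) b)) (Cst 1), Ld tM (Ld tD (Cst 1)));
               (Ld tM (Ld tD (Cst 1)), Plus (Ld tM (eg k (Cnt 6) b)) (Cst 1))]
             (Seq (Put tT (Cst 0) (Cst 1)) (Put tD (Cst 2) (eg k (Cnt 6) b)))))
      (cnds [:: (Cst 1, Ld tT (Cst 0))]
        (Seq (unroll k (fun b => Put tV (eg k (Cnt 6) b) (Cst 1)))
             (Put tD (Cst 1) (Ld tD (Cst 2))))))))))) s (relT M (tstep H i M a j)).
Proof.
case: a => z V rs; set cs := [:: n; m; _; _; _; _; _].
apply: sat_cnds; rewrite /allc /= andbT addn1 /tstep => ij; rewrite ?ij ?(negbTE ij) //=.
apply: sat_seq (sat_put (Q := fun s1 => off tT s s1 /\ s1 tT 0 = 0) _ _) _; first by split => //; apply: off_put.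
move=> s0 [oo t0].
apply: sat_seq (sat_flag X cs k 0 s0 _) _ => [b|s1 [q1 t1]]; first by rewrite /freec /= !loads_emul.
have r0 := relT_off oo rs; have r1 := relT_off q1 r0.
have T1 : s1 tT 0 = (z \in E j).
  rewrite t1 t0 has_iota.
  have -> : [exists b : 'I_k, allc cs s0 [:: (eg k (Cnt 6) b, Ld tD (Cst 1)); (Ld tD (Cst 1), eg k (Cnt 6) b)]] = (z \in E j).
    have ev1 (b : 'I_k) : allc cs s0 [:: (eg k (Cnt 6) b, Ld tD (Cst 1)); (Ld tD (Cst 1), eg k (Cnt 6) b)] = (tnth (H j) b == z).
      case: r0 => -[i0 _] _ z0 _.
      rewrite /allc; have := @ev_eg cs s0 6 j b i0 erefl; move: (eg _ _ _) => eb /= ->.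
      by rewrite z0 andbT -eqn_leq.
    apply/existsP/idP => [[b]|]; first by rewrite ev1 inE => /eqP <-; rewrite mem_tnth.
    by rewrite inE => /tnthP[b e]; exists b; rewrite ev1 e.
  by case: (z \in _).
apply: sat_cnds; rewrite /allc /= T1 andbT lt0b => zj; rewrite ?zj ?(negbTE zj) //=.
apply: sat_seq (sat_put (Q := fun s2 => off tT s1 s2 /\ s2 tT 0 = 0) _ _) _; first by split => //; apply: off_put.
move=> s2 [q2 t2]; have r2 := relT_off q2 r1.
pose relW (w : seq 'I_n) s' := [/\ relT M (z, V) s', s' tT 0 = (w != [::]) & w != [::] -> s' tD 2 = last z w].
pose P b := (1 <= M (tnth (H j) b)) && (M (tnth (H j) b) + 1 == M z).
have W : sat cs (unroll k (fun b => cnds [:: (Cst 1, Ld tM (eg k (Cnt 6) b));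
               (Plus (Ld tM (eg k (Cnt 6) b)) (Cst 1), Ld tM (Ld tD (Cst 1)));
               (Ld tM (Ld tD (Cst 1)), Plus (Ld tM (eg k (Cnt 6) b)) (Cst 1))]
             (Seq (Put tT (Cst 0) (Cst 1)) (Put tD (Cst 2) (eg k (Cnt 6) b))))) s2 (relW (nexts H M z j)).
  have -> : nexts H M z j = foldl (fun w b => if P b then rcons w (tnth (H j) b) else w) [::] (enum 'I_k).
    by rewrite foldl_filter.
  apply: (sat_unroll_fold (rel := relW)); first by split.
  move=> b w s3 [rT tw lw]; have [[i3 m3] v3 z3 f3] := rT.
  have ve s' : hasE s' -> ev cs s' (eg k (Cnt 6) b) = tnth (H j) b by move=> h; apply: ev_eg.
  rewrite /P; move: ve; move: (eg k (Cnt 6) b) (tnth (H j) b) => e v ve.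
  apply: sat_cnds; rewrite /allc /= ve // m3 z3 m3 andbT -eqn_leq => hb; rewrite ?hb ?(negbTE hb) //.
  apply: sat_seq (sat_put (Q := fun s4 => s4 = put s3 tT 0 1) _ _) _ => // s4 ->.
  have i4 : hasE (put s3 tT 0 1) by apply: hasE_put.
  apply: sat_put; rewrite /= ve //; split => //; first by rewrite /put /=; case: (w).
  by rewrite /put /= last_rcons.
apply: sat_seq W _ => s3 [r3 t3 l3].
apply: sat_cnds; rewrite /allc /= t3 andbT lt0b => nw; rewrite ?nw ?(negbTE nw) //=.
pose relV U s' := [/\ relM M s', arrV s' U, s' tD =1 s3 tD & True].
have [rm3 v3 z3 f3] := r3.
apply: sat_seq (sat_unroll_fold (rel := relV) (a := V) (f := fun U b => tnth (H j) b |: U) _ _) _.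
- by split.
- move=> b U s4 [[i4 m4] v4 d4 _]; apply: sat_put; rewrite (@ev_eg cs s4 6 j b i4 erefl); split => //.
  move=> u; rewrite /put /= !inE; case: (eqVneq u (tnth (H j) b)) => [->|uv]; first by rewrite eqxx.
  by rewrite val_neq.
- move=> s4 [[i4 m4] v4 d4 _]; rewrite foldl_edge in v4.
  apply: sat_put; rewrite /= d4 l3 //; split => //.
  by rewrite /put /= d4.
Qed.

Lemma trace_spec (i : 'I_m) M z V s : relT M (z, V) s ->
  sat [:: n; m; ell; Rb; i : nat] (trace_cmd k 5) s (relT M (trace H ell i M z V)).
Proof.
move=> rs; rewrite /trace -[X in iter X](size_down ell).
rewrite -(foldl_const (fun p => foldl (tstep H i M) p (down m))).
apply: (sat_for_fold (rel := relT M)) => // r a s3 r3.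
by apply: (sat_for_fold (rel := relT M)) => // j a' s4 r4; apply: tstep_spec.
Qed.

Lemma wr_trace dl t : t != tD -> t != tT -> t != tV -> ~~ writes (trace_cmd k dl) t.
Proof.
move=> h1 h2 h3; rewrite /trace_cmd /= !negb_or h1 h2 wr_flag //= !andbT; apply/andP; split; first by apply: wr_unroll => b /=; rewrite !orbF negb_or h2.
by apply: wr_unroll.
Qed.

Definition relP (a : bool * {set 'I_n}) s := [/\ hasE s, arrV s a.2 & s tD 0 = a.1].

Lemma pre_spec (i : 'I_m) s : hasE s ->
  sat [:: n; m; ell; Rb; i : nat] (pre_cmd k) s (relP (pre H ell i)).
Proof.
move=> hs; set cs := [:: n; m; _; _; _].
apply: sat_seq (fill_spec (cs := cs) tV s erefl) _ => s1 [w1 z1].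
have i1 : hasE s1 by apply: hasE_eq hs => b; rewrite w1.
pose relV U s' := hasE s' /\ arrV s' U.
apply: sat_seq (sat_unroll_fold (rel := relV) (a := set0) (f := fun U b => tnth (H i) b |: U) _ _) _.
- by split => // v; rewrite z1 // inE.
- move=> b U s2 [i2 v2]; apply: sat_put; rewrite (@ev_eg cs s2 4 i b i2 erefl); split; first exact: hasE_put.
  move=> u; rewrite /put /= !inE; case: (eqVneq u (tnth (H i) b)) => [->|uv]; first by rewrite eqxx.
  by rewrite val_neq.
move=> s2 [i2 v2]; rewrite foldl_edge set0U in v2.
apply: sat_seq (sat_put (Q := relP (false, E i)) _ _) _; first by split => //; apply: hasE_put.
move=> s3 r3; apply: (sat_unroll_fold (rel := relP)) => // a q s4 [i4 v4 f4].
apply: sat_seq (sat_frame (bfs_spec i a i4)) _ => s5 [[i5 m5] fr5].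
set M := bfs _ _ _ _ in m5 *.
pose relQ (a : bool * {set 'I_n}) s := relP a s /\ arrM s M.
suff : sat cs (unroll k (fun b => cnds [:: (Ld tD (Cst 0), Cst 0); (Cst 2, Ld tM (eg k (Cnt 4) b))]
      (Seq (Put tD (Cst 0) (Cst 1)) (Seq (Put tD (Cst 1) (eg k (Cnt 4) b)) (trace_cmd k 5))))) s5 (relQ (foldl (visit H ell i M) q (enum 'I_k))).
  by move=> /sat_weak; apply => s' [].
apply: (sat_unroll_fold (rel := relQ)).
  by split => //; split => //; [move=> v; rewrite fr5 ?v4 //; apply: wr_bfs | rewrite fr5 ?f4 //; apply: wr_bfs].
move=> b [f V] s6 [[i6 v6 f6] m6]; rewrite /visit /=.
have ve s' : hasE s' -> ev cs s' (eg k (Cnt 4) b) = tnth (H i) b by move=> h; apply: ev_eg.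
move: ve; move: (eg k (Cnt 4) b) (tnth (H i) b) => e v ve.
apply: sat_cnds; rewrite /allc /= ve // m6 f6 andbT leqn0 eqb0 => hb; rewrite ?hb ?(negbTE hb) //.
apply: sat_seq (sat_put (Q := fun s7 => s7 = put s6 tD 0 1) _ _) _ => // s7 ->.
apply: sat_seq (sat_put (Q := relT M (v, V)) _ _) _.
  have i7 : hasE (put s6 tD 0 1) by apply: hasE_put.
  by rewrite /= ve //; split => //; split => //; apply: hasE_put.
move=> s8 r8; have [[i8 m8] _ _ _] := r8.
apply: sat_weak (sat_frame (trace_spec i r8)) _ => s9 [[[i9 m9] v9 _ f9] fr9].
by split.
Qed.

Lemma wr_pre t : t != tV -> t != tD -> t != tM -> t != tT -> ~~ writes (pre_cmd k) t.
Proof.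
move=> h1 h2 h3 h4; have wseq a b : ~~ writes a t -> ~~ writes b t -> ~~ writes (Seq a b) t by move=> /= /negbTE ->.
apply: (wseq) => //; apply: (wseq); first by apply: wr_unroll.
apply: (wseq) => //.
apply: wr_unroll => a; apply: (wseq); first exact: wr_bfs.
by apply: wr_unroll => b; rewrite wr_cnds; do 2 (apply: (wseq) => //); apply: wr_trace.
Qed.

Definition rel0 (a : spins n * nat) s := [/\ hasE s, (forall u : 'I_n, s tS u = a.1 u) & s tB 0 = a.2].

Definition ins_op (i : 'I_m) (g : spins n * nat -> R) (a : spins n * nat) : R :=
  let: (f, V) := pre H ell i in
  if f then (if 0 < a.2 then iter Rb (sweep_op i V) (fun sg => g (sg, a.2.-1)) a.1 else g a)
  else iter (cR * ell) (sweep_op i V) (fun sg => g (sg, a.2)) a.1.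

Lemma ins_law (i : 'I_m) g Psi a s : (forall a s', rel0 a s' -> Psi s' = g a) -> rel0 a s ->
  ex (ins_cmd k csw cR) [:: n; m; ell; Rb; i : nat] Psi s = ins_op i g a.
Proof.
case: a => sg b hP [i0 s0 b0]; set cs := [:: n; m; _; _; _].
have [s1 [[r1 fr1] e1]] := sat_frame (pre_spec i i0).
rewrite /ins_cmd; set rest := If _ _ _ _; rewrite -[LHS]/(ex (pre_cmd k) cs (ex rest cs Psi) s) e1 /ins_op {}/rest; move: r1; case: (pre H ell i) => f V [i1 v1 f1].
have s1S u : s1 tS u = s tS u by rewrite fr1 //; apply: wr_pre.
have s1B u : s1 tB u = s tB u by rewrite fr1 //; apply: wr_pre.
have R01 bb sg' s' : rel1 V bb sg' s' -> rel0 (sg', bb) s' by case.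
have r1 : rel1 V b sg s1 by split => // [u|]; rewrite ?s1S ?s1B ?s0.
rewrite /= in v1 f1.
have -> A B : ex (If (Cst 1) (Ld tD (Cst 0)) A B) cs Psi s1 = if f then ex A cs Psi s1 else ex B cs Psi s1 by rewrite -[f]lt0b -f1.
case: f {f1}.
  rewrite ex_cnds.
  have -> : allc cs s1 [:: (Cst 1, Ld tB (Cst 0))] = (0 < (sg, b).2) by rewrite /allc /= s1B b0 andbT.
  case: ifP => b1; last by apply: hP; apply: R01.
  rewrite -[LHS]/(ex (For (Cnt 3) (sweep_cmd k csw 6)) cs Psi (put s1 tB 0 (s1 tB 0 - 1))) s1B b0 subn1; apply: (rounds_law (V := V) (b := b.-1)) => //.
    by move=> sg' s' r'; apply: hP; apply: R01.
  by case: r1 => a1 a2 a3 a4; split => //; apply: hasE_put.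
apply: (rounds_law (V := V) (b := b)) => //; first by move=> s'; rewrite ev_emul.
by move=> sg' s' r'; apply: hP; apply: R01.
Qed.

Lemma body_law (phi : spins n -> R) Psi s : hasE s ->
  (forall a s', rel0 a s' -> Psi s' = phi a.1) ->
  ex (Seq (For (Cnt 0) (Coin tS (Cnt 4) 1)) (Seq (Put tB (Cst 0) (Cnt 3)) (For (Cnt 1) (ins_cmd k csw cR))))
    [:: n; m; ell; Rb] Psi s =
  (\sum_(sg : spins n) (2^-1) ^+ n * foldr ins_op (fun a => phi a.1) (down m) (sg, Rb))%R.
Proof.
move=> hs hP; set cs := [:: n; m; _; _]; set rest := Seq (Put _ _ _) _.
rewrite -[LHS]/(ex (For (Cnt 0) (Coin tS (Cnt (size cs)) 1)) cs (ex rest cs Psi) s).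
rewrite (@ex_coin_for cs (Cnt 0) tS 1 n _ s (fun sg => foldr ins_op (fun a => phi a.1) (down m) (sg, Rb))) //.
  apply: eq_bigr => sg _; congr (_ * _)%R; rewrite /coin_wt X1 (eq_bigr (fun=> 2^-1%R)) ?prodr_const ?card_ord // => x _.
  by case: ifP => // _; lra.
move=> sg s1 w1 h1; pose s2 := put s1 tB 0 Rb.
rewrite -[LHS]/(ex (For (Cnt 1) (ins_cmd k csw cR)) cs Psi s2).
have r2 : rel0 (sg, Rb) s2.
  split => //; first by apply: hasE_put => //; apply: hasE_eq hs => a; rewrite w1.
apply: (ex_for_fold (rel := rel0) (g := fun a => phi a.1)) r2 _ => //.
by move=> i g' Psi' hP' a s' r'; apply: ins_law r'.
Qed.

End Spec.

Lemma setup_spec (R : realType) (X : nat -> R) (n m k q0 g : nat) (H : hypergraph n m k) s :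
  0 < n -> 0 < q0 -> hasE H s ->
  let l := trunc_log (2 ^ q0) n in
  sat X [:: n; m] (setup_cmd q0 g) s (fun s' => [/\ hasE H s', s' tT 5 = l & s' tT 6 = 2 ^ (g * l)]).
Proof.
move=> n0 q00 hs l; set cs := [:: n; m].
have p1 : 1 < 2 ^ q0 by rewrite -{1}(expn0 2) ltn_exp2l.
apply: sat_seq (sat_put (Q := fun s1 => s1 = put s tT 4 1) _ _) _ => // s1 ->.
apply: sat_seq (sat_put (Q := fun s1 => s1 = put (put s tT 4 1) tT 5 0) _ _) _ => // s2 ->.
apply: sat_seq (sat_put (Q := fun s1 => s1 = put (put (put s tT 4 1) tT 5 0) tT 6 1) _ _) _ => // s3 ->.
pose I j s' := hasE H s' /\ exists a, [/\ s' tT 4 = (2 ^ q0) ^ a, s' tT 5 = a, s' tT 6 = 2 ^ (g * a),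
   (2 ^ q0) ^ a <= n & (n < (2 ^ q0) ^ a.+1) || (a + j == n)].
apply: sat_weak (sat_for (I := I) _ _) _ => /=.
- split; first by do 3 apply: hasE_put => //.
  by exists 0; rewrite muln0 !expn0; split => //; rewrite add0n eqxx orbT.
- move=> j s' jn [i1 [a [e4 e5 e6 h1 h2]]].
  apply: sat_cnds; rewrite /allc /= ev_emul /= e4 andbT -expnS => hh.
    apply: sat_seq (sat_put (Q := fun s1 => s1 = put s' tT 4 ((2 ^ q0) ^ a.+1)) _ _) _.
      by rewrite ev_emul /= e4 -expnS.
    move=> s4 ->; apply: sat_seq (sat_put (Q := fun s1 => s1 = put (put s' tT 4 ((2 ^ q0) ^ a.+1)) tT 5 a.+1) _ _) _.
      by rewrite /= /put /= e5 addn1.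
    move=> s5 ->; apply: sat_put; rewrite ev_emul /=.
    split; first by do 3 apply: hasE_put => //.
    exists a.+1; rewrite /put /= e6; split => //; first by rewrite -expnD mulnS.
    by move: h2; rewrite ltnNge hh /= addSnnS orbC => ->.
  split => //; exists a; split => //; by rewrite ltnNge hh.
- move=> s' [i1 [a [e4 e5 e6 h1 h2]]].
  have h3 : n < (2 ^ q0) ^ a.+1.
    case/orP: h2 => //; rewrite addn0 => /eqP an; apply: leq_trans (_ : (2 ^ q0) ^ a < _); last by rewrite ltn_exp2l.
    by rewrite ltnS -{1}an; apply/ltnW/ltn_expl.
  have -> : l = a by apply: trunc_log_eq => //; rewrite h1.
  by [].
Qed.

Lemma main_law (R : realType) (X : nat -> R) (n m k q0 g csw cR : nat) (H : hypergraph n m k) (p : R)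
    (phi : spins n -> R) Psi s : 0 < n -> 0 < q0 -> hasE H s -> pr X 1 = 2^-1%R -> pr X 2 = p ->
  (forall (sg : spins n) (s' : st), (forall u : 'I_n, s' tS u = sg u) -> Psi s' = phi sg) ->
  let l := trunc_log (2 ^ q0) n in let Rb := 2 ^ (g * l) in
  ex X (main_cmd k q0 g csw cR) [:: n; m] Psi s =
  (\sum_(sg : spins n) (2^-1) ^+ n * foldr (ins_op H l Rb csw cR p) (fun a => phi a.1) (down m) (sg, Rb))%R.
Proof.
move=> n0 q00 hs X1 X2 hP l Rb.
have [s1 [[h1 h2 h3] e1]] := setup_spec X g n0 q00 hs.
rewrite /main_cmd; set body := Seq (For _ _) _.
rewrite -[LHS]/(ex X (setup_cmd q0 g) [:: n; m] (ex X (Let (Ld tT (Cst 5)) (Let (Ld tT (Cst 6)) body)) [:: n; m] Psi) s) e1.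
rewrite -[LHS]/(ex X body [:: n; m; s1 tT 5; s1 tT 6] Psi s1) h2 h3.
by apply: body_law => // a s' [_ h _]; apply: hP.
Qed.

Lemma nth_flatten_const (T S : Type) (x0 : T) (k : nat) (f : S -> seq T) (l : seq S) (y0 : S) j b :
  (forall y, size (f y) = k) -> j < size l -> b < k ->
  nth x0 (flatten [seq f y | y <- l]) (k * j + b) = nth x0 (f (nth y0 l j)) b.
Proof.
move=> hf; elim: l j => [|y l IH] [|j] //= jl bk; rewrite nth_cat hf.
  by rewrite muln0 add0n bk.
rewrite mulnS -addnA ltnNge leq_addr /= addKn; exact: IH.
Qed.

Lemma input_hasE (n m k : nat) (H : hypergraph n m k) s :
  (forall q, q < k * m -> s tE q = input_nat H (q + 2)) -> hasE H s.
Proof.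
move=> h j b; rewrite h; last first.
  apply: (@leq_trans (k * j.+1)); first by rewrite mulnS addnC ltn_add2r.
  by rewrite leq_mul2l ltn_ord orbT.
rewrite addn2 [LHS]/= (nth_flatten_const _ j) ?size_enum_ord ?ltn_ord //; last by move=> y; rewrite size_map size_tuple.
by rewrite nth_ord_enum (nth_map (tnth (H j) b)) ?size_tuple ?ltn_ord // -tnth_nth.
Qed.

Require Import Defs.

(** * Breadth-first search for short cycles *)

Section Search.
Variables (n m k : nat) (H : hypergraph n m k) (ell : nat) (i : 'I_m).
Local Notation E := (fun j => [set v in H j]).
Implicit Types (M : {ffun 'I_n -> nat}) (V : {set 'I_n}).

Lemma mem_down q (j : 'I_q) : j \in down q.
Proof. by rewrite mem_rev mem_enum. Qed.

Definition touch M t (v : 'I_n) (j : 'I_m) := [&& i < j, v \in E j & [exists w in E j, 1 <= M w <= t]].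

Lemma bstep_touch t M l :
  (forall v, foldl (bstep H i t) M l v = if M v != 0 then M v else if has (touch M t v) l then t.+1 else 0).
Proof.
elim/last_ind: l => [|l j IH] v; first by rewrite /=; case: eqP.
rewrite foldl_rcons has_rcons; move: (foldl _ _ _) IH => M' IH.
have ex : [exists w in E j, 1 <= M' w <= t] = [exists w in E j, 1 <= M w <= t].
  apply: eq_existsb => w; congr (_ && _); rewrite IH; case: (eqVneq (M w) 0) => [->|] //=.
  by case: ifP => // _; rewrite ltnn.
rewrite /bstep ex {1}/touch; case: (i < j) => //=; case: [exists w in E j, _] => /=; last by rewrite andbF /= IH.
rewrite ffunE IH andbT; case: (eqVneq (M v) 0) => [mv|mv] /=; last by rewrite (negbTE mv) andbF.
by case: (v \in [set v0 in H j]) => //=; case: (has _ _).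
Qed.

Variable x : 'I_n.

(** Invariant after [t] rounds. [mk_next] is only asked of marks at most [t], because the last
    layer, marked [t.+1], has not been expanded. *)
Record marked t M : Prop := Marked {
  mk_le : forall v, M v <= t.+1;
  mk_root : forall v, (M v == 1) = (v == x);
  mk_prev : forall v a, M v = a.+2 -> exists j : 'I_m, [/\ i < j, v \in E j & exists2 w, w \in E j & M w = a.+1];
  mk_next : forall (j : 'I_m) v w, i < j -> v \in E j -> w \in E j -> 1 <= M w <= t -> 1 <= M v <= (M w).+1 }.

Lemma marked_round t M : marked t M -> marked t.+1 (foldl (bstep H i t.+1) M (down m)).
Proof.
case=> h1 h2 h3 h4.
have B v : foldl (bstep H i t.+1) M (down m) v =
    if M v != 0 then M v else if [exists j, touch M t.+1 v j] then t.+2 else 0.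
  rewrite bstep_touch; have -> // : has (touch M t.+1 v) (down m) = [exists j, touch M t.+1 v j].
  by apply/hasP/existsP => [[j _ hj]|[j hj]]; exists j => //; apply: mem_down.
move: (foldl _ _ _) B => M' B.
have old v : M v != 0 -> M' v = M v by move=> h; rewrite B h.
have new v : M v = 0 -> M' v != 0 -> M' v = t.+2 /\ exists j, touch M t.+1 v j.
  by move=> h; rewrite B h /=; case: ifP => // /existsP.
split.
- move=> v; case: (eqVneq (M v) 0) => [/new h|/old ->]; last exact: leqW.
  by case: (eqVneq (M' v) 0) => [->|/h [-> _]].
- move=> v; rewrite -h2 B; case: (eqVneq (M v) 0) => [->|] //=.
  by case: ifP.
- move=> v a e; case: (eqVneq (M v) 0) => [mv|mv]; last first.
    rewrite old // in e; have [j [j1 j2 [w w1 w2]]] := h3 _ _ e.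
    by exists j; split => //; exists w; rewrite // old // w2.
  have [|e' [j /and3P[j1 j2 /exists_inP[w w1 w2]]]] := new v mv; first by rewrite e.
  exists j; split => //; exists w => //; rewrite old; last by lia.
  have [wt|] := leqP (M w) t; last by lia.
  by have := h4 j v w j1 j2 w1; rewrite mv; lia.
- move=> j v w ij vj wj hw.
  have mw : M' w = M w.
    case: (eqVneq (M w) 0) => [m0|/old //].
    by case: (eqVneq (M' w) 0) => [e0|/(new _ m0) [e1 _]]; move: hw; rewrite ?e0 ?e1 ?ltnn ?andbF.
  rewrite mw in hw *; case: (eqVneq (M v) 0) => [mv|mv].
    have -> : M' v = t.+2.
      rewrite B mv /=; have -> // : [exists j0, touch M t.+1 v j0].
      by apply/existsP; exists j; apply/and3P; split => //; apply/exists_inP; exists w.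
    have [wt|] := leqP (M w) t; last by lia.
    by have := h4 j v w ij vj wj; rewrite mv; lia.
  rewrite old //; have [wt|wt] := leqP (M w) t; first by apply: (h4 j) => //; lia.
  by have := h1 v; lia.
Qed.

Lemma bfs_marked : marked ell (bfs H ell i x).
Proof.
have gen q (M : {ffun 'I_n -> nat}) : q <= ell -> marked (ell - q) M ->
    marked ell (foldl (fun M (r : 'I_ell) => foldl (bstep H i (ell - r)) M (down m)) M (drop (ell - q) (down ell))).
  elim: q M => [|q IH] M qe mk; first by rewrite subn0 drop_oversize ?size_down // -[ell]subn0.
  have hq : ell - q.+1 < ell by lia.
  have rq : q < ell by [].
  rewrite (drop_nth (Ordinal rq)) ?size_down //=.
  have -> : nth (Ordinal rq) (down ell) (ell - q.+1) = Ordinal rq.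
    rewrite /down nth_rev ?size_enum_ord // -[X in nth _ _ X]/(ell - (ell - q.+1).+1).
    have -> : ell - (ell - q.+1).+1 = Ordinal rq by rewrite /=; lia.
    exact: nth_ord_enum.
  have -> : (ell - q.+1).+1 = ell - q by lia.
  apply: IH; first exact: ltnW.
  have -> : ell - Ordinal rq = (ell - q.+1).+1 by rewrite /=; lia.
  exact: marked_round.
have := gen ell [ffun v => (v == x) : nat] (leqnn _); rewrite subnn drop0; apply.
split.
- by move=> v; rewrite ffunE; case: (v == x).
- by move=> v; rewrite ffunE; case: (v == x).
- by move=> v a; rewrite ffunE; case: (v == x).
- by move=> j v w _ _ _; rewrite leqn0 => /andP[h /eqP e]; rewrite e in h.
Qed.

Variable M : {ffun 'I_n -> nat}.
Hypothesis mk : marked ell M.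

Variable o : {ffun 'I_m -> k.-tuple 'I_n * bool}.
Hypothesis ho : forall j, (o j).1 = H j.
Local Notation hchain := (chain_of o (@inc n k) [set j : 'I_m | i < j]).

Lemma vertsE j : verts (o j) = E j. Proof. by rewrite /verts ho. Qed.

Lemma chain_marked v ps a : hchain v ps -> 1 <= M v <= a -> a + size ps <= ell.+1 -> 1 <= M (tip v ps) <= a + size ps.
Proof.
elim: ps v a => [|[j u] ps IH] v a /=; first by rewrite addn0.
rewrite /inc !vertsE inE => /andP[/and4P[ij vj uj _] ch] hv ha.
rewrite addnS -addSn; apply: IH => //; last by rewrite addSnnS.
have := mk_next mk ij uj vj; rewrite /=; lia.
Qed.

(** Marks increase by at most one along a hyperedge, so a path of at most [ell] steps would have
    marked its end. *)
Lemma unmarked_chain z ps : M z < 2 -> z != x -> hchain x ps -> tip x ps = z -> ell < size ps.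
Proof.
move=> mz zx ch tp; rewrite ltnNge; apply/negP => sz.
have r1 : M x = 1 by apply/eqP; rewrite (mk_root mk).
have := @chain_marked x ps 1 ch; rewrite tp r1 => /(_ isT); have := mk_root mk z; rewrite (negbTE zx); lia.
Qed.

Variables (z0 : 'I_n) (V0 : {set 'I_n}).

(** [td_old] keeps the labels distinct: a hyperedge already used contains a vertex marked above the
    current one, so by [mk_next] it cannot also contain a vertex marked one below. *)
Record traced (zV : 'I_n * {set 'I_n}) (ps : seq ('I_m * 'I_n)) : Prop := Traced {
  td_chain : hchain z0 ps;
  td_tip : tip z0 ps = zV.1;
  td_uniq : uniq (unzip1 ps);
  td_set : zV.2 = V0 :|: \bigcup_(j in unzip1 ps) E j;
  td_mark : M z0 = M zV.1 + size ps;
  td_pos : 1 <= M zV.1;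
  td_old : {in unzip1 ps, forall j, exists2 v, v \in E j & M zV.1 < M v} }.

Lemma nextsP z j : reflect (exists w, [/\ w \in E j, 1 <= M w & M w + 1 = M z]) (nexts H M z j != [::]).
Proof.
rewrite /nexts; set l := [seq _ | b <- _ & _].
have lP w : w \in l -> [/\ w \in E j, 1 <= M w & M w + 1 = M z].
  by case/mapP => b; rewrite mem_filter => /andP[/andP[h1 /eqP h2] _] ->; rewrite inE mem_tnth.
apply: (iffP idP) => [|[w [wj h1 h2]]].
  by case: (l) lP => // w l' h _; exists w; apply: h; rewrite inE eqxx.
move: wj; rewrite inE => /tnthP[b e].
have : w \in l by apply/mapP; exists b => //; rewrite mem_filter mem_enum -e h1 h2 eqxx.
by case: (l).
Qed.

Lemma last_nexts z j : nexts H M z j != [::] -> let w := last z (nexts H M z j) in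
  [/\ w \in E j, 1 <= M w & M w + 1 = M z].
Proof.
move=> h /=; have : last z (nexts H M z j) \in nexts H M z j by move: h; case: (nexts _ _ _ _) => //= a l _; apply: mem_last.
by case/mapP => b; rewrite mem_filter => /andP[/andP[h1 /eqP h2] _] ->; rewrite inE mem_tnth.
Qed.

Lemma tstep_traced zV ps j : traced zV ps -> exists ps', traced (tstep H i M zV j) ps' /\
  (tstep H i M zV j = zV \/ M (tstep H i M zV j).1 < M zV.1).
Proof.
case: zV => z V td; rewrite /tstep; case: ifP; last by exists ps; split => //; left.
case/and3P => ij zj nx; have [/= w1 w2 w3] := last_nexts nx; move: (last _ _) w1 w2 w3 => w w1 w2 w3.
case: td => /= t1 t2 t3 t4 t5 t6 t7; exists (rcons ps (j, w)); split; last by right => /=; lia.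
have jn : j \notin unzip1 ps.
  apply/negP => /t7 [v vj hv]; have := mk_next mk ij vj w1; have := mk_le mk z; lia.
split => /=.
- rewrite chain_rcons t1 t2 /inc !vertsE inE ij zj w1 /=; apply/negP => /eqP wz.
  by move: w3; rewrite wz; lia.
- by rewrite /tip /unzip2 map_rcons last_rcons.
- by rewrite /unzip1 map_rcons rcons_uniq t3 jn.
- rewrite t4; apply/setP => v; rewrite !inE /unzip1 map_rcons; apply/orP/orP.
    case=> [/orP[h|/bigcupP[j' h1 h2]]|h]; [by left| |]; right; apply/bigcupP.
      by exists j' => //; rewrite mem_rcons inE h1 orbT.
    by exists j; rewrite ?mem_rcons ?inE ?eqxx.
  case=> [h|/bigcupP[j']]; first by left; rewrite h.
  rewrite mem_rcons inE => /orP[/eqP -> h|h1 h2]; first by right; move: h; rewrite inE.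
  by left; apply/orP; right; apply/bigcupP; exists j'.
- by rewrite size_rcons t5; lia.
- by [].
- move=> j'; rewrite /unzip1 map_rcons mem_rcons inE => /orP[/eqP ->|/t7 [v v1 v2]].
    by exists z => //; lia.
  by exists v => //; lia.
Qed.

Lemma pass_traced l zV ps : traced zV ps ->
  let zV' := foldl (tstep H i M) zV l in exists ps', traced zV' ps' /\ (zV' = zV \/ M zV'.1 < M zV.1).
Proof.
elim: l zV ps => [|j l IH] zV ps td /=; first by exists ps; split => //; left.
have [ps1 [t1 le1]] := tstep_traced j td; have [ps2 [t2 le2]] := IH _ _ t1.
exists ps2; split => //; case: le2 => [->|le2]; first exact: le1.
by case: le1 => [e|le1]; right; [rewrite e in le2 *|lia].
Qed.

(** Some hyperedge leads one mark down, and the pass meets it unless it has moved lower before; thus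
    [ell] passes bring the mark to 1. *)
Lemma pass_progress zV ps : traced zV ps ->
  let zV' := foldl (tstep H i M) zV (down m) in exists ps', traced zV' ps' /\ M zV'.1 <= maxn 1 (M zV.1).-1.
Proof.
move=> td /=; have [ps' [t' le']] := pass_traced (down m) td; exists ps'; split => //.
case: le' => [e|]; last by lia.
have [z1|z1] := leqP (M zV.1) 1; first by rewrite e; lia.
have [a ea] : exists a, M zV.1 = a.+2 by exists (M zV.1).-2; lia.
have [j [ij zj [w wj mw]]] := mk_prev mk ea.
have lt l : j \in l -> M (foldl (tstep H i M) zV l).1 < M zV.1.
  case/splitPr => l1 l2; rewrite foldl_cat /=.
  have [ps1 [t1 le1]] := pass_traced l1 td; move: (foldl _ zV l1) t1 le1 => zV1 t1 le1.
  have [ps2 [t2 le2]] := tstep_traced j t1; have [ps3 [_ le3]] := pass_traced l2 t2.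
  have lt2 : M (tstep H i M zV1 j).1 < M zV.1.
    case: le1 => [e1|lt1]; last by case: le2 => [->|le2] //; apply: ltn_trans le2 lt1.
    rewrite e1 /tstep ij zj /=; have nx : nexts H M zV.1 j != [::] by apply/nextsP; exists w; split => //; lia.
    by rewrite nx; have [] := last_nexts nx; move: (last _ _) => w' /=; lia.
  by case: le3 => [->|le3] //; apply: ltn_trans le3 lt2.
by have := lt _ (mem_down j); lia.
Qed.

Lemma trace_path : 2 <= M z0 -> exists ps, [/\ hchain z0 ps, tip z0 ps = x, uniq (unzip1 ps),
  0 < size ps <= ell & (trace H ell i M z0 V0).2 = V0 :|: \bigcup_(j in unzip1 ps) E j].
Proof.
move=> m2; have gen q : exists ps, traced (iter q (fun p => foldl (tstep H i M) p (down m)) (z0, V0)) ps /\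
    M (iter q (fun p => foldl (tstep H i M) p (down m)) (z0, V0)).1 <= maxn 1 (M z0 - q).
  elim: q => [|q [ps [td le]]]; last first.
    have [ps' [td' le']] := pass_progress td; exists ps'; rewrite iterS; split => //.
    by move: le le'; move: (M _) (M _) => ? ?; lia.
  exists [::] => /=; split; last by lia.
  split => //=; [|by lia|by lia].
  by rewrite big1 ?setU0 // => j; rewrite inE.
have [ps [[t1 t2 t3 t4 t5 t6 t7] le]] := gen ell; rewrite -/(trace H ell i M z0 V0) in t2 t4 t5 t6 t7 le.
have e1 : M (trace H ell i M z0 V0).1 = 1 by have := mk_le mk z0; lia.
exists ps; split => //.
- by rewrite t2; apply/eqP; rewrite -(mk_root mk) e1.
- by have := mk_le mk z0; rewrite t5 e1; lia.
Qed.

End Search.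

Section Pre.
Variables (n m k : nat) (H : hypergraph n m k) (ell : nat) (i : 'I_m).
Local Notation E := (fun j => [set v in H j]).
Variable o : {ffun 'I_m -> k.-tuple 'I_n * bool}.
Hypothesis ho : forall j, (o j).1 = H j.
Local Notation hchain := (chain_of o (@inc n k) [set j : 'I_m | i < j]).

Lemma visits (M : {ffun 'I_n -> nat}) V l : let p := foldl (visit H ell i M) (false, V) l in
  if p.1 then exists2 b, 2 <= M (tnth (H i) b) & p.2 = (trace H ell i M (tnth (H i) b) V).2
  else p.2 = V /\ {in l, forall b, M (tnth (H i) b) < 2}.
Proof.
elim/last_ind: l => [|l b IH] //=; rewrite foldl_rcons; move: IH => /=.
case: (foldl _ _ _) => -[] V' /=; first by rewrite /visit.
case=> -> h; rewrite /visit /=; case hb: (1 < M (tnth (H i) b)) => /=; first by exists b.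
by split => // b'; rewrite mem_rcons inE => /orP[/eqP ->|/h] //; rewrite ltnNge hb.
Qed.

Lemma visits_true (M : {ffun 'I_n -> nat}) V l : foldl (visit H ell i M) (true, V) l = (true, V).
Proof. by elim: l. Qed.

Lemma pre_cases : let p := pre H ell i in
  if p.1 then exists a b, let M := bfs H ell i (tnth (H i) a) in
     2 <= M (tnth (H i) b) /\ p.2 = (trace H ell i M (tnth (H i) b) (E i)).2
  else p.2 = E i /\ forall a b, bfs H ell i (tnth (H i) a) (tnth (H i) b) < 2.
Proof.
rewrite /= /pre; set F := fun p a => _.
suff gen (l : seq 'I_k) : let p := foldl F (false, E i) l in if p.1 then exists a b, let M := bfs H ell i (tnth (H i) a) in
     2 <= M (tnth (H i) b) /\ p.2 = (trace H ell i M (tnth (H i) b) (E i)).2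
  else p.2 = E i /\ {in l, forall a b, bfs H ell i (tnth (H i) a) (tnth (H i) b) < 2}.
  have := gen (enum 'I_k); rewrite /=; case: ifP => // _ [-> h]; split => // a b; apply: h; exact: mem_enum.
elim/last_ind: l => [|l a IH] //=; rewrite foldl_rcons; move: IH => /=.
case: (foldl _ _ _) => -[] V' /=; first by rewrite /F visits_true.
case=> -> h; rewrite /F; have := visits (bfs H ell i (tnth (H i) a)) (E i) (enum 'I_k).
move: (foldl _ _ _) => q /=; case: (q.1) => [[b h1 h2]|[e h1]]; first by exists a, b.
split => // a'; rewrite mem_rcons inE => /orP[/eqP -> b|/h] //; apply: h1; exact: mem_enum.
Qed.

Lemma pre_noncloser : ~~ (pre H ell i).1 -> (pre H ell i).2 = E i /\
  forall x z ps, x \in E i -> z \in E i -> z != x -> hchain x ps -> tip x ps = z -> ell < size ps.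
Proof.
move=> /negbTE f; have := pre_cases; rewrite /= f => -[e h]; split => // x z ps.
rewrite !inE => /tnthP[a ->] /tnthP[b ->] zx ch tp.
exact: (unmarked_chain (bfs_marked H ell i (tnth (H i) a)) ho (h a b) zx ch tp).
Qed.

Lemma pre_closer : (pre H ell i).1 -> exists z x ps, [/\ z \in E i, x \in E i, hchain z ps, tip z ps = x & 
  [/\ uniq (unzip1 ps), 0 < size ps <= ell & (pre H ell i).2 = E i :|: \bigcup_(j in unzip1 ps) E j]].
Proof.
move=> f; have := pre_cases; rewrite /= f => -[a [b [h1 ->]]].
have [ps [p1 p2 p3 p4 ->]] := trace_path (bfs_marked H ell i (tnth (H i) a)) ho (E i) h1.
by exists (tnth (H i) b), (tnth (H i) a), ps; rewrite !inE !mem_tnth; split.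
Qed.

End Pre.

Local Open Scope ring_scope.

(** * Law of the output and its distance to the Gibbs measure *)

Section Law.
Variables (R : realType) (n m k : nat) (H : hypergraph n m k) (p : R).
Variables (ell Rb csw cR r : nat).
Hypotheses (p_ge0 : 0 <= p) (p_lt1 : p < 1).
Local Notation E := (fun j => [set v in H j]).
Implicit Types (s : spins n) (nu : spins n -> R) (V : {set 'I_n}) (i : 'I_m).

Definition upd_push i (x : 'I_n) nu := lazy_push p (upd_set H ell csw i x) nu.
Definition seqV V : seq 'I_n := [seq v <- down n | v \in V].
Definition block_push i q V nu := foldl (fun nu x => upd_push i x nu) nu (flatten (nseq q (seqV V))).

(** The semantics of the program transports test functions backwards, the analysis transports
    measures forwards; this lemma and the next ones exchange the two. *)
Lemma flip_dual i v nu g : \sum_s nu s * flip_op H ell csw p i v g s = \sum_s upd_push i v nu s * g s.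
Proof.
rewrite /flip_op /upd_push /lazy_push /push.
under eq_bigr do rewrite mulrDr mulrCA [X in _ + X]mulrCA.
under [RHS]eq_bigr do rewrite mulrDl -!mulrA.
rewrite !big_split /= -!mulr_sumr; congr (_ + _ * _).
under [RHS]eq_bigr do rewrite mulr_suml; rewrite [RHS]exchange_big /=; apply: eq_bigr => s _.
under [RHS]eq_bigr do rewrite mulr_suml; rewrite [RHS]exchange_big /= mulr_sumr; apply: eq_bigr => c _.
rewrite (bigD1 (flip_of s (upd_set H ell csw i v s c))) //= eqxx mulr1 big1 ?addr0 ?mulrA // => s' hs.
by rewrite eq_sym (negbTE hs) mulr0 mul0r.
Qed.

Lemma sweep_dual i V nu g : \sum_s nu s * sweep_op H ell csw p i V g s =
  \sum_s foldl (fun nu x => upd_push i x nu) nu (seqV V) s * g s.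
Proof.
rewrite /sweep_op /seqV; elim: (down n) nu => //= v l IH nu.
by case: ifP => _ //=; rewrite flip_dual IH.
Qed.

Lemma block_dual i q V nu g : \sum_s nu s * iter q (sweep_op H ell csw p i V) g s =
  \sum_s block_push i q V nu s * g s.
Proof.
rewrite /block_push; elim: q nu => //= q IH nu.
by rewrite sweep_dual foldl_cat IH.
Qed.

Definition ins_push (a : (spins n -> R) * nat) i :=
  let: (f, V) := pre H ell i in
  if f then (if (0 < a.2)%N then (block_push i Rb V a.1, a.2.-1) else a) else (block_push i (cR * ell) V a.1, a.2).

Lemma ins_dual i a g : \sum_s a.1 s * ins_op H ell Rb csw cR p i g (s, a.2) =
  \sum_s (ins_push a i).1 s * g (s, (ins_push a i).2).
Proof.
rewrite /ins_op /ins_push; case: a => nu b /=; case: (pre H ell i) => -[] V /=; last exact: block_dual.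
by case: ifP => _ //; apply: block_dual.
Qed.

Lemma law_dual l a g : \sum_s a.1 s * foldr (ins_op H ell Rb csw cR p) g l (s, a.2) =
  \sum_s (foldl ins_push a l).1 s * g (s, (foldl ins_push a l).2).
Proof. by elim: l a => //= i l IH a; rewrite ins_dual IH. Qed.

Definition out_law := (foldl ins_push (fun=> (2 ^+ n)^-1, Rb) (down m)).1.

Definition mko (c : {ffun 'I_m -> bool}) : {ffun 'I_m -> k.-tuple 'I_n * bool} := [ffun j => (H j, c j)].

Lemma mkoE c : (fun j => verts (mko c j)) = E.
Proof. by apply/funext => j; rewrite /verts ffunE. Qed.

Lemma mkoC c : [ffun j => (mko c j).2] = c.
Proof. by apply/ffunP => j; rewrite !ffunE. Qed.

(** Obstructions for a hyperedge closing no short cycle: two cycles, or one closed after at least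
    [ell] active steps. [B2] serves the closing ones: a short cycle of arbitrary, not necessarily
    active, hyperedges, followed by another cycle. *)
Definition B1 i s (o : {ffun 'I_m -> k.-tuple 'I_n * bool}) := two_clo s r [:: (i, o i)] o ||
  long_seg (act_of s) ell.-1 r [:: (i, o i)] (fun L => clo L (fun _ _ => true)) o.
Definition B2 i s (o : {ffun 'I_m -> k.-tuple 'I_n * bool}) := [exists l : 'I_ell,
  seg (@inc n k) l [:: (i, o i)] (vert [:: (i, o i)]) (fun L => clo L (one_clo s r)) o].

Definition above i : {set 'I_m} := [set j : 'I_m | (i < j)%N].
Definition from i : {set 'I_m} := [set j : 'I_m | (i <= j)%N].

Lemma fromE i : above i :|: [set i] = from i.
Proof. by apply/setP => j; rewrite !inE [RHS]leq_eqVlt orbC eq_sym. Qed.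

Lemma fromD i : from i :\ i = above i.
Proof. by apply/setP => j; rewrite !inE ltn_neqAle eq_sym. Qed.

Lemma card_edge (j : 'I_m) : (#|E j| <= k)%N.
Proof. by rewrite cardsE (leq_trans (card_size _)) ?size_tuple. Qed.

Lemma mem_lab i j : (j \in lab i) = (j \in from i).
Proof. by rewrite mem_filter mem_down andbT inE. Qed.

Lemma upd_set_cluster i x s c t : cluster_of E (from i) s c [set x] = rnd E s c (from i) [set x] t ->
  (t <= (nsw ell csw).+1)%N -> upd_set H ell csw i x s c = cluster_of E (from i) s c [set x].
Proof. by move=> h1 h2; apply: (iter_pass (mem_lab i) h1 h2). Qed.

Lemma seqV_mem V x : (x \in seqV V) = (x \in V).
Proof. by rewrite mem_filter mem_down andbT. Qed.

Lemma size_seqV V : size (seqV V) = #|V|.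
Proof.
rewrite cardE; apply/perm_size/uniq_perm; rewrite ?enum_uniq ?filter_uniq ?rev_uniq ?enum_uniq //.
by move=> x; rewrite seqV_mem mem_enum.
Qed.

(** A block of [q] hyperedges has at most [k * q] vertices, each costing a factor [2^-1], and at
    most [k * q] incidences, each costing a factor [1 - p]. *)
Lemma prod_still (C : {set 'I_m}) V q : V \subset \bigcup_(j in C) E j -> (#|C| <= q)%N ->
  (2^-1 * (1 - p)) ^+ (k * q) <= \prod_(y <- seqV V) still_wt E p C y.
Proof.
move=> VC Cq; have cV : (#|V| <= k * q)%N.
  apply: leq_trans (subset_leq_card VC) _; apply: (@leq_trans (k * #|C|)); last by rewrite leq_mul2l Cq orbT.
  rewrite mulnC -sum_nat_const; elim/big_ind2: _ => [|A a A' a' h1 h2|j _]; rewrite ?cards0 ?card_edge //.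
  by apply: leq_trans (leq_card_setU _ _) (leq_add h1 h2).
have cD : (\sum_(y <- seqV V) #|[set j in C | y \in E j]| <= k * q)%N.
  apply: (@leq_trans (\sum_(j in C) #|E j|)); last first.
    apply: leq_trans (_ : \sum_(j in C) k <= _)%N; first by apply: leq_sum => j _; apply: card_edge.
    by rewrite sum_nat_const mulnC leq_mul2l Cq orbT.
  have -> : (\sum_(j in C) #|E j| = \sum_y #|[set j in C | y \in E j]|)%N.
    rewrite (eq_bigr (fun j => \sum_y (y \in E j))%N) => [|j _]; last by rewrite -sum1_card big_mkcond; apply: eq_bigr => y _; case: (y \in E j).
    rewrite exchange_big /=; apply: eq_bigr => y _; rewrite -sum1_card [RHS]big_mkcond /= big_mkcond /=.
    by apply: eq_bigr => j _; rewrite !inE; case: (j \in C) => //=; case: (y \in H j).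
  rewrite /seqV big_filter; apply: leq_trans (_ : \sum_(y <- down n) #|[set j in C | y \in E j]| <= _)%N.
    by rewrite big_mkcond; apply: leq_sum => y _; case: ifP.
  by rewrite (perm_big (index_enum _)) ?leqnn // uniq_perm ?index_enum_uniq ?rev_uniq ?enum_uniq // => y; rewrite mem_down mem_index_enum.
have -> : \prod_(y <- seqV V) still_wt E p C y = 2^-1 ^+ #|V| * (1 - p) ^+ (\sum_(y <- seqV V) #|[set j in C | y \in E j]|)%N.
  rewrite /still_wt big_split /= -size_seqV; congr (_ * _).
    by rewrite big_const_seq count_predT -Monoid.iteropE.
  by elim: (seqV V) => [|y l IH]; rewrite ?big_nil ?expr0 // !big_cons IH exprD.
rewrite exprMn; apply: ler_pM; rewrite ?exprn_ge0 ?subr_ge0 ?(ltW p_lt1) ?invr_ge0 //.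
  by apply: ler_wiXn2l => //; rewrite ?invr_ge0 // invf_le1 ?ler1n.
apply: ler_wiXn2l; [by rewrite subr_ge0 ltW | by rewrite lerBlDr lerDl | exact: cD].
Qed.

Local Notation Bc := ((1 - p)^-1).

Definition bp i (B : 'I_m -> spins n -> {ffun 'I_m -> k.-tuple 'I_n * bool} -> bool) :=
  bad_prob E p (from i) (fun s c => B i s (mko c)).

Lemma block_error i (C : {set 'I_m}) V q a (B : 'I_m -> spins n -> {ffun 'I_m -> k.-tuple 'I_n * bool} -> bool) :
  i \in C -> V = \bigcup_(j in C) E j -> (#|C| <= q)%N ->
  (forall x s c, x \in V -> ~~ B i s (mko c) -> upd_set H ell csw i x s c = cluster_of E (from i) s c [set x] /\
     cluster_of E (from i) s c [set x] :&: V = cluster_of E C s c [set x] :&: V) ->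
  l1 (fun s => block_push i a V (gibbs E p (above i)) s - gibbs E p (from i) s) <=
   4 * Bc * ((a * (k * q))%:R * bp i B) + Bc * (1 - (2^-1 * (1 - p)) ^+ (k * q)) ^+ a.
Proof.
move=> iC VE Cq h.
have VC : V \subset \bigcup_(j in C) E j by rewrite VE.
have CV j : j \in C -> E j \subset V by move=> jC; rewrite VE; apply: bigcup_sup.
have cV : (#|V| <= k * q)%N.
  apply: leq_trans (subset_leq_card VC) _; apply: (@leq_trans (k * #|C|)); last by rewrite leq_mul2l Cq orbT.
  rewrite mulnC -sum_nat_const; elim/big_ind2: _ => [|A a' A' a'' h1 h2|j _]; rewrite ?cards0 ?card_edge //.
  by apply: leq_trans (leq_card_setU _ _) (leq_add h1 h2).
have h0 : 0 <= (2^-1 * (1 - p)) ^+ (k * q) by rewrite exprn_ge0 // mulr_ge0 ?invr_ge0 ?subr_ge0 ?(ltW p_lt1).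
have iJ : i \in from i by rewrite inE.
have := @insertion_error R n m E p p_ge0 p_lt1 (from i) C V i (seqV V) _ a (upd_set H ell csw i)
  (fun x s c => B i s (mko c)) iJ iC CV (seqV_mem V) h0 (prod_still VC Cq) h.
rewrite fromD /= => /le_trans; apply; rewrite lerD2r.
apply: ler_wpM2l; first by rewrite mulr_ge0 // invr_ge0 subr_ge0 ltW.
rewrite big_const_seq count_predT size_flatten /shape map_nseq sumn_nseq size_seqV iter_addr_0 -[leLHS]mulr_natl.
rewrite -/(bp i B); apply: ler_wpM2r; first exact: bad_prob_ge0.
by rewrite ler_nat mulnC leq_mul2l cV orbT.
Qed.

(** The block is the hyperedge alone, and the cluster inside it is one vertex or everything. In the
    second case there is nothing left to return to; in the first a return is excluded by
    [noncloser_return]. *)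
Lemma noncloser_error i a : (0 < ell)%N -> ((r + r).+4 <= nsw ell csw)%N -> ~~ (pre H ell i).1 ->
  l1 (fun s => block_push i a (pre H ell i).2 (gibbs E p (above i)) s - gibbs E p (from i) s) <=
   4 * Bc * ((a * (k * 1))%:R * bp i B1) + Bc * (1 - (2^-1 * (1 - p)) ^+ (k * 1)) ^+ a.
Proof.
move=> l0 hr f.
have hoE c j : (mko c j).1 = H j by rewrite ffunE.
have [VE _] := pre_noncloser (hoE [ffun=> false]) f.
apply: (@block_error i [set i]); rewrite ?cards1 ?set11 //; first by rewrite VE big_set1.
move=> x s c; rewrite VE => xi; rewrite /B1 negb_or => /andP[n1 n2].
have [_ nc] := pre_noncloser (hoE c) f.
have iO : i \notin above i by rewrite inE ltnn.
set A := cluster_of E [set i] s c [set x].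
have AE : A = [set x] \/ A = E i.
  rewrite /A clusterE_of /grow; set D := cluster_of _ _ _ _ _.
  case fi: (fires E s c D i).
    right; apply/setP => u; rewrite inE; apply/orP/idP => [[|/bigcupP[j /andP[]]]|h].
    - by move=> /set1P ->.
    - by move=> /set1P ->.
    - by right; apply/bigcupP; exists i; rewrite // inE eqxx fi.
  left; apply/setUidPl/subsetP => u /bigcupP[j /andP[/set1P ->]].
  by rewrite fi.
have sA : A \subset E i by case: AE => -> //; rewrite sub1set.
have str := @noncloser_structure n m k s (mko c) (above i) r i A iO.
have vi : verts (mko c i) = E i by rewrite /verts ffunE.
rewrite mkoE mkoC vi in str.
have [rA _] := str sA n1.
have ret : cluster_of E (above i) s c A :&: E i = A :&: E i.
  case: AE => AE; last by rewrite AE setIid; apply/setIidPr/sub_cluster.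
  rewrite AE; apply/setP => z; rewrite !inE; case: (boolP (z \in H i)) => zi; rewrite ?andbF ?andbT //.
  apply/idP/idP => [hz|/eqP ->]; last by apply: (subsetP (sub_cluster _ _ _ _ _)); rewrite inE.
  apply: contraLR hz => zx.
  have := @noncloser_return n m k s (mko c) (above i) r i x z ell iO; rewrite mkoE mkoC vi; apply => //.
  - by rewrite inE.
  - by move=> ps ch tp; apply: (nc x z ps xi) => //; rewrite inE.
have sC j : j \in [set i] -> E j \subset E i by rewrite inE => /eqP ->.
have cb := @cluster_block n m E s c (above i) [set i] (E i) x sC ret.
rewrite fromE -/A in cb.
have rb := @rnd_block n m E s c (above i) [set i] x 2 (r + r).+3; rewrite fromE -/A in rb.
have r2 := rnd_card E s c [set i] [set x]; rewrite cards1 -/A in r2.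
have {}rb := rb r2 rA (esym cb).
by split; [exact: upd_set_cluster rb hr | rewrite cb ret].
Qed.

Lemma eq_chain_inc c c' i v ps : chain_of (mko c) (@inc n k) (above i) v ps -> chain_of (mko c') (@inc n k) (above i) v ps.
Proof.
elim: ps v => //= -[j u] ps IH v; rewrite /inc /verts !ffunE /= => /andP[-> /IH ->].
by [].
Qed.

Lemma tip_vert (o : {ffun 'I_m -> k.-tuple 'I_n * bool}) O L v ps : v \in vert L -> chain_of o (@inc n k) O v ps -> tip v ps \in vert (expose o L ps).
Proof.
elim/last_ind: ps => [|ps [j u] _] // vL; rewrite chain_rcons => /andP[_ /and4P[_ _ uj _]].
rewrite vert_expose /tip /unzip2 map_rcons last_rcons; apply/orP; right.
by rewrite has_rcons /= uj.
Qed.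

Lemma path_seg i c z x ps (C : seq ('I_m * (k.-tuple 'I_n * bool)) -> {ffun 'I_m -> k.-tuple 'I_n * bool} -> bool) : let o := mko c in let L0 := [:: (i, o i)] in
  z \in E i -> x \in E i -> chain_of o (@inc n k) (above i) z ps -> tip z ps = x -> uniq (unzip1 ps) ->
  (0 < size ps <= ell)%N -> {in unzip1 ps, forall j : 'I_m, (i < j)%N} -> C (expose o L0 ps) o ->
  [exists l : 'I_ell, seg (@inc n k) l L0 (vert L0) (fun L => clo L C) o].
Proof.
move=> o L0 zi xi; case/lastP: ps => // p0 [j u] ch tp un sz psO oc.
have xu : x = u by rewrite -tp /tip /unzip2 map_rcons last_rcons.
move: ch; rewrite chain_rcons => /andP[ch /and4P[jO ij uj ut]].
move: un psO; rewrite /unzip1 map_rcons rcons_uniq -/(unzip1 _) => /andP[/= jn un] psO.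
have sp : (size p0 < ell)%N by move: sz; rewrite size_rcons.
apply/existsP; exists (Ordinal sp).
have ez : z \in vert L0 by rewrite /vert /= cats0 ffunE; move: zi; rewrite inE.
apply: (@chain_seg n m k o (@inc n k) (above i) _ z) => //.
- by move=> j' hj; rewrite inE; apply/negP => /eqP e; have := psO j'; rewrite mem_rcons inE hj orbT e ltnn => /(_ isT).
rewrite /clo; move: (ij); rewrite /inc inE => /tnthP[a1 e1]; move: (uj); rewrite inE => /tnthP[a2 e2].
apply/existsP; exists (a1, a2); apply/existsP; exists j; apply/and3P; split.
- rewrite expose_labels mem_cat mem_rev negb_or jn /= inE; apply/negP => /eqP e.
  by have := psO j; rewrite mem_rcons inE eqxx e ltnn => /(_ isT).
- rewrite /= -e1 -e2; apply/and3P; split; last 2 first.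
  + exact: tip_vert ch.
  + rewrite vert_expose; apply/orP; left; rewrite /vert /= cats0 ffunE.
    by rewrite -xu; move: xi; rewrite inE.
  + by apply: contra ut => /eqP e; rewrite e2 -e -e1.
- by move: oc; rewrite /expose foldl_rcons.
Qed.

Lemma chain_above i c v ps : chain_of (mko c) (@inc n k) (above i) v ps -> {in unzip1 ps, forall j : 'I_m, (i < j)%N}.
Proof.
elim: ps v => //= -[j u] ps IH v /andP[/and4P[h _ _ _] ch] j'; rewrite inE => /orP[/eqP ->|]; last exact: IH ch j'.
by move: h; rewrite inE.
Qed.

Lemma closer_seg i c : (pre H ell i).1 -> [exists l : 'I_ell,
  seg (@inc n k) l [:: (i, mko c i)] (vert [:: (i, mko c i)]) (fun L => clo L (fun _ _ => true)) (mko c)].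
Proof.
move=> f; have hoE j : (mko c j).1 = H j by rewrite ffunE.
have [z [x [ps [zi xi ch tp [un sz _]]]]] := pre_closer hoE f.
exact: path_seg zi xi ch tp un sz (chain_above ch) _.
Qed.

Lemma sweep_arith (a l b q : nat) : (a <= l.+1 -> l + b + 2 <= q -> a.+1 + b.+1 <= q.+1)%N.
Proof. lia. Qed.

(** The block also contains the path found by the search. Exposing it uses up the short cycle, and
    [closer_structure] applies to the remaining labels [O']. *)
Lemma closer_error i a : (ell + r + 2 <= nsw ell csw)%N -> (pre H ell i).1 ->
  l1 (fun s => block_push i a (pre H ell i).2 (gibbs E p (above i)) s - gibbs E p (from i) s) <=
   4 * Bc * ((a * (k * ell.+1))%:R * bp i B2) + Bc * (1 - (2^-1 * (1 - p)) ^+ (k * ell.+1)) ^+ a.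
Proof.
move=> hr f.
have hoE c j : (mko c j).1 = H j by rewrite ffunE.
have [z [x [ps [zi xi ch tp [un sz VE]]]]] := pre_closer (hoE [ffun=> false]) f.
pose C := i |: [set j in unzip1 ps].
have iC : i \in C by rewrite !inE eqxx.
have psO := chain_above ch.
have VC : (pre H ell i).2 = \bigcup_(j in C) E j.
  rewrite VE /C bigcup_setU big_set1; congr (_ :|: _).
  by apply/setP => v; apply/bigcupP/bigcupP => -[j]; rewrite ?inE => h1 h2; exists j; rewrite ?inE.
have cC : (#|C| <= ell.+1)%N.
  rewrite /C cardsU1 -add1n; apply: leq_add; first exact: leq_b1.
  by rewrite cardsE (leq_trans (card_size _)) // size_map; case/andP: sz.
apply: (block_error _ iC VC cC) => y s c yV nB.
set L0 := [:: (i, mko c i)]; set L := expose (mko c) L0 ps.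
have un0 : uniq (labels L).
  rewrite expose_labels cat_uniq rev_uniq un /= andbT orbF mem_rev.
  by apply/negP => /psO; rewrite ltnn.
have no : ~~ one_clo s r L (mko c).
  by apply: contra nB => oc; apply: path_seg zi xi (eq_chain_inc c ch) tp un sz psO oc.
pose O' := above i :\: [set j in unzip1 ps]; set V := (pre H ell i).2 in VE VC yV *.
have OC : O' :|: C = from i.
  apply/setP => j; rewrite !inE; case: (boolP (j \in unzip1 ps)) => [/psO h|_] /=; first by rewrite orbT ltnW.
  by rewrite orbF [RHS]leq_eqVlt orbC eq_sym.
have CV j : j \in C -> E j \subset V by move=> jC; rewrite VC; apply: bigcup_sup.
have VL v : (v \in V) = (v \in vert L).
  rewrite VE vert_expose /vert /= cats0 ffunE !inE; congr (_ || _).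
  apply/bigcupP/hasP => [[j /mapP[b bp ->]]|[b bp]]; rewrite ?ffunE ?inE => h.
    by exists b => //; rewrite /verts ffunE inE.
  exists b.1; first by apply: map_f.
  by rewrite inE.
set A := cluster_of E C s c [set y].
have sA : A \subset V by apply: cluster_subV.
have st := @closer_structure n m k s (mko c) O' r L A; rewrite mkoE mkoC in st.
have [|||rA ret] := st _ un0 _ _ no.
- by apply: realized_expose; rewrite /realized /= eqxx.
- by move=> v vA; rewrite -VL; apply: (subsetP sA).
- move=> j; rewrite !inE expose_labels mem_cat mem_rev inE negb_or => /andP[-> h].
  by apply/negP => /eqP e; rewrite e ltnn in h.
have rt : cluster_of E O' s c A :&: V = A :&: V.
  apply/setP => v; rewrite !inE; case: (boolP (v \in V)) => vV; rewrite ?andbF ?andbT //.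
  apply/idP/idP => [h|]; first by apply: ret => //; rewrite -VL.
  exact: (subsetP (sub_cluster _ _ _ _ _)).
have cb := @cluster_block n m E s c O' C V y CV rt; rewrite OC -/A in cb.
have rb := @rnd_block n m E s c O' C y #|C|.+1 r.+1; rewrite OC -/A in rb.
have {}rb := rb (rnd_card _ _ _ _ _) rA (esym cb).
by split; [exact: upd_set_cluster rb (sweep_arith cC hr) | rewrite cb rt].
Qed.

Lemma above_next (i : 'I_m) t : i = (m - t.+1)%N :> nat -> (t < m)%N ->
  above i = suffix_set m t /\ from i = suffix_set m t.+1.
Proof. by move=> e tm; split; apply/setP => j; rewrite !inE e; lia. Qed.

Lemma block_push_le i q V nu nu' :
  l1 (fun s => block_push i q V nu s - block_push i q V nu' s) <= l1 (fun s => nu s - nu' s).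
Proof.
rewrite /block_push; elim: (flatten _) nu nu' => //= x l IH nu nu'.
by apply: le_trans (IH _ _) _; apply: lazy_push_le.
Qed.

Definition ins_err i : R :=
  (4 * Bc * ((cR * ell * (k * 1))%:R * bp i B1) + Bc * (1 - (2^-1 * (1 - p)) ^+ (k * 1)) ^+ (cR * ell)) +
  (4 * Bc * ((Rb * (k * ell.+1))%:R * bp i B2) + Bc * (1 - (2^-1 * (1 - p)) ^+ (k * ell.+1)) ^+ Rb).

Lemma err_ge0 i (B : 'I_m -> spins n -> {ffun 'I_m -> k.-tuple 'I_n * bool} -> bool) a b q :
  0 <= 4 * Bc * (a%:R * bp i B) + Bc * (1 - (2^-1 * (1 - p)) ^+ q) ^+ b.
Proof.
have Bp : 0 <= Bc by rewrite invr_ge0 subr_ge0 ltW.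
apply: addr_ge0; first by rewrite !mulr_ge0 // bad_prob_ge0.
apply: mulr_ge0 => //; rewrite exprn_ge0 // subr_ge0 exprn_ile1 //; first by rewrite mulr_ge0 ?invr_ge0 ?subr_ge0 ?ltW.
by rewrite mulr_ile1 ?invr_ge0 ?subr_ge0 ?(ltW p_lt1) ?invf_le1 ?ler1n // lerBlDr lerDl.
Qed.

(** Insertions do not expand [l1], so their errors add up. The invariant that [Rb] is at most the
    remaining budget plus the closing hyperedges met so far shows that the budget is never exhausted
    too early. *)
Lemma out_law_error : (0 < ell)%N -> ((r + r).+4 <= nsw ell csw)%N -> (ell + r + 2 <= nsw ell csw)%N ->
  (#|[set i | (pre H ell i).1]| <= Rb)%N ->
  l1 (fun s => out_law s - gibbs E p setT s) <= \sum_i ins_err i.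
Proof.
move=> l0 h1 h2 hc; set Cl := [set i | _] in hc.
suff gen t : (t <= m)%N -> let a := foldl ins_push (fun=> (2 ^+ n)^-1, Rb) (take t (down m)) in
    l1 (fun s => a.1 s - gibbs E p (suffix_set m t) s) <= \sum_(i in suffix_set m t) ins_err i /\
    (Rb <= a.2 + #|Cl :&: suffix_set m t|)%N.
  have [] := gen m (leqnn m); rewrite take_oversize ?size_down //.
  have -> : suffix_set m m = setT by apply/setP => j; rewrite !inE subnn.
  by move=> h _; rewrite (eq_bigl (mem [set: 'I_m])) // => j; rewrite /= inE.
elim: t => [_|t IH tm] a.
  have e0 : suffix_set m 0 = set0.
    by apply/setP => j; rewrite !inE subn0 leqNgt ltn_ord.
  rewrite /a take0 /= e0 big_set0 setI0 cards0 addn0; split => //.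
  rewrite /l1 big1 // => s _; rewrite /gibbs /part_fun /gibbs_wt big_set0.
  under eq_bigr do rewrite big_set0.
  by rewrite sumr_const card_ffun card_bool card_ord natrX mul1r subrr normr0.
have [] := IH (ltnW tm); rewrite {}/a {IH}.
have it : (m - t.+1 < m)%N by lia.
pose i := Ordinal it.
have ni : nth i (down m) t = i.
  rewrite /down nth_rev ?size_enum_ord // -[X in nth _ _ X]/(nat_of_ord i); exact: nth_ord_enum.
rewrite (take_nth i) ?size_down // ni foldl_rcons.
move: (foldl _ _ _) => [nu b] /= e1 e2.
have [eA eF] := above_next (erefl (i : nat)) tm.
have iS : i \notin suffix_set m t by rewrite -eA inE ltnn.
have sS : suffix_set m t.+1 = i |: suffix_set m t by rewrite -eF -fromE eA setUC.
rewrite sS big_setU1 //= -sS -eF -eA in e1 e2 *.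
have tri q V x : l1 (fun s => block_push i q V (gibbs E p (above i)) s - gibbs E p (from i) s) <= x ->
    l1 (fun s => block_push i q V nu s - gibbs E p (from i) s) <= x + \sum_(j in above i) ins_err j.
  move=> hx; rewrite addrC; apply: le_trans (l1_triangle _ (block_push i q V (gibbs E p (above i))) _) _.
  by apply: lerD => //; apply: le_trans (block_push_le _ _ _ _ _) e1.
have cl : #|Cl :&: from i| = ((i \in Cl) + #|Cl :&: above i|)%N.
  rewrite eF sS -eA setIUr; case: (boolP (i \in Cl)) => hi; last first.
    have -> : Cl :&: [set i] = set0 by apply/setP => j; rewrite !inE; case: eqP => [->|]; rewrite ?andbF // andbT; move: hi; rewrite inE => /negbTE.
    by rewrite set0U.
  have -> : Cl :&: [set i] = [set i] by apply/setIidPr; rewrite sub1set.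
  by rewrite cardsU1 !inE ltnn andbF.
rewrite cl inE /ins_push; have nE := @noncloser_error i (cR * ell) l0 h1; have cE := @closer_error i Rb h2.
case ep: (pre H ell i) nE cE => [[] V] /= nE cE.
  have b0 : (0 < b)%N.
    have : (#|Cl :&: above i| < #|Cl|)%N.
      apply: (@leq_trans #|Cl :&: from i|); first by rewrite cl inE ep.
      by apply: subset_leq_card; apply: subsetIl.
    case: (posnP b) => // b0 h3; move: e2; rewrite b0 add0n => e2.
    by have := leq_ltn_trans e2 (leq_trans h3 hc); rewrite ltnn.
  rewrite b0 /=; split; last by move: e2 b0; lia.
  apply: tri; apply: le_trans (cE isT) _; rewrite /ins_err lerDr; exact: err_ge0.
by split => //; apply: tri; apply: le_trans (nE isT) _; rewrite /ins_err lerDl; apply: err_ge0.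
Qed.

End Law.

(** * Expected counts in the planted model *)

Section PlantedWeight.
Variables (R : realType) (k : nat) (p : R) (n m : nat).
Hypotheses (k_ge2 : (2 <= k)%N) (p_ge0 : 0 <= p) (p_lt1 : p < 1) (n_gt0 : (0 < n)%N).
Local Notation X := (k.-tuple 'I_n * bool)%type.
Local Notation W := {ffun 'I_m -> X}.
Local Notation kap := (kap k p).
Local Notation coinb b := (if b then p else 1 - p).
Implicit Types (s : spins n) (J : {set 'I_m}).

Let N0 : 0 < n%:R :> R. Proof. by rewrite ltr0n. Qed.
Let kap0 : 0 < kap := kap_gt0 k_ge2 p_ge0 p_lt1.

(* Law of a hyperedge with its coin when the labels in [J] are planted with [s]. *)
Definition pw J s (j : 'I_m) (x : X) : R :=
  (n%:R ^+ k)^-1 * (if j \in J then ft p s x.1 else 1) * coinb x.2.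

Lemma ft_ge0 s (t : k.-tuple 'I_n) : 0 <= ft p s t.
Proof. by rewrite /ft divr_ge0 ?(ltW kap0) //; case: (mono _ _); rewrite ?mulr1 ?mulr0 ?subr0 // subr_ge0 ltW. Qed.

Lemma ft_le s (t : k.-tuple 'I_n) : ft p s t <= kap^-1.
Proof.
rewrite /ft -[leRHS]mul1r ler_wpM2r ?invr_ge0 ?(ltW kap0) //; case: (mono _ _); by rewrite ?mulr1 ?mulr0 ?subr0 ?lerBlDr ?lerDl.
Qed.

Lemma coinb_ge0 (b : bool) : 0 <= coinb b.
Proof. by case: b; rewrite ?subr_ge0 ?(ltW p_lt1). Qed.

Lemma pw_ge0 J s j x : 0 <= pw J s j x.
Proof.
rewrite /pw mulr_ge0 ?coinb_ge0 // mulr_ge0 ?invr_ge0 ?exprn_ge0 ?(ltW N0) //.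
by case: ifP => // _; apply: ft_ge0.
Qed.

Lemma pw_mass J s j : \sum_x pw J s j x <= 1.
Proof.
rewrite (eq_bigr (fun x : X => pw J s j (x.1, x.2))) => [|[] //]; rewrite -(pair_bigA _ (fun t b => pw J s j (t, b))) /=.
have -> : \sum_t \sum_b pw J s j (t, b) = avg (fun t : k.-tuple 'I_n => if j \in J then ft p s t else 1).
  rewrite /avg card_tup // mulr_suml; apply: eq_bigr => t _; rewrite big_bool /pw /=; field.
  by rewrite expf_neq0 // lt0r_neq0.
case: (j \in J); first exact: avg_ft_le1.
by rewrite avg_const // card_tuple card_ord expn_gt0 n_gt0.
Qed.

Lemma pw_le J s j x : pw J s j x <= kap^-1 * ((n%:R ^+ k)^-1 * coinb x.2).
Proof.
rewrite /pw mulrAC [leRHS]mulrC ler_wpM2l ?mulr_ge0 ?coinb_ge0 ?invr_ge0 ?exprn_ge0 ?(ltW N0) //.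
case: ifP => _; first exact: ft_le.
by rewrite -[X in X <= _]invr1 lef_pV2 ?posrE //; have /andP[_] := kap_bound k_ge2 p_ge0 p_lt1.
Qed.

(** Bounding the planted density by [kap^-1] leaves independent uniform entries, and a product bound
    on the indicator factorizes over them. *)
Lemma pw_sum J s j (P : pred X) (g : bool -> R) (F : 'I_k -> 'I_n -> R) :
  (forall x, (P x)%:R <= g x.2 * \prod_b F b (tnth x.1 b)) ->
  \sum_(x | P x) pw J s j x <= kap^-1 * (p * g true + (1 - p) * g false) * \prod_b ((\sum_v F b v) / n%:R).
Proof.
move=> h; rewrite big_mkcond /=.
apply: (@le_trans _ _ (\sum_(x : X) kap^-1 * ((n%:R ^+ k)^-1 * coinb x.2) * (g x.2 * \prod_b F b (tnth x.1 b)))).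
  apply: ler_sum => x _; case: ifP => hx.
    apply: le_trans (pw_le J s j x) _; rewrite -[X in X <= _]mulr1; apply: ler_wpM2l.
      by rewrite !mulr_ge0 ?coinb_ge0 ?invr_ge0 ?exprn_ge0 ?(ltW N0) ?(ltW kap0).
    by have := h x; rewrite hx.
  apply: mulr_ge0; last by have := h x; rewrite hx.
  by rewrite !mulr_ge0 ?coinb_ge0 ?invr_ge0 ?exprn_ge0 ?(ltW N0) ?(ltW kap0).
rewrite -(pair_bigA _ (fun t b => kap^-1 * ((n%:R ^+ k)^-1 * coinb b) * (g b * \prod_b0 F b0 (tnth t b0)))) /=.
rewrite big_split /= -sum_tuple_prod.
have -> : \prod_(i < k) n%:R^-1 = (n%:R ^+ k)^-1 :> R by rewrite prodr_const card_ord exprVn.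
rewrite mulr_suml mulr_sumr; apply: ler_sum => t _; rewrite big_bool /=.
rewrite le_eqVlt; apply/orP; left; apply/eqP; ring.
Qed.

Lemma sum_delta (v : 'I_n) : \sum_u (u == v)%:R = 1 :> R.
Proof. by rewrite (bigD1 v) //= eqxx big1 ?addr0 // => u /negbTE ->. Qed.

Lemma sum_one : (\sum_(u : 'I_n) 1) / n%:R = 1 :> R.
Proof. by rewrite sumr_const card_ord divff // lt0r_neq0. Qed.

Lemma prod_delta (a : 'I_k) (t : k.-tuple 'I_n) (f : 'I_n -> bool) (g : 'I_n -> R) :
  f (tnth t a) -> (forall b, b != a -> g (tnth t b) = 1) ->
  \prod_b (if b == a then (f (tnth t b))%:R else g (tnth t b)) = 1.
Proof.
move=> h1 h2; apply: big1 => b _; case: eqP => [->|/eqP ba]; first by rewrite h1.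
exact: h2.
Qed.

Lemma inc_sum J s (a : 'I_k) (v : 'I_n) :
  \sum_j \sum_(x | (tnth x.1 a == v) && inc x v) pw J s j x <= m%:R / n%:R / kap.
Proof.
apply: (@le_trans _ _ (\sum_(j < m) kap^-1 / n%:R)); last by rewrite sumr_const card_ord -mulr_natl; rewrite le_eqVlt; apply/orP; left; apply/eqP; ring.
apply: ler_sum => j _.
apply: le_trans (@pw_sum J s j _ (fun=> 1) (fun b u => if b == a then (u == v)%:R else 1) _) _.
  move=> x; rewrite mul1r; case: (boolP (_ && _)) => [/andP[/eqP e _]|_].
    by rewrite (prod_delta (f := fun u => u == v) (g := fun=> 1)) ?e.
  by apply: prodr_ge0 => b _; case: ifP.
rewrite (bigD1 a) //= eqxx sum_delta big1 ?mulr1 => [|b ba]; last by rewrite (negbTE ba) sum_one.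
rewrite le_eqVlt; apply/orP; left; apply/eqP; ring.
Qed.

Lemma pair_sum J s (a a' : 'I_k) (v v' : 'I_n) : a != a' ->
  \sum_j \sum_(x | (tnth x.1 a == v) && (tnth x.1 a' == v')) pw J s j x <= m%:R / n%:R ^+ 2 / kap.
Proof.
move=> aa; apply: (@le_trans _ _ (\sum_(j < m) kap^-1 / n%:R ^+ 2)); last by rewrite sumr_const card_ord -mulr_natl; rewrite le_eqVlt; apply/orP; left; apply/eqP; ring.
apply: ler_sum => j _.
apply: le_trans (@pw_sum J s j _ (fun=> 1)
  (fun b u => if b == a then (u == v)%:R else if b == a' then (u == v')%:R else 1) _) _.
  move=> x; rewrite mul1r; case: (boolP (_ && _)) => [/andP[/eqP e /eqP e']|_].
    by rewrite big1 // => b _; case: eqP => [->|_]; [rewrite e eqxx | case: eqP => [->|//]; rewrite e' eqxx].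
  by apply: prodr_ge0 => b _; case: ifP => // _; case: ifP.
rewrite (bigD1 a) //= eqxx sum_delta (bigD1 a') 1?eq_sym //= (negbTE aa) eqxx sum_delta.
rewrite big1 ?mulr1 => [|b /andP[ba ba']]; last by rewrite (negbTE ba) (negbTE ba') sum_one.
by rewrite expr2 invfM; rewrite le_eqVlt; apply/orP; left; apply/eqP; ring.
Qed.

Local Notation sv := (spin_value R).

(** The vertex [v] itself is counted because a tuple may repeat it; the hypothesis [4 <= x * n%:R]
    absorbs this extra unit. *)
Lemma opp_count s (v : 'I_n) (x : R) : 4 <= x * n%:R -> `|mag R s| <= x / 2 * n%:R ->
  (\sum_u ((u == v) || (s u != s v))%:R) / n%:R <= (1 + x) / 2 :> R.
Proof.
move=> hx hm; rewrite ler_pdivrMr //.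
apply: (@le_trans _ _ (\sum_u ((u == v)%:R + (1 - sv (s v) * sv (s u)) / 2))).
  apply: ler_sum => u _; case: (u == v); case: (s u); case: (s v); rewrite /spin_value /=; lra.
rewrite big_split /= sum_delta -mulr_suml sumrB sumr_const card_ord -mulr_sumr -/(mag R s).
have : - (sv (s v) * mag R s) <= `|mag R s|.
  by rewrite (le_trans (ler_norm _)) // normrN normrM; case: (s v); rewrite /spin_value /= ?normrN normr1 mul1r.
move: (mag R s) hm hx => M hm hx hs; move: (sv (s v) * M) hs => y hs; lra.
Qed.

(** With [m / n] equal to [d / k], and summed over [k] positions of entry and [k.-1] exits, this is
    the branching number [d * k.-1%:R * theta] up to the loss [(1 + x) ^+ k.-1] caused by
    imbalance. *)
Lemma act_sum J s (x : R) (a : 'I_k) (v : 'I_n) : 0 <= x -> 4 <= x * n%:R -> `|mag R s| <= x / 2 * n%:R ->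
  \sum_j \sum_(y | (tnth y.1 a == v) && act_of s y v) pw J s j y <= m%:R / n%:R * (theta k p * (1 + x) ^+ k.-1).
Proof.
move=> x0 hx hm; apply: (@le_trans _ _ (\sum_(j < m) kap^-1 * p * (n%:R^-1 * ((1 + x) / 2) ^+ k.-1))); last first.
  rewrite sumr_const card_ord -[X in X <= _]mulr_natl expr_div_n /theta /qk; rewrite le_eqVlt; apply/orP; left; apply/eqP; ring.
apply: ler_sum => j _.
apply: le_trans (@pw_sum J s j _ (fun c => c%:R)
  (fun b u => if b == a then (u == v)%:R else ((u == v) || (s u != s v))%:R) _) _.
  move=> y; case: (boolP (_ && _)) => [/andP[/eqP e /and3P[-> _ /forallP h]]|_]; last first.
    by apply: mulr_ge0 => //; apply: prodr_ge0 => b _; case: ifP.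
  rewrite mul1r (prod_delta (f := fun u => u == v) (g := fun u => ((u == v) || (s u != s v))%:R)) ?e //= => b _.
  by have := h (tnth y.1 b); rewrite inE mem_tnth /=; case: eqP => //= _ ->.
rewrite mulr1 mulr0 addr0; apply: ler_wpM2l; first by rewrite mulr_ge0 ?invr_ge0 ?(ltW kap0).
rewrite (bigD1 a) //= eqxx sum_delta mul1r; apply: ler_wpM2l; first by rewrite invr_ge0 ltW.
apply: (@le_trans _ _ (\prod_(b < k | b != a) ((1 + x) / 2))).
  apply: ler_prod => b /negbTE ba; rewrite ba (opp_count v hx hm) andbT divr_ge0 ?(ltW N0) //.
  exact: sumr_ge0.
by rewrite prodr_const (eq_card (B := predC1 a)) ?cardC1 ?card_ord //.
Qed.

Definition joint (H : hypergraph n m k) (c : {ffun 'I_m -> bool}) : W := [ffun j => (H j, c j)].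

(** The Gibbs probability of [Q] multiplied by [part_fun] and divided by [2 ^+ n * kap ^+ #|J|].
    Without the partition function in the denominator, its average over hypergraphs is a product
    measure, accessible to [expo]. *)
Definition planted J (Q : spins n -> W -> bool) (H : hypergraph n m k) : R :=
  (2 ^+ n)^-1 * \sum_s \sum_c (kap ^+ #|J|)^-1 * gibbs_wt (fun j => [set v in H j]) p J s * coin_wt p c * (Q s (joint H c))%:R.

Lemma sum_joint (F : W -> R) : \sum_o F o = \sum_H \sum_c F (joint H c).
Proof.
rewrite pair_bigA /=; apply: (reindex (fun Hc => joint Hc.1 Hc.2)).
exists (fun o : W => ([ffun j => (o j).1], [ffun j => (o j).2])).
  by move=> [H c] _; congr pair; apply/ffunP => j; rewrite !ffunE.
by move=> o _; apply/ffunP => j; rewrite !ffunE; case: (o j).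
Qed.

Lemma avg_planted J Q : avg (planted J Q) = (2 ^+ n)^-1 * \sum_s expo (pw J s) [::] (Q s).
Proof.
rewrite /planted avgZ; congr (_ * _); rewrite avg_sum; apply: eq_bigr => s _.
rewrite /expo sum_joint /avg mulr_suml; apply: eq_bigr => H _; rewrite mulr_suml; apply: eq_bigr => c _.
rewrite mulr1 mulrAC; congr (_ * _).
rewrite card_ffun card_ord natrX card_tup /pw.
under [RHS]eq_bigl do rewrite in_nil.
under [RHS]eq_bigr do rewrite ffunE /=.
rewrite !big_split /= prodr_const card_ord -exprVn -/(coin_wt p c).
have -> : \prod_(j < m) (if j \in J then ft p s (H j) else 1) = (kap ^+ #|J|)^-1 * gibbs_wt (fun j => [set v in H j]) p J s.
  rewrite -big_mkcond /= /ft /gibbs_wt big_split /= prodr_const -exprVn mulrC; congr (_ * _).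
by ring.
Qed.

Lemma planted_ge0 J Q H : 0 <= planted J Q H.
Proof.
rewrite /planted mulr_ge0 ?invr_ge0 ?exprn_ge0 //; apply: sumr_ge0 => s _; apply: sumr_ge0 => c _.
rewrite !mulr_ge0 ?coin_wt_ge0 ?invr_ge0 ?exprn_ge0 ?(ltW kap0) //.
by apply/ltW/gibbs_wt_gt0.
Qed.

Lemma bad_prob_planted J Q (H : hypergraph n m k) (de : R) : 0 < de ->
  de * 2 ^+ n * kap ^+ #|J| <= part_fun (fun j => [set v in H j]) p J ->
  bad_prob (fun j => [set v in H j]) p J (fun s c => Q s (joint H c)) <= de^-1 * planted J Q H.
Proof.
move=> de0 hZ; rewrite /planted /bad_prob mulrA mulr_sumr; apply: ler_sum => s _; rewrite mulr_sumr; apply: ler_sum => c _.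
rewrite !mulrA; apply: ler_wpM2r => //; apply: ler_wpM2r; first exact: coin_wt_ge0.
rewrite /gibbs mulrC; apply: ler_wpM2r; first by apply/ltW/gibbs_wt_gt0.
rewrite -!invfM lef_pV2 ?posrE; first by apply: le_trans hZ; rewrite le_eqVlt; apply/orP; left; apply/eqP; ring.
  exact: part_fun_gt0.
by rewrite !mulr_gt0 ?exprn_gt0.
Qed.

(* [expR y >= y ^+ 2 / 2] turns the Gaussian tail into an inverse square. *)
Lemma unbalanced_count (x : R) : 0 < x ->
  (2 ^+ n)^-1 * \sum_(s : spins n | x / 2 * n%:R < `|mag R s|) 1 <= 4 ^+ 5 * expR (1 / 2) / (x ^+ 4 * n%:R ^+ 2).
Proof.
move=> x0; have := @exp_mag R n (1 / 4) n_gt0; have -> : 1 / 4 / (1 - 2 * (1 / 4)) = 1 / 2 :> R by field.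
move=> hE0; have hE := hE0 ltac:(by rewrite divr_gt0) ltac:(by rewrite ltr_pdivrMr // mulrAC ltr_pdivlMr // !mul1r ltr_nat); move: hE0 => _; pose y := 1 / 4 * (x / 2) ^+ 2 * n%:R.
have y0 : 0 < y by rewrite !mulr_gt0 ?exprn_gt0 ?divr_gt0.
have ey : y ^+ 2 / 4 <= expR y.
  have h0 : y / 2 + 1 <= expR (y / 2) by rewrite addrC; apply: expR_ge1Dx.
  have -> : expR y = expR (y / 2) * expR (y / 2) by rewrite -expRD; congr expR; field.
  apply: le_trans (_ : (y / 2 + 1) * (y / 2 + 1) <= _); first by nra.
  by apply: ler_pM => //; lra.
have : (y ^+ 2 / 4) * \sum_(s : spins n | x / 2 * n%:R < `|mag R s|) 1 <= 2 ^+ n * expR (1 / 2).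
  apply: le_trans hE; rewrite mulr_sumr big_mkcond /=; apply: ler_sum => s _; case: ifP => hs; last exact: expR_ge0.
  rewrite mulr1; apply: le_trans ey _; rewrite ler_expR /y -mulrA; apply: ler_wpM2l; first by lra.
  rewrite -[leRHS]/(mag R s ^+ 2 / n%:R) ler_pdivlMr // -mulrA -expr2 -exprMn -[leRHS]real_normK ?num_real //.
  by rewrite ler_sqr ?nnegrE ?normr_ge0 ?(ltW hs) // mulr_ge0 ?divr_ge0 ?(ltW x0) ?(ltW N0).
set S := \sum_(s | _) _; move=> hS.
have P0 : 0 < 2 ^+ n :> R by rewrite exprn_gt0.
rewrite mulrC ler_pdivrMr // mulrAC ler_pdivlMr ?mulr_gt0 ?exprn_gt0 //.
have e : x ^+ 4 * n%:R ^+ 2 = 4 ^+ 5 * (y ^+ 2 / 4) by rewrite /y; field.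
rewrite {}e; clearbody y S; clear hE ey.
have h1024 : 0 <= 4 ^+ 5 :> R by rewrite exprn_ge0.
have := ler_wpM2l h1024 hS => h.
by apply: le_trans (le_trans _ h) _; rewrite le_eqVlt; apply/orP; left; apply/eqP; ring.
Qed.

End PlantedWeight.

Section Families.
Variables (R : realType) (n m k : nat) (w : 'I_m -> (k.-tuple 'I_n * bool) -> R).
Local Notation X := (k.-tuple 'I_n * bool)%type.
Local Notation W := {ffun 'I_m -> X}.
Hypotheses (w_ge0 : forall j x, 0 <= w j x) (w_mass : forall j, \sum_x w j x <= 1).
Variables (s : spins n) (r ell : nat) (al alF ga be : R).
Local Notation rho := (k.-1%:R * k%:R * al).
Local Notation rhoF := (k.-1%:R * k%:R * alF).
Local Notation N := (4 * r + ell + 3)%N.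
Hypotheses (al_ge0 : 0 <= al) (alF_ge0 : 0 <= alF) (ga_ge0 : 0 <= ga) (be_ge0 : 0 <= be) (rho_lt1 : rho < 1).
Hypothesis actP : forall (a : 'I_k) (v : 'I_n), \sum_j \sum_(x | (tnth x.1 a == v) && act_of s x v) w j x <= al.
Hypothesis incP : forall (a : 'I_k) (v : 'I_n), \sum_j \sum_(x | (tnth x.1 a == v) && inc x v) w j x <= alF.
Hypothesis pairP : forall (a a' : 'I_k) (v v' : 'I_n), a != a' ->
  \sum_j \sum_(x | (tnth x.1 a == v) && (tnth x.1 a' == v')) w j x <= ga.
Hypothesis beP : (k * N * k)%:R * al * rho ^+ r <= be.
Implicit Types (L : seq ('I_m * X)) (C : seq ('I_m * X) -> W -> bool).

(** [fu] is the cost of a short active chain, [fq] counts the ways of closing a cycle, [f1] bounds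
    one cycle, and [fF] the free paths, exponentially many in [ell]. The exposures stay within [N]:
    at most four chains of length [r], a free path shorter than [ell], the root and the closing
    hyperedges. *)
Definition fu := 1 + (k * N * k)%:R * al / (1 - rho).
Definition fq : R := (k * k * (k * N) ^ 2)%:R.
Definition f1 := be + fu * (be + fu * (fq * ga)).
Definition fF : R := (1 + (k * k)%:R * alF) * (1 + rhoF) ^+ ell.

Lemma fu_ge1 : 1 <= fu.
Proof. by rewrite lerDl divr_ge0 ?mulr_ge0 // subr_ge0 ltW. Qed.

Lemma f1_ge0 : 0 <= f1.
Proof.
have fu0 : 0 <= fu := le_trans ler01 fu_ge1.
apply: addr_ge0 => //; apply: mulr_ge0 => //; apply: addr_ge0 => //; apply: mulr_ge0 => //.
by apply: mulr_ge0.
Qed.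

Lemma rch_le N1 L C b : 0 <= b -> uniq (labels L) -> (size L + r <= N1)%N -> (N1 <= N)%N ->
  (forall L', uniq (labels L') -> (size L' <= N1)%N -> expo w L' (C L') <= b) ->
  expo w L (rch (act_of s) r L C) <= be + fu * b.
Proof.
move=> b0 un sz N1N hC; apply: le_trans (expo_rch w_ge0 w_mass al_ge0 actP rho_lt1 b0 un sz hC) _.
have mono (c : R) : 0 <= c -> (k * N1 * k)%:R * c <= (k * N * k)%:R * c.
  by move=> c0; apply: ler_wpM2r => //; rewrite ler_nat leq_mul2r leq_mul2l N1N !orbT.
have r0 : 0 <= rho by rewrite !mulr_ge0.
apply: lerD.
  apply: le_trans beP; rewrite -[leLHS]mulrA -[leRHS]mulrA; apply: mono.
  by apply: mulr_ge0 => //; apply: exprn_ge0.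
apply: ler_wpM2r => //; rewrite lerD2l -[leLHS]mulrA -[leRHS]mulrA; apply: mono.
by rewrite mulr_ge0 // invr_ge0 subr_ge0 ltW.
Qed.

Lemma clo_le N1 L C b : 0 <= b -> uniq (labels L) -> (size L < N1)%N -> (N1 <= N)%N ->
  (forall L', uniq (labels L') -> (size L' <= N1)%N -> expo w L' (C L') <= b) ->
  expo w L (clo L C) <= fq * ga * b.
Proof.
move=> b0 un sz N1N hC; apply: le_trans (expo_clo w_ge0 b0 ga_ge0 un sz pairP hC) _.
apply: ler_wpM2r => //; apply: ler_wpM2r => //; rewrite ler_nat leq_mul2l leq_exp2r // leq_mul2l N1N.
by rewrite !orbT.
Qed.

Lemma clo_true_le L : uniq (labels L) -> (size L < N)%N ->
  expo w L (clo L (fun _ _ => true)) <= fq * ga.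
Proof.
move=> un sz; rewrite -[leRHS]mulr1; apply: clo_le un sz (leqnn _) _ => // L' un' _.
exact: expo_le1.
Qed.

Lemma fqga_ge0 : 0 <= fq * ga. Proof. by rewrite mulr_ge0. Qed.

Lemma one_clo_le L : uniq (labels L) -> (size L + (r + r) < N)%N -> expo w L (one_clo s r L) <= f1.
Proof.
move=> un sz; apply: (@rch_le (size L + r)) => //; [|by move: sz; clear; lia|].
  by rewrite addr_ge0 // mulr_ge0 ?fqga_ge0 // (le_trans ler01 fu_ge1).
move=> L1 un1 sz1; apply: (@rch_le (size L1 + r)) => //; [exact: fqga_ge0|by move: sz sz1; clear; lia|].
by move=> L2 un2 sz2; apply: clo_true_le => //; move: sz sz1 sz2; clear; lia.
Qed.

Lemma two_clo_le L : uniq (labels L) -> size L = 1%N ->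
  expo w L (two_clo s r L) <= be + fu * (be + fu * (fq * ga * f1)).
Proof.
move=> un sz; have fu0 : 0 <= fu := le_trans ler01 fu_ge1.
have q0 : 0 <= fq * ga * f1 by rewrite mulr_ge0 ?fqga_ge0 ?f1_ge0.
apply: (@rch_le (1 + r)) => //; [|by rewrite sz|by clear; lia|].
  by rewrite addr_ge0 // mulr_ge0.
move=> L1 un1 sz1; apply: (@rch_le (1 + r + r)) => //; [by move: sz1; clear; lia|by clear; lia|].
move=> L2 un2 sz2; apply: (@clo_le (2 + r + r)) => //; [exact: f1_ge0|by clear; lia|].
by move=> L3 un3 sz3; apply: one_clo_le => //; move: sz3; clear; lia.
Qed.

Lemma long_seg_le L : uniq (labels L) -> size L = 1%N ->
  expo w L (long_seg (act_of s) ell.-1 r L (fun L => clo L (fun _ _ => true))) <=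
  (k * N * k)%:R * al * r.+1%:R * rho ^+ ell.-1 * (fq * ga).
Proof.
move=> un sz; have r0 : 0 <= rho by rewrite !mulr_ge0.
have sz1 : (size L + r <= 1 + r)%N by rewrite sz.
apply: le_trans (expo_long_seg w_ge0 al_ge0 actP rho_lt1 ell.-1 fqga_ge0 un sz1 _) _.
  by move=> L' un' sz'; apply: clo_true_le => //; move: sz'; clear; lia.
apply: ler_wpM2r; first exact: fqga_ge0.
apply: ler_wpM2r; first by rewrite exprn_ge0.
apply: ler_wpM2r => //; apply: ler_wpM2r => //.
rewrite ler_nat leq_mul2r leq_mul2l; apply/orP; right; apply/orP; right; clear; lia.
Qed.

Lemma seg_inc_le L C (b : R) : 0 <= b -> uniq (labels L) -> size L = 1%N ->
  (forall L', uniq (labels L') -> (size L' <= ell)%N -> expo w L' (C L') <= b) ->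
  expo w L (fun o => [exists l : 'I_ell, seg (@inc n k) l L (vert L) C o]) <= ell%:R * fF * b.
Proof.
move=> b0 un sz hC; have r0 : 0 <= rhoF by rewrite !mulr_ge0.
apply: le_trans (expo_exists w_ge0 _ _) _.
have -> : ell%:R * fF * b = \sum_(l < ell) fF * b by rewrite sumr_const card_ord -[RHS]mulr_natl mulrA.
apply: ler_sum => l _; apply: le_trans (expo_seg w_ge0 alF_ge0 incP (l := l) (vert L) b0 un _) _.
  by move=> L' un' sz'; apply: hC => //; rewrite sz' sz; have := ltn_ord l; clear; lia.
apply: ler_wpM2r => //; rewrite /fF.
have F1 a : 1 <= (1 + rhoF) ^+ a by rewrite exprn_ege1 // lerDl.
have k0 : 0 <= (k * k)%:R * alF by rewrite mulr_ge0.
case: l => -[|l] /= hl; first by rewrite -[X in X <= _]mulr1 ler_pM // lerDl.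
rewrite size_vert sz muln1; apply: ler_pM => //; [by rewrite exprn_ge0|by rewrite lerDr|].
apply: (@le_trans _ _ ((1 + rhoF) ^+ l)); first by rewrite lerXn2r ?nnegrE ?addr_ge0 // lerDr.
by apply: ler_weXn2l; [rewrite lerDl | move: hl; clear; lia].
Qed.

Lemma bad2_le L : uniq (labels L) -> size L = 1%N ->
  expo w L (fun o => [exists l : 'I_ell, seg (@inc n k) l L (vert L) (fun L => clo L (one_clo s r)) o])
   <= ell%:R * fF * (fq * ga * f1).
Proof.
move=> un sz; apply: seg_inc_le => //; first by rewrite mulr_ge0 ?fqga_ge0 ?f1_ge0.
move=> L' un' sz'; apply: (@clo_le ell.+1) => //; [exact: f1_ge0|by clear; lia|].
by move=> L3 un3 sz3; apply: one_clo_le => //; move: sz3; clear; lia.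
Qed.

Lemma closer_le L : uniq (labels L) -> size L = 1%N ->
  expo w L (fun o => [exists l : 'I_ell, seg (@inc n k) l L (vert L) (fun L => clo L (fun _ _ => true)) o])
   <= ell%:R * fF * (fq * ga).
Proof.
move=> un sz; apply: seg_inc_le => //; first exact: fqga_ge0.
by move=> L' un' sz'; apply: clo_true_le => //; move: sz'; clear; lia.
Qed.

Lemma rooted_le (i : 'I_m) (Q : seq ('I_m * X) -> W -> bool) (b : R) : 0 <= b ->
  (forall L, uniq (labels L) -> size L = 1%N -> expo w L (Q L) <= b) ->
  expo w [::] (fun o => Q [:: (i, o i)] o) <= b.
Proof.
move=> b0 h; apply: (expo_root w_ge0 w_mass (i := i) b0) => x.
apply: le_trans (_ : expo w [:: (i, x)] (Q [:: (i, x)]) <= _); last exact: h.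
by apply: (expo_mono w_ge0) => o; rewrite /realized /= andbT => /eqP <-.
Qed.

End Families.

Import numFieldNormedType.Exports.

(** * Powers, and bounds up to powers of the logarithm *)

Section Powers.
Variable R : realType.
Implicit Types (x y t e : R).

Lemma pow_small x e : 0 <= x -> x < 1 -> 0 < e -> exists N, forall q, (N <= q)%N -> x ^+ q <= e.
Proof.
move=> x0 x1 e0.
have h : `|x| < 1 by rewrite ger0_norm.
have /cvgrPdist_le /(_ e e0) [N _ hN] := cvg_expr h.
exists N => q Nq; have := hN q Nq; rewrite /= sub0r normrN ger0_norm //; exact: exprn_ge0.
Qed.

Lemma pow_large y : exists g, y <= 2 ^+ g.
Proof.
have [y0|y0] := lerP y 1; first by exists 0%N; rewrite expr0.
have y00 : 0 < y by apply: lt_trans y0.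
have i0 : 0 < y^-1 by rewrite invr_gt0.
have [||N hN] := @pow_small 2^-1 (y^-1) _ _ i0; [by rewrite invr_ge0|by rewrite invf_lt1 ?ltr1n|].
exists N; have := hN N (leqnn N); rewrite exprVn lef_pV2 ?posrE ?exprn_gt0 //.
Qed.

Lemma linear_pow t q : 0 <= t -> t <= 1 -> q.+1%:R * (1 - t) * t ^+ q + t ^+ q.+1 <= 1.
Proof.
move=> t0 t1; elim: q => [|q IH]; first by rewrite expr0 expr1; rewrite le_eqVlt; apply/orP; left; apply/eqP; ring.
have -> : q.+2%:R * (1 - t) * t ^+ q.+1 + t ^+ q.+2 =
   t * (q.+1%:R * (1 - t) * t ^+ q + t ^+ q.+1) + (1 - t) * t ^+ q.+1.
  by rewrite -[q.+2%:R]natr1 !exprS; ring.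
have h1 : t * (q.+1%:R * (1 - t) * t ^+ q + t ^+ q.+1) <= t by rewrite -[leRHS]mulr1 ler_wpM2l.
have h2 : (1 - t) * t ^+ q.+1 <= 1 - t by rewrite -[leRHS]mulr1 ler_wpM2l ?subr_ge0 // exprn_ile1.
by apply: le_trans (lerD h1 h2) _; rewrite addrC subrK.
Qed.

(** Each factor [q.+1] is paid for by replacing the base with its square root, through
    [linear_pow]. *)
Lemma poly_pow a x : 0 <= x -> x < 1 -> exists C y, [/\ 0 <= C, 1 / 2 <= y, y < 1 &
  forall q, q.+1%:R ^+ a * x ^+ q <= C * y ^+ q].
Proof.
move=> x0 x1; elim: a => [|a [C [y [C0 y0 y1 h]]]].
  exists 1, (Num.max x (1 / 2)); split => //; rewrite ?le_max ?lexx ?orbT //.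
    by rewrite gt_max x1 /= ltr_pdivrMr // mul1r ltr1n.
  by move=> q; rewrite expr0 !mul1r lerXn2r ?nnegrE ?le_max ?x0 ?lexx.
have yy : 0 <= y by apply: le_trans y0; rewrite divr_ge0.
pose t := Num.sqrt y; have t0 : 0 <= t := sqrtr_ge0 y.
have tt : t ^+ 2 = y by rewrite sqr_sqrtr.
have t1 : t < 1 by rewrite -[ltRHS](@sqrtr1 R) ltr_sqrt.
have ty : y <= t by rewrite -tt expr2 -[leRHS]mulr1 ler_wpM2l // ltW.
exists (C / (1 - t)), t; split => //; [by rewrite divr_ge0 // subr_ge0 ltW | exact: le_trans ty |].
move=> q; rewrite exprS -mulrA; apply: le_trans (ler_wpM2l _ (h q)) _ => //.
rewrite -tt -exprM mulnC exprM expr2 [q.+1%:R * _]mulrCA -[C / _ * _]mulrA; apply: ler_wpM2l => //.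
rewrite mulrA; apply: ler_wpM2r; first exact: exprn_ge0.
rewrite -[leRHS]mul1r ler_pdivlMr ?subr_gt0 // mulrAC.
by apply: le_trans (linear_pow q t0 (ltW t1)); rewrite lerDl exprn_ge0.
Qed.

Lemma pow_decay (h : R) q : 0 <= h -> h <= 1 -> (1 - h) ^+ q * (1 + q%:R * h) <= 1.
Proof.
move=> h0 h1; elim: q => [|q IH]; first by rewrite expr0 mul0r addr0 mulr1.
apply: le_trans IH; rewrite exprSr -mulrA; apply: ler_wpM2l; first by rewrite exprn_ge0 // subr_ge0.
rewrite -[q.+1%:R]natr1; have q0 : 0 <= q%:R :> R by []; have : 0 <= q%:R * h by rewrite mulr_ge0.
move: (q%:R) q0 => y y0 yh; nra.
Qed.

End Powers.

Section Bounds.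
Variable R : realType.
Implicit Types (f g : nat -> nat -> R).

(** Order [log^a n / n^b], with [ell] in the role of the logarithm and one constant for all [n] and
    [ell]. *)
Definition bnd (a b : nat) f := exists c : R, 0 <= c /\
  forall n ell, (0 < n)%N -> 0 <= f n ell <= c * ell.+1%:R ^+ a * n%:R^-1 ^+ b.

Let T1 ell a : 1 <= ell.+1%:R ^+ a :> R. Proof. by rewrite exprn_ege1 // ler1n. Qed.

Lemma bndM a b a' b' f g : bnd a b f -> bnd a' b' g -> bnd (a + a') (b + b') (fun n ell => f n ell * g n ell).
Proof.
move=> [c [c0 hc]] [c' [c0' hc']]; exists (c * c'); split; first exact: mulr_ge0.
move=> n ell n0; have /andP[f0 f1] := hc n ell n0; have /andP[g0 g1] := hc' n ell n0.
rewrite mulr_ge0 //=; apply: le_trans (ler_pM f0 g0 f1 g1) _; rewrite !exprD.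
by rewrite le_eqVlt; apply/orP; left; apply/eqP; ring.
Qed.

Lemma bndD a b f g : bnd a b f -> bnd a b g -> bnd a b (fun n ell => f n ell + g n ell).
Proof.
move=> [c [c0 hc]] [c' [c0' hc']]; exists (c + c'); split; first exact: addr_ge0.
move=> n ell n0; have /andP[f0 f1] := hc n ell n0; have /andP[g0 g1] := hc' n ell n0.
by rewrite addr_ge0 //= !mulrDl lerD.
Qed.

Lemma bndW a b a' b' f : (a <= a')%N -> (b' <= b)%N -> bnd a b f -> bnd a' b' f.
Proof.
move=> aa bb [c [c0 hc]]; exists c; split => // n ell n0; have /andP[f0 f1] := hc n ell n0; rewrite f0 /=.
apply: le_trans f1 _; have i0 : 0 <= n%:R^-1 :> R by rewrite invr_ge0.
apply: ler_pM; rewrite ?mulr_ge0 ?exprn_ge0 //.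
  by apply: ler_wpM2l => //; apply: ler_weXn2l => //; rewrite ler1n.
by apply: ler_wiXn2l => //; rewrite invf_le1 ?ltr0n // ler1n.
Qed.

Lemma bnd_const c : 0 <= c -> bnd 0 0 (fun _ _ => c).
Proof. by move=> c0; exists c; split => // n ell _; rewrite !expr0 !mulr1 c0 lexx. Qed.

Lemma bnd_nat (u : nat -> nat) C : (forall ell, (u ell <= C * ell.+1)%N) -> bnd 1 0 (fun _ ell => (u ell)%:R).
Proof.
move=> h; exists C%:R; split => // n ell _; rewrite expr1 expr0 mulr1 ler0n /= -natrM ler_nat; exact: h.
Qed.

Lemma bnd_inv : bnd 0 1 (fun n _ => n%:R^-1).
Proof. by exists 1; split => // n ell n0; rewrite expr0 expr1 !mul1r lexx invr_ge0 ler0n. Qed.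

End Bounds.

Section Expectations.
Variables (R : realType) (k : nat) (p d : R).
Hypotheses (k_ge2 : (2 <= k)%N) (p_ge0 : 0 <= p) (p_lt1 : p < 1) (d_gt0 : 0 < d).
Local Notation kap := (kap k p).
Variables (x : R) (Kr q0 : nat).
Hypotheses (x_gt0 : 0 < x).
Local Notation Q := (2 ^ q0)%N.
(** [A] stands for active: chains multiply by [rhoA < 1]. [I] stands for mere incidence: paths of
    the search ignore spins and coins and multiply by up to [FI >= 1]. *)
Definition alA := d / k%:R * (theta k p * (1 + x) ^+ k.-1).
Definition alI := d / k%:R / kap.
Definition rhoA := k.-1%:R * k%:R * alA.
Definition FI := 1 + k.-1%:R * k%:R * alI.
Hypotheses (rho_lt1 : rhoA < 1) (KrP : rhoA ^+ Kr <= (Q%:R ^+ 2)^-1).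

Let kap0 : 0 < kap := kap_gt0 k_ge2 p_ge0 p_lt1.
Let alA0 : 0 <= alA.
Proof.
apply: mulr_ge0; first by rewrite divr_ge0 // ltW.
by apply: mulr_ge0; [exact: theta_ge0|rewrite exprn_ge0 // addr_ge0 // ltW].
Qed.
Let alI0 : 0 <= alI. Proof. by rewrite !divr_ge0 // ltW. Qed.
Let rho0 : 0 <= rhoA. Proof. by apply: mulr_ge0. Qed.
Lemma FI_ge1 : 1 <= FI. Proof. by rewrite lerDl; apply: mulr_ge0. Qed.

Local Notation rr ell := (Kr * ell)%N.
Local Notation NN ell := (4 * (Kr * ell) + ell + 3)%N.
Definition gaf (n ell : nat) : R := alI * n%:R^-1.
Definition bef (n ell : nat) : R := (k * NN ell * k)%:R * alA * (Q%:R ^+ 2 * n%:R^-1 ^+ 2).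

Lemma bnd_kNk : bnd 1 0 (fun _ ell => (k * NN ell * k)%:R : R).
Proof. by apply: (@bnd_nat R _ ((k * k * (4 * Kr + 4))%N)) => ell; nia. Qed.

Lemma bnd_kN : bnd 1 0 (fun _ ell => (k * NN ell)%:R : R).
Proof. by apply: (@bnd_nat R _ ((k * (4 * Kr + 4))%N)) => ell; nia. Qed.

Lemma bnd_gaf : bnd 0 1 gaf.
Proof. exact: (bndM (bnd_const alI0) (@bnd_inv R)). Qed.

Lemma bnd_bef : bnd 1 2 bef.
Proof.
have h := bndM (bndM bnd_kNk (bnd_const alA0)) (bndM (bnd_const (exprn_ge0 2 (ler0n R Q))) (bndM (@bnd_inv R) (@bnd_inv R))).
by case: h => c [c0 hc]; exists c; split => // n ell n0; have := hc n ell n0; rewrite /bef [_ ^-1 ^+ 2]expr2.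
Qed.

Lemma bnd_fu : bnd 1 0 (fun _ ell => fu k (rr ell) ell alA).
Proof.
apply: bndD; first by apply: bndW (bnd_const ler01).
by apply: (bndM (bndM bnd_kNk (bnd_const alA0))); apply: bnd_const; rewrite invr_ge0 subr_ge0 ltW.
Qed.

Lemma bnd_fq : bnd 2 0 (fun _ ell => fq R k (rr ell) ell).
Proof.
have [c [c0 h]] := bndM (bnd_const (ler0n R (k * k))) (bndM bnd_kN bnd_kN).
by exists c; split => // n ell n0; have := h n ell n0; rewrite /fq -mulnn !natrM.
Qed.

Lemma bnd_f1 : bnd 4 1 (fun n ell => f1 k (rr ell) ell alA (gaf n ell) (bef n ell)).
Proof.
apply: bndD; first exact: bndW bnd_bef.
apply: (@bndW _ (1 + 3) (0 + 1)) => //; apply: bndM bnd_fu _; apply: bndD; first exact: bndW bnd_bef.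
exact: (bndM bnd_fu (bndM bnd_fq bnd_gaf)).
Qed.

(** [tb], [lb], [cb], [sb] belong to two cycles, one long cycle, a short free cycle, and a short
    free cycle followed by another one; factors exponential in [ell] are kept apart. *)
Definition tb n ell := bef n ell + fu k (rr ell) ell alA * (bef n ell + fu k (rr ell) ell alA *
  (fq R k (rr ell) ell * gaf n ell * f1 k (rr ell) ell alA (gaf n ell) (bef n ell))).
Definition lb n ell := (k * NN ell * k)%:R * alA * (rr ell).+1%:R * (fq R k (rr ell) ell * gaf n ell).
Definition cb n ell : R := ell%:R * (1 + (k * k)%:R * alI) * (fq R k (rr ell) ell * gaf n ell).
Definition sb n ell : R := ell%:R * (1 + (k * k)%:R * alI) *
  (fq R k (rr ell) ell * gaf n ell * f1 k (rr ell) ell alA (gaf n ell) (bef n ell)).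

Let bnd_ell : bnd 1 0 (fun _ ell => ell%:R : R).
Proof. by apply: (@bnd_nat R _ (1%N)) => ell; rewrite mul1n. Qed.

Let cF0 : 0 <= 1 + (k * k)%:R * alI. Proof. by rewrite addr_ge0 // mulr_ge0. Qed.

Lemma bnd_tb : bnd 8 2 tb.
Proof.
apply: bndD; first exact: bndW bnd_bef.
apply: (@bndW _ (1 + 7) (0 + 2)) => //; apply: bndM bnd_fu _; apply: bndD; first exact: bndW bnd_bef.
exact: (bndM bnd_fu (bndM (bndM bnd_fq bnd_gaf) bnd_f1)).
Qed.

Lemma bnd_lb : bnd 8 1 lb.
Proof.
apply: (@bndW _ (1 + 0 + 1 + (2 + 0)) (0 + 0 + 0 + (0 + 1))) => //.
apply: bndM (bndM bnd_fq bnd_gaf); apply: bndM; first exact: bndM bnd_kNk (bnd_const alA0).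
by apply: (@bnd_nat R _ (Kr.+1)) => ell; nia.
Qed.

Lemma bnd_cb : bnd 8 1 cb.
Proof. apply: (@bndW _ (1 + 0 + (2 + 0)) (0 + 0 + (0 + 1))) => //; exact: bndM (bndM bnd_ell (bnd_const cF0)) (bndM bnd_fq bnd_gaf). Qed.

Lemma bnd_sb : bnd 8 2 sb.
Proof.
apply: (@bndW _ (1 + 0 + (2 + 0 + 4)) (0 + 0 + (0 + 1 + 1))) => //.
exact: bndM (bndM bnd_ell (bnd_const cF0)) (bndM (bndM bnd_fq bnd_gaf) bnd_f1).
Qed.

Definition CL n m ell (i : 'I_m) (s : spins n) (o : {ffun 'I_m -> k.-tuple 'I_n * bool}) := [exists l : 'I_ell,
  seg (@inc n k) l [:: (i, o i)] (vert [:: (i, o i)]) (fun L => clo L (fun _ _ => true)) o].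

Section Fixed.
Variables (n m ell : nat) (J : {set 'I_m}) (i : 'I_m).
Hypotheses (n_gt0 : (0 < n)%N) (mE : m%:R = d * n%:R / k%:R) (Qn : (n < Q ^ ell.+1)%N) (xn : 4 <= x * n%:R).
Let N0 : 0 < n%:R :> R. Proof. by rewrite ltr0n. Qed.
Let k0 : 0 < k%:R :> R. Proof. by rewrite ltr0n ltnW. Qed.

Let incP s (a : 'I_k) (v : 'I_n) : \sum_j \sum_(y | (tnth y.1 a == v) && inc y v) pw p J s j y <= alI.
Proof.
apply: le_trans (inc_sum k_ge2 p_ge0 p_lt1 n_gt0 J s a v) _; rewrite mE /alI.
rewrite le_eqVlt; apply/orP; left; apply/eqP; field; by rewrite !lt0r_neq0.
Qed.

Let pairP s (a a' : 'I_k) (v v' : 'I_n) : a != a' ->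
  \sum_j \sum_(y | (tnth y.1 a == v) && (tnth y.1 a' == v')) pw p J s j y <= gaf n ell.
Proof.
move=> aa; apply: le_trans (pair_sum k_ge2 p_ge0 p_lt1 n_gt0 J s v v' aa) _; rewrite mE /gaf /alI.
rewrite le_eqVlt; apply/orP; left; apply/eqP; field; by rewrite !lt0r_neq0.
Qed.

Let ga0 : 0 <= gaf n ell. Proof. by rewrite mulr_ge0 // invr_ge0. Qed.
Let be0 : 0 <= bef n ell.
Proof. by apply: mulr_ge0; [exact: mulr_ge0|apply: mulr_ge0; rewrite exprn_ge0 ?invr_ge0]. Qed.

(** By the choice of [Kr] each unit of [ell] gains a factor [Q^-2], and [n < Q ^ ell.+1] turns [ell]
    units into [Q ^+ 2 / n ^+ 2]. *)
Lemma beP : (k * NN ell * k)%:R * alA * rhoA ^+ (rr ell) <= bef n ell.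
Proof.
apply: ler_wpM2l; first exact: mulr_ge0.
have Q0 : 0 < Q%:R :> R by rewrite ltr0n expn_gt0.
rewrite exprM; apply: (@le_trans _ _ ((Q%:R ^+ 2)^-1 ^+ ell)).
  by apply: lerXn2r KrP; rewrite nnegrE ?exprn_ge0 ?invr_ge0 ?exprn_ge0.
rewrite exprVn -exprM mulnC exprM -!exprVn -exprMn; apply: lerXn2r; rewrite ?nnegrE ?mulr_ge0 ?invr_ge0 ?exprn_ge0 //.
rewrite exprVn -[leLHS]mul1r ler_pdivrMr ?exprn_gt0 // mulrAC ler_pdivlMr // mul1r -exprS -natrX ler_nat.
exact: ltnW.
Qed.

Lemma B1_le (s : spins n) : `|mag R s| <= x / 2 * n%:R ->
  expo (pw p J s) [::] (B1 (k:=k) ell (rr ell) i s) <= tb n ell + lb n ell * rhoA ^+ ell.-1.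
Proof.
move=> hm; have w0 := pw_ge0 k_ge2 p_ge0 p_lt1 n_gt0 J s; have wm := pw_mass k_ge2 p_ge0 p_lt1 n_gt0 J s.
have actP (a : 'I_k) (v : 'I_n) : \sum_j \sum_(y | (tnth y.1 a == v) && act_of s y v) pw p J s j y <= alA.
  apply: le_trans (act_sum k_ge2 p_ge0 p_lt1 n_gt0 J a v (ltW x_gt0) xn hm) _; rewrite mE /alA.
  rewrite le_eqVlt; apply/orP; left; apply/eqP; field; by rewrite !lt0r_neq0.
have t1 := two_clo_le w0 wm alA0 ga0 be0 rho_lt1 actP (@pairP s) beP.
have t2 := long_seg_le w0 wm (rr ell) ell alA0 ga0 rho_lt1 actP (@pairP s).
have tb0 : 0 <= tb n ell by have [c [_ h]] := bnd_tb; have /andP[] := h n ell n_gt0.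
have lb0 : 0 <= lb n ell by have [c [_ h]] := bnd_lb; have /andP[] := h n ell n_gt0.
apply: (@rooted_le R n m k _ w0 wm i (fun L o => two_clo s (rr ell) L o || long_seg (act_of s) ell.-1 (rr ell) L (fun L => clo L (fun _ _ => true)) o)).
  by rewrite addr_ge0 // mulr_ge0 // exprn_ge0.
move=> L un sz; apply: le_trans (expo_or w0 _ _ _) _; apply: lerD; first exact: t1.
apply: le_trans (t2 L un sz) _; rewrite /lb -/rhoA le_eqVlt; apply/orP; left; apply/eqP.
by rewrite mulrAC.
Qed.

Lemma B2_le (s : spins n) : `|mag R s| <= x / 2 * n%:R ->
  expo (pw p J s) [::] (B2 (k:=k) ell (rr ell) i s) <= sb n ell * FI ^+ ell.
Proof.
move=> hm; have w0 := pw_ge0 k_ge2 p_ge0 p_lt1 n_gt0 J s; have wm := pw_mass k_ge2 p_ge0 p_lt1 n_gt0 J s.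
have actP (a : 'I_k) (v : 'I_n) : \sum_j \sum_(y | (tnth y.1 a == v) && act_of s y v) pw p J s j y <= alA.
  apply: le_trans (act_sum k_ge2 p_ge0 p_lt1 n_gt0 J a v (ltW x_gt0) xn hm) _; rewrite mE /alA.
  rewrite le_eqVlt; apply/orP; left; apply/eqP; field; by rewrite !lt0r_neq0.
have t1 := bad2_le w0 wm alA0 alI0 ga0 be0 rho_lt1 actP (@incP s) (@pairP s) beP.
have sb0 : 0 <= sb n ell by have [c [_ h]] := bnd_sb; have /andP[] := h n ell n_gt0.
apply: (@rooted_le R n m k _ w0 wm i (fun L o => [exists l : 'I_ell, seg (@inc n k) l L (vert L) (fun L => clo L (one_clo s (rr ell))) o])).
  by rewrite mulr_ge0 // exprn_ge0 // (le_trans ler01 FI_ge1).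
move=> L un sz; apply: le_trans (t1 L un sz) _; rewrite /sb /fF -/FI le_eqVlt; apply/orP; left; apply/eqP; ring.
Qed.

Lemma CL_le s : expo (pw p J s) [::] (@CL n m ell i s) <= cb n ell * FI ^+ ell.
Proof.
have w0 := pw_ge0 k_ge2 p_ge0 p_lt1 n_gt0 J s; have wm := pw_mass k_ge2 p_ge0 p_lt1 n_gt0 J s.
have t1 := closer_le w0 wm (rr ell) ell alI0 ga0 (@incP s) (@pairP s).
have cb0 : 0 <= cb n ell by have [c [_ h]] := bnd_cb; have /andP[] := h n ell n_gt0.
apply: (@rooted_le R n m k _ w0 wm i (fun L o => [exists l : 'I_ell, seg (@inc n k) l L (vert L) (fun L => clo L (fun _ _ => true)) o])).
  by rewrite mulr_ge0 // exprn_ge0 // (le_trans ler01 FI_ge1).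
move=> L un sz; apply: le_trans (t1 L un sz) _; rewrite /cb /fF -/FI le_eqVlt; apply/orP; left; apply/eqP; ring.
Qed.

(** Unbalanced configurations are given up at a cost of order [1 / n^2], small enough for a sum over
    all insertions. *)
Lemma avg_planted_le (Qe : spins n -> {ffun 'I_m -> k.-tuple 'I_n * bool} -> bool) (b : R) : 0 <= b ->
  (forall s, `|mag R s| <= x / 2 * n%:R -> expo (pw p J s) [::] (Qe s) <= b) ->
  avg (planted p J Qe) <= b + 4 ^+ 5 * expR (1 / 2) / (x ^+ 4 * n%:R ^+ 2).
Proof.
move=> b0 h; rewrite avg_planted.
have w0 s := pw_ge0 k_ge2 p_ge0 p_lt1 n_gt0 J s; have wm s := pw_mass k_ge2 p_ge0 p_lt1 n_gt0 J s.
apply: le_trans (_ : (2 ^+ n)^-1 * \sum_s (b + (if x / 2 * n%:R < `|mag R s| then 1 else 0)) <= _).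
  apply: ler_wpM2l; first by rewrite invr_ge0 exprn_ge0.
  apply: ler_sum => s _; case: ltP => hs; last by rewrite addr0 h.
  by apply: le_trans (expo_le1 (w0 s) (wm s) _ _) _ => //; rewrite lerDr.
rewrite big_split /= mulrDr; apply: lerD.
  by rewrite sumr_const card_ffun card_bool card_ord -[b *+ _]mulr_natl natrX mulrA mulVf ?mul1r // expf_neq0 // pnatr_eq0.
by rewrite -big_mkcond; apply: unbalanced_count.
Qed.

End Fixed.
End Expectations.

Local Close Scope ring_scope.
Local Open Scope nat_scope.

(** * Running time *)

Section Deterministic.
Variables (R : realType) (X : nat -> R) (Dm : nat).

Fixpoint nocoin c : bool :=
  match c with
  | Coin _ _ _ => false
  | Seq a b | If _ _ a b => nocoin a && nocoin b
  | For _ c | Let _ c => nocoin c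
  | _ => true
  end.

Lemma tmx_det c cs s : nocoin c -> static c -> exists s', (forall Psi, ex X c cs Psi s = Psi s') /\
  forall post, tmx Dm c cs post s <= cost c cs + post s'.
Proof.
elim: c cs s => [|t e f|t e x|a IHa b IHb|e f a IHa b IHb|e c IHc|e c IHc] cs s //=.
- by exists s.
- move=> _ _; exists (put s t (ev cs s e) (ev cs s f)); split => // post.
  by have := xc_le Dm (size cs) 0 e; have := xc_le Dm (size cs) 1 f; lia.
- move=> /andP[na nb] /andP[sa sb]; have [s1 [e1 t1]] := IHa cs s na sa; have [s2 [e2 t2]] := IHb cs s1 nb sb.
  exists s2; split => [Psi|post]; first by rewrite e1 e2.
  by apply: leq_trans (t1 _) _; have := t2 post; lia.
- move=> /andP[na nb] /andP[sa sb]; have h1 := xc_le Dm (size cs) 0 e; have h2 := xc_le Dm (size cs) 1 f.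
  case: (ev cs s e <= ev cs s f).
    have [s1 [e1 t1]] := IHa cs s na sa; exists s1; split => // post.
    by have := t1 post; have := leq_maxl (cost a cs) (cost b cs); lia.
  have [s1 [e1 t1]] := IHb cs s nb sb; exists s1; split => // post.
  by have := t1 (fun s => (post s).+1); have := leq_maxr (cost a cs) (cost b cs); lia.
- move=> nc /andP[ne sc]; rewrite -(ev_nold cs s st0 ne); move: (ev cs s e) => q.
  suff [s' [h1 h2]] : exists s', (forall Psi, iteri q (fun j K => ex X c (rcons cs j) K) Psi s = Psi s') /\
    forall post, iteri q (fun j K s0 => 4 + tmx Dm c (rcons cs j) (fun s1 => (K s1).+1) s0) post s <=
      \sum_(0 <= j < q) (5 + cost c (rcons cs j)) + post s'.
    exists s'; split => // post; have := h2 (fun s0 => 2 + post s0); have := xc_le Dm (size cs) 0 e; lia.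
  elim: q s => [|q IH] s; first by exists s; split => // post; rewrite big_geq.
  have [s1 [e1 t1]] := IHc (rcons cs q) s nc sc; have [s2 [e2 t2]] := IH s1.
  exists s2; split => [Psi|post]; first by rewrite iteriS e1 e2.
  rewrite iteriS big_nat_recr //=; have := t2 post; have := t1 (fun s1 => (iteri q (fun j K s0 => 4 + tmx Dm c (rcons cs j) (fun s1 => (K s1).+1) s0) post s1).+1).
  lia.
- move=> nc /andP[ne sc]; rewrite -(ev_nold cs s st0 ne).
  have [s1 [e1 t1]] := IHc (rcons cs (ev cs s e)) s nc sc; exists s1; split => // post.
  by have := t1 post; have := xc_le Dm (size cs) 0 e; lia.
Qed.

Lemma sat_time cs c s Q : sat X cs c s Q -> nocoin c -> static c ->
  exists s', Q s' /\ forall post, tmx Dm c cs post s <= cost c cs + post s'.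
Proof.
move=> [s1 [q1 e1]] nc sc; have [s2 [e2 t2]] := tmx_det cs s nc sc; exists s2; split => //.
(* Both descriptions of the run fix a final state; testing with the indicator of one state
   identifies them. *)
have := e1 (fun x => (`[< x = s1 >])%:R%R); rewrite e2.
have -> : `[< s1 = s1 >] = true by apply/asboolP.
by case: asboolP => [->|_] // /eqP; rewrite eq_sym oner_eq0.
Qed.

End Deterministic.

Section Costs.
Implicit Types (c : cmd) (e : nat -> nat -> nat -> nat).

Definition ebnd c e := exists A, forall n m ell l, cost c ([:: n; m; ell] ++ l) <= A * e n m ell.

Lemma ebndW c e e' : (forall n m ell, e n m ell <= e' n m ell) -> ebnd c e -> ebnd c e'.
Proof. by move=> h [A hA]; exists A => n m ell l; apply: leq_trans (hA _ _ _ _) _; rewrite leq_mul2l h orbT. Qed.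

Lemma ebnd_noloop c e : noloop c -> (forall n m ell, 0 < e n m ell) -> ebnd c e.
Proof. by move=> nl h; exists (cost c [::]) => n m ell l; rewrite (cost_noloop _ [::] nl) leq_pmulr. Qed.

Lemma ebnd_seq a b e : ebnd a e -> ebnd b e -> ebnd (Seq a b) e.
Proof. by move=> [A hA] [B hB]; exists (A + B) => n m ell l; rewrite mulnDl leq_add. Qed.

Lemma ebnd_cnds l0 c e : (forall n m ell, 0 < e n m ell) -> ebnd c e -> ebnd (cnds l0 c) e.
Proof.
move=> h hc; elim: l0 => //= ef l0 [B hB]; exists (xb ef.1 + xb ef.2 + 2 + B) => n m ell l.
rewrite -[cost _ _]/(xb ef.1 + xb ef.2 + 2 + maxn (cost (cnds l0 c) ([:: n; m; ell] ++ l)) 0) maxn0 mulnDl leq_add //.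
exact: leq_pmulr.
Qed.

Lemma ebnd_unroll K f e : (forall n m ell, 0 < e n m ell) -> (forall b, ebnd (f b) e) -> ebnd (unroll K f) e.
Proof.
move=> h hf; rewrite /unroll; elim: (iota 0 K) => [|b l IH] /=; first exact: ebnd_noloop.
exact: ebnd_seq.
Qed.

Lemma ebnd_for x c e f B : (forall n m ell l, ev ([:: n; m; ell] ++ l) st0 x <= B * f n m ell) ->
  (forall n m ell, 0 < e n m ell) -> (forall n m ell, 0 < f n m ell) -> ebnd c e ->
  ebnd (For x c) (fun n m ell => f n m ell * e n m ell).
Proof.
move=> hx he hf [A hA]; exists (xb x + 4 + B * (5 + A)) => n m ell l.
apply: leq_trans (cost_for (M := A * e n m ell) _) _.
  by move=> j _; rewrite -[rcons _ _]/([:: n; m; ell] ++ rcons l j).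
rewrite [leqRHS]mulnDl; apply: leq_add; first by apply: leq_pmulr; rewrite muln_gt0 hf he.
apply: leq_trans (leq_mul (hx n m ell l) (_ : _ <= (5 + A) * e n m ell)) _; last by apply: eq_leq; lia.
by rewrite mulnDl leq_add2r leq_pmulr.
Qed.

Lemma noloop_cnds l c : noloop (cnds l c) = noloop c.
Proof. by elim: l => //= ef l IH; rewrite -[LHS]/(noloop (cnds l c) && true) IH andbT. Qed.

Lemma noloop_unroll K f : (forall b, noloop (f b)) -> noloop (unroll K f).
Proof. by move=> h; rewrite /unroll; elim: (iota 0 K) => //= b l ->; rewrite h. Qed.

Lemma static_cnds l c : static (cnds l c) = static c.
Proof. by elim: l => //= ef l IH; rewrite -[LHS]/(static (cnds l c) && true) IH andbT. Qed.

Lemma static_unroll K f : (forall b, static (f b)) -> static (unroll K f).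
Proof. by move=> h; rewrite /unroll; elim: (iota 0 K) => //= b l ->; rewrite h. Qed.

Lemma nocoin_cnds l c : nocoin (cnds l c) = nocoin c.
Proof. by elim: l => //= ef l IH; rewrite -[LHS]/(nocoin (cnds l c) && true) IH andbT. Qed.

Lemma nocoin_unroll K f : (forall b, nocoin (f b)) -> nocoin (unroll K f).
Proof. by move=> h; rewrite /unroll; elim: (iota 0 K) => //= b l ->; rewrite h. Qed.

Lemma nold_emul q (e : expr) : nold e -> nold (emul q e).
Proof. by move=> h; elim: q => //= q IH; rewrite h. Qed.

Variables (k csw cR : nat).

Lemma noloop_seq a b : noloop a -> noloop b -> noloop (Seq a b). Proof. by move=> /= -> ->. Qed.
Lemma static_seq a b : static a -> static b -> static (Seq a b). Proof. by move=> /= -> ->. Qed.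
Lemma nocoin_seq a b : nocoin a -> nocoin b -> nocoin (Seq a b). Proof. by move=> /= -> ->. Qed.
Lemma static_for (e : expr) c : nold e -> static c -> static (For e c). Proof. by move=> /= -> ->. Qed.
Lemma nocoin_for (e : expr) c : nocoin c -> nocoin (For e c). Proof. by []. Qed.
Lemma wr_seq a b t : ~~ writes a t -> ~~ writes b t -> ~~ writes (Seq a b) t.
Proof. by move=> /= /negbTE ->. Qed.
Lemma wr_for (e : expr) c t : writes (For e c) t = writes c t. Proof. by []. Qed.
Lemma noloop_flag K l x : noloop (flag K l x). Proof. by apply: noloop_unroll => b; rewrite noloop_cnds. Qed.
Lemma static_flag K l x : static (flag K l x). Proof. by apply: static_unroll => b; rewrite static_cnds. Qed.
Lemma nocoin_flag K l x : nocoin (flag K l x). Proof. by apply: nocoin_unroll => b; rewrite nocoin_cnds. Qed.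

Lemma simple_edge j : noloop (edge k j) /\ static (edge k j).
Proof.
split; rewrite /edge.
  apply: noloop_seq => //; do 3 (apply: noloop_seq; first exact: noloop_flag).
  by rewrite noloop_cnds; apply: noloop_unroll => b; rewrite noloop_cnds.
apply: static_seq => //; do 3 (apply: static_seq; first exact: static_flag).
by rewrite static_cnds; apply: static_unroll => b; rewrite static_cnds.
Qed.

Definition sz n m ell := (n + m).+1 * ell.+1.

Lemma sz_gt0 n m ell : 0 < sz n m ell. Proof. by rewrite muln_gt0. Qed.

Lemma ebnd_n x c : (forall n m ell l, ev ([:: n; m; ell] ++ l) st0 x <= n.+1) -> noloop c -> ebnd (For x c) sz.
Proof.
move=> hx nc; apply: (@ebndW _ (fun n m ell => n.+1 * 1)) => [n m ell|].
  by rewrite muln1 /sz; apply: leq_trans (leq_pmulr _ (ltn0Sn ell)); lia.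
apply: (@ebnd_for x c (fun _ _ _ => 1) (fun n m ell => n.+1) 1) => //.
  by move=> n m ell l; rewrite mul1n; apply: hx.
exact: ebnd_noloop.
Qed.

Lemma ebnd_m c e : (forall n m ell, 0 < e n m ell) -> ebnd c e -> ebnd (For (Cnt 1) c) (fun n m ell => m.+1 * e n m ell).
Proof. by move=> he; apply: (@ebnd_for (Cnt 1) c e (fun n m ell => m.+1) 1) => // n m ell l; rewrite mul1n. Qed.

Lemma ebnd_mc c : noloop c -> ebnd (For (Cnt 1) c) (fun n m ell => m.+1).
Proof. by move=> nc; have := @ebnd_m c (fun _ _ _ => 1) (fun _ _ _ => isT) (@ebnd_noloop c (fun _ _ _ => 1) nc (fun _ _ _ => isT)); apply: ebndW => n m ell; rewrite muln1. Qed.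

Lemma ebnd_flip dl x : ebnd (flip_cmd k csw dl x) sz.
Proof.
apply: ebnd_seq; first by apply: ebnd_noloop => // *; apply: sz_gt0.
apply: ebnd_cnds; first exact: sz_gt0.
apply: ebnd_seq.
  by apply: (@ebndW _ (fun n m ell => m.+1)); [move=> n m ell; rewrite /sz; apply: leq_trans (leq_pmulr _ (ltn0Sn ell)); lia | apply: ebnd_mc].
apply: ebnd_seq; first exact: ebnd_n.
apply: ebnd_seq; first by apply: ebnd_noloop => // *; apply: sz_gt0.
apply: ebnd_seq; first by apply: ebnd_noloop => // *; apply: sz_gt0.
apply: (@ebndW _ (fun n m ell => ell.+1 * m.+1)); first by move=> n m ell; rewrite /sz mulnC leq_mul2r; apply/orP; right; lia.
apply: (@ebnd_for _ _ (fun n m ell => m.+1) (fun n m ell => ell.+1) csw) => //.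
  by move=> n m ell l; rewrite /= ev_emul /= mulnS addnC.
by apply: ebnd_mc; rewrite noloop_cnds; case: (simple_edge (Cnt dl.+1)).
Qed.

Lemma ebnd_lm c : noloop c -> ebnd (For (Cnt 2) (For (Cnt 1) c)) sz.
Proof.
move=> nc; apply: (@ebndW _ (fun n m ell => ell.+1 * m.+1)); first by move=> n m ell; rewrite /sz mulnC leq_mul2r; apply/orP; right; lia.
apply: (@ebnd_for _ _ (fun n m ell => m.+1) (fun n m ell => ell.+1) 1) => //; last exact: ebnd_mc.
by move=> n m ell l; rewrite mul1n /=.
Qed.

Lemma simple_bfs dl x : [/\ ebnd (bfs_cmd k dl x) sz, static (bfs_cmd k dl x) & nocoin (bfs_cmd k dl x)].
Proof.
split; rewrite /bfs_cmd.
- apply: ebnd_seq; first exact: ebnd_n.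
  apply: ebnd_seq; first by apply: ebnd_noloop => // *; apply: sz_gt0.
  apply: ebnd_lm; rewrite noloop_cnds; apply: noloop_seq => //; apply: noloop_seq; first exact: noloop_flag.
  by rewrite noloop_cnds; apply: noloop_unroll => b; rewrite noloop_cnds.
- do 2 (apply: static_seq => //); do 2 (apply: static_for => //); rewrite static_cnds.
  apply: static_seq => //; apply: static_seq; first exact: static_flag.
  by rewrite static_cnds; apply: static_unroll => b; rewrite static_cnds.
- do 2 (apply: nocoin_seq => //); do 2 (apply: nocoin_for); rewrite nocoin_cnds.
  apply: nocoin_seq => //; apply: nocoin_seq; first exact: nocoin_flag.
  by rewrite nocoin_cnds; apply: nocoin_unroll => b; rewrite nocoin_cnds.
Qed.

Lemma simple_trace dl : [/\ ebnd (trace_cmd k dl) sz, static (trace_cmd k dl) & nocoin (trace_cmd k dl)].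
Proof.
split; rewrite /trace_cmd.
- apply: ebnd_lm; rewrite noloop_cnds; apply: noloop_seq => //; apply: noloop_seq; first exact: noloop_flag.
  rewrite noloop_cnds; apply: noloop_seq => //.
  apply: noloop_seq; first by apply: noloop_unroll => b; rewrite noloop_cnds.
  by rewrite noloop_cnds; apply: noloop_seq => //; apply: noloop_unroll.
- do 2 (apply: static_for => //); rewrite static_cnds; apply: static_seq => //; apply: static_seq; first exact: static_flag.
  rewrite static_cnds; apply: static_seq => //.
  apply: static_seq; first by apply: static_unroll => b; rewrite static_cnds.
  by rewrite static_cnds; apply: static_seq => //; apply: static_unroll.
- do 2 (apply: nocoin_for); rewrite nocoin_cnds; apply: nocoin_seq => //; apply: nocoin_seq; first exact: nocoin_flag.
  rewrite nocoin_cnds; apply: nocoin_seq => //.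
  apply: nocoin_seq; first by apply: nocoin_unroll => b; rewrite nocoin_cnds.
  by rewrite nocoin_cnds; apply: nocoin_seq => //; apply: nocoin_unroll.
Qed.

Lemma simple_pre : [/\ ebnd (pre_cmd k) sz, static (pre_cmd k) & nocoin (pre_cmd k)].
Proof.
have [t1 t2 t3] := simple_trace 5.
split; rewrite /pre_cmd.
- apply: ebnd_seq; first exact: ebnd_n.
  apply: ebnd_seq; first by apply: ebnd_noloop; [apply: noloop_unroll | apply: sz_gt0].
  apply: ebnd_seq; first by apply: ebnd_noloop => // *; apply: sz_gt0.
  apply: ebnd_unroll => [*|a]; first exact: sz_gt0.
  apply: ebnd_seq; first by case: (simple_bfs 5 (eg k (Cnt 4) a)).
  apply: ebnd_unroll => [*|b]; first exact: sz_gt0.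
  apply: ebnd_cnds => [*|]; first exact: sz_gt0.
  by do 2 (apply: ebnd_seq; first by apply: ebnd_noloop => // *; apply: sz_gt0).
- apply: static_seq => //; apply: static_seq; first by apply: static_unroll.
  apply: static_seq => //; apply: static_unroll => a.
  apply: static_seq; first by case: (simple_bfs 5 (eg k (Cnt 4) a)).
  by apply: static_unroll => b; rewrite static_cnds; do 2 (apply: static_seq => //).
- apply: nocoin_seq => //; apply: nocoin_seq; first by apply: nocoin_unroll.
  apply: nocoin_seq => //; apply: nocoin_unroll => a.
  apply: nocoin_seq; first by case: (simple_bfs 5 (eg k (Cnt 4) a)).
  by apply: nocoin_unroll => b; rewrite nocoin_cnds; do 2 (apply: nocoin_seq => //).
Qed.

Lemma static_flip dl x : static (flip_cmd k csw dl x).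
Proof.
apply: static_seq => //; rewrite static_cnds; do 4 (apply: static_seq => //).
apply: static_for; first by rewrite /= nold_emul.
by apply: static_for => //; rewrite static_cnds; case: (simple_edge (Cnt dl.+1)).
Qed.

Lemma wr_flip dl x t : t != tT -> t != tC -> t != tD -> t != tS -> ~~ writes (flip_cmd k csw dl x) t.
Proof.
move=> h1 h2 h3 h4; apply: wr_seq => //; rewrite wr_cnds; do 4 (apply: wr_seq => //).
by rewrite !wr_for wr_cnds wr_edge.
Qed.

Section Sweep.
Variables (Dm n m ell Rb i Af : nat).
Hypothesis hAf : forall l, cost (flip_cmd k csw 7 (Cnt 6)) ([:: n; m; ell] ++ l) <= Af * sz n m ell.

Definition cnt (s : st) q := \sum_(0 <= j < q) (0 < s tV j).
Definition wt v := 20 * n.+1 + v * (Af * sz n m ell).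

(** Only vertices marked in [tV] pay for a cluster search, the others a constant. The static cost,
    blind to the memory, would charge a search to every vertex. *)
Lemma sweep_time r post s M v : cnt s n <= v -> (forall s', agree (sweep_cmd k csw 6) s s' -> post s' <= M) ->
  tmx Dm (sweep_cmd k csw 6) [:: n; m; ell; Rb; i; r] post s <= wt v + M.
Proof.
move=> hv hp; set cs := [:: n; m; ell; Rb; i; r].
have wrE t : writes (sweep_cmd k csw 6) t = writes (flip_cmd k csw 7 (Cnt 6)) t.
  by rewrite /sweep_cmd wr_for wr_cnds.
have st := static_flip 7 (Cnt 6); rewrite /sweep_cmd; move: (flip_cmd k csw 7 (Cnt 6)) st wrE hAf (wr_flip 7 (Cnt 6)) hp => fl st wrE hA wf hp.
have gen q s' : agree (sweep_cmd k csw 6) s s' -> 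
  iteri q (fun j K s0 => 4 + tmx Dm (cnds [:: (Cst 1, Ld tV (Cnt 6))] fl) (rcons cs j) (fun s1 => (K s1).+1) s0)
    (fun s0 => 2 + post s0) s' <= q * 18 + cnt s q * (Af * sz n m ell) + (2 + M).
  elim: q s' => [|q IH] s' ag; first by rewrite /cnt big_geq //= leq_add2l hp.
  have -> : cnt s q.+1 = cnt s q + (0 < s tV q) by rewrite /cnt big_nat_recr.
  rewrite iteriS.
  have -> K' : tmx Dm (cnds [:: (Cst 1, Ld tV (Cnt 6))] fl) (rcons cs q) K' s' =
    xc Dm 7 0 (Cst 1) + xc Dm 7 1 (Ld tV (Cnt 6)) + 1 + (if 1 <= s' tV q then tmx Dm fl (rcons cs q) K' s' else (K' s').+1) by [].
  have h1 := xc_le Dm 7 0 (Cst 1); have h2 := xc_le Dm 7 1 (Ld tV (Cnt 6)); rewrite /= in h1 h2.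
  have sv : s' tV q = s tV q by rewrite ag // wrE wf.
  rewrite sv; case: (ltnP 0 (s tV q)) => hq.
    move: IH; set K := iteri q _ _ => IH.
    have h3 : tmx Dm fl (rcons cs q) (fun s1 => (K s1).+1) s' <=
        cost fl (rcons cs q) + (q * 18 + cnt s q * (Af * sz n m ell) + (2 + M)).+1.
      by apply: tmx_static => // s1 ag1; rewrite ltnS; apply: IH => t ht a; rewrite ag1 ?ag // -wrE.
    have h4 := hA [:: Rb; i; r; q]; rewrite -[_ ++ _]/(rcons cs q) in h4.
    rewrite -[cnt s q + true]/(cnt s q + 1) addn1 !mulSn; move: h3 h4 h1 h2; clear.
    set A1 := tmx _ _ _ _ _; set A2 := cost _ _; set P := cnt s q * _; set Q := Af * _; lia.
  have := IH s' ag; rewrite addn0 mulSn; move: h1 h2; clear; set A1 := iteri _ _ _ _; set P := cnt s q * _; lia.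
have := gen n s (fun _ _ _ => erefl); have h1 := xc_le Dm 6 0 (Cnt 0); rewrite /= in h1.
rewrite -[tmx Dm _ _ _ _]/(xc Dm 6 0 (Cnt 0) + 2 + iteri n _ _ s) /wt.
have : cnt s n * (Af * sz n m ell) <= v * (Af * sz n m ell) by rewrite leq_mul2r hv orbT.
move: h1; clear; set A1 := iteri _ _ _ _; set P := cnt s n * _; set Q := v * _; lia.
Qed.

Lemma rounds_time (e : expr) q post s M v : (forall s, ev [:: n; m; ell; Rb; i] s e = q) -> cnt s n <= v ->
  (forall s', agree (sweep_cmd k csw 6) s s' -> post s' <= M) ->
  tmx Dm (For e (sweep_cmd k csw 6)) [:: n; m; ell; Rb; i] post s <= xb e + 4 + q * (5 + wt v) + M.
Proof.
move=> he hv hp; set cs := [:: n; m; ell; Rb; i].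
have wV : ~~ writes (sweep_cmd k csw 6) tV.
  by rewrite /sweep_cmd wr_for wr_cnds wr_flip.
have gen j s' : agree (sweep_cmd k csw 6) s s' ->
  iteri j (fun j K s0 => 4 + tmx Dm (sweep_cmd k csw 6) (rcons cs j) (fun s1 => (K s1).+1) s0)
    (fun s0 => 2 + post s0) s' <= j * (5 + wt v) + (2 + M).
  elim: j s' => [|j IH] s' ag; first by rewrite /= leq_add2l hp.
  have hv' : cnt s' n <= v by rewrite /cnt; under eq_bigr do rewrite (ag _ wV).
  rewrite iteriS mulSn; move: IH; set K := iteri j _ _ => IH.
  have h : tmx Dm (sweep_cmd k csw 6) (rcons cs j) (fun s1 => (K s1).+1) s' <= wt v + (j * (5 + wt v) + (2 + M)).+1.
    by apply: sweep_time => // s1 ag1; rewrite ltnS; apply: IH => t ht a; rewrite ag1 ?ag.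
  by move: h; set a := tmx _ _ _ _ _; set b := j * _; set w := wt v; lia.
have := gen q s (fun _ _ _ => erefl); have h1 := xc_le Dm 5 0 e.
rewrite -[tmx Dm _ _ _ _]/(xc Dm 5 0 e + 2 + iteri (ev cs s e) _ _ s) he; move: h1.
clear; set A1 := iteri _ _ _ _; set P := q * _; lia.
Qed.

Variables (H : hypergraph n m k) (iH : 'I_m).
Hypothesis iE : i = iH.
Variable (R : realType) (X : nat -> R).
Variable Ap : nat.
Hypothesis hAp : cost (pre_cmd k) [:: n; m; ell; Rb; i] <= Ap * sz n m ell.

Definition ins_a := Ap * sz n m ell + 100 + xb (emul cR (Cnt 2)) + cR * ell * (5 + wt k).
Definition ins_b := Rb * (5 + wt (k * ell.+1)).

Lemma wr_sweep t : t != tT -> t != tC -> t != tD -> t != tS -> ~~ writes (sweep_cmd k csw 6) t.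
Proof. by move=> *; rewrite /sweep_cmd wr_for wr_cnds wr_flip. Qed.

Lemma cnt_card s (V : {set 'I_n}) : arrV s V -> cnt s n = #|V|.
Proof.
move=> h; rewrite /cnt big_mkord -sum1_card [RHS]big_mkcond /=; apply: eq_bigr => v _.
by rewrite h lt0b; case: (v \in V).
Qed.

Lemma card_pre : (#|(pre H ell iH).2| <= (if (pre H ell iH).1 then k * ell.+1 else k))%N.
Proof.
have ho j : (mko H [ffun=> false] j).1 = H j by rewrite ffunE.
case: ifP => f; last by have [-> _] := pre_noncloser ho (negbT f); apply: card_edge.
have [z [x [ps [_ _ _ _ [_ sz ->]]]]] := pre_closer ho f.
rewrite mulnS; apply: leq_trans (leq_card_setU _ _) (leq_add (card_edge H iH) _).
apply: (@leq_trans (\sum_(j in unzip1 ps) k)).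
  elim/big_ind2: _ => [|A a A' a' h1 h2|j _]; rewrite ?cards0 ?card_edge //.
  by apply: leq_trans (leq_card_setU _ _) (leq_add h1 h2).
rewrite sum_nat_const mulnC leq_mul2l (leq_trans (card_size _)) ?orbT // size_map.
by case/andP: sz.
Qed.

(** Amortization with the remaining budget as potential: a closing insertion pays its [ins_b] with
    the unit it consumes. *)
Lemma ins_time post s M : hasE H s -> (forall s', hasE H s' -> post s' <= M + ins_b * s' tB 0) ->
  tmx Dm (ins_cmd k csw cR) [:: n; m; ell; Rb; i] post s <= ins_a + M + ins_b * s tB 0.
Proof.
move=> hs hp; set cs := [:: n; m; ell; Rb; i].
have [_ ps pn] := simple_pre.
have [s1 [[[i1 v1 f1] ag1] ht]] := sat_time Dm (sat_frame (pre_spec X ell Rb iH hs)) pn ps.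
rewrite -iE in ht; rewrite /ins_cmd; set rest := If _ _ _ _.
rewrite -[tmx Dm _ _ _ _]/(tmx Dm (pre_cmd k) cs (tmx Dm rest cs post) s).
apply: leq_trans (ht _) _.
have sB : s1 tB 0 = s tB 0 by rewrite ag1 //; apply: wr_pre.
have cV := card_pre; rewrite -(cnt_card v1) in cV.
suff : tmx Dm rest cs post s1 <= 100 + xb (emul cR (Cnt 2)) + cR * ell * (5 + wt k) + M + ins_b * s1 tB 0.
  by move: hAp; rewrite /ins_a sB; clear; set A1 := cost _ _; set A2 := tmx _ _ _ _ _; set P := ins_b * _; set Q := cR * ell * _; set Z := Ap * _; lia.
have hsw s' M' (h : hasE H s') (hM : M + ins_b * s' tB 0 <= M') s'' : agree (sweep_cmd k csw 6) s' s'' -> post s'' <= M'.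
  move=> ag; apply: leq_trans (hp _ _) _; first by apply: hasE_eq h => a; rewrite ag // wr_sweep.
  by rewrite ag // wr_sweep.
have h1 := xc_le Dm 5 0 (Cst 1); have h2 := xc_le Dm 5 1 (Ld tD (Cst 0)); have h3 := xc_le Dm 5 1 (Ld tB (Cst 0)).
rewrite /= in h1 h2 h3.
rewrite /rest -[tmx Dm _ _ _ _]/(xc Dm 5 0 (Cst 1) + xc Dm 5 1 (Ld tD (Cst 0)) + 1 +
  (if 1 <= s1 tD 0 then tmx Dm (If (Cst 1) (Ld tB (Cst 0)) (Seq (Put tB (Cst 0) (Minus (Ld tB (Cst 0)) (Cst 1))) (For (Cnt 3) (sweep_cmd k csw 6))) Skip) cs post s1
   else tmx Dm (For (emul cR (Cnt 2)) (sweep_cmd k csw 6)) cs (fun s => (post s).+1) s1)).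
rewrite f1 lt0b; move: cV; case: ifP => f cV; last first.
  have := @rounds_time (emul cR (Cnt 2)) (cR * ell) (fun s => (post s).+1) s1 (M + ins_b * s1 tB 0).+1 k.
  rewrite -/cs => h; have {}h := h (fun s => ev_emul _ _ _ _) cV (fun s' ag => hsw s1 _ i1 (leqnn _) s' ag).
  by move: h h1 h2; clear; set A2 := tmx _ _ _ _ _; set P := ins_b * _; set Q := cR * ell * _; lia.
rewrite -[tmx Dm _ _ _ _]/(xc Dm 5 0 (Cst 1) + xc Dm 5 1 (Ld tB (Cst 0)) + 1 +
  (if 1 <= s1 tB 0 then tmx Dm (Seq (Put tB (Cst 0) (Minus (Ld tB (Cst 0)) (Cst 1))) (For (Cnt 3) (sweep_cmd k csw 6))) cs post s1
   else (post s1).+1)).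
case: ifP => b0; last first.
  by have := hp s1 i1; move: h1 h2 h3; clear; set P := ins_b * _; set Q := cR * ell * _; lia.
pose s2 := put s1 tB 0 (s1 tB 0 - 1).
have h4 := xc_le Dm 5 1 (Minus (Ld tB (Cst 0)) (Cst 1)); have h5 := xc_le Dm 5 0 (Cst 0); rewrite /= in h4 h5.
rewrite -[tmx Dm (Seq _ _) _ _ _]/(xc Dm 5 0 (Cst 0) + 6 + xc Dm 5 1 (Minus (Ld tB (Cst 0)) (Cst 1)) + 1 +
   tmx Dm (For (Cnt 3) (sweep_cmd k csw 6)) cs post s2).
have i2 : hasE H s2 by apply: hasE_put.
have := @rounds_time (Cnt 3) Rb post s2 (M + ins_b * s2 tB 0) (k * ell.+1) (fun s => erefl) cV (fun s' ag => hsw s2 _ i2 (leqnn _) s' ag).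
rewrite -/cs -/ins_b; have -> : s2 tB 0 = s1 tB 0 - 1 by [].
have : ins_b * (s1 tB 0 - 1) + ins_b = ins_b * s1 tB 0 by rewrite addnC -mulnS subn1 prednK.
by rewrite [xb (Cnt 3)]/=; move: h1 h2 h3 h4 h5; clear; set P := ins_b * (_ - 1); set Q := ins_b * s1 tB 0; set A2 := tmx _ _ _ _ _; set Z := cR * ell * _; lia.
Qed.

End Sweep.

Section Main.
Variables (q0 g Ce : nat).
Hypotheses (q0_gt0 : 0 < q0) (gq : 2 * g <= q0).

(** Because [Rb * Rb <= n], the whole budget of [Rb] closing insertions with [Rb] rounds each
    amounts to at most [n] sweeps, so it does not dominate. *)
Lemma numeric_time (n L Ap Af m Rb c3 x S a b D E Ca : nat) : 0 < n -> 0 < L -> m <= 2 ^ Ce * n -> Rb * Rb <= n ->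
  S = (n + m).+1 * L -> a = Ap * S + 100 + c3 + cR * L.-1 * (5 + (20 * n.+1 + k * (Af * S))) ->
  b = Rb * (5 + (20 * n.+1 + k * L * (Af * S))) ->
  D = 2 ^ Ce + 2 -> E = 45 + k * (Af * D) -> Ca = Ap * D + 100 + c3 + cR * E ->
  x * n.+1 + m * (5 + a) + b * Rb <= (2 * x + 2 ^ Ce * (5 + Ca) + E) * (n * L) ^ 2.
Proof.
move=> n0 L0 hm hR eS ea eb eD eE eCa; pose W v := 20 * n.+1 + v * (Af * S).
have nL : 0 < n * L * L by rewrite !muln_gt0 n0 L0.
have n1L : n * L <= n * L * L by rewrite leq_pmulr.
have hS : S <= D * (n * L).
  rewrite eS mulnA leq_mul2r; apply/orP; right; rewrite eD mulnDl; move: hm n0; move: (2 ^ Ce * n) => *; lia.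
have hn : n.+1 <= 2 * (n * L) by have := leq_pmulr n L0; move: (n * L) => *; lia.
have hW v : 5 + W v <= (45 + v * (Af * D)) * (n * L).
  have h : v * (Af * S) <= v * (Af * D) * (n * L) by rewrite -mulnA leq_mul // -mulnA leq_mul.
  rewrite mulnDl /W; move: h hn; have : 0 < n * L by rewrite muln_gt0 n0.
  move: (n * L) => nl0; move: (v * (Af * S)) (v * (Af * D) * nl0) => *; lia.
have ha : a <= Ca * (n * L * L).
  rewrite ea eCa !mulnDl; apply: leq_add; last first.
    rewrite -[cR * E * _]mulnA -mulnA; apply: leq_mul => //.
    rewrite [X in _ <= X](_ : _ = L * (E * (n * L))); last by lia.
    by apply: leq_mul; [exact: leq_pred | rewrite eE; apply: hW].
  apply: leq_add; last exact: leq_pmulr.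
  apply: leq_add; last exact: leq_pmulr.
  by rewrite -mulnA; apply: leq_mul => //; apply: leq_trans hS _; rewrite leq_mul2l n1L orbT.
have hb : b * Rb <= n * (E * (n * L * L)).
  rewrite eb mulnAC; apply: leq_mul => //; apply: leq_trans (hW _) _.
  rewrite eE !mulnDl; apply: leq_add; first by rewrite leq_mul2l n1L orbT.
  by apply: eq_leq; lia.
have hma : m * (5 + a) <= 2 ^ Ce * (5 + Ca) * (n * (n * L * L)).
  rewrite [X in _ <= X](_ : _ = (2 ^ Ce * n) * ((5 + Ca) * (n * L * L))); last by lia.
  apply: leq_mul => //; rewrite mulnDl; apply: leq_add => //; exact: leq_pmulr.
have hx : x * n.+1 <= 2 * x * (n * (n * L * L)).
  rewrite [2 * x]mulnC -mulnA; apply: leq_mul => //; apply: leq_trans hn _; apply: leq_mul => //.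
  by apply: leq_trans n1L _; rewrite leq_pmull.
have -> : (n * L) ^ 2 = n * (n * L * L) by rewrite -mulnn; lia.
rewrite [X in _ <= X]mulnDl [X in _ <= X + _]mulnDl; apply: leq_add; first exact: leq_add.
by apply: leq_trans hb _; apply: eq_leq; lia.
Qed.

Lemma main_time (R : realType) (Dm : nat) : exists A, forall n m (H : hypergraph n m k) s M, 0 < n -> m <= 2 ^ Ce * n -> hasE H s ->
  tmx Dm (main_cmd k q0 g csw cR) [:: n; m] (fun=> M) s <= A * (n * (trunc_log (2 ^ q0) n).+1) ^ 2 + M.
Proof.
have [Af hAf] := ebnd_flip 7 (Cnt 6).
have [[Ap hAp] _ _] := simple_pre.
pose X : nat -> R := fun=> 0%R.
pose step := cnds [:: (emul (2 ^ q0) (Ld tT (Cst 4)), Cnt 0)]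
    (Seq (Put tT (Cst 4) (emul (2 ^ q0) (Ld tT (Cst 4))))
    (Seq (Put tT (Cst 5) (Plus (Ld tT (Cst 5)) (Cst 1)))
         (Put tT (Cst 6) (emul (2 ^ g) (Ld tT (Cst 6)))))).
have nstep : noloop step by rewrite noloop_cnds.
pose x := 200 + cost step [::].
pose D := 2 ^ Ce + 2; pose E := 45 + k * (Af * D); pose Ca := Ap * D + 100 + xb (emul cR (Cnt 2)) + cR * E.
exists (2 * x + 2 ^ Ce * (5 + Ca) + E) => n m H s M n0 hm hs.
set ell := trunc_log _ _.
have p1 : 1 < 2 ^ q0 by rewrite -{1}(expn0 2) ltn_exp2l.
pose Rb := 2 ^ (g * ell).
(* This is the reason for the requirement [2 * g <= q0]. *)
have hR : Rb * Rb <= n.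
  rewrite /Rb -expnD addnn -mul2n mulnA; apply: leq_trans (trunc_logP p1 n0).
  by rewrite -expnM leq_exp2l // leq_mul2r gq orbT.
have hsetup : cost (setup_cmd q0 g) [:: n; m] <= 40 + n * (5 + cost step [::]).
  rewrite /setup_cmd -/step; have h : cost (For (Cnt 0) step) [:: n; m] <= xb (Cnt 0) + 4 + n * (5 + cost step [::]).
    by apply: cost_for => j _; rewrite (cost_noloop _ [::] nstep).
  rewrite -[cost (Seq _ _) _]/(9 + (9 + (9 + cost (For (Cnt 0) step) [:: n; m]))).
  by move: h; rewrite [xb _]/=; clear; set A1 := cost (For _ _) _; set P := n * _; lia.
have ssetup : static (setup_cmd q0 g).
  by do 3 (apply: static_seq => //); apply: static_for => //; rewrite static_cnds.
have nsetup : nocoin (setup_cmd q0 g).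
  by do 3 (apply: nocoin_seq => //); apply: nocoin_for; rewrite nocoin_cnds.
have [s1 [[i1 l1 r1] ht]] := sat_time Dm (setup_spec X g n0 q0_gt0 hs) nsetup ssetup.
rewrite -/ell in l1 r1; rewrite -/Rb in r1.
rewrite /main_cmd; set body := Seq (For _ _) _.
rewrite -[tmx Dm _ _ _ _]/(tmx Dm (setup_cmd q0 g) [:: n; m] (tmx Dm (Let (Ld tT (Cst 5)) (Let (Ld tT (Cst 6)) body)) [:: n; m] (fun=> M)) s).
apply: leq_trans (ht _) _.
rewrite -[tmx Dm (Let _ _) _ _ _]/(xc Dm 2 0 (Ld tT (Cst 5)) + 2 + (xc Dm 3 0 (Ld tT (Cst 6)) + 2 + tmx Dm body [:: n; m; s1 tT 5; s1 tT 6] (fun=> M) s1)).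
rewrite l1 r1; have x1 := xc_le Dm 2 0 (Ld tT (Cst 5)); have x2 := xc_le Dm 3 0 (Ld tT (Cst 6)); rewrite /= in x1 x2.
set cs := [:: n; m; ell; Rb]; pose rest := Seq (Put tB (Cst 0) (Cnt 3)) (For (Cnt 1) (ins_cmd k csw cR)).
rewrite -[tmx Dm body _ _ _]/(tmx Dm (For (Cnt 0) (Coin tS (Cnt 4) 1)) cs (tmx Dm rest cs (fun=> M)) s1).
pose a := ins_a n m ell Af Ap; pose b := ins_b n m ell Rb Af.
have hins j s' : hasE H s' -> j <= m ->
   iteri j (fun j K s0 => 4 + tmx Dm (ins_cmd k csw cR) (rcons cs j) (fun s1 => (K s1).+1) s0) (fun=> 2 + M) s' <=
   j * (5 + a) + b * s' tB 0 + (2 + M).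
  elim: j s' => [|j IH] s' hs' jm; first by rewrite mul0n add0n; exact: leq_addl.
  rewrite iteriS; move: IH; set K := iteri j _ _ => IH; pose iH := Ordinal jm.
  have h4 l : cost (flip_cmd k csw 7 (Cnt 6)) ([:: n; m; ell] ++ l) <= Af * sz n m ell := hAf n m ell l.
  have h5 : cost (pre_cmd k) [:: n; m; ell; Rb; j] <= Ap * sz n m ell := hAp n m ell [:: Rb; j].
  have := @ins_time Dm n m ell Rb j Af h4 H iH erefl R X Ap h5 (fun s1 => (K s1).+1) s' (j * (5 + a) + (2 + M)).+1 hs'.
  rewrite -/a -/b -[[:: n; m; ell; Rb; j]]/(rcons cs j) => h.
  have {}h := h (fun s2 hs2 => ltac:(rewrite addSn ltnS; apply: leq_trans (IH s2 hs2 (ltnW jm)) _; rewrite addnAC //)).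
  by move: h; rewrite mulSn; clear; set A1 := tmx _ _ _ _ _; set P := j * _; set Q := b * _; lia.
have hrest s' : agree (For (Cnt 0) (Coin tS (Cnt 4) 1)) s1 s' -> tmx Dm rest cs (fun=> M) s' <= 30 + m * (5 + a) + b * Rb + M.
  move=> ag; have hs' : hasE H (put s' tB 0 Rb) by apply: hasE_put => //; apply: hasE_eq i1 => q; rewrite ag.
  have := hins m _ hs' (leqnn m); have -> : put s' tB 0 Rb tB 0 = Rb by [].
  have y1 := xc_le Dm 4 0 (Cst 0); have y2 := xc_le Dm 4 1 (Cnt 3); have y3 := xc_le Dm 4 0 (Cnt 1); rewrite /= in y1 y2 y3.
  rewrite -[tmx Dm rest _ _ _]/(xc Dm 4 0 (Cst 0) + 6 + xc Dm 4 1 (Cnt 3) + 1 + (xc Dm 4 0 (Cnt 1) + 2 +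
    iteri m (fun j K s0 => 4 + tmx Dm (ins_cmd k csw cR) (rcons cs j) (fun s1 => (K s1).+1) s0) (fun=> 2 + M) (put s' tB 0 Rb))).
  by move: y1 y2 y3; clear; set A1 := iteri _ _ _ _; set P := m * _; set Q := b * _; lia.
have := @tmx_static Dm (For (Cnt 0) (Coin tS (Cnt 4) 1)) cs (tmx Dm rest cs (fun=> M)) s1 _ isT hrest.
have hcoin : cost (For (Cnt 0) (Coin tS (Cnt 4) 1)) cs <= 6 + n * 15.
  by apply: leq_trans (cost_for (M := 10) _) _.
have := @numeric_time n ell.+1 Ap Af m Rb (xb (emul cR (Cnt 2))) x (sz n m ell) a b D E Ca n0 isT hm hR erefl erefl erefl erefl erefl erefl.
have hx : 40 + n * (5 + cost step [::]) + 6 + n * 15 + 100 <= x * n.+1 by rewrite /x; lia.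
move: hsetup hcoin x1 x2 hx; clear; set A1 := tmx _ _ _ _ _; set A2 := cost (setup_cmd _ _) _; set A3 := cost (For _ _) _.
set P := m * _; set Q := b * _; set Z := x * _; set Y := n * (5 + _); set V := _ * (_ ^ _); lia.
Qed.

End Main.

End Costs.

Local Open Scope ring_scope.

Lemma avg_markov (R : realType) (A : finType) (F : A -> R) (a : R) : 0 < a -> (forall x, 0 <= F x) ->
  avg (fun x => (a < F x)%R%:R) <= a^-1 * avg F.
Proof.
move=> a0 F0; rewrite -avgZ; apply: ler_avg => x; case: ltP => h; last by rewrite mulr_ge0 // invr_ge0 ltW.
by rewrite mulrC ler_pdivlMr // mul1r ltW.
Qed.

(** Room for imbalance: the branching number is still below one when the planted configuration is
    slightly unbalanced. *)
Lemma choose_x (R : realType) (c : R) a : 0 <= c -> c < 1 -> exists x, 0 < x /\ c * (1 + x) ^+ a < 1.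
Proof.
move=> c0 c1; have P3 : 1 <= 3 ^+ a :> R by rewrite exprn_ege1 // ler1n.
pose y := 2 * 3 ^+ a : R; have y0 : 0 < y by rewrite mulr_gt0 // exprn_gt0.
pose x := (1 - c) / y; have x0 : 0 < x by rewrite divr_gt0 // subr_gt0.
have x1 : x <= 1.
  rewrite ler_pdivrMr // mul1r /y; apply: le_trans (_ : 1 <= _); first by rewrite lerBlDr lerDl.
  by rewrite mulr_ege1 // ler1n.
have hb : (1 + x) ^+ a <= 1 + 3 ^+ a * x.
  elim: (a) => [|b IH]; first by rewrite !expr0 mul1r lerDl ltW.
  rewrite exprSr; apply: le_trans (ler_wpM2r _ IH) _; first by rewrite addr_ge0 // ltW.
  have P : 1 <= 3 ^+ b :> R by rewrite exprn_ege1 // ler1n.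
  rewrite [3 ^+ b.+1]exprS; move: (3 ^+ b) P => z z1.
  have h : z * x * x <= z * x by rewrite -[leRHS]mulr1 ler_wpM2l // mulr_ge0 ?(ltW x0) // (le_trans ler01 z1).
  have h2 : x <= z * x by rewrite -[leLHS]mul1r ler_wpM2r // ltW.
  have -> : (1 + z * x) * (1 + x) = 1 + x + z * x + z * x * x by ring.
  have -> : 1 + 3 * z * x = 1 + z * x + z * x + z * x by ring.
  by apply: lerD h; rewrite lerD2r lerD2l.
exists x; split => //; apply: le_lt_trans (ler_wpM2l c0 hb) _.
have -> : 3 ^+ a * x = (1 - c) / 2.
  by rewrite /x /y; field; rewrite lt0r_neq0 // (lt_le_trans ltr01 P3).
have h : c * ((1 - c) / 2) <= (1 - c) / 2 by rewrite -[leRHS]mul1r ler_wpM2r ?divr_ge0 ?subr_ge0 ?(ltW c1).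
rewrite mulrDr mulr1; apply: le_lt_trans (_ : c + (1 - c) / 2 < 1); first by rewrite lerD2l.
have : 0 < 1 - c by rewrite subr_gt0.
by move=> u0; rewrite -[ltRHS](subrK c 1) [ltLHS]addrC ltrD2r ltr_pdivrMr // ltr_pMr // ltr1n.
Qed.

Lemma nsw_ge1 (K l : nat) : ((K * l + K * l).+4 <= (2 * K + 4) * l + (2 * K + 4))%N.
Proof. by rewrite mulnDl -mulnA; lia. Qed.

Lemma nsw_ge2 (K l : nat) : (l + K * l + 2 <= (2 * K + 4) * l + (2 * K + 4))%N.
Proof. by rewrite mulnDl -mulnA; lia. Qed.

Lemma push_count (a l k : nat) : (a * l * k <= k * a.+1 * l.+1)%N.
Proof. by rewrite mulnC -mulnA leq_mul // leq_mul. Qed.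

Lemma exp_ge (a l : nat) : (4 * a <= l.+1)%N -> (a * l.+1 <= 2 ^ l)%N.
Proof.
have h : (l.+1 * l.+1 <= 4 * 2 ^ l)%N.
  elim: l => [|[|[|l]] IH] //; rewrite expnS; move: IH; move: (2 ^ l.+2)%N => w; nia.
move=> ha; have := leq_mul ha (leqnn l.+1); rewrite -mulnA => h2.
by rewrite -(@leq_pmul2l 4) // (leq_trans h2 h).
Qed.

Lemma sqrt_facts (R : realType) (t : R) : 1 / 2 <= t -> t < 1 ->
  [/\ 0 < Num.sqrt t, 1 / 2 <= Num.sqrt t, Num.sqrt t < 1 & Num.sqrt t ^+ 2 = t].
Proof.
move=> t0 t1; have tp : 0 < t by apply: lt_le_trans t0; rewrite divr_gt0.
have st := sqr_sqrtr (ltW tp); have s0 : 0 < Num.sqrt t by rewrite sqrtr_gt0.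
have s1 : Num.sqrt t < 1 by rewrite -[ltRHS](@sqrtr1 R) ltr_sqrt.
by split => //; apply: le_trans t0 _; rewrite -{1}st expr2 -[leRHS]mulr1 ler_wpM2l // ltW.
Qed.

(** * Choice of the parameters and the high-probability bound *)

Section Params.
Variables (R : realType) (k : nat) (p d : R).
Hypotheses (k_ge2 : (2 <= k)%N) (p_ge0 : 0 <= p) (p_lt1 : p < 1) (d_gt0 : 0 < d).
Variables (x : R) (Kr q0 g g1 cR csw : nat).
Local Notation Q := (2 ^ q0)%N.
Local Notation rho := (rhoA k p d x).
Local Notation F := (FI k p d).
Local Notation bb := ((2^-1 * (1 - p)) ^+ k).
Hypotheses (x_gt0 : 0 < x) (rho_lt1 : rho < 1) (KrP : rho ^+ Kr <= (Q%:R ^+ 2)^-1).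
(** By [gF] the budget [2 ^ (g * ell)] beats the growth [FI ^+ ell] of the number of closing
    hyperedges by [2 ^ ell]; by [qP] the product of both stays below [n / 2 ^ ell]. [g1P] and [g1g]
    give a closing block enough rounds for its contraction rate, and [cRP] brings the contraction
    error of an ordinary insertion below order [1 / n]. *)
Hypotheses (gF : 2 * F <= 2 ^+ g) (qP : 2 * (2 ^+ g * F) <= Q%:R) (q0_gt0 : (0 < q0)%N).
Hypotheses (g1P : (bb ^+ 2)^-1 <= 2 ^+ g1) (g1g : (g1 < g)%N) (cRP : (1 - bb) ^+ cR <= (2 * Q%:R)^-1).
Hypothesis cswP : csw = (2 * Kr + 4)%N.

Let rho0 : 0 <= rho.
Proof.
apply: mulr_ge0 => //; apply: mulr_ge0; first by rewrite divr_ge0 // ltW.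
by apply: mulr_ge0; [exact: theta_ge0|rewrite exprn_ge0 // addr_ge0 // ltW].
Qed.
Let F1 : 1 <= F. Proof. exact: FI_ge1. Qed.
Let F0 : 0 < F := lt_le_trans ltr01 F1.
Let Q0 : 0 < Q%:R :> R. Proof. by rewrite ltr0n expn_gt0. Qed.
Let bb0 : 0 < bb. Proof. by rewrite exprn_gt0 // mulr_gt0 ?invr_gt0 // subr_gt0. Qed.
Let bb1 : bb <= 1.
Proof.
have h1 : 0 <= 2^-1 * (1 - p) by rewrite mulr_ge0 ?invr_ge0 // subr_ge0 ltW.
apply: exprn_ile1 => //; rewrite mulr_ile1 ?invr_ge0 ?subr_ge0 ?(ltW p_lt1) ?invf_le1 ?ler1n // lerBlDr lerDl.
by [].
Qed.

Local Notation L n := (trunc_log Q n).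
Let p1 : (1 < Q)%N. Proof. by rewrite -{1}(expn0 2) ltn_exp2l. Qed.

Let rho1 := Num.max rho (1 / 2).
Let rho1_ge : 1 / 2 <= rho1. Proof. by rewrite le_max lexx orbT. Qed.
Let rho1_lt : rho1 < 1. Proof. by rewrite gt_max rho_lt1 /= ltr_pdivrMr // mul1r ltr1n. Qed.
Let rho1_0 : 0 <= rho1. Proof. by apply: le_trans rho1_ge; rewrite divr_ge0. Qed.
Let C5 : R := 4 ^+ 5 * expR (1 / 2) / x ^+ 4.
Let C5_0 : 0 <= C5. Proof. by rewrite !mulr_ge0 ?invr_ge0 ?exprn_ge0 ?expR_ge0 // ltW. Qed.

Section Size.
Variables (n m : nat).
Hypotheses (n_gt0 : (0 < n)%N) (mE : m%:R = d * n%:R / k%:R).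
Local Notation ell := (L n).
Local Notation Rb := (2 ^ (g * ell))%N.
Local Notation nu := (n%:R^-1 : R).
Let N0 : 0 < n%:R :> R. Proof. by rewrite ltr0n. Qed.
Let k0 : 0 < k%:R :> R. Proof. by rewrite ltr0n ltnW. Qed.

Lemma m_nu : m%:R * nu = d / k%:R.
Proof. by rewrite mE; field; rewrite !lt0r_neq0. Qed.

Lemma RbE : Rb%:R = (2 ^+ g) ^+ ell :> R.
Proof. by rewrite natrX exprM. Qed.

Lemma Q_le_n : Q%:R ^+ ell <= n%:R :> R.
Proof. by rewrite -natrX ler_nat; apply: trunc_logP. Qed.

Lemma n_lt_Q : n%:R <= Q%:R ^+ ell.+1 :> R.
Proof. by rewrite -natrX ler_nat ltnW //; apply: trunc_log_ltn. Qed.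

Lemma RbF_nu : Rb%:R * F ^+ ell * nu <= (1 / 2) ^+ ell.
Proof.
rewrite RbE -exprMn ler_pdivrMr //; apply: le_trans (_ : (1 / 2) ^+ ell * Q%:R ^+ ell <= _).
  rewrite -exprMn; apply: lerXn2r; rewrite ?nnegrE ?mulr_ge0 ?exprn_ge0 ?divr_ge0 ?(ltW F0) ?(ltW Q0) //.
  by rewrite mul1r [leRHS]mulrC ler_pdivlMr // mulrC.
by apply: ler_wpM2l Q_le_n; rewrite exprn_ge0 // divr_ge0.
Qed.

Lemma nu_half : nu <= (1 / 2) ^+ ell.
Proof.
apply: le_trans RbF_nu; rewrite -[leLHS]mul1r ler_wpM2r ?invr_ge0 ?(ltW N0) // mulr_ege1 ?exprn_ege1 //.
by rewrite ler1n expn_gt0.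
Qed.

Lemma F_Rb : F ^+ ell / Rb%:R <= (1 / 2) ^+ ell.
Proof.
rewrite RbE -expr_div_n; apply: lerXn2r; rewrite ?nnegrE ?divr_ge0 ?exprn_ge0 ?(ltW F0) //.
by rewrite ler_pdivrMr ?exprn_gt0 // mulrC mul1r ler_pdivlMr // mulrC.
Qed.

(** Planted mass of all bad events, weighted up to constants by the number of flips exposed to
    them. *)
Definition Yf (H : hypergraph n m k) : R := \sum_(i < m) (ell.+1%:R * planted p (from i) (B1 ell (Kr * ell) i) H +
  ell.+1%:R * Rb%:R * planted p (from i) (B2 ell (Kr * ell) i) H).

Lemma Yf_ge0 H : 0 <= Yf H.
Proof.
apply: sumr_ge0 => i _; apply: addr_ge0; first by apply: mulr_ge0 => //; exact: planted_ge0.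
by apply: mulr_ge0; [exact: mulr_ge0|exact: planted_ge0].
Qed.

(** Summing over order [n] insertions costs one power of [n]. The terms in [n^-2] can afford it,
    also after the factor [Rb * F ^+ ell] of closing insertions by [RbF_nu]; the long cycles, of
    order [n^-1], survive by their factor [rho ^+ ell.-1]. *)
Lemma Yf_mean (c1 c2 c3 : R) : 4 <= x * n%:R -> 0 <= c1 -> 0 <= c2 -> 0 <= c3 -> (0 < ell)%N ->
  0 <= tb k p d x Kr q0 n ell <= c1 * ell.+1%:R ^+ 8 * nu ^+ 2 ->
  0 <= lb k p d x Kr n ell <= c2 * ell.+1%:R ^+ 8 * nu ^+ 1 ->
  0 <= sb k p d x Kr q0 n ell <= c3 * ell.+1%:R ^+ 8 * nu ^+ 2 ->
  avg Yf <= d / k%:R * (c1 + C5 + 2 * c2 + c3 + C5) * (ell.+1%:R ^+ 9 * rho1 ^+ ell).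
Proof.
move=> xn c10 c20 c30 l0 /andP[t0 t1] /andP[b0 b1] /andP[s0 s1].
have Qn : (n < Q ^ ell.+1)%N by apply: trunc_log_ltn.
have C5E : 4 ^+ 5 * expR (1 / 2) / (x ^+ 4 * n%:R ^+ 2) = C5 * nu ^+ 2.
  by rewrite /C5; field; rewrite !lt0r_neq0 ?exprn_gt0.
set T := ell.+1%:R; have T1 : 1 <= T ^+ 8 by rewrite exprn_ege1 // ler1n.
have T0 : 0 <= T by [].
have nu0 : 0 <= nu by rewrite invr_ge0.
have r0 : 0 <= rho ^+ ell.-1 by rewrite exprn_ge0.
have Fl1 : 1 <= F ^+ ell by rewrite exprn_ege1.
have h1 (i : 'I_m) : avg (fun H : hypergraph n m k => planted p (from i) (B1 ell (Kr * ell) i) H) <= (c1 + C5) * T ^+ 8 * nu ^+ 2 + c2 * T ^+ 8 * nu * rho ^+ ell.-1.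
  apply: (@le_trans _ _ (tb k p d x Kr q0 n ell + lb k p d x Kr n ell * rho ^+ ell.-1 + 4 ^+ 5 * expR (1 / 2) / (x ^+ 4 * n%:R ^+ 2))).
    apply: avg_planted_le => //; first by rewrite addr_ge0 // mulr_ge0.
    by move=> s hs; apply: B1_le.
  rewrite C5E addrAC; apply: lerD; last by apply: ler_wpM2r => //; move: b1; rewrite expr1.
  rewrite !mulrDl; apply: lerD => //; rewrite -mulrA; apply: ler_wpM2l => //.
  by rewrite -[leLHS]mul1r ler_wpM2r // exprn_ge0.
have h2 (i : 'I_m) : avg (fun H : hypergraph n m k => planted p (from i) (B2 ell (Kr * ell) i) H) <= (c3 + C5) * T ^+ 8 * F ^+ ell * nu ^+ 2.
  apply: (@le_trans _ _ (sb k p d x Kr q0 n ell * F ^+ ell + 4 ^+ 5 * expR (1 / 2) / (x ^+ 4 * n%:R ^+ 2))).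
    apply: avg_planted_le => //; first by rewrite mulr_ge0 // ltW // exprn_gt0.
    by move=> s hs; apply: B2_le.
  rewrite C5E !mulrDl; apply: lerD.
    by rewrite [leRHS]mulrAC; apply: ler_wpM2r => //; rewrite ltW // exprn_gt0.
  apply: ler_wpM2r; first by rewrite exprn_ge0.
  by rewrite -mulrA -[leLHS]mulr1 ler_wpM2l // mulr_ege1.
rewrite /Yf avg_sum.
apply: le_trans (_ : \sum_(i < m) (T * ((c1 + C5) * T ^+ 8 * nu ^+ 2 + c2 * T ^+ 8 * nu * rho ^+ ell.-1) +
   T * Rb%:R * ((c3 + C5) * T ^+ 8 * F ^+ ell * nu ^+ 2)) <= _).
  apply: ler_sum => i _; rewrite avgD; apply: lerD; rewrite avgZ.
    by apply: ler_wpM2l; [|exact: h1].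
  by apply: ler_wpM2l; [exact: mulr_ge0|exact: h2].
rewrite sumr_const card_ord -[X in X <= _]mulr_natl.
have -> : m%:R * (T * ((c1 + C5) * T ^+ 8 * nu ^+ 2 + c2 * T ^+ 8 * nu * rho ^+ ell.-1) +
   T * Rb%:R * ((c3 + C5) * T ^+ 8 * F ^+ ell * nu ^+ 2)) =
   (m%:R * nu) * (T ^+ 9 * ((c1 + C5) * nu + c2 * rho ^+ ell.-1 + (c3 + C5) * (Rb%:R * F ^+ ell * nu))) by ring.
rewrite m_nu -[leRHS]mulrA; apply: ler_wpM2l; first by rewrite divr_ge0 // ltW.
rewrite [leRHS]mulrCA; apply: ler_wpM2l; first exact: exprn_ge0.
have hh : (1 / 2) ^+ ell <= rho1 ^+ ell by apply: lerXn2r; rewrite ?nnegrE ?divr_ge0.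
have e1 : nu <= rho1 ^+ ell := le_trans nu_half hh.
have e2 : Rb%:R * F ^+ ell * nu <= rho1 ^+ ell := le_trans RbF_nu hh.
have e3 : rho ^+ ell.-1 <= 2 * rho1 ^+ ell.
  apply: (@le_trans _ _ (rho1 ^+ ell.-1)); first by apply: lerXn2r; rewrite ?nnegrE // le_max lexx.
  rewrite -{2}(prednK l0) exprS mulrA -[leLHS]mul1r ler_wpM2r ?exprn_ge0 //.
  by move: rho1_ge; rewrite ler_pdivrMr // mulrC.
have -> : (c1 + C5 + 2 * c2 + c3 + C5) * rho1 ^+ ell = (c1 + C5) * rho1 ^+ ell + c2 * (2 * rho1 ^+ ell) + (c3 + C5) * rho1 ^+ ell by ring.
by rewrite !lerD // ler_wpM2l // addr_ge0.
Qed.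

(** At [set0] nothing is planted, so the average is over the plain random hypergraph; a closing
    hyperedge satisfies [CL] whatever the spins and coins. *)
Lemma closers_mean (c4 : R) : 0 <= c4 -> 0 <= cb k p d Kr n ell <= c4 * ell.+1%:R ^+ 8 * nu ^+ 1 ->
  avg (fun H : hypergraph n m k => #|[set i | (pre H ell i).1]|%:R : R) <= d / k%:R * c4 * ell.+1%:R ^+ 8 * F ^+ ell.
Proof.
move=> c40 /andP[b0 b1].
apply: le_trans (_ : avg (fun H : hypergraph n m k => \sum_(i < m) planted p set0 (@CL k n m ell i) H) <= _).
  apply: ler_avg => H; rewrite -sum1_card natr_sum big_mkcond; apply: ler_sum => i _.
  rewrite inE; case: ifP => f; last exact: planted_ge0.
  rewrite /planted cards0 expr0 invr1.
  have -> : \sum_s \sum_c 1 * gibbs_wt (fun j => [set v in H j]) p set0 s * coin_wt p c * (@CL k n m ell i s (joint H c))%:R = 2 ^+ n.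
    have hCL (s : spins n) c : @CL k n m ell i s (joint H c) = true by apply: closer_seg.
    rewrite (eq_bigr (fun=> 1)) => [|s _]; first by rewrite sumr_const card_ffun card_bool card_ord natrX.
    transitivity (\sum_(c : {ffun 'I_m -> bool}) coin_wt p c); last exact: sum_coin_wt.
    by apply: eq_bigr => c _; rewrite hCL /gibbs_wt big_set0 !mul1r mulr1.
  by rewrite mulVf // expf_neq0 // pnatr_eq0.
rewrite avg_sum; apply: le_trans (_ : \sum_(i < m) cb k p d Kr n ell * F ^+ ell <= _).
  apply: ler_sum => i _; rewrite avg_planted.
  have -> : cb k p d Kr n ell * F ^+ ell = (2 ^+ n)^-1 * \sum_(s : spins n) (cb k p d Kr n ell * F ^+ ell).
    by rewrite sumr_const card_ffun card_bool card_ord -[X in _ = _ * X]mulr_natl natrX mulrA mulVf ?mul1r // expf_neq0 // pnatr_eq0.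
  apply: ler_wpM2l; first by rewrite invr_ge0 exprn_ge0.
  by apply: ler_sum => s _; exact: (CL_le k_ge2 p_ge0 p_lt1 d_gt0 x_gt0 rho_lt1 KrP).
rewrite sumr_const card_ord -[X in X <= _]mulr_natl mulrA; apply: ler_wpM2r; first by rewrite exprn_ge0 // ltW.
apply: le_trans (ler_wpM2l _ b1) _ => //; rewrite -m_nu expr1 le_eqVlt; apply/orP; left; apply/eqP; ring.
Qed.

Lemma error_le (de : R) (H : hypergraph n m k) : 0 < de -> (0 < ell)%N -> (q0.+1 * ell.+1 <= 2 ^ ell)%N ->
  ~~ [exists u : 'I_m.+1, part_fun (fun j => [set v in H j]) p (suffix_set m u) < de * 2 ^+ n * kap k p ^+ #|suffix_set m u|] ->
  (#|[set i | (pre H ell i).1]| <= Rb)%N ->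
  l1 (fun s => out_law H p ell Rb csw cR s - gibbs (fun j => [set v in H j]) p setT s) <=
    4 * (1 - p)^-1 * (k * cR.+1)%:R * de^-1 * Yf H + d * (1 - p)^-1 * (Q%:R + 1) * (1 / 2) ^+ ell.
Proof.
move=> de0 l0 hell hZ hc.
set Bc := (1 - p)^-1; have Bc0 : 0 <= Bc by rewrite invr_ge0 subr_ge0 ltW.
have hn1 : ((Kr * ell + Kr * ell).+4 <= nsw ell csw)%N by rewrite /nsw cswP; apply: nsw_ge1.
have hn2 : (ell + Kr * ell + 2 <= nsw ell csw)%N by rewrite /nsw cswP; apply: nsw_ge2.
apply: le_trans (@out_law_error R n m k H p ell Rb csw cR (Kr * ell) p_ge0 p_lt1 l0 hn1 hn2 hc) _.
have pl B (i : 'I_m) : bp H p i B <= de^-1 * planted p (from i) (B i) H.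
  apply: bad_prob_planted => //; rewrite leNgt; move: hZ; rewrite negb_exists => /forallP h.
  have hu : (m - i < m.+1)%N by rewrite ltnS leq_subr.
  have := h (Ordinal hu); have -> : suffix_set m (Ordinal hu) = from i by apply/setP => j; rewrite !inE /= subKn // ltnW.
  by [].
pose t1 := (1 - bb) ^+ (cR * ell); pose t2 := (1 - bb ^+ ell.+1) ^+ Rb.
have bbX : (2^-1 * (1 - p)) ^+ (k * ell.+1) = bb ^+ ell.+1 by rewrite exprM.
apply: le_trans (_ : \sum_(i < m) (4 * Bc * (k * cR.+1)%:R * de^-1 * (ell.+1%:R * planted p (from i) (B1 ell (Kr * ell) i) H +
    ell.+1%:R * Rb%:R * planted p (from i) (B2 ell (Kr * ell) i) H) + Bc * (t1 + t2)) <= _).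
  apply: ler_sum => i _; rewrite /ins_err muln1 bbX -/Bc -/t1 -/t2.
  set u1 := planted _ _ (B1 _ _ _) _; set u2 := planted _ _ (B2 _ _ _) _.
  have u10 : 0 <= u1 by exact: planted_ge0.
  have u20 : 0 <= u2 by exact: planted_ge0.
  have dV : 0 <= de^-1 by rewrite invr_ge0 ltW.
  have v1 : (cR * ell * k)%:R * bp H p i (B1 ell (Kr * ell)) <= (k * cR.+1)%:R * de^-1 * (ell.+1%:R * u1).
    apply: le_trans (_ : (k * cR.+1 * ell.+1)%:R * (de^-1 * u1) <= _).
      apply: ler_pM => //; [exact: bad_prob_ge0|by rewrite ler_nat; apply: push_count].
    by rewrite natrM le_eqVlt; apply/orP; left; apply/eqP; ring.
  have v2 : (Rb * (k * ell.+1))%:R * bp H p i (B2 ell (Kr * ell)) <= (k * cR.+1)%:R * de^-1 * (ell.+1%:R * Rb%:R * u2).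
    apply: le_trans (_ : (k * cR.+1 * (ell.+1 * Rb))%:R * (de^-1 * u2) <= _).
      apply: ler_pM => //; [exact: bad_prob_ge0|rewrite ler_nat].
      have -> : (Rb * (k * ell.+1) = k * (ell.+1 * Rb))%N by rewrite mulnC mulnA.
      by rewrite -[(k * cR.+1 * _)%N]mulnA leq_mul // leq_pmull.
    by rewrite !natrM le_eqVlt; apply/orP; left; apply/eqP; ring.
  have B4 : 0 <= 4 * Bc by rewrite mulr_ge0.
  have w1 := ler_wpM2l B4 v1; have w2 := ler_wpM2l B4 v2.
  rewrite [X in _ <= X](_ : _ = (4 * Bc * ((k * cR.+1)%:R * de^-1 * (ell.+1%:R * u1)) + Bc * t1) +
     (4 * Bc * ((k * cR.+1)%:R * de^-1 * (ell.+1%:R * Rb%:R * u2)) + Bc * t2)); last by ring.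
  by apply: lerD; rewrite lerD2r.
rewrite big_split /= -mulr_sumr -/(Yf H) lerD2l sumr_const card_ord -[X in X <= _]mulr_natl.
have mn : m%:R <= d * n%:R by rewrite mE ler_pdivrMr // -[leLHS]mulr1 ler_wpM2l ?mulr_ge0 ?(ltW d_gt0) // ler1n ltnW.
have b1b : 0 <= 1 - bb by rewrite subr_ge0.
have ht1 : n%:R * t1 <= Q%:R * (1 / 2) ^+ ell.
  apply: le_trans (_ : Q%:R ^+ ell.+1 * (2 * Q%:R)^-1 ^+ ell <= _).
    apply: ler_pM => //; [by rewrite exprn_ge0|exact: n_lt_Q|].
    by rewrite /t1 exprM; apply: lerXn2r; rewrite ?nnegrE ?exprn_ge0 ?invr_ge0 ?mulr_ge0 ?(ltW Q0).
  rewrite exprS -mulrA -exprMn le_eqVlt; apply/orP; left; apply/eqP; congr (_ * _ ^+ _).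
  by field; rewrite lt0r_neq0.
(* A group of [2 ^ (g1 * ell)] rounds halves the error, and the [2 ^ ((g - g1) * ell)] groups are at
   least [q0.+1 * ell.+1] in number, which beats [Q ^+ ell.+1] and hence [n]. *)
have ht2 : n%:R * t2 <= (1 / 2) ^+ ell.
  pose h := bb ^+ ell.+1; have h0 : 0 <= h by rewrite exprn_ge0 // ltW.
  have h1 : h <= 1 by rewrite exprn_ile1 // ltW.
  have h1b : 0 <= 1 - h by rewrite subr_ge0.
  pose R1 := (2 ^ (g1 * ell))%N; pose W := (2 ^ ((g - g1) * ell))%N.
  have RW : Rb = (R1 * W)%N by rewrite /R1 /W -expnD -mulnDl subnKC // ltnW.
  have R1h : 1 <= R1%:R * h.
    have bp2 : 0 < bb ^+ 2 by rewrite exprn_gt0.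
    apply: le_trans (_ : (2 ^+ g1 * bb ^+ 2) ^+ ell <= _).
      by rewrite exprn_ege1 // -ler_pdivrMr // mul1r.
    rewrite exprMn /R1 natrX exprM; apply: ler_wpM2l; first by rewrite exprn_ge0 // exprn_ge0.
    rewrite /h [leLHS](_ : _ = bb ^+ (2 * ell)); last by rewrite [RHS]exprM.
    by apply: (ler_wiXn2l (ltW bb0) bb1); move: l0; clear; lia.
  have half : (1 - h) ^+ R1 <= 1 / 2.
    have := pow_decay R1 h0 h1; have : 2 <= 1 + R1%:R * h by rewrite -[2]/(1 + 1) lerD2l.
    move=> e2 e1; rewrite ler_pdivlMr //; apply: le_trans e1; apply: ler_wpM2l => //; exact: exprn_ge0.
  apply: le_trans (_ : Q%:R ^+ ell.+1 * (1 / 2) ^+ (q0.+1 * ell.+1) <= _).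
    apply: ler_pM => //; [by rewrite exprn_ge0|exact: n_lt_Q|].
    rewrite /t2 -/h RW exprM; apply: (@le_trans _ _ ((1 / 2) ^+ W)).
      by apply: lerXn2r; rewrite ?nnegrE ?exprn_ge0 ?divr_ge0.
    apply: ler_wiXn2l; rewrite ?divr_ge0 ?ler_pdivrMr ?mul1r ?ler1n //.
    apply: leq_trans hell _; rewrite leq_exp2l // leq_pmull // subn_gt0 //.
  rewrite mulnC exprM.
  have -> : Q%:R ^+ ell.+1 * ((1 / 2) ^+ ell.+1) ^+ q0.+1 = (1 / 2) ^+ ell.+1 :> R.
    have e (u : R) : u ^+ q0.+1 = u * u ^+ q0 by rewrite exprS.
    have e2 : Q%:R * (1 / 2) ^+ q0 = 1 :> R.
      by rewrite natrX -exprMn (_ : 2 * (1 / 2) = 1) ?expr1n //; field.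
    by rewrite e mulrCA -exprM [(ell.+1 * q0)%N]mulnC exprM -exprMn e2 expr1n mulr1.
  by apply: ler_wiXn2l; rewrite ?divr_ge0 ?ler_pdivrMr ?mul1r ?ler1n ?leqnSn.
have t12 : 0 <= t1 + t2.
  rewrite addr_ge0 // exprn_ge0 // subr_ge0 exprn_ile1 //; exact: ltW.
apply: le_trans (ler_wpM2r _ mn) _; first by rewrite mulr_ge0.
have -> : d * n%:R * (Bc * (t1 + t2)) = d * Bc * (n%:R * t1 + n%:R * t2) by ring.
rewrite -[leRHS]mulrA; apply: ler_wpM2l; first by rewrite mulr_ge0 // ltW.
by rewrite mulrDl [1 * (_ ^+ _)]mul1r; apply: lerD.
Qed.

End Size.

Hypothesis hreg : d * k.-1%:R * theta k p < 1.

Lemma whp : exists c : R, 0 < c /\ forall eps : R, 0 < eps -> exists n0, forall n m, (n0 <= n)%N -> m%:R = d * n%:R / k%:R ->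
  avg (fun H : hypergraph n m k => (~~ (l1 (fun s => out_law H p (L n) (2 ^ (g * L n)) csw cR s -
    gibbs (fun j => [set v in H j]) p setT s) <= n%:R `^ (- c))%R)%:R) <= eps.
Proof.
have [c1 [c10 h1]] := bnd_tb k_ge2 p_ge0 p_lt1 d_gt0 x_gt0 rho_lt1 KrP.
have [c2 [c20 h2]] := bnd_lb k_ge2 p_ge0 p_lt1 d_gt0 x_gt0 rho_lt1 KrP.
have [c3 [c30 h3]] := bnd_sb k_ge2 p_ge0 p_lt1 d_gt0 x_gt0 rho_lt1 KrP.
have [c4 [c40 h4]] := bnd_cb k_ge2 p_ge0 p_lt1 d_gt0 x_gt0 rho_lt1 KrP.
have [CY [y [CY0 yh y1 hy]]] := poly_pow 9 rho1_0 rho1_lt.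
have hf0 : 0 <= 1 / 2 :> R by rewrite divr_ge0.
have hf1 : 1 / 2 < 1 :> R by rewrite ltr_pdivrMr // mul1r ltr1n.
have [C4 [z [C40 zh z1 hz]]] := poly_pow 8 hf0 hf1.
have z0 : 0 <= z := le_trans hf0 zh.
(* Two square roots of the rate are given away: the first to Markov's inequality for [Yf], the
   second to the multiplicative constants. *)
have [y20 y2h y21 y2E] := sqrt_facts yh y1; set y2 := Num.sqrt y in y20 y2h y21 y2E *.
have [y30 y3h y31 y3E] := sqrt_facts y2h y21; set y3 := Num.sqrt y2 in y30 y3h y31 y3E *.
have lQ : 0 < ln Q%:R :> R by apply: ln_gt0; rewrite ltr1n.
have ly : ln y3 < 0 by rewrite -[ltRHS](@ln1 R) ltr_ln ?posrE.
(* Since [n <= Q ^+ ell.+1], the bound [y3 ^+ ell.+1] is at most this negative power of [n]. *)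
exists (- ln y3 / ln Q%:R); split; first by rewrite divr_gt0 // oppr_gt0.
move=> eps eps0; pose e3 := eps / 3; have e30 : 0 < e3 by rewrite divr_gt0.
have [de [de0 hde]] := contiguity k_ge2 p_ge0 p_lt1 d_gt0 hreg e30.
have dk0 : 0 <= d / k%:R by rewrite divr_ge0 // ltW.
pose AY := d / k%:R * (c1 + C5 + 2 * c2 + c3 + C5) * CY.
have AY0 : 0 <= AY by apply: mulr_ge0 => //; apply: mulr_ge0 => //; rewrite !addr_ge0 // mulr_ge0.
pose AC := d / k%:R * c4 * C4; have AC0 : 0 <= AC by apply: mulr_ge0 => //; apply: mulr_ge0.
pose Bc := (1 - p)^-1; have Bc0 : 0 <= Bc by rewrite invr_ge0 subr_ge0 ltW.
pose a1 := 4 * Bc * (k * cR.+1)%:R * de^-1; have a10 : 0 <= a1 by rewrite !mulr_ge0 // invr_ge0 ltW.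
pose a2 := d * Bc * (Q%:R + 1); have a20 : 0 <= a2 by rewrite !mulr_ge0 ?addr_ge0 // ltW.
have small t (u e : R) : 0 <= t -> t < 1 -> 0 <= u -> 0 < e -> exists N, forall q, (N <= q)%N -> u * t ^+ q <= e.
  move=> t0 t1 u0 e0; have u1 : 0 < u + 1 by apply: ltr_wpDl.
  have [N hN] := pow_small t0 t1 (divr_gt0 e0 u1); exists N => q /hN h.
  apply: le_trans (_ : (u + 1) * (e / (u + 1)) <= _); last by rewrite mulrC divfK // lt0r_neq0.
  by apply: ler_pM => //; [exact: exprn_ge0|rewrite lerDl].
have [N1 hN1] := small y2 AY e3 (ltW y20) y21 AY0 e30.
have [N2 hN2] := small z AC e3 z0 z1 AC0 e30.
have [N3 hN3] := small y3 (a1 + a2) y3 (ltW y30) y31 (addr_ge0 a10 a20) y30.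
have [nx hnx] := pow_large (4 / x).
pose S := (N1 + N2 + N3 + 4 * q0.+1 + 1)%N; exists (Q ^ S + 2 ^ nx)%N => n m hn mE.
have n_gt0 : (0 < n)%N by apply: leq_trans hn; rewrite addn_gt0 expn_gt0 expn_gt0.
have N0 : 0 < n%:R :> R by rewrite ltr0n.
have lS : (S <= L n)%N by apply: trunc_log_max => //; apply: leq_trans hn; apply: leq_addr.
set ell := L n in lS *; pose Rb := (2 ^ (g * ell))%N.
have l0 : (0 < ell)%N by apply: leq_trans lS; rewrite /S addn1.
have hell : (q0.+1 * ell.+1 <= 2 ^ ell)%N.
  by apply: exp_ge; apply: leq_trans (leqnSn _); apply: leq_trans lS; rewrite /S -addnA; apply: leq_trans (leq_addr _ _) (leq_addl _ _).
have xn : 4 <= x * n%:R.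
  rewrite mulrC -ler_pdivrMr //; apply: le_trans hnx _; rewrite -natrX ler_nat; apply: leq_trans hn; exact: leq_addl.
have Rb0 : 0 < Rb%:R :> R by rewrite ltr0n expn_gt0.
pose E1 (H : hypergraph n m k) := [exists u : 'I_m.+1, part_fun (fun j => [set v in H j]) p (suffix_set m u) < de * 2 ^+ n * kap k p ^+ #|suffix_set m u|].
pose E2 (H : hypergraph n m k) := Rb%:R < #|[set i | (pre H ell i).1]|%:R :> R.
pose E3 (H : hypergraph n m k) := y2 ^+ ell < Yf H.
apply: (@le_trans _ _ (avg (fun H : hypergraph n m k => (E1 H)%:R + ((E2 H)%:R + (E3 H)%:R)))).
  apply: ler_avg => H; case e1 : (E1 H); first by apply: (@le_trans _ _ 1); [rewrite lern1 leq_b1|rewrite lerDl addr_ge0].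
  case e2 : (E2 H); first by rewrite add0r; apply: (@le_trans _ _ 1); [rewrite lern1 leq_b1|rewrite lerDl].
  case e3' : (E3 H); first by rewrite !add0r lern1 leq_b1.
  rewrite !add0r lern0 eqb0 negbK.
  have hc : (#|[set i | (pre H ell i).1]| <= Rb)%N by move/negbT: e2; rewrite /E2 -leNgt ler_nat.
  have hE : l1 (fun s => out_law H p ell Rb csw cR s - gibbs (fun j => [set v in H j]) p setT s) <= a1 * Yf H + a2 * (1 / 2) ^+ ell.
    by apply: error_le => //; exact: (negbT e1).
  apply: le_trans hE _; have hY : Yf H <= y2 ^+ ell by move/negbT: e3'; rewrite /E3 -leNgt.
  apply: (@le_trans _ _ ((a1 + a2) * y2 ^+ ell)).
    rewrite mulrDl; apply: lerD; first exact: ler_wpM2l.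
    by apply: ler_wpM2l => //; apply: lerXn2r; rewrite ?nnegrE // ltW.
  apply: (@le_trans _ _ (y3 ^+ ell.+1)).
    rewrite -y3E -exprM mulnC exprM expr2 mulrA exprS; apply: ler_wpM2r; first by rewrite exprn_ge0 // ltW.
    by apply: hN3; apply: leq_trans lS; rewrite /S -!addnA; apply: leq_trans (leq_addr _ _) (leq_trans (leq_addl _ _) (leq_addl _ _)).
  rewrite /powR pnatr_eq0 (gtn_eqF n_gt0).
  rewrite -{1}[y3]lnK ?posrE // -expRM_natl ler_expR.
  have hln : ln n%:R <= ell.+1%:R * ln Q%:R :> R.
    rewrite mulr_natl -lnXn // ler_ln ?posrE ?exprn_gt0 //; exact: n_lt_Q.
  rewrite -subr_ge0.
  have -> : - (- ln y3 / ln Q%:R) * ln n%:R - ell.+1%:R * ln y3 = - ln y3 * ((ell.+1%:R * ln Q%:R - ln n%:R) / ln Q%:R).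
    by field; rewrite lt0r_neq0.
  by rewrite mulr_ge0 ?oppr_ge0 ?(ltW ly) // divr_ge0 ?(ltW lQ) // subr_ge0.
have -> : eps = e3 + (e3 + e3) by rewrite /e3; field.
rewrite !avgD; apply: lerD; first exact: hde.
apply: lerD.
  apply: le_trans (@avg_markov R _ (fun H : hypergraph n m k => #|[set i | (pre H ell i).1]|%:R) _ Rb0 _) _; first by move=> H; exact: ler0n.
  apply: le_trans (ler_wpM2l _ (closers_mean n_gt0 mE c40 (h4 n ell n_gt0))) _; first by rewrite invr_ge0 ltW.
  apply: (@le_trans _ _ (AC * z ^+ ell)); last by apply: hN2; apply: leq_trans lS; rewrite /S -!addnA; apply: leq_trans (leq_addr _ _) (leq_addl _ _).
  have -> : Rb%:R^-1 * (d / k%:R * c4 * ell.+1%:R ^+ 8 * FI k p d ^+ ell) = d / k%:R * c4 * (ell.+1%:R ^+ 8 * (FI k p d ^+ ell / Rb%:R)) by ring.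
  rewrite /AC -[leRHS]mulrA; apply: ler_wpM2l; first exact: mulr_ge0.
  apply: le_trans (hz ell); apply: ler_wpM2l; first exact: exprn_ge0.
  exact: F_Rb.
apply: le_trans (@avg_markov R _ (fun H : hypergraph n m k => Yf H) _ (exprn_gt0 ell y20) _) _; first by move=> H; exact: Yf_ge0.
apply: le_trans (ler_wpM2l _ (Yf_mean n_gt0 mE xn c10 c20 c30 l0 (h1 n ell n_gt0) (h2 n ell n_gt0) (h3 n ell n_gt0))) _.
  by rewrite invr_ge0 exprn_ge0 // ltW.
apply: (@le_trans _ _ (AY * y2 ^+ ell)); last by apply: hN1; apply: leq_trans lS; rewrite /S -!addnA; apply: leq_addr.
have yp : 0 < y2 ^+ ell by rewrite exprn_gt0.
rewrite mulrC ler_pdivrMr // /AY; set w := (_ ^+ 9 * _); rewrite -!mulrA.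
apply: ler_wpM2l; first exact: ltW.
apply: ler_wpM2l; first by rewrite invr_ge0.
apply: ler_wpM2l; first by rewrite !addr_ge0 // mulr_ge0.
by rewrite -expr2 -exprM mulnC exprM y2E /w; exact: hy.
Qed.

End Params.

(** * The algorithm on the machine, and the theorem *)

Section Machine.
Variables (R : realType) (k : nat) (beta : R).
Hypothesis beta_le0 : beta <= 0.
Local Notation p := (1 - expR beta).

Lemma ex_one X c cs (s : st) : ex X c cs (fun=> 1 : R) s = 1.
Proof.
elim: c cs s => [|t e f|t e x|a IHa b IHb|e f a IHa b IHb|e c IHc|e c IHc] cs s //=.
- by rewrite !mulr1 addrC subrK.
- by have -> : ex X b cs (fun=> 1) = (fun=> 1) by apply/funext.
- by case: ifP.
- move: (ev cs s e) => q; elim: q s => //= q IH s; rewrite -[RHS](IHc (rcons cs q) s); congr (ex _ _ _ _ _).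
  by apply/funext => s'; rewrite IH.
Qed.

Let e01 : 0 < expR beta <= 1. Proof. by rewrite expR_gt0 -expR0 ler_expR. Qed.

Lemma p_bound : 0 <= p < 1.
Proof. by have /andP[h1 h2] := e01; rewrite subr_ge0 h2 /= ltrBlDr ltrDl. Qed.

Lemma pr_half (X0 : nat -> R) : pr (xfin X0) 1 = 2^-1.
Proof.
have -> : pr (xfin X0) 1 = Num.max 0 (Num.min 1 (1 / (1 + 1))) by [].
have -> : 1 / (1 + 1) = 2^-1 :> R by rewrite mul1r.
by rewrite (min_idPr _) ?(max_idPr _) ?invr_ge0 ?invf_le1 ?ler1n.
Qed.

Lemma pr_p (X0 : nat -> R) : X0 0%N = expR beta -> pr (xfin X0) 2 = p.
Proof.
move=> h; have -> : pr (xfin X0) 2 = Num.max 0 (Num.min 1 (1 - X0 0%N)) by [].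
have /andP[h1 h2] := p_bound; rewrite h (min_idPr _) ?(max_idPr _) //; exact: ltW.
Qed.

Lemma mono_prodE n (s : spins n) (t : k.-tuple 'I_n) :
  \prod_(i < k) \prod_(j < k) (s (tnth t i) == s (tnth t j))%:R = (mono s [set v in t])%:R :> R.
Proof.
case: (boolP [forall i, forall j, s (tnth t i) == s (tnth t j)]) => h.
  have -> : mono s [set v in t].
    apply/monoP => u v; rewrite !inE => /tnthP[i ->] /tnthP[j ->].
    by move/forallP: h => /(_ i) /forallP /(_ j) /eqP.
  by apply: big1 => i _; apply: big1 => j _; move/forallP: h => /(_ i) /forallP /(_ j) ->.
move: h; rewrite negb_forall => /existsP[i]; rewrite negb_forall => /existsP[j hij].
have -> : mono s [set v in t] = false.
  by apply/monoP => h; move: hij; rewrite (h (tnth t i) (tnth t j)) ?inE ?mem_tnth // eqxx.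
by rewrite (bigD1 i) //= (bigD1 j) //= (negbTE hij) !mul0r.
Qed.

Lemma ising_gibbs n m (H : hypergraph n m k) s :
  ising beta 0 H s = gibbs (fun j => [set v in H j]) p setT s.
Proof.
have w t : ising_weight beta 0 H t = gibbs_wt (fun j => [set v in H j]) p setT t.
  rewrite /ising_weight mul0r addr0 mulr_sumr expR_sum /gibbs_wt; apply: eq_big => [j|j _]; first by rewrite inE.
  rewrite mono_prodE /edge_wt; case: (mono _ _); rewrite ?mulr1 ?mulr0 ?expR0 ?subr0 //.
  by rewrite opprB addrC subrK.
by rewrite /ising /gibbs /part_fun w; congr (_ / _); apply: eq_bigr => t _; rewrite w.
Qed.

Variables (Ce q0 g csw cR : nat).
Hypotheses (q0_gt0 : (0 < q0)%N) (gq : (2 * g <= q0)%N).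
Let main := main_cmd k q0 g csw cR.
Definition alg := prog k Ce main.
Local Notation L n := (trunc_log (2 ^ q0) n).

Lemma output_lawE n m (H : hypergraph n m k) s : (0 < n)%N -> (m <= 2 ^ Ce * n)%N ->
  output_law alg beta H s = out_law H p (L n) (2 ^ (g * L n)) csw cR s.
Proof.
move=> n0 hm; have [s0 [hE hP]] := prog_correct beta main H n0 hm.
pose phi (st : st) : R := ([ffun x : 'I_n => st tS x != 0%N] == s)%:R.
have hA : forall (st : st) N X, (forall x, (x < n)%N -> N x = st tS x) ->
    ((output n (@State R (pend k Ce main) N X) == s)%:R : R) = phi st.
  by move=> st N X h; rewrite /phi; congr ((_ == _)%:R); apply/ffunP => x; rewrite !ffunE /= h.
have {}hP := hP (fun s1 => output n s1 == s) phi hA; set X := xfin _ in hP.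
have eE : ex X main [:: n; m] phi s0 = out_law H p (L n) (2 ^ (g * L n)) csw cR s.
  rewrite (@main_law R X n m k q0 g csw cR H p (fun sg => (sg == s)%:R)) //.
  - have := @law_dual R n m k H p (L n) (2 ^ (g * L n)) csw cR (down m) (fun=> (2 ^+ n)^-1, (2 ^ (g * L n))%N) (fun a => (a.1 == s)%:R).
    rewrite /= exprVn => ->; rewrite (bigD1 s) //= eqxx mulr1 big1 ?addr0 // => s' /negbTE ->.
    by rewrite mulr0.
  - exact: input_hasE.
  - exact: pr_half.
  - exact: pr_p.
  - move=> sg st h; rewrite /phi; congr ((_ == _)%:R); apply/ffunP => x; rewrite ffunE h.
    by case: (sg x).
(* The halting probability no longer changes once [t] exceeds the worst-case time, so the limit is
   attained. *)
rewrite /output_law -eE; apply: lim_near_cst; first exact: Rhausdorff.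
set t0 := (_ + _)%N in hP; exists t0 => // t /= ht; exact: hP.
Qed.

Local Open Scope classical_set_scope.
Local Open Scope ring_scope.

Lemma alg_time : exists T : nat -> nat, runs_in_time alg k beta T /\
  (fun n : nat => (T n)%:R : R^o) =O_\oo (fun n : nat => (n%:R * ln n%:R) ^+ 2 : R^o).
Proof.
have [A hA] := @main_time k csw cR q0 g Ce q0_gt0 gq R (depth main + 12).
(* One bound for all branches: the summand [1] serves the immediate halt at [n = 0], and [tim_pro]
   alone covers the halt on too many hyperedges. *)
pose T n := (tim_pro k Ce main (2 ^ Ce * n) + (A * (n * (L n).+1) ^ 2 + tim_epi main n) + 1)%N.
exists T; split.
  move=> n m H; have [n0|n0] := posnP n; first by rewrite (prog_zero Ce beta main H xpredT n0) // /T addn1.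
  have [hm|hm] := leqP m (2 ^ Ce * n).
    have [s0 [hE hP]] := prog_correct beta main H n0 hm.
    rewrite (hP xpredT (fun=> 1)) ?ex_one //.
    apply: leq_trans (_ : tim_pro k Ce main m + (A * (n * (L n).+1) ^ 2 + tim_epi main n) <= _)%N.
      by rewrite leq_add2l; apply: (hA n m H) => //; exact: input_hasE hE.
    rewrite /T -addnA; apply: leq_add; last exact: leq_addr.
    by rewrite /tim_pro leq_add2r leq_add2l leq_mul2l leq_mul2l hm !orbT.
  have [|N [X ->]] := @prog_dense R k Ce beta main n m H xpredT (T n) n0 hm; last by [].
  rewrite /T -addnA; apply: leq_trans (leq_addr _ _); rewrite /tim_pro leq_add2r leq_add2l muln0; exact: leq0n.
pose c1 := (tim_line k Ce main + 12 * (k * 2 ^ Ce) + 8 + A + (17 + 12 + tim_low main) + 1)%N.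
have hT n : (0 < n)%N -> (T n <= c1 * (n * (L n).+1) ^ 2)%N.
  move=> n0; rewrite /T /c1 /tim_pro /tim_epi; set y := ((n * (L n).+1) ^ 2)%N.
  have y1 : (n <= y)%N by rewrite /y -mulnn; apply: leq_trans (leq_mul (leq_pmulr n (ltn0Sn (L n))) (_ : 1 <= _)%N); rewrite ?muln1 ?muln_gt0 ?n0.
  have y2 : (0 < y)%N by apply: leq_trans y1.
  have -> : (12 * (k * (2 ^ Ce * n)) = 12 * (k * 2 ^ Ce) * n)%N by rewrite !mulnA.
  have h1 := leq_mul (leqnn (12 * (k * 2 ^ Ce))) y1; have h2 := leq_pmulr (tim_line k Ce main) y2.
  have h3 := leq_pmulr (tim_low main) y2.
  move: h1 h2 h3 y1 y2; move: (12 * (k * 2 ^ Ce))%N (tim_line k Ce main) (tim_low main) (y) => w a b z; clear.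
  by rewrite !mulnDl; lia.
have l2 : 0 < ln 2 :> R by apply: ln_gt0; rewrite ltr1n.
have hL n : (1 < n)%N -> (L n).+1%:R <= 2 / ln 2 * ln n%:R :> R.
  move=> n1; have n0 := ltnW n1; rewrite -mulrA -[(ln 2)^-1 * _]mulrC mulrA ler_pdivlMr //.
  have a1 : ln 2 <= ln n%:R :> R by rewrite ler_ln ?posrE ?ltr0n // ler_nat.
  have p1 : (1 < 2 ^ q0)%N by rewrite -{1}(expn0 2) ltn_exp2l.
  have a2 : (L n)%:R * ln 2 <= ln n%:R :> R.
    rewrite mulr_natl -lnXn ?ltr0n // ler_ln ?posrE ?exprn_gt0 ?ltr0n // -natrX ler_nat.
    apply: leq_trans (trunc_logP p1 n0); rewrite -expnM leq_exp2l //; exact: leq_pmull.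
  by rewrite -natr1 mulrDl mul1r mulr2n mulrDl !mul1r lerD.
apply/eqO_exP; exists (c1.+1%:R * (2 / ln 2) ^+ 2).
  by rewrite mulr_gt0 ?exprn_gt0 ?divr_gt0.
exists 2%N => // n /= n2; have n0 : (0 < n)%N by apply: leq_trans n2.
have ln0 : 0 <= ln n%:R :> R by rewrite ln_ge0 // ler1n.
rewrite ger0_norm // [X in _ <= _ * X]ger0_norm ?exprn_ge0 ?mulr_ge0 //.
apply: (@le_trans _ _ ((c1.+1 * (n * (L n).+1) ^ 2)%N%:R)).
  by rewrite ler_nat; apply: leq_trans (hT n n0) _; rewrite leq_mul2r leqnSn orbT.
rewrite natrM natrX natrM -[leRHS]mulrA; apply: ler_wpM2l => //; rewrite -exprMn lerXn2r ?nnegrE ?mulr_ge0 ?invr_ge0 ?(ltW l2) //.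
by rewrite mulrCA ler_wpM2l // hL.
Qed.

End Machine.

Local Open Scope classical_set_scope.
Local Open Scope ring_scope.

Lemma hypergraph_probE (R : realType) n m k (A : pred (hypergraph n m k)) :
  random_hypergraph_prob R A = avg (fun H : hypergraph n m k => (A H)%:R).
Proof.
rewrite /random_hypergraph_prob /avg; congr (_ / _).
by rewrite -sum1_card natr_sum big_mkcond; apply: eq_bigr => H _; rewrite unfold_in; case: (A H).
Qed.

(* The threshold is exactly the condition under which the branching number
   [d (k - 1) theta] of the clusters stays below one. *)
Lemma regime_branching (R : realType) (k : nat) (d beta : R) : (2 <= k)%N -> 0 < d ->
  ((2 ^+ k.-1 - 1) / (k.-1)%:R < d /\ beta_ising (d + (k.-1)%:R^-1) k < beta /\ beta <= 0)
      \/ (d <= (2 ^+ k.-1 - 1) / (k.-1)%:R /\ beta = 0) ->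
  beta <= 0 /\ d * k.-1%:R * theta k (1 - expR beta) < 1.
Proof.
move=> k2 d0; have k1 : 0 < k.-1%:R :> R by rewrite ltr0n; case: k k2 => [|[|]].
case=> [[h1 [h2 b0]]|[_ ->]]; last first.
  by split => //; rewrite expR0 subrr /theta !mul0r mulr0 ltr01.
split => //; set p := 1 - expR beta.
have /andP[p0 p1] := p_bound b0; rewrite -/p in p0 p1.
have ka := kap_gt0 k2 p0 p1.
pose q := 2 ^+ k.-1 : R; have q0 : 0 < q by rewrite exprn_gt0.
pose D := d * k.-1%:R + 1; have D0 : 0 < D by rewrite addr_gt0 // mulr_gt0.
have DE : (d + (k.-1)%:R^-1) * (k.-1)%:R = D by rewrite mulrDl mulVf // lt0r_neq0.
have qD : q < D by move: h1; rewrite ltr_pdivrMr // ltrBlDr.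
move: h2; rewrite /beta_ising DE -/q -[beta](@expRK R) ltr_ln ?posrE ?expR_gt0 ?divr_gt0 ?subr_gt0 //.
rewrite ltr_pdivrMr // => hh.
have pD : p * D < q by rewrite /p mulrBl mul1r ltrBlDr -ltrBlDl.
rewrite /theta mulrA ltr_pdivrMr // mul1r /kap ltrBrDr.
have -> : d * k.-1%:R * (p * qk R k) + p * qk R k = p * D * q^-1 by rewrite /D /qk -/q; ring.
by rewrite ltr_pdivrMr // mul1r.
Qed.

Lemma half_le (R : realType) (S : R) : 0 <= S -> 2^-1 * S <= S.
Proof. by move=> S0; lra. Qed.

Lemma add_le_double (g h : nat) : (g + h <= 2 * g + h + 1)%N.
Proof. by lia. Qed.

Theorem theorem1p3 (R : realType) (k : nat) (d beta : R)
    (k_ge2 : (2 <= k)%N) (d_gt0 : 0 < d)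
    (regime :
      ((2 ^+ k.-1 - 1) / (k.-1)%:R < d
        /\ beta_ising (d + (k.-1)%:R^-1) k < beta /\ beta <= 0)
      \/ (d <= (2 ^+ k.-1 - 1) / (k.-1)%:R /\ beta = 0)) :
  exists P : program,
    (exists T : nat -> nat,
      runs_in_time P k beta T
      /\ (fun n : nat => (T n)%:R : R^o)
           =O_\oo (fun n : nat => (n%:R * ln n%:R) ^+ 2 : R^o))
    /\ exists c0 : R, 0 < c0 /\
      forall eps : R, 0 < eps -> exists n0 : nat, forall n m : nat,
        (n0 <= n)%N -> m%:R = d * n%:R / k%:R ->
        1 - eps <= random_hypergraph_prob R (fun H : hypergraph n m k =>
          tv_dist (output_law P beta H) (ising beta 0 H)
            <= n%:R `^ (- (c0 / (55 * ln (d * k%:R))))).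
Proof.
have [b0 hreg] := regime_branching k_ge2 d_gt0 regime.
pose p := 1 - expR beta; have /andP[p_ge0 p_lt1] : 0 <= p < 1 := p_bound b0.
have k0 : 0 < k%:R :> R by rewrite ltr0n ltnW.
have c0 : 0 <= d * k.-1%:R * theta k p by rewrite mulr_ge0 ?theta_ge0 // mulr_ge0 // ltW.
have [x [x_gt0 hx]] := choose_x k.-1 c0 hreg.
have rho_lt1 : rhoA k p d x < 1.
  by rewrite /rhoA /alA; apply: le_lt_trans hx; rewrite le_eqVlt; apply/orP; left; apply/eqP; field; rewrite lt0r_neq0.
have rho0 : 0 <= rhoA k p d x.
  apply: mulr_ge0 => //; apply: mulr_ge0; first by rewrite divr_ge0 // ltW.
  by apply: mulr_ge0; [exact: theta_ge0|rewrite exprn_ge0 // addr_ge0 // ltW].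
pose bb := (2^-1 * (1 - p)) ^+ k.
have bb0 : 0 < bb by rewrite exprn_gt0 // mulr_gt0 ?invr_gt0 // subr_gt0.
have bb1 : bb <= 1.
  apply: exprn_ile1; first by rewrite mulr_ge0 ?invr_ge0 // subr_ge0 ltW.
  by rewrite mulr_ile1 ?invr_ge0 ?subr_ge0 ?(ltW p_lt1) ?invf_le1 ?ler1n // lerBlDr lerDl.
have [g1 g1P] := pow_large ((bb ^+ 2)^-1).
have [g2 g2P] := pow_large (2 * FI k p d).
(* In [q0] the summand [2 * g] is required by the running time; with [g2] added, [qP] holds as
   well. *)
pose g := (g1 + g2 + 1)%N; pose q0 := (2 * g + g2 + 1)%N.
have g1g : (g1 < g)%N by rewrite /g -addnA addn1 addnS ltnS leq_addr.
have two1 : 1 <= 2 :> R by rewrite ler1n.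
have gF : 2 * FI k p d <= 2 ^+ g.
  by apply: le_trans g2P _; apply: ler_weXn2l => //; rewrite /g -addnA addnCA leq_addr.
have qP : 2 * (2 ^+ g * FI k p d) <= (2 ^ q0)%:R.
  rewrite mulrCA; apply: le_trans (ler_wpM2l _ g2P) _; first exact: exprn_ge0.
  rewrite -exprD natrX; apply: ler_weXn2l => //; exact: add_le_double.
have q0_gt0 : (0 < q0)%N by rewrite /q0 addn1.
have gq : (2 * g <= q0)%N by rewrite /q0 -addnA leq_addr.
have Q0 : 0 < (2 ^ q0)%:R :> R by rewrite ltr0n expn_gt0.
have [Kr KrP] : exists Kr, rhoA k p d x ^+ Kr <= ((2 ^ q0)%:R ^+ 2)^-1.
  have e0 : 0 < ((2 ^ q0)%:R ^+ 2)^-1 :> R by rewrite invr_gt0 exprn_gt0.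
  by have [N hN] := pow_small rho0 rho_lt1 e0; exists N; apply: hN.
have [cR cRP] : exists cR, (1 - bb) ^+ cR <= (2 * (2 ^ q0)%:R)^-1.
  have e0 : 0 < (2 * (2 ^ q0)%:R)^-1 :> R by rewrite invr_gt0 mulr_gt0.
  have b1 : 0 <= 1 - bb by rewrite subr_ge0.
  have b2 : 1 - bb < 1 by rewrite ltrBlDr ltrDl.
  by have [N hN] := pow_small b1 b2 e0; exists N; apply: hN.
(* The typical input has [m = d * n / k] and must not be rejected as too dense. *)
have [Ce CeP] := pow_large (d / k%:R).
pose csw := (2 * Kr + 4)%N.
exists (alg k Ce q0 g csw cR); split; first exact: (alg_time k beta Ce csw cR q0_gt0 gq).
have [c [cp hc]] := @whp R k p d k_ge2 p_ge0 p_lt1 d_gt0 x Kr q0 g g1 cR csw x_gt0 rho_lt1 KrP gF qP q0_gt0 g1P g1g cRP erefl hreg.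
pose l := ln (d * k%:R).
(* When [ln (d * k)] is positive, the constant of the statement merely rescales [c]. Otherwise the
   exponent in the statement is nonnegative, and equal to 0 by the convention [x / 0 = 0] if the
   logarithm vanishes, so the bound with exponent [- c] is stronger. *)
pose cc := if 0 < l then 55 * c * l else 1; exists cc; split.
  by rewrite /cc; case: ifP => l0 //; rewrite !mulr_gt0.
move=> eps eps0; have [n0 hn0] := hc eps eps0; exists n0.+1 => n m hn mE.
have n_gt0 : (0 < n)%N by apply: leq_trans hn.
have hm : (m <= 2 ^ Ce * n)%N.
  rewrite -(ler_nat R) natrM natrX mE mulrAC; exact: ler_wpM2r.
have n1 : 1 <= n%:R :> R by rewrite ler1n.
move: (hn0 n m (ltnW hn) mE); set B := (X in avg X) => hB.
pose A (H : hypergraph n m k) := tv_dist (output_law (alg k Ce q0 g csw cR) beta H) (ising beta 0 H) <= n%:R `^ (- (cc / (55 * l))).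
rewrite [leRHS](_ : _ = avg (fun H : hypergraph n m k => (A H)%:R)); last exact: hypergraph_probE.
have one : avg (fun _ : hypergraph n m k => 1 : R) = 1.
  by apply: avg_const; apply/card_gt0P; exists [ffun=> nseq_tuple k (Ordinal n_gt0)].
rewrite lerBlDr -[leLHS]one.
apply: (@le_trans _ _ (avg (fun H : hypergraph n m k => (A H)%:R) + avg B)); last by rewrite lerD2l.
rewrite -avgD; apply: ler_avg => H; rewrite /B.
case: (boolP (l1 _ <= _)) => h /=; last by rewrite -[X in X <= _]/(1%:R : R) lerDr ler0n.
suff AH : A H by rewrite AH -[X in X <= _]/(true%:R : R) lerDl ler0n.
rewrite /A; apply: (@le_trans _ _ (n%:R `^ (- c))).
  apply: le_trans h; rewrite /tv_dist /l1; apply: le_trans (half_le _) _; first by apply: sumr_ge0 => s _; exact: normr_ge0.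
  by apply: ler_sum => s _; rewrite (output_lawE b0 g csw cR q0_gt0 H s n_gt0 hm) ising_gibbs.
apply: ler_powR => //; rewrite lerN2 /cc; case: ifP => l0.
  by rewrite [X in X <= _](_ : _ = c) //; field; rewrite lt0r_neq0.
have l0' : l <= 0 by rewrite leNgt l0.
apply: le_trans (ltW cp); rewrite div1r invr_le0 mulr_ge0_le0 //.
Qed.
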